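(* Let $P:(\tilde M,\tilde g)\to(M,g)$ be a Riemannian submersion with $\tilde M$ compact and with integrable horizontal distribution $\mathcal H^P$. Let $(f_n:M\to(0,+\infty))_{n\in\mathbb N}$ be a uniformly bounded sequence of (smooth) warping functions, and let $p,q\in\mathbb R$ with $q\ge 0$. Let $\tilde M_n=(\tilde M,\tilde g_{f_n})$, let $\tilde E^1_n=(\tilde E^1_{f_n},\tilde{\mathbf h}_{f_n})$ be the unit horizontal bundle of the warped submersion $P:(\tilde M,\tilde g_{f_n})\to(M,g)$ equipped with its $(p,q)$-metric, and equip the unit sphere bundle $SM$ of $(M,g)$ with its $(p,q)$-metric $\mathbf h$. Then $\lim_{n\to\infty}\tilde E^1_n=SM$ if and only if $\lim_{n\to\infty}\tilde M_n=M$, where both limits are taken in the Gromov-Hausdorff topology.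
   Context: **Horizontal and vertical bundles.** For a Riemannian submersion $P:\tilde M\to M$, $\mathcal V^P=\ker P_*$ and $\mathcal H^P=(\mathcal V^P)^\perp$ are the vertical and horizontal distributions. **Warped submersions.** For a smooth function $f:M\to(0,+\infty)$ (a warping function), put $\tilde f=f\circ P$ and let $\tilde g_f$ be the Riemannian metric on $\tilde M$ with $\tilde g_f=\tilde g$ on $\mathcal H^P\times\mathcal H^P$ and $\tilde g_f=\tilde f^2\tilde g$ on $\mathcal V^P\times T\tilde M$ (so $\mathcal H^P$ and $\mathcal V^P$ remain orthogonal). Then $P:(\tilde M,\tilde g_f)\to(M,g)$ is again a Riemannian submersion, with the same horizontal distribution $\mathcal H^P$; it is called a warped submersion. ''Uniformly bounded'' means there is a constant $C$ with $f_n\le C$ on $M$ for all $n$. **Connection map and $(p,q)$-metrics.** Let $\pi:\mathcal E\to N$ be a vector bundle over a Riemannian manifold $(N,g_N)$, with fibre metric $h$ and a connection $D$ compatible with $h$. The connection map $K^D:T\mathcal E\to\mathcal E$ is the smooth map which for each $\zeta\in\mathcal E$, $x=\pi(\zeta)$, is linear as a map $T_\zeta\mathcal E\to\mathcal E_x$, and which satisfies $K^D(\xi_*v)=D_v\xi$ for every $v\in TN$ and every section $\xi$ of $\mathcal E$. For $p,q\in\mathbb R$, $q\ge0$, the $(p,q)$-metric on $\mathcal E$ is the Riemannian metric $$\mathbf h_{p,q}(A,B)=g_N(\pi_*A,\pi_*B)+\frac{1}{(1+|\zeta|^2)^p}\bigl(h(K^DA,K^DB)+q\,h(K^DA,\zeta)\,h(K^DB,\zeta)\bigr),$$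 for $A,B\in T_\zeta\mathcal E$, $|\zeta|^2=h(\zeta,\zeta)$. The unit bundle is $\mathcal E^1=\{\xi\in\mathcal E:|\xi|=1\}$; the $(p,q)$-metric on $\mathcal E^1$ is the restriction of $\mathbf h_{p,q}$ to $T(\mathcal E^1)$. **The bundles involved.** $SM$ is the unit bundle of $TM$, with fibre metric $g$ and the Levi-Civita connection of $g$. For a warping function $f$, $\tilde E^1_f$ is the unit bundle of $\mathcal H^P\to\tilde M$ (over the base $(\tilde M,\tilde g_f)$), with fibre metric $\tilde g_f$ and connection $\tilde D^f$ given by the orthogonal projection onto $\mathcal H^P$ of the Levi-Civita connection of $\tilde g_f$; $\tilde{\mathbf h}_f$ denotes its $(p,q)$-metric. All Riemannian manifolds are regarded as metric spaces via their Riemannian distance. *)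

(* Defs.v *)
From HB Require Import structures.
From mathcomp Require Import all_boot all_order all_algebra.
From mathcomp Require Import all_classical all_reals all_analysis.
Set Implicit Arguments.
Unset Strict Implicit.
Unset Printing Implicit Defensive.
Import Order.TTheory GRing.Theory Num.Theory.
Import numFieldNormedType.Exports.
Local Open Scope classical_set_scope.
Local Open Scope ring_scope.

Section Manifolds.
Context {R : realType}.

(* C^k on W, for W open in a finite-dimensional V: f and all its iterated    *)
(* directional derivatives of order at most k exist and are continuous.      *)
Fixpoint Ck (V U : normedModType R) (k : nat) (W : set V) (f : V -> U) : Prop :=
  (forall x, W x -> {for x, continuous f}) /\
  match k with
  | 0%N => True
  | k'.+1 => forall v, (forall x, W x -> derivable f x v) /\
                       Ck k' W (fun x => 'D_v f x)
  end.

Definition smooth_on (V U : normedModType R) (W : set V) (f : V -> U) : Prop :=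
  forall k, Ck k W f.

(* [chart a] is meaningful on [dom a] only, [ichart a] on its image only.    *)
(* [chart_at x] is a preferred chart around x: the tangent space at x is the *)
(* model space V, a vector of V being the coordinate expression of a tangent *)
(* vector in the chart [chart_at x].                                         *)
Record atlas (V : normedModType R) (X : Type) := Atlas {
  index : Type;
  dom : index -> set X;
  chart : index -> X -> V;
  ichart : index -> V -> X;
  chart_at : X -> index }.

Record smooth_manifold (V : normedModType R) (X : topologicalType)
    (A : atlas V X) : Prop := {
  mfd_hausdorff : hausdorff_space X;
  mfd_second_countable : @second_countable X;
  mfd_open_dom : forall a, open (dom (a : index A));
  mfd_cover : forall x, dom (chart_at A x) x;
  mfd_open_img : forall a : index A, open (chart a @` dom a);
  mfd_chartK : forall (a : index A) x, dom a x -> ichart a (chart a x) = x;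
  mfd_chart_cont : forall (a : index A) x, dom a x ->
    {for x, continuous (chart a)};
  mfd_ichart_cont : forall (a : index A) y, (chart a @` dom a) y ->
    {for y, continuous (ichart a)};
  mfd_transition : forall a b : index A,
    smooth_on (chart a @` (dom a `&` dom b)) (chart b \o ichart a) }.

Definition euclid (V : normedModType R) : atlas V V :=
  @Atlas V V unit (fun=> setT) (fun=> id) (fun=> id) (fun=> tt).

Section Maps.
Context {V W : normedModType R} {X Y : Type}.
Variables (A : atlas V X) (B : atlas W Y).

Definition in_charts (F : X -> Y) (x : X) : V -> W :=
  chart (chart_at B (F x)) \o F \o ichart (chart_at A x).

(* F is C^oo in a neighbourhood of x, not just differentiable at x *)
Definition smooth_at (F : X -> Y) (x : X) : Prop :=
  let a := chart_at A x in let b := chart_at B (F x) in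
  exists U : set V,
    [/\ open U, U (chart a x), U `<=` chart a @` dom a,
        (forall y, U y -> dom b (F (ichart a y))) &
        smooth_on U (in_charts F x)].

(* the differential F_* : T_x X -> T_(F x) Y *)
Definition mdiff (F : X -> Y) (x : X) (v : V) : W :=
  'D_v (in_charts F x) (chart (chart_at A x) x).

End Maps.

(* The tangent bundle, with total space X * V. Its charts are those induced  *)
(* by A: [chart a (x, v)] is made of the coordinates of x and of v in the    *)
(* chart a, v being given in the preferred chart at x.                       *)
Definition tangent_atlas (V : normedModType R) (X : Type) (A : atlas V X) :
    atlas (V * V)%type (X * V)%type :=
  @Atlas (V * V)%type (X * V)%type (index A)
    (fun a z => dom a z.1)
    (fun a z => (chart a z.1,
       'D_(z.2) (chart a \o ichart (chart_at A z.1))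
                (chart (chart_at A z.1) z.1)))
    (fun a y => (ichart a y.1,
       'D_(y.2) (chart (chart_at A (ichart a y.1)) \o ichart a) y.1))
    (fun z => chart_at A z.1).

End Manifolds.

Section Riemannian.
Context {R : realType} {V : normedModType R} {X : Type}.
Variable A : atlas V X.

Definition smooth_fun_at (f : X -> R^o) (x : X) : Prop :=
  smooth_at A (euclid R^o) f x.

Definition dfun (f : X -> R^o) (x : X) (v : V) : R :=
  mdiff A (euclid R^o) f x v.

Definition section_map (xi : X -> V) (x : X) : X * V := (x, xi x).

Definition smooth_field_at (xi : X -> V) (x : X) : Prop :=
  smooth_at A (tangent_atlas A) (section_map xi) x.

Definition smooth_curve_at (c : R^o -> X) (t : R^o) : Prop :=
  smooth_at (euclid R^o) A c t.

Definition velocity (c : R^o -> X) (t : R^o) : V :=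
  mdiff (euclid R^o) A c t (1 : R^o).

Definition form := X -> V -> V -> R.

Record riemannian_metric (g : form) : Prop := {
  rm_sym : forall x u v, g x u v = g x v u;
  rm_lin : forall x (k : R) u v w, g x (k *: u + v) w = k * g x u w + g x v w;
  rm_pos : forall x u, u != 0 -> 0 < g x u u;
  rm_smooth : forall x xi eta, smooth_field_at xi x -> smooth_field_at eta x ->
    smooth_fun_at (fun y => g y (xi y) (eta y)) x }.

(* [length g c] is the length of the restriction of c to [0, 1]. *)
Definition length (g : form) (c : R^o -> X) : \bar R :=
  (\int[lebesgue_measure]_(t in `[0%R, 1%R])
     (Num.sqrt (g (c t) (velocity c t) (velocity c t)))%:E)%E.

(* [pw_path g S x y l]: l is the length of a piecewise smooth curve from x   *)
(* to y inside S, i.e. of a finite concatenation of curves parametrized by   *)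
(* [0, 1], each smooth on a neighbourhood of [0, 1].                         *)
Inductive pw_path (g : form) (S : set X) : X -> X -> \bar R -> Prop :=
| pw_nil x : S x -> pw_path g S x x 0%E
| pw_cons (c : R^o -> X) y l :
    (forall t : R, 0 <= t <= 1 -> smooth_curve_at c t /\ S (c t)) ->
    pw_path g S (c 1) y l -> pw_path g S (c 0) y (length g c + l)%E.

(* Riemannian distance of a submanifold S with the restriction of g; it is   *)
(* +oo between different connected components of S.                          *)
Definition rdist (g : form) (S : set X) (x y : X) : \bar R :=
  ereal_inf [set l | pw_path g S x y l].

(* For an embedded submanifold S these vectors form the tangent space T_x S. *)
Definition tangent_to (S : set X) (x : X) (v : V) : Prop :=
  exists c : R^o -> X, [/\ smooth_curve_at c 0, (\forall t \near (0 : R^o), S (c t)),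
    c 0 = x & velocity c 0 = v].

End Riemannian.

Section Bundles.
Context {R : realType} {V : normedModType R} {X : Type}.
Variable A : atlas V X.

Definition distribution := X -> set V.

Definition total_space (E : distribution) : set (X * V) :=
  [set z | E z.1 z.2].

(* [D x v xi] is D_v xi, for v tangent at x and xi a local section defined   *)
(* and smooth near x; the values of D on other arguments are irrelevant.     *)
Definition connection := X -> V -> (X -> V) -> V.

Record levi_civita (g : form) (D : connection) : Prop := {
  lc_linear : forall x xi, smooth_field_at A xi x ->
    forall (k : R) u v, D x (k *: u + v) xi = k *: D x u xi + D x v xi;
  lc_additive : forall x v xi eta,
    smooth_field_at A xi x -> smooth_field_at A eta x ->
    D x v (fun y => xi y + eta y) = D x v xi + D x v eta;
  lc_leibniz : forall x v (f : X -> R^o) xi,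
    smooth_fun_at A f x -> smooth_field_at A xi x ->
    D x v (fun y => (f y : R) *: xi y) =
      dfun A f x v *: xi x + (f x : R) *: D x v xi;
  lc_smooth : forall x xi eta,
    smooth_field_at A xi x -> smooth_field_at A eta x ->
    smooth_field_at A (fun y => D y (xi y) eta) x;
  (* D_xi eta - D_eta xi = [xi, eta] as derivations *)
  lc_torsion : forall x xi eta (f : X -> R^o),
    smooth_field_at A xi x -> smooth_field_at A eta x -> smooth_fun_at A f x ->
    dfun A f x (D x (xi x) eta - D x (eta x) xi) =
      dfun A (fun y => dfun A f y (eta y)) x (xi x) -
      dfun A (fun y => dfun A f y (xi y)) x (eta x);
  lc_metric : forall x v xi eta,
    smooth_field_at A xi x -> smooth_field_at A eta x ->
    dfun A (fun y => g y (xi y) (eta y)) x v =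
      g x (D x v xi) (eta x) + g x (xi x) (D x v eta) }.

Definition oproj (g : form) (E : distribution) (x : X) (w : V) : V :=
  get [set u | E x u /\ forall e, E x e -> g x (w - u) e = 0].

Definition projected_connection (g : form) (E : distribution)
    (D : connection) : connection := fun x v xi => oproj g E x (D x v xi).

(* K is the connection map of the connection D on the subbundle E of the     *)
(* tangent bundle; K z is meaningful only on T_z E, where it is determined   *)
(* by these conditions (smoothness of K is a consequence).                   *)
Definition connection_map (E : distribution) (D : connection)
    (K : X * V -> V * V -> V) : Prop :=
  forall z, total_space E z ->
    let T_zE := tangent_to (tangent_atlas A) (total_space E) z in
    [/\ (forall a, T_zE a -> E z.1 (K z a)),
        (forall (k : R) a b, T_zE a -> T_zE b ->
           K z (k *: a + b) = k *: K z a + K z b) &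
        (forall xi v, smooth_field_at A xi z.1 ->
           (forall y, E y (xi y)) -> section_map xi z.1 = z ->
           K z (mdiff A (tangent_atlas A) (section_map xi) z.1 v) =
             D z.1 v xi)].

Definition pq_metric (g : form) (K : X * V -> V * V -> V) (p q : R) :
    @form R (V * V)%type (X * V)%type :=
  fun z a b =>
    let dpi := mdiff (tangent_atlas A) A fst z in
    let g_x := g z.1 in
    g_x (dpi a) (dpi b) +
    ((1 + g_x z.2 z.2) `^ p)^-1 *
      (g_x (K z a) (K z b) + q * g_x (K z a) z.2 * g_x (K z b) z.2).

Definition unit_bundle (g : form) (E : distribution) : set (X * V) :=
  [set z | total_space E z /\ g z.1 z.2 z.2 = 1].

Definition unit_bundle_dist (g : form) (E : distribution)
    (K : X * V -> V * V -> V) (p q : R) : X * V -> X * V -> \bar R :=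
  rdist (tangent_atlas A) (pq_metric g K p q) (unit_bundle g E).

End Bundles.

Section Submersions.
Context {R : realType} {V W : normedModType R} {Y X : Type}.
Variables (B : atlas V Y) (A : atlas W X) (P : Y -> X).

Definition vertical : @distribution R V Y :=
  fun y => [set u | mdiff B A P y u = 0].

Definition horizontal (gY : @form R V Y) : distribution :=
  fun y => [set u | forall v, vertical y v -> gY y u v = 0].

Definition riemannian_submersion (gY : @form R V Y) (gX : @form R W X) : Prop :=
  [/\ (forall y, smooth_at B A P y),
      (forall x, exists y, P y = x),
      (forall y w, exists v, mdiff B A P y v = w) &
      (forall y u v, horizontal gY y u -> horizontal gY y v ->
         gX (P y) (mdiff B A P y u) (mdiff B A P y v) = gY y u v)].

(* [h] is the projection on H, so u - h u is the vertical part of u: this is  *)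
(* the metric equal to gY on H x H and to (f o P)^2 gY on V x TY.            *)
Definition warp (gY : @form R V Y) (f : X -> R) : @form R V Y :=
  fun y u v =>
    let h := oproj gY (horizontal gY) y in
    gY y (h u) (h v) + (f (P y)) ^+ 2 * gY y (u - h u) (v - h v).

End Submersions.

(* E is integrable, the model space W having the rank of E as dimension:     *)
(* through each point passes an immersed integral manifold of E.             *)
Definition integrable_distribution (R : realType) (W V : normedModType R)
    (Y : Type) (B : atlas V Y) (E : @distribution R V Y) : Prop :=
  forall y, exists (U : set W) (i : W -> Y), [/\ open U, U 0, i 0 = y &
    forall u, U u -> [/\ smooth_at (euclid W) B i u,
      injective (mdiff (euclid W) B i u) &
      range (mdiff (euclid W) B i u) = E (i u)]].

Section GromovHausdorff.
Context {R : realType}.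
Local Open Scope ereal_scope.

(* Distances may be infinite: the unit sphere bundle of a manifold of        *)
(* dimension 1 need not be connected.                                        *)
Record extended_metric (Z : Type) (d : Z -> Z -> \bar R) : Prop := {
  em_ge0 : forall x y, 0 <= d x y;
  em_eq0 : forall x y, d x y = 0 <-> x = y;
  em_sym : forall x y, d x y = d y x;
  em_triangle : forall x y z, d x z <= d x y + d y z }.

Definition hausdorff_dist (Z : Type) (d : Z -> Z -> \bar R) (S T : set Z) :
    \bar R :=
  maxe (ereal_sup [set ereal_inf [set d s t | t in T] | s in S])
       (ereal_sup [set ereal_inf [set d s t | s in S] | t in T]).

(* isometric embedding; injectivity on S follows when dX is a metric *)
Definition isometric_on (X Z : Type) (S : set X) (dX : X -> X -> \bar R)
    (dZ : Z -> Z -> \bar R) (i : X -> Z) : Prop :=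
  forall x y, S x -> S y -> dZ (i x) (i y) = dX x y.

Definition gh_dist (X Y : Type) (S : set X) (dS : X -> X -> \bar R)
    (T : set Y) (dT : Y -> Y -> \bar R) : \bar R :=
  ereal_inf [set r | exists (Z : Type) (d : Z -> Z -> \bar R)
                            (i : X -> Z) (j : Y -> Z),
    [/\ extended_metric d, isometric_on S dS d i, isometric_on T dT d j &
        r = hausdorff_dist d (i @` S) (j @` T)]].

Definition gh_cvg (X Y : Type) (S : nat -> set X)
    (dS : nat -> X -> X -> \bar R) (T : set Y) (dT : Y -> Y -> \bar R) : Prop :=
  gh_dist (S n) (dS n) T dT @[n --> \oo] --> 0.

End GromovHausdorff.

(* Main.v *)
(** Write [gn] for the warped metrics, [E] for their unit horizontal bundles and
    [Ps : E -> SM] for the map [(y, eta) |-> (P y, P_* eta)].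

    A leaf of the horizontal distribution is locally the graph of an isometric
    section of [P], and the differential of that section is a local isometric
    section of [Ps]: on [E] the connection map is the pull-back of that of [SM],
    so the metric of [E] is the pull-back of the metric of [SM] plus the vertical
    part of [gn]. As [Mt] is compact, curves of [M] and of [SM] therefore lift to
    curves of the same length, starting at a prescribed point.

    For 1-Lipschitz maps onto a totally bounded space which lift curves in this
    way, Gromov-Hausdorff convergence to the base means that the diameters of the
    fibres tend to 0 uniformly: the composite of a quasi-inverse given by
    the convergence with the projection is a nearly nonexpanding, nearly onto
    self-map of a totally bounded space, hence nearly an isometry.

    It remains to compare fibres. The projection [E -> Mt] is 1-Lipschitz and maps
    the fibres of [Ps] onto those of [P]. Conversely, let [z], [z'] in [E] have the
    same image in [SM], and join their base points by a short curve [c]. The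
    horizontal lift along [c] of a normalised coordinate field of [M] joins [z] to
    [z'], and its length is at most a constant times that of [c]; the constant only
    involves [M], so it does not depend on the warping function. *)
From HB Require Import structures.
Require Import Defs.
From mathcomp Require Import all_boot all_order all_algebra.
From mathcomp Require Import all_classical all_reals all_analysis.
From mathcomp Require Import measurable_realfun ring lra.
Import Defs.
Set Implicit Arguments.
Unset Strict Implicit.
Unset Printing Implicit Defensive.
Import Order.TTheory GRing.Theory Num.Theory.
Import numFieldNormedType.Exports.
Local Open Scope classical_set_scope.
Local Open Scope ring_scope.

(** * Calculus in finite dimension *)

(** No differential equation is solved. Lifting a curve only produces a point over its end, at
    distance at most its length from the given start, so local sections and a supremum argument
    suffice. Integrability is used twice: for those sections, and to make lifted coordinate fields
    commute. In Koszul's formula for the warped metric all remaining terms are inner products with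
    lifted fields, in which the warping function does not occur; hence derivatives of lifted fields
    project to derivatives on [M]. The obstacle is that the data are only partly specified:
    connections are known on smooth sections, [Kt] on vectors tangent to the horizontal bundle, and
    tangent bundles carry no topology. The (p,q)-metrics are therefore traded for forms that are
    continuous on all tangent vectors and agree with them along curves in the unit bundles. In the
    metric part the order of quantifiers matters: the tolerance that turns closeness to the base
    into small fibres depends on the limit space and the desired bound only, and the constant
    comparing the two kinds of fibres is fixed before the warping function. *)

Definition clin {R : realType} {V U : normedModType R} (f : V -> U) : Prop :=
  linear f /\ continuous f.

Section ContinuousLinear.
Context {R : realType}.
Implicit Types V U W : normedModType R.

Definition linear_pack V U (f : V -> U) (lf : linear f) : {linear V -> U} :=
  HB.pack f (GRing.isLinear.Build R V U *:%R f lf).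

Lemma clinD V U (f : V -> U) u v : clin f -> f (u + v) = f u + f v.
Proof. by case=> lf _; have := raddfD (linear_pack lf) u v. Qed.

Lemma clinZ V U (f : V -> U) k v : clin f -> f (k *: v) = k *: f v.
Proof. by case=> lf _; have := linearZ_LR (linear_pack lf) k v. Qed.

Lemma clin0 V U (f : V -> U) : clin f -> f 0 = 0.
Proof. by case=> lf _; have := linear0 (linear_pack lf). Qed.

Lemma clinB V U (f : V -> U) u v : clin f -> f (u - v) = f u - f v.
Proof. by case=> lf _; have := linearB (linear_pack lf) u v. Qed.

Lemma clin_sum V U (f : V -> U) n (g : 'I_n -> V) :
  clin f -> f (\sum_i g i) = \sum_i f (g i).
Proof.
by case=> lf _; have := linear_sum (linear_pack lf) (index_enum 'I_n) predT g.
Qed.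

Lemma clin_comp V U W (f : V -> U) (g : U -> W) :
  clin f -> clin g -> clin (g \o f).
Proof.
move=> cf cg; split=> [k u v|x] /=; first by rewrite cf.1 cg.1.
by apply: continuous_comp; [exact: cf.2|exact: cg.2].
Qed.

Lemma clin_id V : clin (@id V).
Proof. by split=> // x; exact: cvg_id. Qed.

Lemma clin_scalel V (e : V) : clin (fun r : R^o => r *: e).
Proof.
split=> [k u v|]; first by rewrite scalerDl scalerA.
exact: scalel_continuous.
Qed.

Lemma clin_scaler V (k : R) : clin (fun v : V => k *: v).
Proof.
split=> [a u v|]; first by rewrite scalerDr !scalerA mulrC.
exact: scaler_continuous.
Qed.

Lemma clin_fst V U : clin (fun z : V * U => z.1).
Proof. by split=> // x; apply: cvg_fst. Qed.

Lemma clin_snd V U : clin (fun z : V * U => z.2).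
Proof. by split=> // x; apply: cvg_snd. Qed.

Lemma clin_inl V U : clin (fun v : V => (v, 0 : U)).
Proof.
split=> [k u v|x]; first by congr pair; rewrite /= scaler0 addr0.
by apply: cvg_pair => //=; exact: cvg_cst.
Qed.

Lemma clin_inr V U : clin (fun v : U => (0 : V, v)).
Proof.
split=> [k u v|x]; first by congr pair; rewrite /= scaler0 addr0.
by apply: cvg_pair => //=; exact: cvg_cst.
Qed.

Lemma clin_bounded V U (f : V -> U) :
  clin f -> exists2 C : R, 0 < C & forall v, `|f v| <= C * `|v|.
Proof.
case=> lf cf; have /linear_boundedP := @continuous_linear_bounded _ _ _ 0 (linear_pack lf) (cf 0).
move=> [C [Cr H]]; exists (`|C| + 1); first by rewrite ltr_pwDr.
by apply: H; rewrite (le_lt_trans (ler_norm _))// ltrDl.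
Qed.

End ContinuousLinear.

(** Coordinates are given by continuous functionals [l], so linear maps out of such a space are
    continuous without any comparison of norms. The family [e] need only span, and products, hence
    model spaces of tangent bundles, inherit the structure. *)
Class findim {R : realType} (V : normedModType R) : Prop := Findim {
  findim_coord : exists n (e : 'I_n -> V) (l : 'I_n -> V -> R^o),
    (forall i, clin (l i)) /\ forall v, v = \sum_i l i v *: e i }.

Lemma clin_findim {R : realType} (V U : normedModType R) {fV : findim V} (l : V -> U) :
  linear l -> clin l.
Proof.
move=> ll; split=> //; have [n [e [c [cc ce]]]] := @findim_coord _ _ fV.
have -> : l = fun v => \sum_i c i v *: l (e i).
  apply/funext => v; rewrite {1}(ce v).
  have := linear_sum (linear_pack ll) (index_enum 'I_n) predT (fun i => c i v *: e i).
  by move=> /= ->; apply: eq_bigr => i _; have /= -> := linearZ_LR (linear_pack ll) (c i v) (e i).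
move=> x; rewrite /continuous_at; elim: n e c {ce} cc => [|n IH] e c cc.
  by under eq_fun do rewrite big_ord0; rewrite big_ord0; exact: cvg_cst.
under eq_fun do rewrite big_ord_recr/=; rewrite big_ord_recr/=.
apply: cvgD; first by apply: IH.
apply: (continuous_comp (f := c ord_max) (g := fun r : R => r *: l (e ord_max))).
  exact: (cc ord_max).2.
exact: scalel_continuous.
Qed.

Section FindimInstances.
Context {R : realType}.

Lemma clin_coord m n (i : 'I_m) (j : 'I_n) :
  clin (fun v : 'M[R]_(m, n) => v i j : R^o).
Proof.
split=> [k u v|]; first by rewrite !mxE.
exact: coord_continuous.
Qed.

#[global] Instance findim_mx m n : findim ('M[R]_(m, n)).
Proof.
split; exists #|{: 'I_m * 'I_n}|, (fun s => delta_mx (enum_val s).1 (enum_val s).2),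
  (fun s (v : 'M[R]_(m, n)) => v (enum_val s).1 (enum_val s).2); split=> [s|v].
  exact: clin_coord.
rewrite [LHS]matrix_sum_delta pair_big /=.
rewrite (reindex (@enum_val _ predT)) //=.
by exists enum_rank => x _; [exact: enum_valK|exact: enum_rankK].
Qed.

#[global] Instance findim_reg : findim R^o.
Proof.
split; exists 1%N, (fun=> 1), (fun=> id); split=> [_|v]; first exact: clin_id.
by rewrite big_ord1 [_ *: _]mulr1.
Qed.

#[global] Instance findim_prod (V U : normedModType R) :
  findim V -> findim U -> findim (V * U)%type.
Proof.
move=> [[n [e [l [cl el]]]]] [[m [e' [l' [cl' el']]]]].
split; exists (n + m)%N,
  (fun i => match fintype.split i with inl i => (e i, 0) | inr j => (0, e' j) end),
  (fun i v => match fintype.split i with inl i => l i v.1 | inr j => l' j v.2 end).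
split=> [i|[v u]].
  case: (fintype.split i) => j.
    exact: clin_comp (clin_fst V U) (cl j).
  exact: clin_comp (clin_snd V U) (cl' j).
rewrite big_split_ord /=.
under eq_bigr do rewrite (unsplitK (inl _)).
under [X in _ + X]eq_bigr do rewrite (unsplitK (inr _)).
rewrite {1}(el v) {1}(el' u).
rewrite (_ : (_, _) = (\sum_i l i v *: e i, 0) + (0, \sum_i l' i u *: e' i)); last first.
  by congr pair; rewrite /= ?addr0 ?add0r.
congr (_ + _).
  by rewrite (clin_sum _ (clin_inl V U)); apply: eq_bigr => i _; rewrite (clinZ _ _ (clin_inl V U)).
by rewrite (clin_sum _ (clin_inr V U)); apply: eq_bigr => i _; rewrite (clinZ _ _ (clin_inr V U)).
Qed.

End FindimInstances.

Section DirectionalDerivative.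
Context {R : realType}.
Implicit Types V U W : normedModType R.

Lemma near_eq_continuous V U (f g : V -> U) x :
  (\forall y \near x, f y = g y) -> {for x, continuous f} -> {for x, continuous g}.
Proof.
move=> fg; have E := nbhs_singleton fg.
move=> cf'; rewrite /prop_for /continuous_at -E; apply: cvg_trans cf'.
exact: near_eq_cvg.
Unshelve. all: by end_near. Qed.

Lemma is_derive_clin V U W (l : U -> W) (f : V -> U) x v :
  clin l -> derivable f x v -> is_derive x v (l \o f) (l ('D_v f x)).
Proof.
move=> cl df.
have H : (fun h => h^-1 *: (((l \o f) \o shift x) (h *: v) - (l \o f) x)) @ 0^' -->
   l ('D_v f x).
  rewrite (_ : (fun h => _) =
     l \o (fun h => h^-1 *: ((f \o shift x) (h *: v) - f x))).
    by apply: continuous_cvg => //; exact: cl.2.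
  by apply/funext => h /=; rewrite (clinZ _ _ cl) (clinB _ _ cl).
by split; [apply/cvg_ex; exists (l ('D_v f x))|exact: cvg_lim H].
Qed.

Lemma is_derive_scaledir V U (f : V -> U) x v k :
  derivable f x v -> is_derive x (k *: v) f (k *: 'D_v f x).
Proof.
move=> df; have [->|k0] := eqVneq k 0.
  by rewrite !scale0r; exact: is_derive0.
have H : (fun h => h^-1 *: ((f \o shift x) (h *: (k *: v)) - f x)) @ 0^' -->
    k *: 'D_v f x.
  rewrite (_ : (fun h => _) = (fun h => k *: h) \o
     (fun h => h^-1 *: ((f \o shift x) (h *: v) - f x)) \o (fun h => h * k)).
    apply: continuous_cvg; first exact: scaler_continuous.
    apply: (cvg_comp _ _ _ df).
    move=> A /nbhs_ballP [e /= e0 eA].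
    apply/nbhs_ballP; exists (e / `|k|) => /=; first by rewrite divr_gt0// normr_gt0.
    move=> y; rewrite /ball /= sub0r normrN ltr_pdivlMr ?normr_gt0// -normrM => ye y0.
    by apply: eA; rewrite ?mulf_neq0//= /ball /= sub0r normrN.
  apply/funext => h /=; rewrite !scalerA.
  have [->|h0] := eqVneq h 0; first by rewrite !mul0r invr0 !(scale0r, mulr0, add0r, subrr, scaler0).
  by rewrite invfM mulrCA mulfV// mulr1.
by split; [apply/cvg_ex; exists (k *: ('D_v f x))|exact: cvg_lim H].
Qed.

End DirectionalDerivative.

(** * C^k maps: closure properties and differentiability *)

Section CkTheory.
Context {R : realType}.
Implicit Types V U W : normedModType R.

Lemma Ck_cont V U k (O : set V) (f : V -> U) :
  Ck k O f -> forall x, O x -> {for x, continuous f}.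
Proof. by case: k => [|k] []. Qed.

Lemma CkSP V U k (O : set V) (f : V -> U) :
  Ck k.+1 O f <-> [/\ forall x, O x -> {for x, continuous f},
    (forall v x, O x -> derivable f x v) & forall v, Ck k O ('D_v f)].
Proof.
split=> [[cf df]|[cf df cdf]].
  by split=> // [v x Ox|v]; have [? ?] := df v; auto.
by split=> // v; split=> // x; exact: df.
Qed.

Lemma open_near_eq V U (O : set V) (f g : V -> U) : open O ->
  (forall x, O x -> f x = g x) -> forall x, O x -> \forall y \near x, f y = g y.
Proof.
by move=> oO fg x Ox; apply: filterS (open_nbhs_nbhs (conj oO Ox)) => y; exact: fg.
Qed.

Lemma Ck_ext V U k (O : set V) (f g : V -> U) : open O ->
  (forall x, O x -> f x = g x) -> Ck k O f -> Ck k O g.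
Proof.
move=> oO; elim: k f g => [|k IH] f g fg.
  move=> [cf _]; split=> // x Ox.
  exact: near_eq_continuous (open_near_eq oO fg Ox) (cf _ Ox).
move=> /CkSP [cf df cdf]; apply/CkSP; split.
- by move=> x Ox; apply: near_eq_continuous (open_near_eq oO fg Ox) (cf _ Ox).
- by move=> v x Ox; apply: near_eq_derivable (open_near_eq oO fg Ox) (df _ _ Ox).
- move=> v; apply: IH (cdf v) => x Ox.
  exact: near_eq_derive (open_near_eq oO fg Ox).
Qed.

Lemma Ck_sub V U k (O O' : set V) (f : V -> U) :
  O' `<=` O -> Ck k O f -> Ck k O' f.
Proof.
move=> s; elim: k f => [|k IH] f; first by move=> [cf _]; split=> // x /s; exact: cf.
move=> /CkSP [cf df cdf]; apply/CkSP; split=> [x /s|v x /s|v].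
- exact: cf.
- exact: df.
- exact: IH.
Qed.

Lemma Ck_pred V U k (O : set V) (f : V -> U) : Ck k.+1 O f -> Ck k O f.
Proof.
elim: k f => [|k IH] f; first by case.
move=> /CkSP [cf df cdf]; apply/CkSP; split=> // v; exact: IH.
Qed.

Lemma Ck_clin V U W k (O : set V) (f : V -> U) (l : U -> W) : open O ->
  clin l -> Ck k O f -> Ck k O (l \o f).
Proof.
move=> oO cl; elim: k f => [|k IH] f.
  by move=> [cf _]; split=> // x Ox; apply: continuous_comp; [exact: cf|exact: cl.2].
move=> /CkSP [cf df cdf]; apply/CkSP; split=> [x Ox|v x Ox|v].
- by apply: continuous_comp; [exact: cf|exact: cl.2].
- by have [] := is_derive_clin cl (df v x Ox).
- apply: Ck_ext (IH _ (cdf v)) => // x Ox /=.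
  by have [_ ->] := is_derive_clin cl (df v x Ox).
Qed.

Lemma Ck_cst V U k (O : set V) (c : U) : Ck k O (cst c).
Proof.
elim: k c => [|k IH] c; first by split=> // x _; exact: cvg_cst.
apply/CkSP; split=> [x _|v x _|v]; first exact: cvg_cst.
  exact: derivable_cst.
rewrite (_ : 'D_v (cst c) = cst 0); first exact: IH.
by apply/funext => x; rewrite derive_cst.
Qed.

Lemma CkD V U k (O : set V) (f g : V -> U) : open O ->
  Ck k O f -> Ck k O g -> Ck k O (fun x => f x + g x).
Proof.
move=> oO; elim: k f g => [|k IH] f g.
  by move=> [cf _] [cg _]; split=> // x Ox; apply: cvgD; [exact: cf|exact: cg].
move=> /CkSP [cf df cdf] /CkSP [cg dg cdg]; apply/CkSP; split=> [x Ox|v x Ox|v].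
- by apply: cvgD; [exact: cf|exact: cg].
- by apply: derivableD; [exact: df|exact: dg].
- apply: Ck_ext (IH _ _ (cdf v) (cdg v)) => // x Ox.
  by rewrite -deriveD//; [exact: df|exact: dg].
Qed.

Lemma Ck_sum V U k (O : set V) n (f : 'I_n -> V -> U) : open O ->
  (forall i, Ck k O (f i)) -> Ck k O (fun x => \sum_i f i x).
Proof.
move=> oO; elim: n f => [|n IH] f cf.
  rewrite (_ : (fun _ => _) = cst 0); first exact: Ck_cst.
  by apply/funext => x; rewrite big_ord0.
rewrite (_ : (fun _ => _) = fun x => \sum_(i < n) f (widen_ord (leqnSn n) i) x + f ord_max x).
  by apply: CkD => //; exact: IH.
by apply/funext => x; rewrite big_ord_recr.
Qed.

Lemma CkM V k (O : set V) (f g : V -> R^o) : open O ->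
  Ck k O f -> Ck k O g -> Ck k O (fun x => f x * g x : R^o).
Proof.
move=> oO; elim: k f g => [|k IH] f g.
  by move=> [cf _] [cg _]; split=> // x Ox; apply: cvgM; [exact: cf|exact: cg].
move=> Cf Cg; have := Cf; have := Cg.
move=> /CkSP [cg dg cdg] /CkSP [cf df cdf]; apply/CkSP; split=> [x Ox|v x Ox|v].
- by apply: cvgM; [exact: cf|exact: cg].
- by apply: derivableM; [exact: df|exact: dg].
- have H := CkD oO (IH _ _ (Ck_pred Cf) (cdg v)) (IH _ _ (Ck_pred Cg) (cdf v)).
  apply: Ck_ext H => // x Ox.
  by rewrite [RHS](deriveM (df v x Ox) (dg v x Ox)).
Qed.

Lemma Ck_coord V U k (O : set V) (f : V -> U) n (e : 'I_n -> U) (l : 'I_n -> U -> R^o) :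
  open O -> (forall v, v = \sum_i l i v *: e i) ->
  (forall i, Ck k O (l i \o f)) -> Ck k O f.
Proof.
move=> oO el cf.
rewrite (_ : f = fun x => \sum_i (fun r : R^o => r *: e i) ((l i \o f) x)); last first.
  by apply/funext => x; rewrite {1}(el (f x)).
apply: Ck_sum => // i; apply: (Ck_clin (l := fun r : R^o => r *: e i) oO) (cf i).
exact: clin_scalel.
Qed.

Lemma CkZ V U {fU : findim U} k (O : set V) (f : V -> R^o) (g : V -> U) : open O ->
  Ck k O f -> Ck k O g -> Ck k O (fun x => f x *: g x).
Proof.
move=> oO cf cg; have [n [e [l [cl el]]]] := @findim_coord _ _ fU.
apply: (Ck_coord oO el) => i.
rewrite (_ : _ \o _ = fun x => f x * (l i \o g) x).
  by apply: CkM => //; apply: Ck_clin.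
by apply/funext => x /=; rewrite (clinZ _ _ (cl i)).
Qed.

Lemma Ck_pair V U W k (O : set V) (f : V -> U) (g : V -> W) : open O ->
  Ck k O f -> Ck k O g -> Ck k O (fun x => (f x, g x)).
Proof.
move=> oO cf cg.
have H := CkD oO (Ck_clin oO (clin_inl U W) cf) (Ck_clin oO (clin_inr U W) cg).
by apply: Ck_ext H => // x _ /=; congr pair; rewrite /= ?addr0 ?add0r.
Qed.

(** The derivative of [1/f] is minus the product of ['D_v f] with two copies of [1/f], so the
    induction hypothesis for [1/f] itself closes the step. *)
Lemma CkV V k (O : set V) (f : V -> R^o) : open O ->
  (forall x, O x -> f x != 0) -> Ck k O f -> Ck k O (fun x => (f x)^-1 : R^o).
Proof.
move=> oO f0; elim: k => [|k IH].
  by move=> [cf _]; split=> // x Ox; apply: cvgV; [exact: f0|exact: cf].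
move=> Cf; have /CkSP [cf df cdf] := Cf; apply/CkSP; split=> [x Ox|v x Ox|v].
- by apply: cvgV; [exact: f0|exact: cf].
- by apply: derivableV; [exact: f0|exact: df].
- have Ci := IH (Ck_pred Cf).
  have H := CkM oO (Ck_cst k O (-1 : R^o)) (CkM oO (cdf v) (CkM oO Ci Ci)).
  apply: Ck_ext H => // x Ox.
  rewrite [RHS](deriveV (f0 x Ox) (df v x Ox)) /cst /GRing.scale/=.
  by rewrite -exprVn; ring.
Qed.

Lemma is_derive_line V U (f : V -> U) x v (t : R) :
  derivable f (x + t *: v) v ->
  is_derive t 1 (fun s : R => f (x + s *: v)) ('D_v f (x + t *: v)).
Proof.
move=> df; pose g (s : R) := f (x + s *: v).
have E : (fun h => h^-1 *: ((g \o shift t) (h *: 1) - g t)) =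
  (fun h => h^-1 *: ((f \o shift (x + t *: v)) (h *: v) - f (x + t *: v))).
  apply/funext => h /=; rewrite /g [h *: 1]mulr1; congr (_ *: (f _ - _)).
  by rewrite scalerDl addrCA.
by split; rewrite /derivable /derive E.
Qed.

Lemma MVT_dir V (f : V -> R^o) x e s :
  (forall t, `|t| <= `|s| -> derivable f (x + t *: e) e) ->
  exists2 t, `|t| <= `|s| & f (x + s *: e) - f x = s * 'D_e f (x + t *: e).
Proof.
move=> df.
(* Rescaling the segment to [0, 1] treats both signs of [s] at once. *)
pose g (t : R) := f (x + t *: (s *: e)).
have dg (t : R) : 0 <= t <= 1 -> is_derive t 1 g (s * 'D_e f (x + (t * s) *: e)).
  move=> /andP[t0 t1].
  have /df dfx : `|t * s| <= `|s| by rewrite normrM ger0_norm// ler_piMl.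
  have [d D] := is_derive_scaledir s dfx.
  rewrite -[s * _]/(s *: ('D_e f (x + (t * s) *: e) : R^o)) -D -scalerA.
  by apply: is_derive_line; rewrite scalerA.
have [t t01 Et] := @MVT_segment R g (fun t => s * 'D_e f (x + (t * s) *: e)) 0 1 ler01
  (fun t ht => dg t ltac:(by move: ht; rewrite in_itv /= => /andP[/ltW-> /ltW->]))
  ltac:(apply: derivable_within_continuous => t ht;
     by have [] := dg t ltac:(by move: ht; rewrite in_itv /=)).
move: t01; rewrite in_itv /= => /andP[t0 t1].
exists (t * s); first by rewrite normrM ger0_norm// ler_piMl.
by move: Et; rewrite /g scale1r scale0r addr0 subr0 mulr1.
Qed.

(** Indexing by [nat], with zero outside the range, makes the partial sums of the coordinate
    expansion available for induction. *)
Lemma findim_nat V {fV : findim V} : exists n (e : nat -> V) (l : nat -> V -> R^o),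
  (forall i, clin (l i)) /\ forall v, v = \sum_(0 <= i < n) l i v *: e i.
Proof.
have [n [e [l [cl el]]]] := @findim_coord _ _ fV.
exists n, (fun i => oapp e 0 (insub i)), (fun i => oapp l (fun=> 0) (insub i)); split.
  move=> i; case: insub => [j|] /=; first exact: cl.
  by split=> [k u v|x]; [rewrite scaler0 addr0|exact: cvg_cst].
by move=> v; rewrite {1}(el v) big_mkord; apply: eq_bigr => i _; rewrite valK.
Qed.

Lemma differentiable_eps V U (f df : V -> U) x : clin df ->
  (forall e, 0 < e -> \forall h \near 0, `|f (x + h) - f x - df h| <= e * `|h|) ->
  differentiable f x /\ forall v, 'd f x v = df v.
Proof.
move=> cdf H.
have E : f \o shift x = cst (f x) + linear_pack cdf.1 +o_ 0 id.
  apply/eqaddoP => e e0; have := H e e0; apply: filterS => h.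
  by rewrite -[(_ - _) h]/(f (h + x) - (f x + df h)) [h + x]addrC opprD addrA.
have D : 'd f x = linear_pack cdf.1 :> (V -> U) by apply: diff_unique => //; exact: cdf.2.
split; last by move=> v; rewrite D.
by apply/diff_locallyP; rewrite D; split=> //; exact: cdf.2.
Qed.

(** Walk from [x] to [x + h] one direction [e i] at a time and apply the mean value theorem on each
    leg; continuity of the directional derivatives makes the total error small compared with [h]. *)
Lemma Ck1_differentiable_real V {fV : findim V} (O : set V) (f : V -> R^o) x :
  open O -> Ck 1 O f -> O x -> differentiable f x.
Proof.
move=> oO /CkSP [cf df cdf] Ox.
have [n [e [l [cl el]]]] := @findim_nat V fV.
have /choice [C HC] i : exists C, 0 < C /\ forall v, `|l i v| <= C * `|v|.
  by have [c c0 H] := clin_bounded (cl i); exists c.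
pose D i := 'D_(e i) f x.
have cD : clin (fun h => \sum_(0 <= i < n) l i h * D i : R^o).
  split=> [k u v|v].
    rewrite scaler_sumr -big_split /=; apply: eq_bigr => i _.
    by rewrite (cl i).1 mulrDl; congr (_ + _); rewrite -mulrA.
  rewrite /continuous_at; elim: n {el} => [|n IH].
    by under eq_fun do rewrite big_geq//; rewrite big_geq//; exact: cvg_cst.
  under eq_fun do rewrite big_nat_recr//=; rewrite big_nat_recr//=.
  by apply: cvgD => //; apply: cvgM; [exact: (cl n).2|exact: cvg_cst].
apply: (proj1 (differentiable_eps cD _)) => eps eps0.
pose CC := \sum_(0 <= i < n) C i.
pose B := \sum_(0 <= i < n) C i * `|e i|.
have CC0 : 0 <= CC by apply: sumr_ge0 => i _; exact: ltW (HC i).1.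
have B0 : 0 <= B by apply: sumr_ge0 => i _; apply: mulr_ge0 => //; exact: ltW (HC i).1.
(* The increments [l i h] add up in absolute value to at most [CC] times the norm of [h], so an
   error [ep] per unit of increment totals at most [eps] times that norm. *)
pose ep := eps / (CC + 1).
have ep0 : 0 < ep by rewrite divr_gt0// ltr_wpDl.
have : \forall y \near x, O y /\ forall i : 'I_n, `|'D_(e i) f y - D i| <= ep.
  apply: filterI; first exact: open_nbhs_nbhs.
  apply: filter_forall => i; have /cvgrPdist_le := (Ck_cont (cdf (e i)) Ox).
  by move=> /(_ _ ep0); apply: filterS => y; rewrite distrC.
move=> /nbhs_ballP [d /= d0 Hd].
(* [B] times the norm of [h] bounds the length of every partial walk, so this radius keeps all legs
   in the ball of radius [d]; the [+ 1] covers [B = 0]. *)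
apply/nbhs_ballP; exists (d / (B + 1)) => /=; first by rewrite divr_gt0// ltr_wpDl.
move=> h; rewrite -ball_normE /= sub0r normrN ltr_pdivlMr ?ltr_wpDl// => hd.
pose P j := \sum_(0 <= i < j) l i h *: e i.
have bP j t : (j < n)%N -> `|t| <= `|l j h| -> `|P j + t *: e j| < d.
  move=> jn tl; apply: le_lt_trans hd; rewrite mulrDr mulr1.
  apply: (@le_trans _ _ (`|h| * B)); last by rewrite lerDl.
  rewrite /B mulr_sumr (big_cat_nat _ (n := j.+1))//=.
  apply: (@le_trans _ _ (\sum_(0 <= i < j.+1) `|h| * (C i * `|e i|))); last first.
    by rewrite lerDl; apply: sumr_ge0 => i _; rewrite !mulr_ge0//; exact: ltW (HC i).1.
  rewrite big_nat_recr//=; apply: le_trans (ler_normD _ _) _; apply: lerD.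
    apply: le_trans (ler_norm_sum _ _ _) _; apply: ler_sum => i _.
    by rewrite normrZ mulrA ler_wpM2r// mulrC (HC i).2.
  by rewrite normrZ mulrA ler_wpM2r// (le_trans tl)// mulrC (HC j).2.
have key j : (j <= n)%N ->
  `|f (x + P j) - f x - \sum_(0 <= i < j) l i h * D i| <= \sum_(0 <= i < j) `|l i h| * ep.
  elim: j => [|j IH] jn; first by rewrite /P !big_geq// addr0 subrr subr0 normr0.
  have jn' := ltnW jn.
  have [t tl Et] := @MVT_dir V f (x + P j) (e j) (l j h)
    (fun t tl => df _ _ (proj1 (Hd (x + P j + t *: e j)
       ltac:(by rewrite -ball_normE /= -addrA opprD addNKr normrN bP)))).
  have [_ Hj] := Hd (x + P j + t *: e j)
    ltac:(by rewrite -ball_normE /= -addrA opprD addNKr normrN bP).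
  rewrite !(big_nat_recr j)//=.
  have -> : f (x + P j.+1) - f x - (\sum_(0 <= i < j) l i h * D i + l j h * D j) =
     (f (x + P j) - f x - \sum_(0 <= i < j) l i h * D i) +
     l j h * ('D_(e j) f (x + P j + t *: e j) - D j).
    rewrite mulrBr -Et /P big_nat_recr//= addrA; ring.
  apply: le_trans (ler_normD _ _) _; apply: lerD; first exact: IH.
  by rewrite normrM ler_wpM2l// (Hj (Ordinal jn)).
have := key n (leqnn n); rewrite /P -el => /le_trans; apply.
rewrite -mulr_suml mulrC.
apply: (@le_trans _ _ (ep * (CC * `|h|))).
  rewrite ler_wpM2l ?(ltW ep0)// /CC mulr_suml; apply: ler_sum => i _; exact: (HC i).2.
rewrite mulrA ler_wpM2r// /ep -mulrA ler_piMr ?(ltW eps0)// mulrC ler_pdivrMr ?ltr_wpDl//.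
by rewrite mul1r lerDl.
Qed.

Lemma differentiable_coord_findim V U (f : V -> U) n (e : 'I_n -> U)
   (l : 'I_n -> U -> R^o) x :
  (forall v, v = \sum_i l i v *: e i) ->
  (forall i, differentiable (l i \o f) x) -> differentiable f x.
Proof.
move=> el df; rewrite (_ : f = \sum_i (fun y => (l i \o f) y *: e i)); last first.
  by apply/funext => y; rewrite fct_sumE {1}(el (f y)).
apply: differentiable_sum => i; exact: differentiableZl.
Qed.

Lemma Ck1_differentiable V U {fV : findim V} {fU : findim U} (O : set V)
    (f : V -> U) x :
  open O -> Ck 1 O f -> O x -> differentiable f x.
Proof.
move=> oO cf Ox; have [n [e [l [cl el]]]] := @findim_coord _ _ fU.
apply: (differentiable_coord_findim el) => i.
have Cl : Ck 1 O (l i \o f) by apply: Ck_clin.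
exact: Ck1_differentiable_real oO Cl Ox.
Qed.

Lemma differentiable_clin V U (f : V -> U) x : differentiable f x -> clin (fun v => 'D_v f x).
Proof.
move=> df; rewrite (_ : (fun v => 'D_v f x) = 'd f x); last by apply/funext => v; exact: deriveE.
by split; [move=> k u v; exact: linearP|exact: diff_continuous].
Qed.

Lemma derive_comp V U W (f : V -> U) (g : U -> W) x v :
  differentiable f x -> differentiable g (f x) ->
  'D_v (g \o f) x = 'D_('D_v f x) g (f x).
Proof.
move=> df dg; rewrite !deriveE//; last exact: differentiable_comp.
by rewrite diff_comp.
Qed.

(** In the chain rule the direction ['D_v f x] depends on the point. Expanding it in the spanning
    family turns the derivative into a sum of products of C^k functions, one factor of which is a
    composite covered by the induction hypothesis. *)
Lemma Ck_comp V U W {fV : findim V} {fU : findim U} {fW : findim W} k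
    (O : set V) (O' : set U) (f : V -> U) (g : U -> W) :
  open O -> open O' -> (forall x, O x -> O' (f x)) ->
  Ck k O f -> Ck k O' g -> Ck k O (g \o f).
Proof.
move=> oO oO' fO; have [n [e [l [cl el]]]] := @findim_coord _ _ fU.
elim: k f g fO => [|k IH] f g fO.
  by move=> [cf _] [cg _]; split=> // x Ox; apply: continuous_comp; [exact: cf|apply: cg; exact: fO].
move=> Cf Cg; have /CkSP [cf df cdf] := Cf; have /CkSP [cg dg cdg] := Cg.
have le1 (X Y : normedModType R) (Z : set X) (h : X -> Y) : Ck k.+1 Z h -> Ck 1 Z h.
  by clear; elim: k => // k IH /Ck_pred /IH.
have Df x : O x -> differentiable f x.
  by move=> Ox; apply: Ck1_differentiable oO (le1 _ _ _ _ Cf) Ox.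
have Dg x : O x -> differentiable g (f x).
  by move=> Ox; apply: Ck1_differentiable oO' (le1 _ _ _ _ Cg) (fO _ Ox).
apply/CkSP; split=> [x Ox|v x Ox|v].
- by apply: continuous_comp; [exact: cf|apply: cg; exact: fO].
- by apply: diff_derivable; apply: differentiable_comp; [exact: Df|exact: Dg].
- have H i : Ck k O (fun x => l i ('D_v f x) *: ('D_(e i) g \o f) x).
    by apply: CkZ => //; [exact: Ck_clin|apply: IH => //; exact: Ck_pred].
  apply: Ck_ext (Ck_sum oO H) => // x Ox /=.
  rewrite [RHS]derive_comp; [|exact: Df|exact: Dg].
  have c := differentiable_clin (Dg x Ox).
  rewrite [in RHS](el ('D_v f x)) (clin_sum _ c).
  by apply: eq_bigr => i _; rewrite (clinZ _ _ c).
Qed.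

End CkTheory.

(** * Smooth maps, symmetry of second derivatives, inverse function theorem *)

Section Smooth.
Context {R : realType}.
Implicit Types V U W : normedModType R.

Lemma smooth_cont V U (O : set V) (f : V -> U) x :
  smooth_on O f -> O x -> {for x, continuous f}.
Proof. by move=> /(_ 0%N) [cf _]; exact: cf. Qed.

Lemma smooth_ext V U (O : set V) (f g : V -> U) : open O ->
  (forall x, O x -> f x = g x) -> smooth_on O f -> smooth_on O g.
Proof. by move=> oO fg sf k; exact: Ck_ext (sf k). Qed.

Lemma smooth_sub V U (O O' : set V) (f : V -> U) :
  O' `<=` O -> smooth_on O f -> smooth_on O' f.
Proof. by move=> OO sf k; exact: Ck_sub (sf k). Qed.

Lemma smooth_derive V U (O : set V) (f : V -> U) v :
  smooth_on O f -> smooth_on O ('D_v f).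
Proof. by move=> sf k; have /CkSP [_ _] := sf k.+1; apply. Qed.

Lemma smooth_differentiable V U {fV : findim V} {fU : findim U} (O : set V)
    (f : V -> U) x : open O -> smooth_on O f -> O x -> differentiable f x.
Proof. by move=> oO sf; exact: Ck1_differentiable oO (sf 1%N). Qed.

Lemma smooth_clin V U W (O : set V) (f : V -> U) (l : U -> W) : open O ->
  clin l -> smooth_on O f -> smooth_on O (l \o f).
Proof. by move=> oO cl sf k; exact: Ck_clin. Qed.

Lemma smooth_cst V U (O : set V) (c : U) : smooth_on O (cst c).
Proof. by move=> k; exact: Ck_cst. Qed.

Lemma smooth_id V (O : set V) : smooth_on O id.
Proof.
case=> [|k]; first by split=> // x _; exact: cvg_id.
apply/CkSP; split=> [x _|v x _|v]; first exact: cvg_id.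
  exact: derivable_id.
rewrite (_ : 'D_v id = cst v); first exact: Ck_cst.
by apply/funext => x; rewrite derive_id.
Qed.

Lemma smooth_linear V U (O : set V) (l : V -> U) : open O -> clin l -> smooth_on O l.
Proof. by move=> oO cl; have := smooth_clin oO cl (smooth_id O). Qed.

Lemma smoothD V U (O : set V) (f g : V -> U) : open O ->
  smooth_on O f -> smooth_on O g -> smooth_on O (fun x => f x + g x).
Proof. by move=> oO sf sg k; exact: CkD. Qed.

Lemma smooth_sum V U (O : set V) I (r : seq I) (P : pred I) (f : I -> V -> U) :
  open O -> (forall i, smooth_on O (f i)) ->
  smooth_on O (fun x => \sum_(i <- r | P i) f i x).
Proof.
move=> oO sf; elim: r => [|i r IH].
  by under eq_fun do rewrite big_nil; exact: smooth_cst.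
under eq_fun do rewrite big_cons.
by case: (P i) => //; exact: smoothD.
Qed.

Lemma smoothM V (O : set V) (f g : V -> R^o) : open O ->
  smooth_on O f -> smooth_on O g -> smooth_on O (fun x => f x * g x : R^o).
Proof. by move=> oO sf sg k; exact: CkM. Qed.

Lemma smooth_prod V (O : set V) I (r : seq I) (P : pred I) (f : I -> V -> R^o) :
  open O -> (forall i, smooth_on O (f i)) ->
  smooth_on O (fun x => \prod_(i <- r | P i) f i x : R^o).
Proof.
move=> oO sf; elim: r => [|i r IH].
  by under eq_fun do rewrite big_nil; exact: smooth_cst.
under eq_fun do rewrite big_cons.
by case: (P i) => //; exact: smoothM.
Qed.

Lemma smoothZ V U {fU : findim U} (O : set V) (f : V -> R^o) (g : V -> U) : open O ->
  smooth_on O f -> smooth_on O g -> smooth_on O (fun x => f x *: g x).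
Proof. by move=> oO sf sg k; exact: CkZ. Qed.

Lemma smooth_pair V U W (O : set V) (f : V -> U) (g : V -> W) : open O ->
  smooth_on O f -> smooth_on O g -> smooth_on O (fun x => (f x, g x)).
Proof. by move=> oO sf sg k; exact: Ck_pair. Qed.

Lemma smoothV V (O : set V) (f : V -> R^o) : open O ->
  (forall x, O x -> f x != 0) -> smooth_on O f -> smooth_on O (fun x => (f x)^-1 : R^o).
Proof. by move=> oO f0 sf k; exact: CkV. Qed.

Lemma smooth_comp V U W {fV : findim V} {fU : findim U} {fW : findim W}
    (O : set V) (O' : set U) (f : V -> U) (g : U -> W) :
  open O -> open O' -> (forall x, O x -> O' (f x)) ->
  smooth_on O f -> smooth_on O' g -> smooth_on O (g \o f).
Proof. by move=> oO oO' fO sf sg k; exact: Ck_comp (sf k) (sg k). Qed.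

Lemma smooth_fst V U (O : set (V * U)%type) : open O -> smooth_on O fst.
Proof. by move=> oO; apply: smooth_linear => //; exact: clin_fst. Qed.

Lemma smooth_snd V U (O : set (V * U)%type) : open O -> smooth_on O snd.
Proof. by move=> oO; apply: smooth_linear => //; exact: clin_snd. Qed.

Lemma smooth_onT V U (O : set V) (f : V -> U) : open O ->
  (forall x, O x -> exists N, [/\ open N, N x & smooth_on N f]) -> smooth_on O f.
Proof.
move=> oO H k; elim: k f H => [|k IH] f H.
  by split=> // x /H [N [_ Nx sf]]; exact: smooth_cont sf Nx.
apply/CkSP; split=> [x /H [N [_ Nx sf]]|v x /H [N [_ Nx sf]]|v].
- exact: smooth_cont sf Nx.
- by have /CkSP [_ + _] := sf 1%N; apply.
- by apply: IH => x /H [N [oN Nx sf]]; exists N; split=> //; exact: smooth_derive.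
Qed.

Lemma openXT V U (O : set V) : open O -> open [set z : V * U | O z.1].
Proof.
by move=> oO; apply: (open_comp (f := fst)) => // x _; apply: cvg_fst.
Qed.

(** Expanding the direction reduces to derivatives along finitely many fixed directions. This is
    what makes transition maps of tangent bundles smooth. *)
Lemma smooth_derive_joint V U {fV : findim V} {fU : findim U} (O : set V)
    (f : V -> U) : open O -> smooth_on O f ->
  smooth_on [set z : V * V | O z.1] (fun z => 'D_(z.2) f z.1).
Proof.
move=> oO sf; have [n [e [l [cl el]]]] := @findim_coord _ _ fV.
have oOT := @openXT V V O oO.
have H i : smooth_on [set z : V * V | O z.1] (fun z => l i z.2 *: ('D_(e i) f \o fst) z).
  apply: smoothZ => //; first exact: smooth_clin (smooth_snd oOT).
  apply: (smooth_comp (O' := O)) => //; [exact: smooth_fst|exact: smooth_derive].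
apply: smooth_ext (smooth_sum _ predT oOT H) => // -[x v] /= Ox.
have c := differentiable_clin (@smooth_differentiable _ _ fV fU _ _ _ oO sf Ox).
by rewrite [in RHS](el v) (clin_sum _ c); apply: eq_bigr => i _; rewrite (clinZ _ _ c).
Qed.

(** The function solves [y' = - y^3 / 2], so its derivative is a polynomial in itself and the C^k
    induction closes. *)
Lemma smooth_invsqrt_pos :
  smooth_on [set t : R^o | 0 < t] (fun t : R^o => (Num.sqrt t)^-1 : R^o).
Proof.
have oP : open [set t : R^o | 0 < t] by exact: open_gt.
have D (t : R) : 0 < t -> is_derive (t : R^o) (1 : R^o) (fun t : R^o => (Num.sqrt t)^-1 : R^o)
    (- 2^-1 * ((Num.sqrt t)^-1 * ((Num.sqrt t)^-1 * (Num.sqrt t)^-1))).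
  move=> t0; have s0 : Num.sqrt t != 0 by rewrite gt_eqF// sqrtr_gt0.
  have [ds Ds] := is_derive1_sqrt t0.
  split; first exact: derivableV.
  rewrite deriveV// Ds /GRing.scale/= invfM; field; exact: s0.
elim=> [|k IH].
  split=> // t /D [dt _]; exact/differentiable_continuous/derivable1_diffP.
have E (v : R^o) : v = (v : R) *: (1 : R^o) by rewrite [RHS]mulr1.
apply/CkSP; split=> [t /D [dt _]|v t /D [dt _]|v].
- exact/differentiable_continuous/derivable1_diffP.
- by rewrite (E v); have [] := is_derive_scaledir (v : R) dt.
- have H := CkM oP (Ck_cst k _ ((v : R) * - 2^-1 : R^o)) (CkM oP IH (CkM oP IH IH)).
  apply: Ck_ext H => // t t0; have [dt Dt] := D t t0.
  rewrite [in RHS](E v); have [_ ->] := is_derive_scaledir (v : R) dt.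
  by rewrite Dt /cst [RHS]mulrA.
Qed.

Lemma smooth_invsqrt V {fV : findim V} (O : set V) (f : V -> R^o) : open O ->
  (forall x, O x -> 0 < f x) -> smooth_on O f ->
  smooth_on O (fun x => (Num.sqrt (f x))^-1 : R^o).
Proof.
move=> oO f0 sf; have oP : open [set t : R^o | 0 < t] by exact: open_gt.
exact: (smooth_comp oO oP f0 sf smooth_invsqrt_pos).
Qed.

Lemma smooth_mxP V m n (O : set V) (M : V -> 'M[R]_(m, n)) : open O ->
  (forall i j, smooth_on O (fun x => M x i j : R^o)) -> smooth_on O M.
Proof.
move=> oO sM.
rewrite (_ : M = fun x => \sum_i \sum_j M x i j *: delta_mx i j); last first.
  by apply/funext => x; exact: matrix_sum_delta.
apply: smooth_sum => // i; apply: smooth_sum => // j; apply: smoothZ => //; exact: smooth_cst.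
Qed.

Lemma smooth_mxE V m n (O : set V) (M : V -> 'M[R]_(m, n)) i j : open O ->
  smooth_on O M -> smooth_on O (fun x => M x i j : R^o).
Proof. by move=> oO sM; apply: (smooth_clin oO (clin_coord i j) sM). Qed.

Lemma smooth_mulmx V m n p (O : set V) (M : V -> 'M[R]_(m, n)) (N : V -> 'M[R]_(n, p)) :
  open O -> smooth_on O M -> smooth_on O N -> smooth_on O (fun x => M x *m N x).
Proof.
move=> oO sM sN; apply: smooth_mxP => // i j.
under eq_fun do rewrite mxE.
by apply: smooth_sum => // l; apply: smoothM => //; exact: smooth_mxE.
Qed.

Lemma smooth_trmx V m n (O : set V) (M : V -> 'M[R]_(m, n)) :
  open O -> smooth_on O M -> smooth_on O (fun x => (M x)^T).
Proof.
move=> oO sM; apply: smooth_mxP => // i j.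
by under eq_fun do rewrite mxE; exact: smooth_mxE.
Qed.

Lemma smooth_det V n (O : set V) (M : V -> 'M[R]_n) :
  open O -> smooth_on O M -> smooth_on O (fun x => \det (M x) : R^o).
Proof.
move=> oO sM; apply: smooth_sum => // s; apply: smoothM => //; first exact: smooth_cst.
by apply: smooth_prod => // i; exact: smooth_mxE.
Qed.

(** Cramer's rule: only determinants and one division occur. *)
Lemma smooth_invmx V n (O : set V) (M : V -> 'M[R]_n) : open O ->
  (forall x, O x -> M x \in unitmx) ->
  smooth_on O M -> smooth_on O (fun x => invmx (M x)).
Proof.
move=> oO uM sM.
have s : smooth_on O (fun x => (\det (M x))^-1 *: \adj (M x)).
  apply: smoothZ => //.
    by apply: smoothV => // [x /uM|]; [rewrite unitmxE unitfE|exact: smooth_det].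
  apply: smooth_mxP => // i j; under eq_fun do rewrite !mxE.
  apply: smoothM => //; first exact: smooth_cst.
  apply: smooth_det => //; apply: smooth_mxP => // a b.
  by under eq_fun do rewrite !mxE; exact: smooth_mxE.
by apply: smooth_ext s => // x /uM u; rewrite /invmx u.
Qed.

Lemma is_derive_translate V U (f : V -> U) x c v :
  derivable f (x + c) v -> is_derive x v (fun y => f (y + c)) ('D_v f (x + c)).
Proof.
move=> df.
have E : (fun h : R => h^-1 *: (((fun y => f (y + c)) \o shift x) (h *: v) - f (x + c))) =
   (fun h => h^-1 *: ((f \o shift (x + c)) (h *: v) - f (x + c))).
  by apply/funext => h /=; rewrite addrA.
by split; rewrite /derivable /derive E.
Qed.

(** The mean value theorem is applied twice, along [v] to the difference [f (y + s *: w) - f y] and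
    then along [w] to ['D_v f]. The second difference is thus [s * s] times the mixed derivative at
    a nearby point. *)
Lemma second_difference V (O : set V) (f : V -> R^o) x v w e : open O -> O x ->
  Ck 2 O f -> 0 < e -> \forall s \near 0, `|f (x + s *: v + s *: w) -
    f (x + s *: v) - f (x + s *: w) + f x - s * s * 'D_w ('D_v f) x| <= s * s * e.
Proof.
move=> oO Ox Cf e0.
have /CkSP [_ df C1] := Cf; have /CkSP [_ ddf /(_ w) C2] := C1 v.
have [G EG] : exists G : V -> R^o, 'D_w ('D_v f) = G by exists ('D_w ('D_v f)).
have EGx y : 'D_w ('D_v f) y = G y by rewrite -EG.
rewrite EG in C2; rewrite EGx.
have : \forall y \near x, O y /\ `|G x - G y| <= e.
  apply: filterI; first exact: open_nbhs_nbhs.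
  have /cvgrPdist_le := Ck_cont C2 Ox; exact.
move=> /nbhs_ballP [d /= d0 Hd].
apply/nbhs_ballP; exists (d / (`|v| + `|w| + 1)) => /=.
  by rewrite divr_gt0// ltr_wpDl// addr_ge0.
move=> s; rewrite -ball_normE /= sub0r normrN ltr_pdivlMr ?ltr_wpDl ?addr_ge0// => hs.
have bd t t' : `|t| <= `|s| -> `|t'| <= `|s| -> ball x d (x + t *: v + t' *: w).
  move=> ht ht'; rewrite -ball_normE /= -addrA opprD addNKr normrN.
  apply: le_lt_trans hs; rewrite !mulrDr mulr1 -[leLHS]addr0.
  apply: lerD => //; apply: le_trans (ler_normD _ _) _.
  by rewrite !normrZ; apply: lerD; exact: ler_wpM2r.
have z0 : `|0 : R| <= `|s| by rewrite normr0.
have dphi t : `|t| <= `|s| -> is_derive (x + t *: v) v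
    (fun y => f (y + s *: w) - f y : R^o)
    ('D_v f (x + t *: v + s *: w) - 'D_v f (x + t *: v)).
  move=> ht; apply: is_deriveB.
    by apply: is_derive_translate; apply: df; exact: (Hd _ (bd _ _ ht (lexx _))).1.
  apply: derivableP; apply: df.
  by have := (Hd _ (bd _ _ ht z0)).1; rewrite scale0r addr0.
have [t ht Et] := @MVT_dir R V (fun y => f (y + s *: w) - f y : R^o) x v s
  (fun t ht => ex_derive (is_derive := dphi t ht)).
have [_ Dt] := dphi t ht; rewrite Dt in Et.
have [t' ht' Et'] := @MVT_dir R V ('D_v f) (x + t *: v) w s
  (fun t' ht' => ddf w _ (Hd _ (bd _ _ ht ht')).1).
rewrite Et' EGx in Et.
rewrite (_ : _ - _ = - (s * s * (G x - G (x + t *: v + t' *: w)))).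
  rewrite normrN normrM ger0_norm -?expr2 ?sqr_ge0//.
  by apply: ler_wpM2l; rewrite ?sqr_ge0//; exact: (Hd _ (bd _ _ ht ht')).2.
transitivity (s * (s * G (x + t *: v + t' *: w)) - s * s * G x); last by ring.
by rewrite -Et; ring.
Qed.

(** Schwarz's theorem: the second difference is symmetric in [v] and [w], so both mixed derivatives
    are its limit after division by [s * s]. *)
Lemma derive_symmetric V (O : set V) (f : V -> R^o) x v w : open O -> O x ->
  Ck 2 O f -> 'D_w ('D_v f) x = 'D_v ('D_w f) x.
Proof.
move=> oO Ox Cf; apply/eqP; rewrite -subr_eq0 -normr_le0.
apply/ler_addgt0Pl => e e0; rewrite addr0.
have e20 : 0 < e / 2 by rewrite divr_gt0.
have H1 := second_difference v w oO Ox Cf e20.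
have H2 := second_difference w v oO Ox Cf e20.
have N0 : \forall s \near (0 : R)^', s != 0 by exact: nbhs_dnbhs_neq.
move: H1 H2; move: ('D_w ('D_v f) x) ('D_v ('D_w f) x) => D1 D2 H1 H2.
near (0 : R)^' => s.
have s0 : s != 0 by near: s.
have A : `|f (x + s *: v + s *: w) - f (x + s *: v) - f (x + s *: w) + f x -
     s * s * D1| <= s * s * (e / 2) by near: s; exact: nbhs_dnbhs H1.
have B : `|f (x + s *: w + s *: v) - f (x + s *: w) - f (x + s *: v) + f x -
     s * s * D2| <= s * s * (e / 2) by near: s; exact: nbhs_dnbhs H2.
rewrite -(ler_pM2l (x := s * s)); last by rewrite -expr2 exprn_even_gt0.
have ss0 : 0 <= s * s by rewrite -expr2 sqr_ge0.
rewrite -{1}(ger0_norm ss0) -normrM.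
rewrite (addrAC x (s *: w)) in B.
move: A B; rewrite !ler_norml => /andP[A1 A2] /andP[B1 B2].
by apply/andP; split; lra.
Unshelve. all: by end_near. Qed.

Lemma mx_norm_le m n (M : 'M[R]_(m, n)) c : 0 <= c ->
  (forall i j, `|M i j| <= c) -> `|M| <= c.
Proof.
move=> c0 H; rewrite [`|M|]mx_normrE.
by apply: bigmax_le => // -[i j] _; exact: H.
Qed.

Lemma mx_norm_ge m n (M : 'M[R]_(m, n)) i j : `|M i j| <= `|M|.
Proof.
rewrite [`|M|]mx_normrE.
exact: (le_bigmax _ (fun p : 'I_m * 'I_n => `|M p.1 p.2|) (i, j)).
Qed.

(** Vectors are rows, so this matrix acts on the right ([jacE]); it is the transpose of the usual
    Jacobian matrix. *)
Definition jac m n (f : 'rV[R]_m -> 'rV[R]_n) (u : 'rV[R]_m) : 'M[R]_(m, n) :=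
  \matrix_(i, j) ('D_(delta_mx 0 i) f u) 0 j.

Lemma jacE m n (f : 'rV[R]_m -> 'rV[R]_n) u h :
  differentiable f u -> 'D_h f u = h *m jac f u.
Proof.
move=> df; have c := differentiable_clin df.
rewrite [in LHS](row_sum_delta h) (clin_sum _ c); apply/rowP => j.
rewrite summxE mxE; apply: eq_bigr => i _.
by rewrite (clinZ _ _ c) !mxE.
Qed.

Lemma smooth_jac m n (O : set 'rV[R]_m) (f : 'rV[R]_m -> 'rV[R]_n) : open O ->
  smooth_on O f -> smooth_on O (jac f).
Proof.
move=> oO sf; apply: smooth_mxP => // i j; under eq_fun do rewrite mxE.
by apply: smooth_mxE => //; exact: smooth_derive.
Qed.

Lemma row_injective_unitmx n (M : 'M[R]_n) :
  (forall h : 'rV_n, h *m M = 0 -> h = 0) -> M \in unitmx.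
Proof.
move=> H; rewrite -row_free_unit -kermx_eq0; apply/eqP/row_matrixP => i.
by rewrite row0; apply: H; rewrite -row_mul mulmx_ker row0.
Qed.

(** Mean value theorem for the coordinates of [f - id] on the segment from [u] to [v]; in the
    maximum norm a bound on each coordinate suffices. *)
Lemma approx_identity_lipschitz m (c : 'rV[R]_m) r (f : 'rV[R]_m -> 'rV[R]_m) :
  (forall u, `|u - c| <= r -> differentiable f u /\
     forall h, `|'D_h f u - h| <= 2^-1 * `|h|) ->
  forall u v, `|u - c| <= r -> `|v - c| <= r -> `|f v - f u - (v - u)| <= 2^-1 * `|v - u|.
Proof.
move=> H u v hu hv; apply: mx_norm_le => [|i j]; first by rewrite mulr_ge0.
rewrite (ord1 i).
have hb t : 0 <= t <= 1 -> `|u + t *: (v - u) - c| <= r.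
  move=> /andP[t0 t1]; rewrite (_ : _ - c = (1 - t) *: (u - c) + t *: (v - c)).
    apply: le_trans (ler_normD _ _) _; rewrite !normrZ !ger0_norm ?subr_ge0//.
    move: hu hv; move: `|u - c| `|v - c| => a b; nra.
  by apply/rowP => l; rewrite !mxE; ring.
pose g (w : 'rV[R]_m) := (f w) 0 j - w 0 j : R^o.
have dg w h : `|w - c| <= r -> is_derive w h g (('D_h f w - h) 0 j).
  move=> hw; have [df _] := H w hw.
  have [a1 a2] := is_derive_clin (clin_coord 0 j) (@diff_derivable _ _ _ f w h df).
  have dI : derivable (@id 'rV[R]_m) w h by exact: derivable_id.
  have [b1 b2] := is_derive_clin (clin_coord 0 j) dI.
  rewrite mxE [(- h) 0 j]mxE.
  apply: is_deriveB; first exact: (DeriveDef a1 a2).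
  by rewrite derive_id in b2; exact: (DeriveDef b1 b2).
pose g1 (t : R) := g (u + t *: (v - u)).
have dg1 (t : R) : 0 <= t <= 1 -> is_derive t 1 g1 (('D_(v - u) f (u + t *: (v - u)) - (v - u)) 0 j).
  by move=> t01; have [d <-] := dg _ (v - u) (hb t t01); exact: is_derive_line.
have [t t01 Et] := @MVT_segment R g1 (fun t => ('D_(v - u) f (u + t *: (v - u)) - (v - u)) 0 j) 0 1 ler01
  (fun t ht => dg1 t ltac:(by move: ht; rewrite in_itv /= => /andP[/ltW-> /ltW->]))
  ltac:(apply: derivable_within_continuous => t ht;
     by have [] := dg1 t ltac:(by move: ht; rewrite in_itv /=)).
have E : (f v - f u - (v - u)) 0 j = g1 1 - g1 0.
  by rewrite /g1 /g scale1r scale0r addr0 (addrC u) subrK !mxE; ring.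
rewrite E Et subr0 mulr1; apply: le_trans (mx_norm_ge _ _ _) _.
by apply: (H _ (hb t _)).2; move: t01; rewrite in_itv.
Qed.

(** In place of a Picard iteration, the distance from [f u] to [z] is minimised over the compact
    closed ball. Were the minimum [d] positive, the single Newton step [u - (f u - z)] would stay in
    the ball and bring the distance down to at most [d / 2]. *)
Lemma approx_identity_onto m (c : 'rV[R]_m) r (f : 'rV[R]_m -> 'rV[R]_m) z :
  0 < r -> (forall u, `|u - c| <= r -> differentiable f u /\
     forall h, `|'D_h f u - h| <= 2^-1 * `|h|) ->
  `|z - f c| < r / 6 -> exists2 u, `|u - c| <= r & f u = z.
Proof.
move=> r0 H hz; have L := approx_identity_lipschitz H.
have cB : compact [set u : 'rV[R]_m | `|u - c| <= r].
  apply: bounded_closed_compact.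
    exists (r + `|c|); split=> [|M rM u /= uc]; first exact: num_real.
    apply: le_trans (ltW rM).
    by rewrite -lerBlDr; apply: le_trans (lerB_dist _ _) uc.
  apply: (closed_comp (f := fun u : 'rV[R]_m => `|u - c|) (D := [set x | x <= r])).
    move=> u _; apply: (@cvg_norm _ _ _ (nbhs u)); apply: cvgB; [exact: cvg_id|exact: cvg_cst].
  exact: closed_le.
have [u uB umin] := @EVT_min_rV R m (fun u => `|f u - z|) _
  (ex_intro _ c (ltac:(by rewrite /= subrr normr0 ltW) : [set u : 'rV[R]_m | `|u - c| <= r] c)) cB
  ltac:(apply: continuous_in_subspaceT => w; rewrite inE /= => hw;
    apply: (@cvg_norm _ _ _ (nbhs w)); apply: cvgB;
    [exact/differentiable_continuous/(H w hw).1|exact: cvg_cst]).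
rewrite inE /= in uB; exists u => //; apply/eqP; rewrite -subr_eq0 -normr_eq0.
apply: contraT => d0; set d := `|f u - z| in d0 umin.
have {}d0 : 0 < d by rewrite lt_def d0 normr_ge0.
have dz : d < r / 6.
  by apply: le_lt_trans hz; rewrite distrC; apply: umin; rewrite inE /= subrr normr0 ltW.
(* [f u] is within [d + r / 6 < r / 3] of [f c], which confines [u] to two thirds of the ball; the
   Newton step of length [d < r / 6] then stays inside. *)
have uc : `|u - c| <= 2 * (r / 3).
  have := L c u (ltac:(by rewrite subrr normr0 ltW)) uB.
  have := ler_normB (f u - z) (f c - z); rewrite opprB addrA subrK -/d (distrC (f c)) => A.
  have := ler_normD (u - c - (f u - f c)) (f u - f c); rewrite subrK.
  rewrite (distrC (u - c)); move: A hz; lra.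
have u'B : `|u - (f u - z) - c| <= r.
  rewrite addrAC; apply: le_trans (ler_normB _ _) _; rewrite -/d; lra.
have := L u _ uB u'B; have := umin (u - (f u - z)) (ltac:(by rewrite inE)).
rewrite (_ : u - (f u - z) - u = - (f u - z)); last by rewrite addrAC subrr add0r.
rewrite opprK normrN -/d (_ : _ - f u + _ = f (u - (f u - z)) - z).
  by move=> A B; move: (le_trans A B); lra.
by rewrite addrA subrK.
Qed.

Lemma clin_mulmxr m n (M : 'M[R]_(m, n)) : clin (fun v : 'rV[R]_m => v *m M).
Proof. by apply: clin_findim => k u v; rewrite mulmxDl scalemxAl. Qed.

Lemma open_preimage_on (X Y : topologicalType) (O : set X) (B : set Y) (h : X -> Y) :
  open O -> open B -> (forall x, O x -> {for x, continuous h}) ->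
  open [set x | O x /\ B (h x)].
Proof.
move=> oO oB ch; rewrite openE => x [Ox Bx].
apply: (@filterI _ (nbhs x)); first exact: open_nbhs_nbhs.
by apply: (ch x Ox); exact: open_nbhs_nbhs.
Qed.

Lemma differentiable_epsP V U (f : V -> U) x e : differentiable f x -> 0 < e ->
  \forall h \near 0, `|f (x + h) - f x - 'D_h f x| <= e * `|h|.
Proof.
move=> df e0; have /eqaddoP /(_ e e0) := diff_locally df.
apply: filterS => h.
by rewrite -[(_ - _) h]/(f (h + x) - (f x + 'd f x h)) [h + x]addrC opprD addrA deriveE.
Qed.

(** Inverse function theorem. Composed with the inverse Jacobian at [c] the map is close to the
    identity near [c], and the two preceding lemmas give injectivity and local surjectivity. *)
Lemma smooth_local_inverse m (O : set 'rV[R]_m) (f : 'rV[R]_m -> 'rV[R]_m) c :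
  open O -> O c -> smooth_on O f -> (forall h : 'rV[R]_m, 'D_h f c = 0 -> h = 0) ->
  exists (N : set 'rV[R]_m) g, [/\ open N, N (f c), g (f c) = c, smooth_on N g &
    forall z, N z -> O (g z) /\ f (g z) = z].
Proof.
move=> oO Oc sf injc.
have Df u : O u -> differentiable f u by exact: smooth_differentiable.
have uc : jac f c \in unitmx.
  apply: row_injective_unitmx => h; rewrite -(jacE _ (Df c Oc)); exact: injc.
pose T := invmx (jac f c); have cT := clin_mulmxr T.
pose F u := f u *m T.
have sF : smooth_on O F by apply: smooth_clin cT sf.
(* In the maximum norm [h *m B] is bounded by [m] times the product of the norms, so entries at most
   [ep] give the factor one half; [m.+1] avoids a division by zero. *)
pose ep : R := (2 * m.+1%:R)^-1.
have ep0 : 0 < ep by rewrite invr_gt0 mulr_gt0.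
pose A u := jac f u *m T.
have sA : smooth_on O A by apply: smooth_mulmx => //; [exact: smooth_jac|exact: smooth_cst].
have : \forall u \near c, O u /\ `|A c - A u| <= ep.
  apply: filterI; first exact: open_nbhs_nbhs.
  have /cvgrPdist_le := smooth_cont sA Oc; exact.
move=> /nbhs_ballP [d /= d0 Hd].
pose r := d / 2; have r0 : 0 < r by rewrite divr_gt0.
have Hr u : `|u - c| <= r -> O u /\ `|A c - A u| <= ep.
  move=> hu; apply: Hd; rewrite -ball_normE /= distrC (le_lt_trans hu)//.
  by rewrite /r ltr_pdivrMr// mulr_natr mulr2n ltrDl.
have HF u : `|u - c| <= r -> differentiable F u /\
    forall h : 'rV[R]_m, `|'D_h F u - h| <= 2^-1 * `|h|.
  move=> hu; have [Ou hA] := Hr u hu; split; first exact: smooth_differentiable sF Ou.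
  move=> h; have [_ ->] := is_derive_clin cT (@diff_derivable _ _ _ f u h (Df u Ou)).
  rewrite (jacE _ (Df u Ou)) -mulmxA -/(A u).
  rewrite (_ : _ - h = - (h *m (A c - A u))); last first.
    have Ac : A c = 1%:M by exact: mulmxV.
    by rewrite mulmxBr Ac mulmx1 opprB.
  rewrite normrN; apply: mx_norm_le => [|i j]; first by rewrite mulr_ge0.
  rewrite mxE; apply: le_trans (ler_norm_sum _ _ _) _.
  apply: (@le_trans _ _ (\sum_(l < m) `|h| * ep)).
    apply: ler_sum => l _; rewrite normrM; apply: ler_pM => //; first exact: mx_norm_ge.
    by apply: le_trans hA; exact: mx_norm_ge.
  rewrite (_ : \sum_(l < m) _ = m%:R * ep * `|h|).
    by rewrite ler_wpM2r// /ep invfM mulrCA ler_piMr// ler_pdivrMr// mul1r ler_nat.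
  by rewrite sumr_const card_ord -[LHS]mulr_natl mulrA [in RHS]mulrAC.
have L := approx_identity_lipschitz HF.
have inj u v : `|u - c| <= r -> `|v - c| <= r -> `|v - u| <= 2 * `|F v - F u|.
  move=> hu hv; have := L u v hu hv.
  have := ler_normB (F v - F u) (F v - F u - (v - u)); rewrite opprB addrC subrK.
  lra.
pose N := [set z : 'rV[R]_m | `|z *m T - F c| < r / 6].
have cN : continuous (fun z : 'rV[R]_m => `|z *m T - F c|).
  move=> z; apply: (@cvg_norm _ _ _ (nbhs z)); apply: cvgB; [exact: cT.2|exact: cvg_cst].
have oN : open N by apply: (open_comp (f := fun z : 'rV[R]_m => `|z *m T - F c|) (D := [set x | x < r / 6])) => //; exact: open_lt.
pose g z := xget c [set u | `|u - c| <= r /\ F u = z *m T].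
have gP z : N z -> `|g z - c| <= r /\ F (g z) = z *m T.
  move=> Nz; have [u hu Fu] := approx_identity_onto r0 HF Nz.
  by have /= := @xgetPex _ c [set u | `|u - c| <= r /\ F u = z *m T] (ex_intro _ u (conj hu Fu)).
have fK z : N z -> O (g z) /\ f (g z) = z.
  move=> Nz; have [h1 h2] := gP z Nz; split; first exact: (Hr _ h1).1.
  by rewrite -(mulmxKV uc (f (g z))) -/T -/(F _) h2 mulmxKV.
have Nc : N (f c) by rewrite /N /= subrr normr0 divr_gt0.
have gc : g (f c) = c.
  have [h1 h2] := gP _ Nc; apply/eqP; rewrite -subr_eq0 -normr_le0.
  have := inj c (g (f c)) (ltac:(by rewrite subrr normr0 ltW)) h1.
  by rewrite h2 subrr normr0 mulr0.
have [C C0 HC] := clin_bounded cT.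
have gL z z' : N z -> N z' -> `|g z' - g z| <= 2 * C * `|z' - z|.
  move=> Nz Nz'; have [h1 h2] := gP z Nz; have [h1' h2'] := gP z' Nz'.
  apply: le_trans (inj _ _ h1 h1') _; rewrite h2 h2' -mulmxBl -mulrA.
  by apply: ler_wpM2l => //; exact: HC.
have uJ u : `|u - c| <= r -> jac f u \in unitmx.
  move=> hu; have [dF H] := HF u hu; apply: row_injective_unitmx => h h0.
  have [_ E] := is_derive_clin cT (@diff_derivable _ _ _ f u h (Df u (Hr u hu).1)).
  have := H h; rewrite E (jacE _ (Df u (Hr u hu).1)) h0 (clin0 cT) sub0r normrN.
  by move=> hh; apply/eqP; rewrite -normr_le0; move: hh; have := normr_ge0 h; lra.
(* The Lipschitz bound [gL] makes increments of [g] comparable to those of [z], so the first-order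
   expansion of [f] at [g z] can be solved for the increment of [g]. *)
have gD z v : N z -> differentiable g z /\ 'D_v g z = v *m invmx (jac f (g z)).
  move=> Nz; have [h1 h2] := gP z Nz; have [Ou fu] := fK z Nz.
  pose Ji := invmx (jac f (g z)); have cJ := clin_mulmxr Ji.
  have [C' C'0 HC'] := clin_bounded cJ.
  have [] := @differentiable_eps _ _ _ g (fun v => v *m Ji) z cJ.
    move=> e e0; pose e' := e / (C' * (2 * C)).
    have e'0 : 0 < e' by rewrite divr_gt0// !mulr_gt0.
    have /nbhs_ballP [d1 /= d10 Hd1] := differentiable_epsP (Df _ Ou) e'0.
    have /nbhs_ballP [d2 /= d20 Hd2] : nbhs z N by exact: open_nbhs_nbhs.
    apply/nbhs_ballP; exists (Num.min d2 (d1 / (2 * C))) => /=.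
      by rewrite lt_min d20 divr_gt0// mulr_gt0.
    move=> zeta; rewrite -ball_normE /= sub0r normrN lt_min => /andP[hz2 hz1].
    have Nz' : N (z + zeta) by apply: Hd2; rewrite -ball_normE /= opprD addNKr normrN.
    have [Ou' fu'] := fK _ Nz'.
    pose h := g (z + zeta) - g z.
    have hh : `|h| <= 2 * C * `|zeta|.
      by have := gL _ _ Nz Nz'; rewrite (addrC z zeta) addrK (addrC zeta).
    have := Hd1 h; rewrite -ball_normE /= sub0r normrN => /(_ _) Hh.
    have {}Hh := Hh (ltac:(by apply: le_lt_trans hh _; rewrite mulrC -ltr_pdivlMr// mulr_gt0)).
    have hE : g z + h = g (z + zeta) by rewrite /h addrC subrK.
    move: Hh; rewrite hE fu fu' (addrC z zeta) addrK (jacE _ (Df _ Ou)) => Hh.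
    rewrite (addrC zeta z) -/h.
    rewrite (_ : h - zeta *m Ji = - ((zeta - h *m jac f (g z)) *m Ji)); last first.
      by rewrite mulmxBl mulmxK ?uJ// opprB.
    rewrite normrN; apply: le_trans (HC' _) _.
    apply: (@le_trans _ _ (C' * (e' * (2 * C * `|zeta|)))).
      rewrite ler_wpM2l ?(ltW C'0)//; apply: le_trans Hh _.
      by rewrite ler_wpM2l ?(ltW e'0).
    rewrite le_eqVlt /e'; apply/orP; left; apply/eqP; field.
    by rewrite !gt_eqF.
  by move=> dg Eg; split; [exact: dg|rewrite (deriveE _ dg); exact: Eg].
(* Bootstrap: ['D_v g] is [g] followed by the smooth map sending [u] to [v *m invmx (jac f u)], so
   it is C^k as soon as [g] is. *)
exists N, g; split=> // k; elim: k => [|k IH].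
  by split=> // z Nz; exact: differentiable_continuous (gD z 0 Nz).1.
apply/CkSP; split=> [z Nz|v z Nz|v].
- exact: differentiable_continuous (gD z 0 Nz).1.
- exact: diff_derivable (gD z 0 Nz).1.
- have o0 : open [set x : R^o | x != 0] by exact: (@open_neq R).
  pose O2 := [set u | O u /\ \det (jac f u) != 0].
  have oO2 : open O2.
    apply: (@open_preimage_on _ R^o O [set x : R^o | x != 0] (fun u => \det (jac f u))) => //.
    by move=> u Ou; apply: (smooth_cont (smooth_det oO (smooth_jac oO sf)) Ou).
  have sO2 : O2 `<=` O by move=> u [].
  have sJ : smooth_on O2 (fun u => invmx (jac f u)).
    apply: smooth_invmx; [exact: oO2|by move=> u []; rewrite unitmxE unitfE|].
    exact: smooth_sub sO2 (smooth_jac oO sf).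
  have sG : smooth_on O2 (fun u => v *m invmx (jac f u)).
    by apply: smooth_mulmx => //; exact: smooth_cst.
  have gO2 z : N z -> O2 (g z).
    by move=> Nz; split; [exact: (fK z Nz).1|rewrite -unitfE -unitmxE uJ// (gP z Nz).1].
  apply: Ck_ext (Ck_comp oN oO2 gO2 IH (sG k)) => // z Nz /=.
  by rewrite (gD z v Nz).2.
Qed.

End Smooth.

(** * Smooth manifolds *)

Section SmoothAtlas.
Context {R : realType}.

Definition cimg (V : normedModType R) X (A : atlas V X) (a : index A) : set V :=
  chart a @` dom a.

Definition overlap (V : normedModType R) X (A : atlas V X) (a b : index A) : set V :=
  chart a @` (dom a `&` dom b).

(* Tangent bundles carry no topology in this development: what is kept of a
   manifold is its smooth structure, the topology being recovered as [mnbhs]. *)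
Record satlas (V : normedModType R) X (A : atlas V X) : Prop := Satlas {
  sa_cover : forall x, dom (chart_at A x) x;
  sa_K : forall (a : index A) x, dom a x -> ichart a (chart a x) = x;
  sa_open : forall a b : index A, open (overlap a b);
  sa_trans : forall a b : index A, smooth_on (overlap a b) (chart b \o ichart a) }.

Definition dtr (V : normedModType R) X (A : atlas V X) (a b : index A) x (h : V) : V :=
  'D_h (chart b \o ichart a) (chart a x).

(** A tangent vector is stored by its components in the preferred chart, which may change abruptly
    from point to point. [tv a] and its inverse [cv a] translate from and to components in one fixed
    chart [a], where smooth dependence on the point can be expressed. *)
Definition tv (V : normedModType R) X (A : atlas V X) (a : index A) x (h : V) : V :=
  dtr a (chart_at A x) x h.

Definition cv (V : normedModType R) X (A : atlas V X) (a : index A) x (h : V) : V :=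
  dtr (chart_at A x) a x h.

Definition mnbhs (V : normedModType R) X (A : atlas V X) (x : X) : set_system X :=
  ichart (chart_at A x) @ nbhs (chart (chart_at A x) x).

#[global] Instance mnbhs_filter (V : normedModType R) X (A : atlas V X) x :
  ProperFilter (mnbhs A x).
Proof. exact: fmap_proper_filter. Qed.

(** [smooth_at] insists on the preferred charts; this version allows any pair of charts, and
    [smooth_inP] identifies the two. *)
Definition smooth_in (V W : normedModType R) X Y (A : atlas V X) (B : atlas W Y)
    (a : index A) (b : index B) (F : X -> Y) (x : X) : Prop :=
  exists U : set V, [/\ open U, U (chart a x), U `<=` cimg a,
    (forall y, U y -> dom b (F (ichart a y))) &
    smooth_on U (chart b \o F \o ichart a)].

Section OneAtlas.
Context {V : normedModType R} {fV : findim V} {X : Type} {A : atlas V X}.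
Hypothesis sA : satlas A.
Implicit Types a b c : index A.

Lemma cimgK a u : cimg a u -> dom a (ichart a u) /\ chart a (ichart a u) = u.
Proof. by move=> [x ax <-]; rewrite (sa_K sA ax). Qed.

Lemma overlap_self a : overlap a a = cimg a.
Proof. by rewrite /overlap setIid. Qed.

Lemma open_cimg a : open (cimg a).
Proof. by rewrite -overlap_self; exact: sa_open. Qed.

Lemma overlapP a b u : overlap a b u <-> cimg a u /\ dom b (ichart a u).
Proof.
split=> [[x [ax bx] <-]|[[x ax <-]]]; rewrite (sa_K sA ax).
  by split=> //; exists x.
by move=> bx; exists x.
Qed.

Lemma overlap_chart a b x : dom a x -> dom b x -> overlap a b (chart a x).
Proof. by move=> ax bx; exists x. Qed.

Lemma overlapK a b u : overlap a b u ->
  ichart b (chart b (ichart a u)) = ichart a u.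
Proof. by move=> /overlapP [_ bu]; rewrite (sa_K sA). Qed.

Lemma overlap_near a b x : dom a x -> dom b x ->
  \forall u \near chart a x, overlap a b u.
Proof.
by move=> ax bx; apply: open_nbhs_nbhs; split; [exact: sa_open|exact: overlap_chart].
Qed.

Lemma differentiable_trans a b x : dom a x -> dom b x ->
  differentiable (chart b \o ichart a) (chart a x).
Proof.
move=> ax bx; apply: smooth_differentiable (overlap_chart ax bx).
  exact: sa_open.
exact: sa_trans.
Qed.

Lemma clin_dtr a b x : dom a x -> dom b x -> clin (dtr a b x).
Proof. by move=> ax bx; exact: differentiable_clin (differentiable_trans ax bx). Qed.

Lemma dtr_comp a b c x h : dom a x -> dom b x -> dom c x ->
  dtr b c x (dtr a b x h) = dtr a c x h.
Proof.
move=> ax bx cx; rewrite /dtr.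
rewrite (_ : chart b x = (chart b \o ichart a) (chart a x)); last by rewrite /= (sa_K sA).
rewrite -derive_comp; [|exact: differentiable_trans|]; last first.
  by rewrite /= (sa_K sA)//; exact: differentiable_trans.
apply: near_eq_derive.
by apply: filterS (overlap_near ax bx) => u ab /=; rewrite overlapK.
Qed.

Lemma dtr_id a x h : dom a x -> dtr a a x h = h.
Proof.
move=> ax; rewrite /dtr -[RHS](derive_id (chart a x) h); apply: near_eq_derive.
have := overlap_near ax ax.
by apply: filterS => u; rewrite overlap_self => /cimgK [_ /= ->].
Qed.

Lemma tvK a x h : dom a x -> cv a x (tv a x h) = h.
Proof. by move=> ax; rewrite /cv /tv dtr_comp ?dtr_id//; exact: sa_cover. Qed.

Lemma cvK a x h : dom a x -> tv a x (cv a x h) = h.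
Proof.
by move=> ax; rewrite /cv /tv dtr_comp ?dtr_id//; exact: sa_cover.
Qed.

Lemma clin_tv a x : dom a x -> clin (tv a x).
Proof. by move=> ax; apply: clin_dtr => //; exact: sa_cover. Qed.

Lemma clin_cv a x : dom a x -> clin (cv a x).
Proof. by move=> ax; apply: clin_dtr => //; exact: sa_cover. Qed.

Lemma near_change a b x (P : set X) : dom a x -> dom b x ->
  (\forall u \near chart a x, P (ichart a u)) -> \forall u \near chart b x, P (ichart b u).
Proof.
move=> ax bx HP.
have ct : {for chart b x, continuous (chart a \o ichart b)}.
  exact: smooth_cont (sa_trans sA b a) (overlap_chart bx ax).
have H : \forall u \near chart b x, P (ichart a (chart a (ichart b u))).
  by have := ct (fun u => P (ichart a u)); rewrite /= (sa_K sA bx) => /(_ HP).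
apply: filterS2 H (overlap_near bx ax) => u + ou.
by rewrite overlapK.
Qed.

Lemma mnbhsE a x (P : set X) : dom a x ->
  mnbhs A x P <-> \forall u \near chart a x, P (ichart a u).
Proof.
by move=> ax; split; apply: near_change => //; exact: sa_cover.
Qed.

Lemma mnbhs_dom a x : dom a x -> mnbhs A x (dom a).
Proof.
move=> ax; apply/(mnbhsE _ ax).
have := overlap_near ax ax.
by apply: filterS => u; rewrite overlap_self => /cimgK [].
Qed.

Lemma mnbhs_singleton x (P : set X) : mnbhs A x P -> P x.
Proof.
move=> H; have := nbhs_singleton H.
by rewrite /= (sa_K sA)//; exact: sa_cover.
Qed.

Lemma mnbhs_interior x (P : set X) : mnbhs A x P -> \forall y \near mnbhs A x, mnbhs A y P.
Proof.
have ax := sa_cover sA x; set a := chart_at A x in ax.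
move=> /(mnbhsE _ ax) /nbhs_interior H; apply/(mnbhsE _ ax).
have := overlap_near ax ax; rewrite overlap_self.
apply: filterS2 H => u Hu /cimgK [au ua].
by apply/(mnbhsE _ au); rewrite ua.
Qed.

Lemma chart_cvg a x : dom a x -> chart a y @[y --> mnbhs A x] --> chart a x.
Proof.
move=> ax B HB; apply/(mnbhsE (fun y => B (chart a y)) ax).
have := overlap_near ax ax; rewrite overlap_self.
by apply: filterS2 HB => u Bu /cimgK [_ ->].
Qed.

End OneAtlas.

Section TwoAtlases.
Context {V W : normedModType R} {fV : findim V} {fW : findim W} {X Y : Type}.
Context {A : atlas V X} {B : atlas W Y}.
Hypotheses (sA : satlas A) (sB : satlas B).
Implicit Types (a : index A) (b : index B) (F G : X -> Y).

Lemma smooth_in_change a a' b b' F x : dom a x -> dom a' x ->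
  dom b (F x) -> dom b' (F x) -> smooth_in a b F x -> smooth_in a' b' F x.
Proof.
move=> ax a'x bx b'x [U [oU Ux Ui Ub sU]].
pose t := chart a \o ichart a'; pose r := chart b \o F \o ichart a.
pose U1 := [set u | overlap a' a u /\ U (t u)].
have st : smooth_on (overlap a' a) t by exact: sa_trans.
have oU1 : open U1.
  by apply: open_preimage_on => // [|u ou]; [exact: sa_open|exact: smooth_cont st ou].
have s1 : smooth_on U1 (r \o t).
  apply: (smooth_comp oU1 oU) => //; first by move=> u [].
  by apply: smooth_sub st => u [].
have rtE u : U1 u -> (r \o t) u = chart b (F (ichart a' u)).
  by move=> [ou _]; rewrite /r /t /= (overlapK sA).
have bU1 u : U1 u -> dom b (F (ichart a' u)).
  by move=> [ou Ut]; have := Ub _ Ut; rewrite /t /= (overlapK sA).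
pose U2 := [set u | U1 u /\ overlap b b' ((r \o t) u)].
have oU2 : open U2.
  by apply: open_preimage_on => // [|u ou]; [exact: sa_open|exact: smooth_cont s1 ou].
exists U2; split=> //.
- split; first by split; [exact: overlap_chart|rewrite /t /= (sa_K sA)].
  rewrite rtE; last by split; [exact: overlap_chart|rewrite /t /= (sa_K sA)].
  by rewrite (sa_K sA)//; exact: overlap_chart.
- by move=> u [[/(overlapP sA) []]].
- move=> u [U1u]; rewrite rtE// => /(overlapP sB) [_].
  by rewrite (sa_K sB)//; exact: bU1.
- have s2 : smooth_on U2 ((chart b' \o ichart b) \o (r \o t)).
    apply: (smooth_comp oU2 (sa_open sB b b')) => //; first by move=> u [].
      by apply: smooth_sub s1 => u [].
    exact: sa_trans.
  apply: smooth_ext s2 => // u [U1u ou].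
  by rewrite [LHS]/= -/(comp r t u) rtE// (sa_K sB)//; exact: bU1.
Qed.

Lemma smooth_inP a b F x : dom a x -> dom b (F x) ->
  smooth_at A B F x <-> smooth_in a b F x.
Proof.
move=> ax bx; have ax0 := sa_cover sA x; have bx0 := sa_cover sB (F x).
by split; apply: smooth_in_change.
Qed.

Lemma smooth_atI a b F x U r : dom a x -> dom b (F x) -> open U -> U (chart a x) ->
  U `<=` cimg a ->
  (forall u, U u -> dom b (F (ichart a u)) /\ chart b (F (ichart a u)) = r u) ->
  smooth_on U r -> smooth_at A B F x.
Proof.
move=> ax bx oU Ux Ui H sr; apply/(smooth_inP ax bx); exists U; split=> //.
  by move=> u /H [].
by apply: smooth_ext sr => // u /H [].
Qed.

Lemma smooth_at_cont F x (P : set Y) :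
  smooth_at A B F x -> mnbhs B (F x) P -> mnbhs A x (fun y => P (F y)).
Proof.
move=> [U [oU Ux Ui Ub sU]] H.
have c := smooth_cont sU Ux; have nU : nbhs (chart (chart_at A x) x) U by exact: open_nbhs_nbhs.
have := c (fun w => P (ichart (chart_at B (F x)) w)).
rewrite /in_charts /= (sa_K sA); last exact: sa_cover.
move=> /(_ H); apply: filterS2 nU => u Uu /=.
by rewrite (sa_K sB)//; exact: Ub.
Qed.

Lemma smooth_at_near F x : smooth_at A B F x -> \forall y \near mnbhs A x, smooth_at A B F y.
Proof.
move=> [U [oU Ux Ui Ub sU]]; have ax := sa_cover sA x.
apply/(mnbhsE sA _ ax).
have nU : nbhs (chart (chart_at A x) x) U by exact: open_nbhs_nbhs.
apply: filterS nU => u Uu; have [au ua] := cimgK sA (Ui _ Uu).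
apply/(smooth_inP au (Ub _ Uu)); exists U; split=> //.
by rewrite ua.
Qed.

Lemma mdiffE a b F x h : smooth_at A B F x -> dom a x -> dom b (F x) ->
  'D_h (chart b \o F \o ichart a) (chart a x) = cv b (F x) (mdiff A B F x (tv a x h)).
Proof.
move=> [U [oU Ux Ui Ub sU]] ax bx.
have ax0 := sa_cover sA x; have bx0 := sa_cover sB (F x).
rewrite /tv /cv /dtr /mdiff.
set a0 := chart_at A x in U oU Ux Ui Ub sU ax0 *.
set b0 := chart_at B (F x) in Ub sU bx0 *.
have xE : (chart a0 \o ichart a) (chart a x) = chart a0 x by rewrite /= (sa_K sA).
have FE : in_charts A B F x (chart a0 x) = chart b0 (F x).
  by rewrite /in_charts /= (sa_K sA).
have D1 : differentiable (chart a0 \o ichart a) (chart a x) by exact: differentiable_trans.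
have D2 : differentiable (in_charts A B F x) (chart a0 x).
  exact: smooth_differentiable sU Ux.
have D3 : differentiable (chart b \o ichart b0) (chart b0 (F x)) by exact: differentiable_trans.
rewrite -{1}xE -derive_comp//; last by rewrite xE.
set T0 := (in_charts _ _ _ _) \o _.
have TE : T0 (chart a x) = chart b0 (F x) by rewrite -FE -xE.
have D0 : differentiable T0 (chart a x) by apply: differentiable_comp; rewrite ?xE.
rewrite -TE -derive_comp; [|exact: D0|by rewrite TE].
apply: near_eq_derive.
have nU : \forall u \near chart a x, U ((chart a0 \o ichart a) u).
  have c : {for chart a x, continuous (chart a0 \o ichart a)} by exact: differentiable_continuous.
  by apply: c; rewrite /= (sa_K sA)//; exact: open_nbhs_nbhs.
apply: filterS2 nU (overlap_near sA ax ax0) => u Uu ou.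
rewrite /T0 /in_charts /= (overlapK sA ou) (sa_K sB)//.
by have := Ub _ Uu; rewrite /= (overlapK sA ou).
Qed.

Lemma mdiffI a b F x U r h : dom a x -> dom b (F x) -> open U -> U (chart a x) ->
  U `<=` cimg a ->
  (forall u, U u -> dom b (F (ichart a u)) /\ chart b (F (ichart a u)) = r u) ->
  smooth_on U r -> mdiff A B F x (tv a x h) = tv b (F x) ('D_h r (chart a x)).
Proof.
move=> ax bx oU Ux Ui H sr.
have sF := smooth_atI ax bx oU Ux Ui H sr.
rewrite -[LHS](cvK sB _ bx) -(mdiffE _ sF ax bx); congr tv.
apply: near_eq_derive; have nU : nbhs (chart a x) U by exact: open_nbhs_nbhs.
by apply: filterS nU => u /H [].
Qed.

Lemma clin_mdiff F x : smooth_at A B F x -> clin (mdiff A B F x).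
Proof.
by move=> [U [oU Ux Ui Ub sU]]; exact: differentiable_clin (smooth_differentiable oU sU Ux).
Qed.

Lemma smooth_at_ext F G x : (\forall y \near mnbhs A x, F y = G y) ->
  smooth_at A B F x -> smooth_at A B G x.
Proof.
move=> FG [U [oU Ux Ui Ub sU]]; have ax := sa_cover sA x.
have FGx : F x = G x by exact: mnbhs_singleton FG.
have [N [oN Nx NE]] : exists N, [/\ open N, N (chart (chart_at A x) x) &
    forall u, N u -> F (ichart (chart_at A x) u) = G (ichart (chart_at A x) u)].
  move: FG => /(mnbhsE sA _ ax); rewrite /prop_near1 nbhsE => -[N [oN Nx] HN].
  by exists N; split.
apply: (smooth_atI (b := chart_at B (F x)) (U := U `&` N) (r := in_charts A B F x) ax) => //.
- by rewrite -FGx; exact: sa_cover.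
- exact: openI.
- by move=> u [/Ui].
- by move=> u [/Ub Uu /NE <-].
- by apply: smooth_sub sU => u [].
Qed.

Lemma mdiff_ext F G x : (\forall y \near mnbhs A x, F y = G y) ->
  mdiff A B F x = mdiff A B G x.
Proof.
move=> FG; have ax := sa_cover sA x; apply/funext => h.
have FGx : F x = G x by exact: mnbhs_singleton FG.
apply: near_eq_derive; move: FG => /(mnbhsE sA _ ax).
by apply: filterS => u /= E; rewrite /in_charts /= E FGx.
Qed.

End TwoAtlases.

Section Composition.
Context {V W Z : normedModType R} {fV : findim V} {fW : findim W} {fZ : findim Z}.
Context {X Y T : Type} {A : atlas V X} {B : atlas W Y} {C : atlas Z T}.
Hypotheses (sA : satlas A) (sB : satlas B) (sC : satlas C).

Lemma smooth_at_comp (F : X -> Y) (G : Y -> T) x : smooth_at A B F x ->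
  smooth_at B C G (F x) -> smooth_at A C (G \o F) x.
Proof.
move=> [U [oU Ux Ui Ub sU]] [U' [oU' Ux' Ui' Ub' sU']].
have ax := sa_cover sA x; have bx := sa_cover sB (F x).
pose U2 := [set u | U u /\ U' (in_charts A B F x u)].
have oU2 : open U2.
  by apply: open_preimage_on => // u ou; exact: smooth_cont sU ou.
have E u : U u -> ichart (chart_at B (F x)) (in_charts A B F x u) =
    F (ichart (chart_at A x) u).
  by move=> Uu; rewrite /in_charts /= (sa_K sB)//; exact: Ub.
apply: (smooth_atI sA sC (b := chart_at C (G (F x))) (U := U2)
  (r := in_charts B C G (F x) \o in_charts A B F x) ax) => //.
- exact: sa_cover.
- by split=> //; rewrite /in_charts /= (sa_K sA).
- by move=> u [/Ui].
- by move=> u [Uu /Ub']; rewrite E// => Gu; split=> //; rewrite [in RHS]/= {1}/in_charts /= E.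
- apply: (smooth_comp oU2 oU') => //; first by move=> u [].
  by apply: smooth_sub sU => u [].
Qed.

Lemma mdiff_comp (F : X -> Y) (G : Y -> T) x h : smooth_at A B F x ->
  smooth_at B C G (F x) -> mdiff A C (G \o F) x h = mdiff B C G (F x) (mdiff A B F x h).
Proof.
move=> [U [oU Ux Ui Ub sU]] [U' [oU' Ux' Ui' Ub' sU']].
have ax := sa_cover sA x.
have FE : in_charts A B F x (chart (chart_at A x) x) = chart (chart_at B (F x)) (F x).
  by rewrite /in_charts /= (sa_K sA).
rewrite {1 2}/mdiff -FE -derive_comp; first last.
- by rewrite FE; exact: smooth_differentiable sU' Ux'.
- exact: smooth_differentiable sU Ux.
apply: near_eq_derive; have nU : nbhs (chart (chart_at A x) x) U by exact: open_nbhs_nbhs.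
apply: filterS nU => u Uu.
by rewrite /in_charts /= (sa_K sB)//; exact: Ub.
Qed.

End Composition.

Section Basics.
Context {V : normedModType R} {fV : findim V} {X : Type} {A : atlas V X}.
Hypothesis sA : satlas A.

Lemma mdiff_id x h : mdiff A A id x h = h.
Proof. exact: dtr_id (sa_cover sA x). Qed.

Lemma smooth_at_cst (W : normedModType R) {fW : findim W} Y (B : atlas W Y) (sB : satlas B) y x :
  smooth_at A B (fun=> y) x.
Proof.
have ax := sa_cover sA x.
apply: (smooth_atI sA sB (U := cimg (chart_at A x)) (r := cst (chart (chart_at B y) y)) ax).
- exact: sa_cover.
- exact: open_cimg.
- by exists x.
- by [].
- by move=> u _; split=> //; exact: sa_cover.
- exact: smooth_cst.
Qed.

Lemma mdiff_cst (W : normedModType R) {fW : findim W} Y (B : atlas W Y) y x h :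
  mdiff A B (fun=> y) x h = 0.
Proof. exact: derive_cst. Qed.

Lemma satlas_euclid : satlas (euclid V).
Proof.
have E (a b : index (euclid V)) : overlap a b = setT.
  by rewrite predeqE => x; split=> // _; exists x.
by split=> // a b; rewrite E; [exact: openT|exact: smooth_id].
Qed.

Lemma mnbhs_euclid (x : V) : mnbhs (euclid V) x = nbhs x.
Proof. by []. Qed.

Lemma tv_euclid (x h : V) : tv (A := euclid V) tt x h = h.
Proof. exact: derive_id. Qed.

Lemma cv_euclid (x h : V) : cv (A := euclid V) tt x h = h.
Proof. exact: derive_id. Qed.

Lemma smooth_at_euclid (W : normedModType R) {fW : findim W} (O : set V) (f : V -> W) x :
  open O -> O x -> smooth_on O f -> smooth_at (euclid V) (euclid W) f x.
Proof.
move=> oO Ox sf; exists O; split=> // y _; by exists y.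
Qed.

End Basics.

Lemma derive_clin (V U : normedModType R) (l : V -> U) x v : clin l -> 'D_v l x = l v.
Proof.
move=> cl; have dI : derivable (@id V) x v by exact: derivable_id.
by have [_] := is_derive_clin cl dI; rewrite derive_id.
Qed.

Lemma derive_pair (V U W : normedModType R) (f : V -> U) (g : V -> W) x v :
  differentiable f x -> differentiable g x ->
  'D_v (fun y => (f y, g y)) x = ('D_v f x, 'D_v g x).
Proof.
move=> df dg; rewrite !deriveE//; first by rewrite diff_pair.
exact: differentiable_pair.
Qed.

(** * Tangent bundles, vector fields and differentials of sections *)

Section TangentBundle.
Context {V : normedModType R} {fV : findim V} {X : Type} {A : atlas V X}.
Hypothesis sA : satlas A.
Implicit Types a b : index A.
Local Notation TA := (tangent_atlas A).

Lemma tangent_chartE a z : chart (a : index TA) z = (chart a z.1, cv a z.1 z.2).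
Proof. by []. Qed.

Lemma tangent_ichartE a u : cimg a u.1 ->
  ichart (a : index TA) u = (ichart a u.1, tv a (ichart a u.1) u.2).
Proof. by move=> /(cimgK sA) [_ E]; rewrite /tv /dtr E. Qed.

Lemma tangent_overlap a b :
  overlap (a : index TA) b = [set u | overlap a b u.1].
Proof.
rewrite predeqE => -[u h]; split=> [[z [az bz] <-]|[x [ax bx] /= <-]].
  by exists z.1.
by exists (x, tv a x h) => //=; congr pair; exact: tvK.
Qed.

Lemma tangent_cimg a : cimg (a : index TA) = [set u | cimg a u.1].
Proof. by rewrite -!overlap_self tangent_overlap. Qed.

Lemma tangent_trans a b :
  smooth_on (overlap (a : index TA) b) (chart (b : index TA) \o ichart (a : index TA)).
Proof.
rewrite tangent_overlap; have oO := sa_open sA a b; have sT := sa_trans sA a b.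
have sf : smooth_on [set u : V * V | overlap a b u.1]
    (fun u => ((chart b \o ichart a) u.1, 'D_(u.2) (chart b \o ichart a) u.1)).
  have oT := @openXT _ V V _ oO.
  apply: smooth_pair => //; last exact: smooth_derive_joint.
  by apply: (smooth_comp oT oO) => //; exact: smooth_fst.
apply: smooth_ext sf; first exact: openXT.
move=> u ou; have [ua bu] := (overlapP sA _ _ _).1 ou.
transitivity (chart (b : index TA) (ichart (a : index TA) u)); last by [].
rewrite tangent_ichartE// tangent_chartE /=; congr pair; have [au uE] := cimgK sA ua.
by rewrite /cv /tv (dtr_comp sA _ au (sa_cover sA _) bu) /dtr uE.
Qed.

Lemma satlas_tangent : satlas TA.
Proof.
split=> [z|a z az|a b|a b].
- exact: (sa_cover sA z.1).
- have Ka := sa_K sA az.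
  rewrite tangent_ichartE; last by exists z.1.
  by rewrite tangent_chartE /= Ka cvK//; case: z {az Ka}.
- rewrite tangent_overlap; apply: openXT; exact: sa_open.
- exact: tangent_trans.
Qed.

Lemma smooth_at_fst z : smooth_at TA A fst z.
Proof.
have az := sa_cover sA z.1; set a := chart_at A z.1 in az.
apply: (smooth_atI satlas_tangent sA (a := a) (b := a) (r := fst)
  (U := [set u : V * V | cimg a u.1])) => //.
- by apply: openXT; exact: open_cimg.
- by exists z.1.
- by rewrite tangent_cimg.
- by move=> u ua; exact: (cimgK sA ua).
- by apply: smooth_fst; apply: openXT; exact: open_cimg.
Qed.

Lemma mdiff_fst a z h k : dom a z.1 ->
  mdiff TA A fst z (tv (a : index TA) z (h, k)) = tv a z.1 h.
Proof.
move=> az; rewrite (mdiffI satlas_tangent sA (a := a) (b := a) (r := fst)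
  (U := [set u : V * V | cimg a u.1])) //.
- by rewrite (derive_clin _ _ (clin_fst V V)).
- by apply: openXT; exact: open_cimg.
- by exists z.1.
- by rewrite tangent_cimg.
- by move=> u ua; exact: (cimgK sA ua).
- by apply: smooth_fst; apply: openXT; exact: open_cimg.
Qed.

Lemma smooth_field_atI a xi x U r : dom a x -> open U -> U (chart a x) -> U `<=` cimg a ->
  (forall u, U u -> xi (ichart a u) = tv a (ichart a u) (r u)) -> smooth_on U r ->
  smooth_field_at A xi x /\
  forall h, mdiff A TA (section_map xi) x (tv a x h) =
    tv (a : index TA) (x, xi x) (h, 'D_h r (chart a x)).
Proof.
move=> ax oU Ux Ui H sr.
have sp : smooth_on U (fun u => (u, r u)) by apply: smooth_pair => //; exact: smooth_id.
have E u : U u -> dom (a : index TA) (section_map xi (ichart a u)) /\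
    chart (a : index TA) (section_map xi (ichart a u)) = (u, r u).
  move=> Uu; have [au uE] := cimgK sA (Ui _ Uu).
  by split=> //; rewrite tangent_chartE /= uE H// tvK.
split; first exact: (smooth_atI sA satlas_tangent ax _ oU Ux Ui E sp).
have bx : dom (a : index TA) (section_map xi x) by [].
move=> h; have -> : (h, 'D_h r (chart a x)) = 'D_h (fun u => (u, r u)) (chart a x).
  rewrite derive_pair; first by rewrite derive_id.
    exact: smooth_differentiable oU (smooth_id U) Ux.
  exact: smooth_differentiable oU sr Ux.
exact: (mdiffI sA satlas_tangent h ax bx oU Ux Ui E sp).
Qed.

Lemma smooth_fieldP a xi x : dom a x -> smooth_field_at A xi x <->
  exists U, [/\ open U, U (chart a x), U `<=` cimg a &
    smooth_on U (fun u => cv a (ichart a u) (xi (ichart a u)))].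
Proof.
move=> ax; split.
  move=> /(smooth_inP sA satlas_tangent (a := a) (b := a)) [] // U [oU Ux Ui _ sU].
  exists U; split=> //.
  exact: (smooth_clin oU (clin_snd V V) sU).
move=> [U [oU Ux Ui sU]].
apply: (proj1 (smooth_field_atI (xi := xi) ax oU Ux Ui _ sU)) => u /Ui /(cimgK sA) [au _].
by rewrite cvK.
Qed.

Lemma smooth_funP a (f : X -> R^o) x : dom a x -> smooth_fun_at A f x <->
  exists U, [/\ open U, U (chart a x), U `<=` cimg a & smooth_on U (f \o ichart a)].
Proof.
move=> ax; have sR := @satlas_euclid R^o.
split.
  move=> /(smooth_inP sA sR (a := a) (b := tt)) [] // U [oU Ux Ui _ sU].
  by exists U.
move=> [U [oU Ux Ui sU]].
by apply/(smooth_inP sA sR (a := a) (b := tt)) => //; exists U.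
Qed.

Lemma dfunE a (f : X -> R^o) x h : dom a x -> smooth_fun_at A f x ->
  dfun A f x (tv a x h) = 'D_h (f \o ichart a) (chart a x).
Proof.
move=> ax sf; have sR := @satlas_euclid R^o.
have E : 'D_h (chart (tt : index (euclid R^o)) \o f \o ichart a) (chart a x) =
    cv (tt : index (euclid R^o)) (f x) (mdiff A (euclid R^o) f x (tv a x h)).
  exact: mdiffE.
by rewrite -[RHS]/('D_h (chart (tt : index (euclid R^o)) \o f \o ichart a) (chart a x)) E cv_euclid.
Qed.

Lemma smooth_fieldD xi eta x : smooth_field_at A xi x -> smooth_field_at A eta x ->
  smooth_field_at A (fun y => xi y + eta y) x.
Proof.
have ax := sa_cover sA x.
move=> /(smooth_fieldP _ ax) [U [oU Ux Ui sU]] /(smooth_fieldP _ ax) [U' [oU' Ux' Ui' sU']].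
apply/(smooth_fieldP _ ax); exists (U `&` U'); split=> //.
- exact: openI.
- by move=> u [/Ui].
- have oUU := openI oU oU'.
  have := smoothD oUU (smooth_sub (@subIsetl _ U U') sU) (smooth_sub (@subIsetr _ U U') sU').
  apply: smooth_ext => // u [/Ui /(cimgK sA) [au _] _].
  by rewrite (clinD _ _ (clin_cv sA au)).
Qed.

Lemma smooth_fieldZ (f : X -> R^o) xi x : smooth_fun_at A f x -> smooth_field_at A xi x ->
  smooth_field_at A (fun y => (f y : R) *: xi y) x.
Proof.
have ax := sa_cover sA x.
move=> /(smooth_funP _ ax) [U [oU Ux Ui sU]] /(smooth_fieldP _ ax) [U' [oU' Ux' Ui' sU']].
apply/(smooth_fieldP _ ax); exists (U `&` U'); split=> //.
- exact: openI.
- by move=> u [/Ui].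
- have oUU := openI oU oU'.
  have s1 : smooth_on (U `&` U') (fun u => (f \o ichart (chart_at A x)) u *:
      cv (chart_at A x) (ichart (chart_at A x) u) (xi (ichart (chart_at A x) u))).
    by apply: smoothZ => //; [exact: smooth_sub (@subIsetl _ U U') sU|exact: smooth_sub (@subIsetr _ U U') sU'].
  apply: smooth_ext s1 => // u [/Ui /(cimgK sA) [au _] _].
  by rewrite (clinZ _ _ (clin_cv sA au)).
Qed.

(** The field with constant components [w] in the chart [a], meaningful on [dom a]. Such fields
    commute and serve as frames in which connections are computed. *)
Definition cfield a (w : V) (x : X) : V := tv a x w.

Lemma smooth_cfield a w x : dom a x -> smooth_field_at A (cfield a w) x.
Proof.
move=> ax; apply/(smooth_fieldP _ ax); exists (cimg a); split=> //.
- exact: open_cimg.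
- by exists x.
- apply: smooth_ext (smooth_cst (cimg a) w); first exact: open_cimg.
  by move=> u /(cimgK sA) [au _]; rewrite /cfield tvK.
Qed.

Lemma mdiff_cfield a w x h : dom a x ->
  mdiff A TA (section_map (cfield a w)) x (tv a x h) =
  tv (a : index TA) (x, tv a x w) (h, 0).
Proof.
move=> ax; have oU := open_cimg sA a.
have [] := @smooth_field_atI a (cfield a w) x (cimg a) (cst w) ax oU (ex_intro2 _ _ x ax erefl).
- by [].
- by [].
- exact: smooth_cst.
by move=> _ ->; rewrite derive_cst.
Qed.

Lemma smooth_fun_near (f : X -> R^o) x : smooth_fun_at A f x ->
  \forall y \near mnbhs A x, smooth_fun_at A f y.
Proof. exact: smooth_at_near sA satlas_euclid _ _. Qed.

Lemma smooth_dfun (f : X -> R^o) xi x : smooth_fun_at A f x -> smooth_field_at A xi x ->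
  smooth_fun_at A (fun y => dfun A f y (xi y)) x.
Proof.
have ax := sa_cover sA x; set a := chart_at A x in ax.
move=> sf sx; have /(smooth_funP _ ax) [U [oU Ux Ui sU]] := sf.
move: sx => /(smooth_fieldP _ ax) [U' [oU' Ux' Ui' sU']].
apply/(smooth_funP _ ax); exists (U `&` U'); have oUU := openI oU oU'; split=> //.
- by move=> u [/Ui].
- have s1 : smooth_on [set z : V * V | U z.1] (fun z => 'D_(z.2) (f \o ichart a) z.1).
    exact: smooth_derive_joint.
  have s2 : smooth_on (U `&` U') (fun u => (u, cv a (ichart a u) (xi (ichart a u)))).
    apply: smooth_pair => //; first exact: smooth_id.
    exact: smooth_sub (@subIsetr _ U U') sU'.
  have s3 : smooth_on (U `&` U') ((fun z : V * V => 'D_(z.2) (f \o ichart a) z.1) \o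
      (fun u => (u, cv a (ichart a u) (xi (ichart a u))))).
    by apply: (smooth_comp oUU (@openXT _ V V _ oU)) => // u [].
  apply: smooth_ext s3 => // u [Uu _] /=; have [au uE] := cimgK sA (Ui _ Uu).
  have sfu : smooth_fun_at A f (ichart a u).
    by apply/(smooth_funP _ au); exists U; split=> //; rewrite uE.
  by rewrite -[in RHS](cvK sA (xi (ichart a u)) au) (dfunE _ au sfu) uE.
Qed.

End TangentBundle.

Section TangentMap.
Context {V W : normedModType R} {fV : findim V} {fW : findim W} {X Y : Type}.
Context (A : atlas V X) (B : atlas W Y).
Hypotheses (sA : satlas A) (sB : satlas B).

Definition tangent_map (F : X -> Y) (z : X * V) : Y * W := (F z.1, mdiff A B F z.1 z.2).

Lemma smooth_tangent_map F z : smooth_at A B F z.1 ->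
  smooth_at (tangent_atlas A) (tangent_atlas B) (tangent_map F) z.
Proof.
have az := sa_cover sA z.1; have bz := sa_cover sB (F z.1).
set a := chart_at A z.1 in az; set b := chart_at B (F z.1) in bz.
move=> /(smooth_inP sA sB az bz) [U [oU Uz Ui Ub sU]].
pose f := chart b \o F \o ichart a.
apply: (smooth_atI (satlas_tangent sA) (satlas_tangent sB) (a := a) (b := b)
  (U := [set u : V * V | U u.1]) (r := fun u => (f u.1, 'D_(u.2) f u.1))) => //.
- exact: openXT.
- by rewrite tangent_cimg => // u /Ui.
- move=> u Uu; have [au uE] := cimgK sA (Ui _ Uu).
  rewrite -/(ichart (a : index (tangent_atlas A)) u) (tangent_ichartE sA); last exact: Ui.
  split; first exact: (Ub _ Uu).
  rewrite tangent_chartE /=; congr pair.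
  have sF : smooth_at A B F (ichart a u.1).
    by apply/(smooth_inP sA sB au (Ub _ Uu)); exists U; split=> //; rewrite uE.
  by rewrite -(mdiffE sA sB _ sF au (Ub _ Uu)) uE.
- have oT := @openXT _ V V _ oU; apply: smooth_pair => //; last exact: smooth_derive_joint.
  by apply: (smooth_comp oT oU) => //; exact: smooth_fst.
Qed.

End TangentMap.

Section Curves.
Context {V : normedModType R} {fV : findim V} {X : Type} {A : atlas V X}.
Hypothesis sA : satlas A.

Lemma smooth_curveP (a : index A) (c : R^o -> X) t : dom a (c t) ->
  smooth_curve_at A c t <-> exists U : set R^o, [/\ open U, U t,
    (forall s, U s -> dom a (c s)) & smooth_on U (chart a \o c)].
Proof.
move=> at_; have sR := @satlas_euclid R^o.
split.
  move=> /(smooth_inP sR sA (a := tt) (b := a)) [] // U [oU Ux Ui Ub sU].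
  by exists U.
move=> [U [oU Ux Ub sU]].
apply/(smooth_inP sR sA (a := tt) (b := a)) => //; exists U; split=> //.
by move=> y _; exists y.
Qed.

Lemma velocityE (a : index A) (c : R^o -> X) t : dom a (c t) -> smooth_curve_at A c t ->
  velocity A c t = tv a (c t) ('D_(1 : R^o) (chart a \o c) t).
Proof.
move=> at_ sc; have sR := @satlas_euclid R^o.
have := @mdiffE _ _ _ _ _ _ _ _ sR sA tt a c t (1 : R^o) sc I at_.
by rewrite tv_euclid => ->; rewrite cvK.
Qed.

Lemma velocity_comp (W : normedModType R) {fW : findim W} Y (B : atlas W Y)
    (sB : satlas B) (F : X -> Y) (c : R^o -> X) t :
  smooth_curve_at A c t -> smooth_at A B F (c t) ->
  smooth_curve_at B (F \o c) t /\
  velocity B (F \o c) t = mdiff A B F (c t) (velocity A c t).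
Proof.
move=> sc sF; have sR := @satlas_euclid R^o; split.
  exact: (smooth_at_comp sR sA sB).
exact: (mdiff_comp sR sA _ sc sF).
Qed.

End Curves.
End SmoothAtlas.

(** * Lengths and distances *)

Section Arc.
Context {R : realType}.
Local Notation mu := (@lebesgue_measure R).
Implicit Types f g : R -> R.

(** Continuity is two-sided even at the end points: curves are smooth on a neighbourhood of their
    parameter interval. *)
Definition cont_on f (a b : R) : Prop := forall r, a <= r <= b -> {for r, continuous f}.

Definition arc f (a b : R) : R := (\int[mu]_(x in `[a, b]) f x)%R.

Lemma cont_on_within f a b : cont_on f a b -> {within `[a, b], continuous f}.
Proof.
by move=> cf; apply: continuous_in_subspaceT => x; rewrite inE /= in_itv /=; exact: cf.
Qed.

Lemma integrable_cont f a b : cont_on f a b -> mu.-integrable `[a, b] (EFin \o f).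
Proof.
move=> cf; apply: continuous_compact_integrable; first exact: segment_compact.
exact: cont_on_within.
Qed.

Lemma arcE f a b : cont_on f a b -> (\int[mu]_(x in `[a, b]) (f x)%:E)%E = (arc f a b)%:E.
Proof.
move=> cf; rewrite /arc /Rintegral fineK//.
by apply: integrable_fin_num => //; exact: integrable_cont.
Qed.

Lemma arc_add f a b c : a <= b -> b <= c -> cont_on f a c -> arc f a c = arc f a b + arc f b c.
Proof.
move=> ab bc cf; have ic := integrable_cont cf.
have /eqP := Rintegral_itvB ic (x := b) (ltac:(by rewrite bnd_simp)) (ltac:(by rewrite bnd_simp)).
rewrite subr_eq => /eqP E; rewrite /arc E addrC; congr (_ + _).
apply: Rintegral_itv_obnd_cbnd; apply: integrableS ic => //.
by apply: subset_itvr; rewrite bnd_simp.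
Qed.

Lemma arc_refl f a : arc f a a = 0.
Proof. by rewrite /arc set_itv1 Rintegral_set1. Qed.

Lemma arc_ge0 f a b : (forall r, 0 <= f r) -> 0 <= arc f a b.
Proof. by move=> f0; apply: Rintegral_ge0. Qed.

Lemma arc_le f g a b : cont_on f a b -> cont_on g a b ->
  (forall r, a < r < b -> f r <= g r) -> arc f a b <= arc g a b.
Proof.
move=> cf cg fg; have jf := integrable_cont cf; have jg := integrable_cont cg.
have s : `]a, b[ `<=` `[a, b] by apply: subset_itv; rewrite bnd_simp.
have s' : `[a, b[ `<=` `[a, b] by apply: subset_itvl; rewrite bnd_simp.
rewrite /arc -(Rintegral_itv_bndo_bndc (f := f)); last exact: integrableS jf.
rewrite -(Rintegral_itv_bndo_bndc (f := g)); last exact: integrableS jg.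
rewrite -(Rintegral_itv_obnd_cbnd (f := f)); last exact: integrableS jf.
rewrite -(Rintegral_itv_obnd_cbnd (f := g)); last exact: integrableS jg.
apply: le_Rintegral => //; try exact: integrableS jf; try exact: integrableS jg.
Qed.

Lemma arc_cst a b k : a <= b -> arc (fun=> k) a b = k * (b - a).
Proof.
move=> ab; rewrite /arc Rintegral_cst//= lebesgue_measure_itv /= lte_fin.
by case: ltgtP ab => //= -> _; rewrite subrr.
Qed.

Lemma arc_affine f s d : 0 <= d -> cont_on f s (s + d) ->
  arc (fun r => d * f (s + d * r)) 0 1 = arc f s (s + d).
Proof.
rewrite le_eqVlt => /predU1P[<- _|d0 cf].
  rewrite addr0 arc_refl; under [X in arc X]eq_fun do rewrite mul0r.
  by rewrite arc_cst// mul0r.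
pose F (r : R) := s + d * r.
have dF (r : R) : is_derive r 1 F d.
  have : is_derive r 1 F (0 + d * 1) by apply: is_deriveD.
  by rewrite add0r mulr1.
have F' : derive1 F = cst d by apply/funext => r; rewrite derive1E derive_val.
have := @integration_by_substitution_increasing R F f 0 1 ler01.
rewrite F' (_ : F 0 = s); last by rewrite /F mulr0 addr0.
rewrite (_ : F 1 = s + d); last by rewrite /F mulr1.
move=> H.
rewrite /arc /Rintegral H.
- by congr fine; apply: eq_integral => r _ /=; rewrite mulrC.
- by move=> x y _ _ xy; rewrite /F ltrD2l ltr_pM2l.
- by move=> x _; exact: cvg_cst.
- exact: is_cvg_cst.
- exact: is_cvg_cst.
- split=> [r _|/=|/=]; first exact: ex_derive.
    apply: cvg_at_right_filter; apply: differentiable_continuous; exact/derivable1_diffP.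
  apply: cvg_at_left_filter; apply: differentiable_continuous; exact/derivable1_diffP.
- exact: cont_on_within.
Qed.

Lemma arc_onem f : cont_on f 0 1 -> arc (fun r => f (1 - r)) 0 1 = arc f 0 1.
Proof.
move=> cf; rewrite /arc /Rintegral.
rewrite [in RHS](integration_by_substitution_onem (r := 1)) ?lexx ?ler01//.
  by rewrite /unstable.onem subrr.
exact: cont_on_within.
Qed.

Lemma arc_derive f b s : 0 < s < b -> cont_on f 0 b -> is_derive s 1 (arc f 0) (f s).
Proof.
move=> /andP[s0 sb] cf.
have [] := continuous_FTC1_closed sb (integrable_cont cf) s0 (cf s (ltac:(by rewrite !ltW))).
by move=> d E; apply: DeriveDef; [exact: d|rewrite -derive1E; exact: E].
Qed.

Lemma arc_continuous f b : 0 <= b -> cont_on f 0 b -> {within `[0, b], continuous (arc f 0)}.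
Proof.
by move=> b0 cf; exact: parameterized_integral_continuous (integrable_cont cf).
Qed.

End Arc.

Section ContinuousForms.
Context {R : realType} {V : normedModType R} {X : Type} (A : atlas V X).
Implicit Types (g : @form R V X) (c : R^o -> X).
Local Notation TA := (tangent_atlas A).

(** What lengths of curves require of a metric: the associated quadratic form is continuous on the
    tangent bundle and homogeneous of degree 2. Degenerate forms such as pull-backs and vertical
    parts are included, which lets metrics be assembled from pieces. *)
Definition cform g : Prop :=
  (forall z, g z'.1 z'.2 z'.2 @[z' --> mnbhs TA z] --> g z.1 z.2 z.2) /\
  forall x k v, g x (k *: v) (k *: v) = k ^+ 2 * g x v v.

Definition speed g c (t : R) : R := Num.sqrt (g (c t) (velocity A c t) (velocity A c t)).

Definition smooth_in_S (S : set X) c (a b : R) : Prop :=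
  forall t : R, a <= t <= b -> smooth_curve_at A c t /\ S (c t).

Lemma speed_ge0 g c t : 0 <= speed g c t.
Proof. exact: sqrtr_ge0. Qed.

End ContinuousForms.

Section Paths.
Context {R : realType} {V : normedModType R} {X : Type} {A : atlas V X}.
Implicit Types (g : @form R V X) (c : R^o -> X) (S : set X).

Lemma pw_path_cat g S x y z l l' : pw_path A g S x y l -> pw_path A g S y z l' ->
  pw_path A g S x z (l + l')%E.
Proof.
elim=> [x' _|c y' l1 H p IH] p'; first by rewrite add0e.
by rewrite -addeA; apply: pw_cons => //; exact: IH.
Qed.

Lemma length_ge0 g c : (0 <= length A g c)%E.
Proof. by apply: integral_ge0 => t _; rewrite lee_fin sqrtr_ge0. Qed.

Lemma pw_path_ge0 g S x y l : pw_path A g S x y l -> (0 <= l)%E.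
Proof. by elim=> [//|c y' l' _ _ l0]; rewrite adde_ge0// length_ge0. Qed.

Lemma rdist_ge0 g S x y : (0 <= rdist A g S x y)%E.
Proof. by apply: le_ereal_inf_tmp => l; exact: pw_path_ge0. Qed.

Lemma rdist_le g S x y l : pw_path A g S x y l -> (rdist A g S x y <= l)%E.
Proof. by move=> p; apply: ereal_inf_lbound. Qed.

Lemma rdist_refl g S x : S x -> rdist A g S x x = 0%E.
Proof.
move=> Sx; apply/eqP; rewrite eq_le rdist_ge0 andbT.
by apply: rdist_le; exact: pw_nil.
Qed.

Lemma rdist_lt_path g S x y e : (rdist A g S x y < e)%E ->
  exists2 l, pw_path A g S x y l & (l < e)%E.
Proof. by move=> /ereal_inf_lt [l p le]; exists l. Qed.

Lemma rdist_triangle g S x y z :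
  (rdist A g S x z <= rdist A g S x y + rdist A g S y z)%E.
Proof.
have [->|] := eqVneq (rdist A g S x y) +oo%E.
  by rewrite addye ?leey// gt_eqF// (lt_le_trans _ (rdist_ge0 _ _ _ _)).
have [->|] := eqVneq (rdist A g S y z) +oo%E.
  by rewrite addey ?leey// gt_eqF// (lt_le_trans _ (rdist_ge0 _ _ _ _)).
move=> fyz fxy.
have [a Ea] : exists a, rdist A g S x y = a%:E.
  by case: (rdist A g S x y) (rdist_ge0 g S x y) fxy => // a _ _; exists a.
have [b Eb] : exists b, rdist A g S y z = b%:E.
  by case: (rdist A g S y z) (rdist_ge0 g S y z) fyz => // b _ _; exists b.
rewrite Ea Eb; apply/lee_addgt0Pr => e e0.
have e20 : 0 < e / 2 by rewrite divr_gt0.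
have [l p hl] : exists2 l, pw_path A g S x y l & (l < (a + e / 2)%:E)%E.
  by apply: rdist_lt_path; rewrite Ea lte_fin ltrDl.
have [l' p' hl'] : exists2 l, pw_path A g S y z l & (l < (b + e / 2)%:E)%E.
  by apply: rdist_lt_path; rewrite Eb lte_fin ltrDl.
apply: le_trans (rdist_le (pw_path_cat p p')) _.
apply: le_trans (leeD (ltW hl) (ltW hl')) _.
rewrite -!EFinD lee_fin; lra.
Qed.

End Paths.

Section Speed.
Context {R : realType} {V : normedModType R} {fV : findim V} {X : Type} {A : atlas V X}.
Hypothesis sA : satlas A.
Implicit Types (g : @form R V X) (c : R^o -> X) (S : set X).
Local Notation TA := (tangent_atlas A).
Let sTA : satlas TA := satlas_tangent sA.

Lemma mnbhs_tangent_euclid (W : normedModType R) (z : W * W) :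
  mnbhs (tangent_atlas (euclid W)) z = nbhs z.
Proof.
rewrite /mnbhs /=.
have -> : (fun y : W * W => (y.1, 'D_y.2 (@id W \o @id W) y.1)) = id.
  by apply/funext => -[u h] /=; congr pair; exact: derive_id.
by rewrite [X in nbhs (_, X)]derive_id; case: z.
Qed.

Lemma cform_smooth g (W : normedModType R) {fW : findim W} (F : W -> X) u h :
  cform A g -> smooth_at (euclid W) A F u ->
  (fun z : W * W => g (F z.1) (mdiff (euclid W) A F z.1 z.2) (mdiff (euclid W) A F z.1 z.2))
    @ nbhs (u, h) --> g (F u) (mdiff (euclid W) A F u h) (mdiff (euclid W) A F u h).
Proof.
move=> [cg _] sF; have sW := @satlas_euclid R W.
have sT : smooth_at (tangent_atlas (euclid W)) TA (tangent_map (euclid W) A F) (u, h).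
  exact: smooth_tangent_map.
move=> P HP; have H := cg (tangent_map (euclid W) A F (u, h)) P HP.
have : mnbhs (tangent_atlas (euclid W)) (u, h) (fun y =>
    ((fun z' : X * V => g z'.1 z'.2 z'.2) @^-1` P) (tangent_map (euclid W) A F y)).
  exact: (smooth_at_cont (satlas_tangent sW) sTA sT H).
by rewrite mnbhs_tangent_euclid.
Qed.

Lemma speed_continuous g c t : cform A g -> smooth_curve_at A c t ->
  {for t, continuous (speed A g c)}.
Proof.
move=> cg sc; have H := @cform_smooth g R^o (findim_reg) c t (1 : R^o) cg sc.
apply: (@continuous_comp _ _ _ (fun s => g (c s) (velocity A c s) (velocity A c s)) Num.sqrt);
  last exact: sqrt_continuous.
have sp : smooth_on [set: R^o] (fun s : R^o => (s, 1 : R^o)).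
  by apply: smooth_pair; [exact: openT|exact: smooth_id|exact: smooth_cst].
have cp s := smooth_cont (x := s) sp I.
exact: (cvg_comp _ _ (cp t) H).
Qed.

Lemma speed_cont_on g c S a b : cform A g -> smooth_in_S A S c a b ->
  cont_on (speed A g c) a b.
Proof. by move=> cg H r /H [sc _]; exact: speed_continuous. Qed.

Lemma lengthE g c S : cform A g -> smooth_in_S A S c 0 1 ->
  length A g c = (arc (speed A g c) 0 1)%:E.
Proof. by move=> cg H; rewrite -arcE//; exact: speed_cont_on H. Qed.

Lemma smooth_affine (s d t : R) : smooth_at (euclid R^o) (euclid R^o) (fun r : R^o => s + d * r : R^o) t.
Proof.
apply: (@smooth_at_euclid _ R^o R^o _ setT) => //; first exact: openT.
apply: smoothD; [exact: openT|exact: smooth_cst|].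
by apply: smooth_linear; [exact: openT|exact: (@clin_scaler _ R^o d)].
Qed.

Lemma curve_affine c (s d t : R) : smooth_curve_at A c (s + d * t) ->
  smooth_curve_at A (fun r : R^o => c (s + d * r)) t /\
  velocity A (fun r : R^o => c (s + d * r)) t = d *: velocity A c (s + d * t).
Proof.
move=> sc; have sR := @satlas_euclid R R^o.
have sa := smooth_affine s d t; split; first exact: (smooth_at_comp sR sR sA sa sc).
have := @mdiff_comp _ _ _ _ _ _ _ _ _ _ (euclid R^o) (euclid R^o) A sR sR _ _ t (1 : R^o) sa sc.
rewrite /velocity => ->.
have -> : mdiff (euclid R^o) (euclid R^o) (fun r : R^o => s + d * r : R^o) t (1 : R^o) = d *: (1 : R^o).
  have : is_derive (t : R) 1 (fun r : R => s + d * r) (0 + d * 1) by apply: is_deriveD.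
  by rewrite add0r => -[].
have cm : clin (mdiff (euclid R^o) A c (s + d * t)) by exact: clin_mdiff.
by rewrite (clinZ _ _ cm).
Qed.

Lemma speed_affine g c (s d t : R) : cform A g -> smooth_curve_at A c (s + d * t) ->
  speed A g (fun r : R^o => c (s + d * r)) t = `|d| * speed A g c (s + d * t).
Proof.
move=> [_ hg] sc; have [_ E] := curve_affine sc.
by rewrite /speed E hg sqrtrM ?sqr_ge0// sqrtr_sqr.
Qed.

Lemma length_affine g c S (s d : R) : cform A g -> 0 <= d -> smooth_in_S A S c s (s + d) ->
  smooth_in_S A S (fun r : R^o => c (s + d * r)) 0 1 /\
  length A g (fun r : R^o => c (s + d * r)) = (arc (speed A g c) s (s + d))%:E.
Proof.
move=> cg d0 H.
have B (r : R) : 0 <= r <= 1 -> s <= s + d * r <= s + d.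
  by move=> /andP[r0 r1]; rewrite lerDl mulr_ge0//= lerD2l ler_piMr.
have H' : smooth_in_S A S (fun r : R^o => c (s + d * r)) 0 1.
  by move=> r /B /H [sc Sc]; split=> //; exact: (curve_affine sc).1.
split; first exact: H'.
rewrite (lengthE cg H') -arc_affine//; last exact: speed_cont_on H.
congr EFin; rewrite /arc; apply: eq_Rintegral => r; rewrite inE /= in_itv /= => /B /H [sc _].
by rewrite speed_affine// ger0_norm.
Qed.

Lemma length_reverse g c S : cform A g -> smooth_in_S A S c 0 1 ->
  smooth_in_S A S (fun r : R^o => c (1 + (- 1) * r)) 0 1 /\
  length A g (fun r : R^o => c (1 + (- 1) * r)) = length A g c.
Proof.
set c' := (X in length A g X).
move=> cg H.
have B (r : R) : 0 <= r <= 1 -> 0 <= 1 + (-1) * r <= 1.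
  by move=> /andP[r0 r1]; rewrite mulN1r subr_ge0 r1 lerBlDr lerDl r0.
have H' : smooth_in_S A S c' 0 1.
  by move=> r /B /H [sc Sc]; split=> //; exact: (curve_affine sc).1.
split; first exact: H'.
have cs := speed_cont_on cg H.
rewrite (lengthE cg H') (lengthE cg H) -(arc_onem cs); apply: congr1.
rewrite /arc; apply: eq_Rintegral => r; rewrite inE /= in_itv /= => /B /H [sc _].
by rewrite (speed_affine cg sc) normrN normr1 mul1r mulN1r.
Qed.

Lemma pw_path_one g S c x y : smooth_in_S A S c 0 1 -> c 0 = x -> c 1 = y ->
  pw_path A g S x y (length A g c).
Proof.
move=> H <- <-; rewrite -[length A g c]adde0; apply: pw_cons => //.
by apply: pw_nil; have [] := H 1 (ltac:(by rewrite ler01 lexx)).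
Qed.

Lemma pw_path_rev g S x y l : cform A g -> pw_path A g S x y l -> pw_path A g S y x l.
Proof.
move=> cg; elim=> [x' Sx|c y' l1 H p IH]; first exact: pw_nil.
rewrite addeC; apply: pw_path_cat IH _.
have [H' <-] := length_reverse cg (H : smooth_in_S A S c 0 1).
by apply: pw_path_one => //; [rewrite mulr0 addr0|rewrite mulN1r subrr].
Qed.

Lemma rdist_sym g S x y : cform A g -> rdist A g S x y = rdist A g S y x.
Proof.
by move=> cg; congr ereal_inf; rewrite predeqE => l; split; exact: pw_path_rev.
Qed.

Lemma rdist_arc g S c s t : cform A g -> s <= t -> smooth_in_S A S c s t ->
  (rdist A g S (c s) (c t) <= (arc (speed A g c) s t)%:E)%E.
Proof.
move=> cg st H; have tE : t = s + (t - s) by rewrite addrC subrK.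
rewrite {2}tE; rewrite {1}tE in H.
have d0 : 0 <= t - s by rewrite subr_ge0.
have [H' <-] := length_affine cg d0 H.
apply: rdist_le; apply: pw_path_one => //; first by rewrite mulr0 addr0.
by rewrite mulr1 -tE.
Qed.

(** Join [v] to [u] by a straight segment. The form vanishes on the zero vector, so by continuity at
    [(u, 0)] the image of a short segment has speed at most [e]. This yields continuity of [F] for
    the distance inside [S] without comparing metrics. *)
Lemma rdist_smooth_map g S (W : normedModType R) {fW : findim W} (N : set W)
    (F : W -> X) u : cform A g -> open N -> N u ->
  (forall v, N v -> smooth_at (euclid W) A F v /\ S (F v)) ->
  forall e, 0 < e -> \forall v \near u, (rdist A g S (F v) (F u) <= e%:E)%E.
Proof.
move=> cg oN Nu sF e e0; have sW := @satlas_euclid R W.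
have cm : clin (mdiff (euclid W) A F u) by exact: clin_mdiff (sF u Nu).1.
have := @cform_smooth g W fW F u 0 cg (sF u Nu).1.
rewrite (clin0 cm).
have -> : g (F u) 0 0 = 0 by have := cg.2 (F u) 0 0; rewrite scale0r expr0n mul0r.
have e20 : 0 < e ^+ 2 by rewrite exprn_gt0.
move=> /cvgrPdist_lt /(_ _ e20) /nbhs_ballP [d /= d0 Hd].
have /nbhs_ballP [d' /= d'0 Hd'] : nbhs u N by exact: open_nbhs_nbhs.
apply/nbhs_ballP; exists (Num.min d d') => /=; first by rewrite lt_min d0.
move=> v; rewrite -ball_normE /= lt_min distrC => /andP[vd vd'].
pose c (t : R^o) : X := F (v + t *: (u - v)).
have B (t : R) : 0 <= t <= 1 -> `|u - (v + t *: (u - v))| <= `|v - u|.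
  move=> /andP[t0 t1]; rewrite (_ : u - _ = (1 - t) *: (u - v)).
    by rewrite normrZ ger0_norm ?subr_ge0// (distrC u) ler_piMl// lerBlDr lerDl.
  by rewrite scalerBl scale1r opprD addrA.
have sl : smooth_on setT (fun t : R^o => v + t *: (u - v)).
  apply: smoothD; [exact: openT|exact: smooth_cst|].
  by apply: smooth_linear; [exact: openT|exact: clin_scalel].
have sR := @satlas_euclid R R^o.
have vel (t : R) : 0 <= t <= 1 -> smooth_curve_at A c t /\
    velocity A c t = mdiff (euclid W) A F (v + t *: (u - v)) (u - v).
  move=> t01; have Nt : N (v + t *: (u - v)).
    by apply: Hd'; rewrite -ball_normE /=; exact: le_lt_trans (B t t01) vd'.
  have sl' : smooth_at (euclid R^o) (euclid W) (fun t : R^o => v + t *: (u - v)) t.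
    exact: smooth_at_euclid openT I sl.
  split; first exact: (smooth_at_comp sR sW sA sl' (sF _ Nt).1).
  rewrite /velocity (@mdiff_comp _ _ _ _ _ _ _ _ _ _ (euclid R^o) (euclid W) A sR sW
     (fun t : R^o => v + t *: (u - v)) F t (1 : R^o) sl' (sF _ Nt).1).
  congr mdiff; have cl := clin_scalel (u - v).
  have : is_derive t (1 : R^o) (fun t : R^o => v + t *: (u - v)) (0 + (u - v)).
    apply: is_deriveD; split.
      by apply: diff_derivable; apply: smooth_differentiable (smooth_linear openT cl) I; exact: openT.
    by rewrite (derive_clin _ _ cl) scale1r.
  by rewrite add0r => -[].
have H : smooth_in_S A S c 0 1.
  move=> t t01; split; first exact: (vel t t01).1.
  apply: (sF _ _).2; apply: Hd'; rewrite -ball_normE /=; exact: le_lt_trans (B t t01) vd'.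
have := rdist_arc cg ler01 H; rewrite /c scale0r addr0 scale1r addrC subrK => /le_trans; apply.
rewrite lee_fin -[leRHS]mulr1 -[X in e * X](subr0 1) -arc_cst//.
apply: arc_le => [||t /andP[t0 t1]].
- exact: speed_cont_on H.
- by move=> r _; exact: cvg_cst.
have t01 : 0 <= t <= 1 by rewrite !ltW.
rewrite /speed (vel t t01).2 -(ger0_norm (ltW e0)) -sqrtr_sqr ler_wsqrtr//.
have := Hd (v + t *: (u - v), u - v); rewrite /= sub0r normrN => H2.
apply: le_trans (ler_norm _) (ltW (H2 _)); split=> /=.
  by rewrite -ball_normE /=; exact: le_lt_trans (B t t01) vd.
by rewrite -ball_normE /= sub0r normrN distrC.
Qed.

End Speed.

Section TwoForms.
Context {R : realType}.
Local Notation mu := (@lebesgue_measure R).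

(** End points are negligible. They have to be discarded because two forms are compared only at
    times around which the curve stays in [S] on both sides. *)
Lemma integral_eq_oo (h k : R -> R) (a b : R) : cont_on k a b ->
  (forall t, a < t < b -> h t = k t) ->
  (\int[mu]_(t in `[a, b]) (h t)%:E = \int[mu]_(t in `[a, b]) (k t)%:E)%E.
Proof.
move=> ck hk.
have s : `]a, b[ `<=` `[a, b] by apply: subset_itv; rewrite bnd_simp.
have ik : mu.-integrable `]a, b[ (EFin \o k) by apply: integrableS (integrable_cont ck).
have ih : mu.-integrable `]a, b[ (EFin \o h).
  apply: eq_integrable ik => // t; rewrite inE /= in_itv /= => /hk.
  by move=> ->.
have E f : mu.-integrable `]a, b[ (EFin \o f) ->
    (\int[mu]_(t in `[a, b]) (f t)%:E = \int[mu]_(t in `]a, b[) (f t)%:E)%E.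
  move=> jf; have mf := measurable_int mu jf.
  rewrite -integral_itv_obnd_cbnd; last first.
    exact/measurable_EFinP/measurable_fun_itv_bndo_bndcP/measurable_EFinP.
  by rewrite -integral_itv_bndo_bndc.
rewrite !E//; apply: eq_integral => t; rewrite inE /= in_itv /= => /hk.
by move=> ->.
Qed.

Section SameManifold.
Context {V : normedModType R} {fV : findim V} {X : Type} {A : atlas V X}.
Hypothesis sA : satlas A.
Variables (g1 g2 : @form R V X) (S : set X).
Hypothesis cg2 : cform A g2.
Hypothesis g12 : forall c (t : R), smooth_curve_at A c t -> (\forall s \near t, S (c s)) ->
  g1 (c t) (velocity A c t) (velocity A c t) = g2 (c t) (velocity A c t) (velocity A c t).

Lemma length_ext c : smooth_in_S A S c 0 1 -> length A g1 c = length A g2 c.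
Proof.
move=> H; apply: integral_eq_oo; first exact: (speed_cont_on sA cg2 H).
move=> t t01; congr Num.sqrt; apply: g12.
  by apply: (H t _).1; case/andP: t01 => /ltW-> /ltW->.
have : t \in `]0%R, 1%R[ by rewrite in_itv.
move=> /near_in_itvoo; apply: filterS => s; rewrite in_itv /= => /andP[s0 s1].
by apply: (H s _).2; rewrite !ltW.
Qed.

(** Agreement is asked only along curves that remain in [S]. This is what permits trading a
    (p,q)-metric, unspecified away from the unit bundle, for a form continuous everywhere. *)
Lemma rdist_ext : rdist A g1 S = rdist A g2 S.
Proof.
apply/funext => x; apply/funext => y; congr ereal_inf; rewrite predeqE => l; split.
  elim=> [x' Sx|c y' l' H _ IH]; first exact: pw_nil.
  by rewrite length_ext//; exact: pw_cons.
elim=> [x' Sx|c y' l' H _ IH]; first exact: pw_nil.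
by rewrite -length_ext//; exact: pw_cons.
Qed.

End SameManifold.

(** * Lifting curves *)

Section Submersion.
Context {V V' : normedModType R} {fV : findim V} {fV' : findim V'} {X X' : Type}.
Context {A : atlas V X} {A' : atlas V' X'}.
Hypotheses (sA : satlas A) (sA' : satlas A').
Variables (g : @form R V X) (S : set X) (g' : @form R V' X') (S' : set X') (p : X -> X').
Hypotheses (cg : cform A g) (cg' : cform A' g').

Lemma rdist_map x y :
  (forall x, S x -> [/\ smooth_at A A' p x, S' (p x) &
    forall v, g' (p x) (mdiff A A' p x v) (mdiff A A' p x v) <= g x v v]) ->
  (rdist A' g' S' (p x) (p y) <= rdist A g S x y)%E.
Proof.
move=> H; apply: le_ereal_inf_tmp => l q.
suff [l' q' ll'] : exists2 l', pw_path A' g' S' (p x) (p y) l' & (l' <= l)%E.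
  by apply: le_trans ll'; exact: rdist_le.
elim: q => [x' /H [_ S'x _]|c y' l1 Hc q [l' q' ll']].
  by exists 0%E => //; exact: pw_nil.
have Hc' : smooth_in_S A' S' (p \o c) 0 1.
  move=> t t01; have [sc /H [sp Sp _]] := Hc t t01; split=> //.
  exact: (velocity_comp sA sA' sc sp).1.
exists (length A' g' (p \o c) + l')%E; first exact: (pw_cons (c := p \o c) Hc').
apply: leeD => //; rewrite (lengthE sA' cg' Hc') (lengthE sA cg (Hc : smooth_in_S A S c 0 1)) lee_fin.
apply: arc_le => [||t t01].
- exact: (speed_cont_on sA' cg' Hc').
- exact: (speed_cont_on sA cg (Hc : smooth_in_S A S c 0 1)).
have [sc /H [sp _ le]] := Hc t (ltac:(by case/andP: t01 => /ltW-> /ltW->)).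
by rewrite /speed (velocity_comp sA sA' sc sp).2 ler_wsqrtr.
Qed.

(** [S'] may be a proper submanifold, such as the unit sphere bundle; hence [s] lives on a
    neighbourhood in the ambient manifold and only its values over [S'] are asked to lie in [S]. *)
Definition local_isometric_section w (s : X' -> X) : Prop :=
  s (p w) = w /\ \forall x' \near mnbhs A' (p w), [/\ smooth_at A' A s x',
    (S' x' -> S (s x')), p (s x') = x' &
    forall v, g (s x') (mdiff A' A s x' v) (mdiff A' A s x' v) = g' x' v v].

(** Sequential compactness of the fibres, phrased without a topology on the total space: from points
    over [c t], for times [t] in [B] accumulating at [T], a point over [c T] is obtained that they
    approach in distance. *)
Definition proper_over_curves : Prop :=
  forall (c : R^o -> X') (T : R) (B : set R) (w : R -> X), smooth_curve_at A' c T ->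
    S' (c T) -> closure B T -> (forall t, B t -> S (w t) /\ p (w t) = c t) ->
    exists w0, [/\ S w0, p w0 = c T & forall e, 0 < e ->
      exists t, [/\ B t, `|t - T| < e & (rdist A g S (w t) w0 <= e%:E)%E]].

Hypothesis sections : forall w, S w -> exists s, local_isometric_section w s.
Hypothesis proper : proper_over_curves.

(** The local section through [w], followed along [c] for a short time, lifts an arc of [c] together
    with its length. *)
Lemma lift_right (c : R^o -> X') (T : R) w : smooth_in_S A' S' c 0 1 -> 0 <= T -> T < 1 ->
  S w -> p w = c T -> exists2 T', T < T' <= 1 &
  exists w', [/\ S w', p w' = c T' &
    (rdist A g S w w' <= (arc (speed A' g' c) T T')%:E)%E].
Proof.
move=> Hc T0 T1 Sw pw.
have [s [sw sP]] := sections Sw.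
have [scT S'T] := Hc T (ltac:(by rewrite T0 ltW)).
have sR := @satlas_euclid R R^o.
rewrite pw in sP sw.
have : \forall r \near (T : R^o), [/\ smooth_at A' A s (c r),
    (S' (c r) -> S (s (c r))), p (s (c r)) = c r &
    forall v, g (s (c r)) (mdiff A' A s (c r) v) (mdiff A' A s (c r) v) = g' (c r) v v].
  by have := smooth_at_cont sR sA' scT sP.
move=> /nbhs_ballP [d /= d0 Hd].
pose T' := Num.min 1 (T + d / 2).
have TT' : T < T' by rewrite lt_min T1 ltrDl divr_gt0.
have T'1 : T' <= 1 by rewrite ge_min lexx.
have T'd : T' <= T + d / 2 by rewrite ge_min lexx orbT.
have Hr (r : R) : T <= r <= T' -> smooth_curve_at A' c r /\ S' (c r) /\
    [/\ smooth_at A' A s (c r),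
    (S' (c r) -> S (s (c r))), p (s (c r)) = c r &
    forall v, g (s (c r)) (mdiff A' A s (c r) v) (mdiff A' A s (c r) v) = g' (c r) v v].
  move=> /andP[Tr rT']; have [] := Hc r (ltac:(by rewrite (le_trans T0 Tr) (le_trans rT' T'1))).
  move=> ? ?; split=> //; split=> //; apply: Hd; rewrite -ball_normE /=.
  rewrite distrC ger0_norm ?subr_ge0//; lra.
have H : smooth_in_S A S (s \o c) T T'.
  move=> r /Hr [scr [S'r [sm SS _ _]]]; split; last exact: SS.
  exact: (velocity_comp sA' sA scr sm).1.
exists T'; first by rewrite TT'.
exists (s (c T')); have [_ [S'T' [_ SS ps _]]] := Hr T' (ltac:(by rewrite lexx ltW)).
split=> //; first exact: SS.
have rr : (rdist A g S ((s \o c) T) ((s \o c) T') <= (arc (speed A g (s \o c)) T T')%:E)%E.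
  exact: rdist_arc (ltW TT') H.
rewrite /= sw in rr; apply: le_trans rr _.
rewrite lee_fin; apply: arc_le => [||r /andP[/ltW r1 /ltW r2]].
- exact: (speed_cont_on sA cg H).
- apply: (speed_cont_on sA' cg' (S := S')) => r /andP[r1 r2]; apply: Hc.
  by rewrite (le_trans T0 r1) (le_trans r2 T'1).
have [scr [S'r [sm _ _ E]]] := Hr r (ltac:(by rewrite r1 r2)).
by rewrite /speed (velocity_comp sA' sA scr sm).2 E.
Qed.

(* The set of times which can be reached over [c] at the right cost is closed by
   properness, and open to the right by [lift_right]. *)
Lemma lift_curve (c : R^o -> X') z : smooth_in_S A' S' c 0 1 -> S z -> p z = c 0 ->
  exists w, [/\ S w, p w = c 1 & (rdist A g S z w <= length A' g' c)%E].
Proof.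
move=> Hc Sz pz; pose el t := arc (speed A' g' c) 0 t.
have cs := speed_cont_on sA' cg' Hc.
have el_mono (s t : R) : 0 <= s -> s <= t -> t <= 1 -> el t = el s + arc (speed A' g' c) s t.
  move=> s0 st t1; apply: arc_add => // r /andP[r0 rt]; apply: cs.
  by rewrite r0 (le_trans rt t1).
pose Q (t : R) w := [/\ S w, p w = c t & (rdist A g S z w <= (el t)%:E)%E].
pose B := [set t : R | 0 <= t <= 1 /\ exists w, Q t w].
have B0 : B 0.
  split; first by rewrite lexx ler01.
  by exists z; split=> //; rewrite rdist_refl// /el arc_refl.
have supB : has_sup B by split; [exists 0|exists 1 => t [/andP[]]].
have T0 : 0 <= sup B by apply: ub_le_sup => //; case: supB.
have T1 : sup B <= 1 by apply: ge_sup; [exists 0|move=> t [/andP[]]].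
have /choice [w Hw] : forall t, exists w, B t -> Q t w.
  move=> t; have [[_ [w Hw]]|nB] := pselect (B t); first by exists w.
  by exists z.
set T := sup B in T0 T1.
have clT : closure B T.
  move=> N /nbhs_ballP [e /= e0 He].
  have [t Bt hT] := sup_adherent e0 supB.
  exists t; split=> //; apply: He; rewrite -ball_normE /=.
  have tT : t <= T by apply: ub_le_sup => //; case: supB.
  by rewrite ger0_norm ?subr_ge0//; move: hT; rewrite -/T; lra.
have [scT S'T] := Hc T (ltac:(by rewrite T0 T1)).
have [w0 [Sw0 pw0 Hw0]] := proper scT S'T clT (fun t Bt => let: And3 a b _ := Hw t Bt in conj a b).
have QT : Q T w0.
  split=> //; apply/lee_addgt0Pr => e e0.
  have [t [Bt _ tw]] := Hw0 e e0; have [_ _ tz] := Hw t Bt.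
  have [/andP[t0 t1] _] := Bt.
  have tT : t <= T by apply: ub_le_sup => //; case: supB.
  apply: le_trans (rdist_triangle g S z (w t) w0) _.
  apply: leeD => //; apply: le_trans tz _; rewrite lee_fin (el_mono t T)// lerDl.
  by apply: arc_ge0 => r; exact: speed_ge0.
have [T1'|T1'] := ltP T 1; last first.
  have TE : T = 1 by apply/eqP; rewrite eq_le T1 T1'.
  rewrite TE in QT pw0; have [h1 h2 h3] := QT; exists w0; split=> //.
  by rewrite (lengthE sA' cg' Hc).
have [T' /andP[TT' T'1] [w' [Sw' pw' hw']]] := lift_right Hc T0 T1' Sw0 pw0.
have BT' : B T'.
  split; first by rewrite (le_trans T0 (ltW TT')).
  exists w'; split=> //; apply: le_trans (rdist_triangle g S z w0 w') _.
  rewrite (el_mono T T') ?(ltW TT')// EFinD; apply: leeD => //.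
  by have [] := QT.
have : T' <= T by apply: ub_le_sup => //; case: supB.
by rewrite leNgt TT'.
Qed.

Lemma lift_path z x' l : S z -> pw_path A' g' S' (p z) x' l ->
  exists w, [/\ S w, p w = x' & (rdist A g S z w <= l)%E].
Proof.
move=> Sz q; have [pz pzE] : exists y, y = p z by exists (p z).
rewrite -pzE in q; elim: q z pzE Sz => [y S'y|c y l' Hc q IH] z pzE Sz.
  by exists z; rewrite rdist_refl.
have [w [Sw pw hw]] := lift_curve Hc Sz (esym pzE).
have [w' [Sw' pw' hw']] := IH w (esym pw) Sw.
exists w'; split=> //; apply: le_trans (rdist_triangle g S z w w') _.
exact: leeD.
Qed.

End Submersion.
End TwoForms.

(** * Gromov-Hausdorff convergence and fibres *)

Section GHTheory.
Context {R : realType}.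
Local Open Scope ereal_scope.

(** Only reflexivity is restricted to [S]: a point outside [S] is the end of no path in [S], so
    [rdist] gives it distance [+oo] from itself. *)
Record pseudometric_on X (S : set X) (d : X -> X -> \bar R) : Prop := {
  pm_ge0 : forall x y, 0 <= d x y;
  pm_refl : forall x, S x -> d x x = 0;
  pm_sym : forall x y, d x y = d y x;
  pm_triangle : forall x y z, d x z <= d x y + d y z }.

Lemma quotient_metric (W : Type) (D : W -> W -> \bar R) : pseudometric_on setT D ->
  exists (Z : Type) (d : Z -> Z -> \bar R) (k : W -> Z),
    extended_metric d /\ forall u v, d (k u) (k v) = D u v.
Proof.
move=> pD; pose cl w : set W := [set v | D w v = 0].
pose Z := {c : set W | exists w, c = cl w}.
pose k w : Z := exist _ (cl w) (ex_intro _ w erefl).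
pose r (z : Z) : W := projT1 (cid (proj2_sig z)).
have rP (z : Z) : proj1_sig z = cl (r z) by rewrite /r; case: cid.
pose d (z z' : Z) := D (r z) (r z').
have D0 w : D w (r (k w)) = 0.
  have /= E := rP (k w).
  have : cl w (r (k w)) by rewrite E; exact: (pm_refl pD).
  by [].
have le u v : D u v <= d (k u) (k v).
  apply: le_trans (pm_triangle pD u (r (k u)) v) _; rewrite D0 add0e.
  apply: le_trans (pm_triangle pD _ (r (k v)) v) _.
  by rewrite (pm_sym pD (r (k v)) v) D0 adde0.
have ge u v : d (k u) (k v) <= D u v.
  apply: le_trans (pm_triangle pD _ u _) _; rewrite (pm_sym pD _ u) D0 add0e.
  by apply: le_trans (pm_triangle pD _ v _) _; rewrite D0 adde0.
exists Z, d, k; split; last by move=> u v; apply/eqP; rewrite eq_le le ge.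
split=> [x y|x y|x y|x y z].
- exact: (pm_ge0 pD).
- split=> [h|->]; last exact: (pm_refl pD).
  suff E : proj1_sig x = proj1_sig y.
    move: x y E {h} => [cx hx] [cy hy] /= E.
    by subst cy; congr exist; exact: Prop_irrelevance.
  rewrite !rP predeqE => w; split=> /= hw; apply/eqP; rewrite eq_le (pm_ge0 pD) andbT.
    apply: le_trans (pm_triangle pD _ (r x) _) _.
    by rewrite hw adde0 (pm_sym pD) -/(d x y) h.
  apply: le_trans (pm_triangle pD _ (r y) _) _.
  by rewrite hw adde0 -/(d x y) h.
- exact: (pm_sym pD).
- exact: (pm_triangle pD).
Qed.

Section Projection.
Context {X Y : Type} (S : set X) (T : set Y) (dS : X -> X -> \bar R) (dT : Y -> Y -> \bar R).
Variable p : X -> Y.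
Hypotheses (pS : pseudometric_on S dS) (pT : pseudometric_on T dT).
Hypothesis p_in : forall x, S x -> T (p x).
Hypothesis p_onto : forall y, T y -> exists2 x, S x & p x = y.
Hypothesis p_lip : forall x y, S x -> S y -> dT (p x) (p y) <= dS x y.

(** A point of [S] is required because the supremum of the empty set is [-oo]. *)
Lemma gh_dist_ge0 : S !=set0 -> 0 <= gh_dist S dS T dT.
Proof.
move=> [a Sa]; apply: le_ereal_inf_tmp => r [Z [d [i [j [md _ _ ->]]]]].
rewrite /hausdorff_dist le_max; apply/orP; left.
apply: (@le_trans _ _ (ereal_inf [set d (i a) t | t in j @` T])).
  by apply: le_ereal_inf_tmp => _ [t _ <-]; exact: (em_ge0 md).
by apply: ereal_sup_ubound; exists (i a) => //; exists a.
Qed.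

Hypothesis p_lift : forall x y, S x -> T y -> forall r : R, dT (p x) y < r%:E ->
  exists w, [/\ S w, p w = y & dS x w <= r%:E].

(** The disjoint union of [S] and [T] is metrised by placing [x] and [y] at distance
    [dT (p x) y + e]. Going from [S] to [S] through [T] respects the triangle inequality because
    lifting and the bound on fibres give [dS x y <= dT (p x) (p y) + e]. *)
Lemma gh_dist_fibers (e : R) : S !=set0 -> (0 < e)%R ->
  (forall x y, S x -> S y -> p x = p y -> dS x y <= e%:E) ->
  gh_dist S dS T dT <= e%:E.
Proof.
move=> [a0 Sa0] e0 fib.
have dist x y : S x -> S y -> dS x y <= dT (p x) (p y) + e%:E.
  move=> Sx Sy.
  case E : (dT (p x) (p y)) (pm_ge0 pT (p x) (p y)) => [r| |] // _; last first.
    by rewrite addye// leey.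
  apply/lee_addgt0Pr => h h0.
  have hr : dT (p x) (p y) < (r + h)%:E by rewrite E lte_fin ltrDl.
  have [w [Sw pw hw]] := p_lift Sx (p_in Sy) hr.
  apply: le_trans (pm_triangle pS x w y) _.
  apply: le_trans (leeD hw (fib _ _ Sw Sy pw)) _.
  by rewrite -!EFinD lee_fin; lra.
(* Points outside [S] and [T] are discarded, as reflexivity is known on these sets only. *)
pose W := {z : X + Y | match z with inl x => S x | inr y => T y end}.
pose D (u v : W) : \bar R := match proj1_sig u, proj1_sig v with
  | inl x, inl y => dS x y | inr x, inr y => dT x y
  | inl x, inr y => dT (p x) y + e%:E | inr y, inl x => dT (p x) y + e%:E end.
have e0' : 0 <= e%:E by rewrite lee_fin ltW.
have pD : pseudometric_on setT D.
  split.
  - move=> [[x|x] /= hx] [[y|y] /= hy]; rewrite /D /= ?adde_ge0//;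
    by [exact: (pm_ge0 pS)|exact: (pm_ge0 pT)].
  - by move=> [[x|x] /= hx] _; rewrite /D /=; [exact: (pm_refl pS)|exact: (pm_refl pT)].
  - by move=> [[x|x] /= hx] [[y|y] /= hy]; rewrite /D /=; [exact: (pm_sym pS)| | |exact: (pm_sym pT)].
  - move=> [[x|x] /= hx] [[y|y] /= hy] [[z|z] /= hz]; rewrite /D /=.
    + exact: (pm_triangle pS).
    + by rewrite addeA; apply: leeD => //; apply: le_trans (pm_triangle pT _ (p y) _) _;
        apply: leeD => //; exact: p_lip.
    + apply: le_trans (dist _ _ hx hz) _; rewrite addeAC.
      rewrite (_ : dT (p x) y + (dT (p z) y + e%:E) + e%:E = dT (p x) y + dT y (p z) + e%:E + e%:E); last first.
        by rewrite !addeA (pm_sym pT (p z) y).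
      rewrite -[leLHS]adde0; apply: leeD => //; apply: leeD => //; exact: (pm_triangle pT).
    + by rewrite addeAC; apply: leeD => //; exact: (pm_triangle pT).
    + rewrite addeAC; apply: leeD => //; rewrite (pm_sym pT (p y) x) (pm_sym pT (p z) x).
      rewrite addeC; apply: le_trans (pm_triangle pT _ (p y) _) _.
      rewrite addeC; apply: leeD => //; exact: p_lip.
    + rewrite (_ : dT (p y) x + e%:E + (dT (p y) z + e%:E) = dT x (p y) + dT (p y) z + (e%:E + e%:E)).
        by rewrite -[leLHS]adde0; apply: leeD; [exact: (pm_triangle pT)|exact: adde_ge0].
      by rewrite addeACA (pm_sym pT x).
    + rewrite addeA; apply: leeD => //; rewrite addeC (pm_sym pT x y).
      exact: (pm_triangle pT).
    + exact: (pm_triangle pT).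
have [Z [d [k [md kE]]]] := quotient_metric pD.
(* Default value of the two embeddings outside [S] and [T], where [isometric_on] asks nothing. *)
pose w0 : W := exist _ (inl a0) Sa0.
pose i x : Z := match pselect (S x) with
  left h => k (exist _ (inl x) h) | right _ => k w0 end.
pose j y : Z := match pselect (T y) with
  left h => k (exist _ (inr y) h) | right _ => k w0 end.
have dij x y : S x -> T y -> d (i x) (j y) = dT (p x) y + e%:E.
  by rewrite /i /j; case: pselect => // h1; case: pselect => // h2; rewrite kE.
apply: ge_ereal_inf; exists (hausdorff_dist d (i @` S) (j @` T)).
  exists Z, d, i, j; split=> //.
    by move=> x y Sx Sy; rewrite /i; case: pselect => // h1; case: pselect => // h2; rewrite kE.
  by move=> x y Sx Sy; rewrite /j; case: pselect => // h1; case: pselect => // h2; rewrite kE.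
rewrite /hausdorff_dist ge_max; apply/andP; split; apply: ge_ereal_sup => _ [_ [x Sx <-] <-].
  apply: ge_ereal_inf; exists (d (i x) (j (p x))).
    by exists (j (p x)) => //; exists (p x) => //; exact: p_in.
  by rewrite dij//; [rewrite (pm_refl pT) ?add0e//; exact: p_in|exact: p_in].
have [a Sa pa] := p_onto Sx.
apply: ge_ereal_inf; exists (d (i a) (j x)); first by exists (i a) => //; exists a.
by rewrite dij// pa (pm_refl pT)// add0e.
Qed.

End Projection.

Definition totally_bounded Y (T : set Y) (d : Y -> Y -> \bar R) : Prop :=
  forall e : R, (0 < e)%R -> exists N (c : 'I_N -> set Y),
    (forall y, T y -> exists i, c i y) /\
    forall i x y, T x -> T y -> c i x -> c i y -> d x y <= e%:E.

(* An almost nonexpanding, almost onto self-map of a totally bounded space is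
   almost isometric: follow two points backwards until the pair of orbits
   nearly returns, then push the near-coincidence forward. *)
Lemma almost_isometry Y (T : set Y) (d : Y -> Y -> \bar R) (delta : R) :
  pseudometric_on T d -> totally_bounded T d -> (0 < delta)%R ->
  exists e : R, (0 < e)%R /\ forall phi : Y -> Y, (forall x, T x -> T (phi x)) ->
    (forall x y, T x -> T y -> d (phi x) (phi y) <= d x y + e%:E) ->
    (forall z, T z -> exists x, T x /\ d (phi x) z <= e%:E) ->
    forall x y, T x -> T y -> d x y <= d (phi x) (phi y) + delta%:E.
Proof.
move=> pd tb delta0; have [|N [c [cT cd]]] := tb (delta / 4)%R; first by rewrite divr_gt0.
(* There are [K] pairs of cells, so among the times 0 to [K] the pair of backward orbits visits some
   pair of cells twice. Each forward push costs [3 * e], and in all the estimate loses at most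
   [delta / 2 + (9 * K + 4) * e], which this [e] makes equal to [delta]. *)
pose K := (N * N)%N; pose e : R := (delta / (2 * (9 * K%:R + 4)))%R.
have K0 : (0 < 9 * K%:R + 4 :> R)%R by rewrite ltr_wpDl// mulr_ge0.
have e0 : (0 < e)%R by rewrite divr_gt0// mulr_gt0.
exists e; split=> // phi phiT lip onto x y Tx Ty.
have /choice [pre preP] : forall z, exists x, T z -> T x /\ d (phi x) z <= e%:E.
  by move=> z; have [/onto [w hw]|nT] := pselect (T z); [exists w|exists z].
pose u z n := iter n pre z.
have uT z n : T z -> T (u z n) by move=> Tz; elim: n => //= n /preP [].
have ue z n : T z -> d (phi (u z n.+1)) (u z n) <= e%:E by move=> /(uT z n) /preP [].
(* One step forward along two orbits: [2 * e] for replacing images under [phi] by orbit points, and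
   [e] for the expansion of [phi]. *)
have push z z' i j eta : T z -> T z' -> d (u z i.+1) (u z' j.+1) <= eta ->
    d (u z i) (u z' j) <= eta + (3 * e)%:E.
  move=> Tz Tz' h.
  apply: le_trans (pm_triangle pd _ (phi (u z i.+1)) _) _.
  rewrite (pm_sym pd); apply: le_trans (leeD (ue z i Tz) (pm_triangle pd _ (phi (u z' j.+1)) _)) _.
  have h2 := le_trans (lip _ _ (uT z i.+1 Tz) (uT z' j.+1 Tz')) (leeD h (lexx e%:E)).
  apply: le_trans (leeD (lexx e%:E) (leeD h2 (ue z' j Tz'))) _.
  rewrite addeCA -!addeA -!EFinD; apply: leeD => //; rewrite lee_fin; lra.
have pushn z z' i j n eta : T z -> T z' -> d (u z (i + n)%N) (u z' (j + n)%N) <= eta ->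
    d (u z i) (u z' j) <= eta + (n%:R * (3 * e))%:E.
  move=> Tz Tz'; elim: n eta => [|n IH] eta; first by rewrite !addn0 mul0r adde0.
  rewrite !addnS => /(push _ _ _ _ _ Tz Tz') /IH /le_trans; apply.
  have -> : (n.+1%:R * (3 * e) = 3 * e + n%:R * (3 * e))%R by rewrite -natr1; ring.
  by rewrite -addeA -EFinD.
have cell z n : exists i, T z -> c i (u z n).
  have [Tz|nT] := pselect (T z); last by have [i _] := cT x Tx; exists i.
  by have [i hi] := cT _ (uT z n Tz); exists i.
have /choice [cx cxP] : forall n, exists i, c i (u x n).
  by move=> n; have [i hi] := cell x n; exists i; exact: hi.
have /choice [cy cyP] : forall n, exists i, c i (u y n).
  by move=> n; have [i hi] := cell y n; exists i; exact: hi.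
have [k [l [kl lK ckl1 ckl2]]] : exists k l,
    [/\ (k < l)%N, (l <= K)%N, cx k = cx l & cy k = cy l].
  pose F (n : 'I_K.+1) := (cx n, cy n).
  have : ~~ injectiveb F.
    apply/negP => /injectiveP /leq_card.
    by rewrite card_prod !card_ord ltnn.
  move=> /injectivePn [k [l kl [E1 E2]]].
  have : (k != l :> nat)%N by exact: kl.
  rewrite neq_ltn => /orP[kl'|lk'].
    by exists k, l; split=> //; rewrite -ltnS.
  by exists l, k; split=> //; rewrite -ltnS.
have [m [lE]] : exists m, (l = m.+1 + k)%N /\ (m < K)%N.
  exists (l - k).-1; split; first by rewrite prednK ?subn_gt0// subnK// ltnW.
  by rewrite -ltnS prednK ?subn_gt0// (leq_ltn_trans (leq_subr _ _)).
move=> mK.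
have kK : (k <= K)%N by rewrite (leq_trans (ltnW kl)).
pose eta : R := (delta / 4 + k%:R * (3 * e))%R.
(* The orbit nearly returns after [m.+1] steps. Pushed back to time 0 and then through [phi], this
   places [phi z] near [u z m]. Hence [u x m] and [u y m] are about as far apart as [phi x] and
   [phi y], and [m] more pushes reach [x] and [y]. *)
have ret z (cz : nat -> 'I_N) : T z -> (forall n, c (cz n) (u z n)) -> cz k = cz l ->
    d (phi z) (u z m) <= (eta + 2 * e)%:E.
  move=> Tz czP E.
  have h1 : d (u z (0 + k)%N) (u z (m.+1 + k)%N) <= (delta / 4)%:E.
    rewrite -lE add0n; apply: (cd (cz k)); [exact: uT|exact: uT|exact: czP|].
    by rewrite E; exact: czP.
  have h2 := pushn _ _ _ _ _ _ Tz Tz h1.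
  apply: le_trans (pm_triangle pd _ (phi (u z m.+1)) _) _.
  apply: le_trans (leeD (lip _ _ Tz (uT z m.+1 Tz)) (ue z m Tz)) _.
  apply: le_trans (leeD (leeD h2 (lexx _)) (lexx _)) _.
  rewrite -!EFinD lee_fin /eta; lra.
have hx := ret x cx Tx cxP ckl1; have hy := ret y cy Ty cyP ckl2.
have h3 : d (u x (0 + m)%N) (u y (0 + m)%N) <= d (phi x) (phi y) + (2 * (eta + 2 * e))%:E.
  rewrite !add0n; apply: le_trans (pm_triangle pd _ (phi x) _) _.
  rewrite (pm_sym pd).
  apply: le_trans (leeD hx (pm_triangle pd _ (phi y) _)) _.
  apply: le_trans (leeD (lexx _) (leeD (lexx _) hy)) _.
  by rewrite addeCA -EFinD leeD// lee_fin; lra.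
have := pushn _ _ _ _ _ _ Tx Ty h3; rewrite /u /= => /le_trans; apply.
rewrite -addeA -EFinD leeD// lee_fin /eta.
have kK' : (k%:R <= K%:R :> R)%R by rewrite ler_nat.
have mK' : (m%:R <= K%:R :> R)%R by rewrite ler_nat ltnW.
have E : (e * (9 * K%:R + 4) = delta / 2)%R by rewrite /e; field; rewrite gt_eqF.
have : (k%:R * e <= K%:R * e)%R by rewrite ler_wpM2r// ltW.
have : (m%:R * e <= K%:R * e)%R by rewrite ler_wpM2r// ltW.
lra.
Qed.

(** A common embedding yields a quasi-inverse [psi] of [p] up to small errors, and [p \o psi] is
    almost isometric by [almost_isometry]. Two points of one fibre lie near [psi s] and [psi t]
    whose projections are close, so [s] and [t] are close, and then so are the points. The tolerance
    is found before [S] is given, since the total spaces vary along the sequence. *)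
Lemma fibers_gh_dist Y (T : set Y) (dT : Y -> Y -> \bar R) (delta : R) :
  pseudometric_on T dT -> totally_bounded T dT -> (0 < delta)%R ->
  exists e : R, (0 < e)%R /\ forall X (S : set X) (dS : X -> X -> \bar R) (p : X -> Y),
    pseudometric_on S dS -> (forall x, S x -> T (p x)) ->
    (forall y, T y -> exists2 x, S x & p x = y) ->
    (forall x y, S x -> S y -> dT (p x) (p y) <= dS x y) ->
    gh_dist S dS T dT < e%:E ->
    forall x y, S x -> S y -> p x = p y -> dS x y <= delta%:E.
Proof.
move=> pT tb delta0; have d20 : (0 < delta / 2)%R by rewrite divr_gt0.
have [e' [e'0 H]] := almost_isometry pT tb d20.
(* [2 * e <= e'] meets the hypotheses of [almost_isometry]; the final chain of triangle inequalities
   collects [10 * e + delta / 2]. *)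
pose e : R := (Num.min (e' / 2) (delta / 20))%R.
have e0 : (0 < e)%R by rewrite lt_min !divr_gt0.
have ee' : (2 * e <= e')%R.
  have : (e <= e' / 2)%R by rewrite ge_min lexx.
  lra.
have ed : (10 * e <= delta / 2)%R.
  have : (e <= delta / 20)%R by rewrite ge_min lexx orbT.
  lra.
exists e; split=> // X S dS p pS p_in p_onto p_lip gh x y Sx Sy pxy.
move: gh => /ereal_inf_lt [_ [Z [D [i [j [mD iS iT ->]]]]]].
rewrite /hausdorff_dist gt_max => /andP[h1 h2].
have near1 a : S a -> exists t, T t /\ D (i a) (j t) < e%:E.
  move=> Sa; have : ereal_inf [set D (i a) t | t in j @` T] < e%:E.
    by apply: le_lt_trans h1; apply: ereal_sup_ubound; exists (i a) => //; exists a.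
  by move=> /ereal_inf_lt [_ [_ [t Tt <-] <-]] h; exists t.
have near2 t : T t -> exists a, S a /\ D (i a) (j t) < e%:E.
  move=> Tt; have : ereal_inf [set D s (j t) | s in i @` S] < e%:E.
    by apply: le_lt_trans h2; apply: ereal_sup_ubound; exists (j t) => //; exists t.
  by move=> /ereal_inf_lt [_ [_ [a Sa <-] <-]] h; exists a.
have /choice [psi psiP] : forall t, exists a, T t -> S a /\ D (i a) (j t) < e%:E.
  by move=> t; have [/near2 [a ha]|nT] := pselect (T t); [exists a|exists x].
have psi_close a t : S a -> T t -> D (i a) (j t) < e%:E -> dS (psi t) a <= (2 * e)%:E.
  move=> Sa Tt h; have [Sp hp] := psiP t Tt; rewrite -iS//.
  apply: le_trans (em_triangle mD _ (j t) _) _; rewrite (em_sym mD (j t)).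
  apply: le_trans (leeD (ltW hp) (ltW h)) _.
  by rewrite -EFinD lee_fin; lra.
have psi_lip s t : T s -> T t -> dS (psi s) (psi t) <= dT s t + (2 * e)%:E.
  move=> Ts Tt; have [Ss hs] := psiP s Ts; have [St ht] := psiP t Tt.
  rewrite -iS// -iT//.
  apply: le_trans (em_triangle mD _ (j s) _) _.
  apply: le_trans (leeD (ltW hs) (em_triangle mD _ (j t) _)) _.
  rewrite (em_sym mD (j t) (i _)).
  apply: le_trans (leeD (lexx _) (leeD (lexx _) (ltW ht))) _.
  by rewrite addeCA -EFinD leeD// lee_fin; lra.
pose phi := p \o psi.
have phiT t : T t -> T (phi t) by move=> /psiP [] /p_in.
have {}H := H phi phiT.
have lip s t : T s -> T t -> dT (phi s) (phi t) <= dT s t + e'%:E.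
  move=> Ts Tt; apply: le_trans (p_lip _ _ (psiP s Ts).1 (psiP t Tt).1) _.
  by apply: le_trans (psi_lip s t Ts Tt) _; rewrite leeD// lee_fin.
have onto z : T z -> exists s, T s /\ dT (phi s) z <= e'%:E.
  move=> Tz; have [a Sa pa] := p_onto z Tz; have [t [Tt ht]] := near1 a Sa.
  exists t; split=> //; rewrite -pa; apply: le_trans (p_lip _ _ (psiP t Tt).1 Sa) _.
  by apply: le_trans (psi_close a t Sa Tt ht) _; rewrite lee_fin.
have [s [Ts hs]] := near1 x Sx; have [t [Tt ht]] := near1 y Sy.
have hs2 := psi_close x s Sx Ts hs; have ht2 := psi_close y t Sy Tt ht.
have [Sps _] := psiP s Ts; have [Spt _] := psiP t Tt.
have h5 : dT (phi s) (phi t) <= (4 * e)%:E.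
  apply: le_trans (pm_triangle pT _ (p x) _) _; rewrite {2}pxy (pm_sym pT (p y)).
  apply: le_trans (leeD (le_trans (p_lip _ _ Sps Sx) hs2) (le_trans (p_lip _ _ Spt Sy) ht2)) _.
  by rewrite -EFinD lee_fin; lra.
have h6 := le_trans (H lip onto s t Ts Tt) (leeD h5 (lexx _)).
apply: le_trans (pm_triangle pS _ (psi s) _) _; rewrite (pm_sym pS x).
apply: le_trans (leeD hs2 (pm_triangle pS _ (psi t) _)) _.
apply: le_trans (leeD (lexx _) (leeD (le_trans (psi_lip s t Ts Tt) (leeD h6 (lexx _))) ht2)) _.
by rewrite -!EFinD lee_fin; lra.
Qed.

Lemma gh_cvg_fibers X Y (S : nat -> set X) (dS : nat -> X -> X -> \bar R)
    (T : set Y) (dT : Y -> Y -> \bar R) (p : X -> Y) :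
  (forall n, S n !=set0) -> (forall n, pseudometric_on (S n) (dS n)) ->
  pseudometric_on T dT -> totally_bounded T dT ->
  (forall n x, S n x -> T (p x)) ->
  (forall n y, T y -> exists2 x, S n x & p x = y) ->
  (forall n x y, S n x -> S n y -> dT (p x) (p y) <= dS n x y) ->
  (forall n x y, S n x -> T y -> forall r : R, dT (p x) y < r%:E ->
    exists w, [/\ S n w, p w = y & dS n x w <= r%:E]) ->
  gh_cvg S dS T dT <->
  forall e : R, (0 < e)%R -> \forall n \near \oo, forall x y, S n x -> S n y ->
    p x = p y -> dS n x y <= e%:E.
Proof.
move=> S0 pS pT tb p_in p_onto p_lip p_lift.
have ge0 n : 0 <= gh_dist (S n) (dS n) T dT by exact: gh_dist_ge0.
split=> [cv e e0|H].
  have [e' [e'0 He']] := fibers_gh_dist pT tb e0.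
  have : \forall n \near \oo, gh_dist (S n) (dS n) T dT < e'%:E.
    have := cv; rewrite /gh_cvg => /(_ [set x | x < e'%:E]); apply.
    by apply: open_nbhs_nbhs; split; [exact: open_ereal_lt_ereal|rewrite /= lte_fin].
  apply: filterS => n hn; apply: He' hn => //; [exact: p_in|exact: p_onto|exact: p_lip].
(* Convergence to 0 in the extended reals amounts to eventual finiteness and convergence of the
   finite parts; fibres of diameter at most 1 give the former. *)
apply/fine_cvgP; split.
  have := H 1%R ltr01; apply: filterS => n hn.
  have h := gh_dist_fibers (pS n) pT (p_in n) (p_onto n) (p_lip n) (p_lift n) (S0 n) ltr01 hn.
  rewrite fin_numE; apply/andP; split.
    by rewrite gt_eqF// (lt_le_trans _ (ge0 n)).
  by rewrite lt_eqF// (le_lt_trans h)// ltry.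
apply/cvgrPdist_le => e e0; have := H e e0; apply: filterS => n hn.
have h := gh_dist_fibers (pS n) pT (p_in n) (p_onto n) (p_lip n) (p_lift n) (S0 n) e0 hn.
rewrite /= sub0r normrN; move: h (ge0 n).
by case: gh_dist => //= r; rewrite !lee_fin => h1 h2; rewrite ger0_norm.
Qed.

(** The Hausdorff distance of two empty sets is a supremum over nothing. This value settles the case
    of empty manifolds. *)
Lemma gh_dist_empty X Y (S : set X) (dS : X -> X -> \bar R) (T : set Y)
    (dT : Y -> Y -> \bar R) :
  S = set0 -> T = set0 -> gh_dist S dS T dT = -oo.
Proof.
move=> -> ->; apply/eqP; rewrite -leeNy_eq; apply: ereal_inf_lbound.
exists unit, (fun _ _ => 0), (fun=> tt), (fun=> tt); split=> //.
  split=> //; first by move=> [] [].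
  by move=> *; rewrite adde0.
by rewrite /hausdorff_dist !image_set0 ereal_sup0 maxxx.
Qed.

End GHTheory.

(** * Riemannian submersions and warpings *)

Section MetricForms.
Context {R : realType} {V : normedModType R} {X : Type} {A : atlas V X} {g : @form R V X}.
Hypothesis gm : riemannian_metric A g.

Lemma rm_Dl x u v w : g x (u + v) w = g x u w + g x v w.
Proof. by have := rm_lin gm x 1 u v w; rewrite scale1r mul1r. Qed.

Lemma rm_0l x w : g x 0 w = 0.
Proof. by have := rm_Dl x 0 0 w; rewrite addr0 => /eqP; rewrite -subr_eq subrr eq_sym => /eqP. Qed.

Lemma rm_Zl x k u w : g x (k *: u) w = k * g x u w.
Proof. by rewrite -[k *: u]addr0 (rm_lin gm) rm_0l addr0. Qed.

Lemma rm_Nl x u w : g x (- u) w = - g x u w.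
Proof. by rewrite -scaleN1r rm_Zl mulN1r. Qed.

Lemma rm_Bl x u v w : g x (u - v) w = g x u w - g x v w.
Proof. by rewrite rm_Dl rm_Nl. Qed.

Lemma rm_Zr x k u w : g x w (k *: u) = k * g x w u.
Proof. by rewrite !(rm_sym gm x w) rm_Zl. Qed.

Lemma rm_0r x w : g x w 0 = 0.
Proof. by rewrite (rm_sym gm) rm_0l. Qed.

Lemma rm_ge0 x u : 0 <= g x u u.
Proof.
by have [->|u0] := eqVneq u 0; [rewrite rm_0l|exact: ltW (rm_pos gm x u0)].
Qed.

Lemma rm_eq0 x u : g x u u = 0 -> u = 0.
Proof.
by move=> h; apply/eqP; apply: contraT => u0; have := rm_pos gm x u0; rewrite h ltxx.
Qed.

Lemma rm_nondeg x u : (forall v, g x u v = 0) -> u = 0.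
Proof. by move=> h; exact: rm_eq0 (h u). Qed.

Lemma rm_suml x n (u : 'I_n -> V) w : g x (\sum_i u i) w = \sum_i g x (u i) w.
Proof.
elim: n u => [|n IH] u; first by rewrite !big_ord0 rm_0l.
by rewrite !big_ord_recr /= rm_Dl IH.
Qed.

Lemma rm_sumr x n (u : 'I_n -> V) w : g x w (\sum_i u i) = \sum_i g x w (u i).
Proof. by rewrite (rm_sym gm) rm_suml; apply: eq_bigr => i _; rewrite (rm_sym gm). Qed.

End MetricForms.

Section Gram.
Context {R : realType} {n : nat} {X : Type} {A : atlas 'rV[R]_n X} {g : @form R 'rV[R]_n X}.
Hypotheses (sA : satlas A) (gm : riemannian_metric A g).
Let ctv a x (ax : dom a x) : clin (tv a x) := clin_tv sA ax.
Let ccv a x (ax : dom a x) : clin (cv a x) := clin_cv sA ax.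

Definition gram (a : index A) (u : 'rV[R]_n) : 'M[R]_n :=
  \matrix_(i, j) g (ichart a u) (tv a (ichart a u) (delta_mx 0 i))
                                (tv a (ichart a u) (delta_mx 0 j)).

Lemma smooth_gram a : smooth_on (cimg a) (gram a).
Proof.
have oU := open_cimg sA a; apply: smooth_mxP => // i j; under eq_fun do rewrite mxE.
apply: smooth_onT => // u ua; have [au uE] := cimgK sA ua.
have sf : smooth_fun_at A (fun y => g y (cfield a (delta_mx 0 i) y) (cfield a (delta_mx 0 j) y))
    (ichart a u) by apply: (rm_smooth gm); exact: smooth_cfield.
move: sf => /(smooth_funP sA _ au) [U [oU' Uu Ui sU]].
by exists U; rewrite -uE.
Qed.

Lemma gramE a x v w : dom a x ->
  g x (tv a x v) (tv a x w) = (v *m gram a (chart a x) *m w^T) 0 0.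
Proof.
move=> ax; have ct := ctv ax.
rewrite {1}(row_sum_delta v) {1}(row_sum_delta w) !(clin_sum _ ct) (rm_suml gm).
rewrite -mulmxA mxE; apply: eq_bigr => i _.
rewrite (clinZ _ _ ct) (rm_Zl gm) (rm_sumr gm); congr (_ * _).
rewrite mxE; apply: eq_bigr => j _.
by rewrite (clinZ _ _ ct) (rm_Zr gm) !mxE (sa_K sA ax) mulrC.
Qed.

Lemma gram_unit a x : dom a x -> gram a (chart a x) \in unitmx.
Proof.
move=> ax; apply: row_injective_unitmx => h h0.
have : g x (tv a x h) (tv a x h) = 0 by rewrite gramE// h0 mul0mx mxE.
by move=> /(rm_eq0 gm) E; rewrite -(tvK sA h ax) E (clin0 (ccv ax)).
Qed.

Lemma gram_sym a u : (gram a u)^T = gram a u.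
Proof. by apply/matrixP => i j; rewrite 3!mxE; exact: (rm_sym gm). Qed.

Lemma gram_pos a x (h : 'rV[R]_n) : dom a x -> (h *m gram a (chart a x) *m h^T) 0 0 = 0 -> h = 0.
Proof.
move=> ax; rewrite -gramE// => /(rm_eq0 gm) E.
by rewrite -(tvK sA h ax) E (clin0 (ccv ax)).
Qed.

End Gram.

#[local] Opaque mdiff tv cv.

Section SubmersionGeometry.
Context {R : realType} {m k : nat} {M Mt : Type}.
Context {A : atlas 'rV[R]_m M} {At : atlas 'rV[R]_k Mt}.
Context {g : @form R 'rV[R]_m M} {gt : @form R 'rV[R]_k Mt} {P : Mt -> M}.
Hypotheses (sA : satlas A) (sAt : satlas At).
Hypotheses (gm : riemannian_metric A g) (gtm : riemannian_metric At gt).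
Hypothesis Psub : riemannian_submersion At A P gt g.

Let ccv a x (ax : dom a x) : clin (cv a x) := clin_cv sA ax.
Local Notation dP := (mdiff At A P).
Local Notation hor := (horizontal At A P gt).

Lemma P_smooth y : smooth_at At A P y. Proof. by have [] := Psub. Qed.

Lemma clin_dP y : clin (dP y).
Proof. exact: clin_mdiff (P_smooth y). Qed.

Lemma dP_lin y c u v : dP y (c *: u + v) = c *: dP y u + dP y v.
Proof. have [l _] := clin_dP y; exact (l c u v). Qed.

Lemma dP_onto y w : exists v, dP y v = w. Proof. by have [_ _ + _] := Psub; apply. Qed.

Lemma P_isometry y u v : hor y u -> hor y v -> g (P y) (dP y u) (dP y v) = gt y u v.
Proof. by have [_ _ _] := Psub; apply. Qed.

Definition Pdom (b : index At) (a : index A) : set 'rV[R]_k :=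
  [set u | cimg b u /\ dom a (P (ichart b u))].

Definition Phat (b : index At) (a : index A) : 'rV[R]_k -> 'rV[R]_m :=
  chart a \o P \o ichart b.

Lemma Pdom_local b a u : Pdom b a u -> exists U, [/\ open U, U u, U `<=` Pdom b a &
  smooth_on U (Phat b a)].
Proof.
move=> [ub ua]; have [bu uE] := cimgK sAt ub.
have /(smooth_inP sAt sA bu ua) [U [oU Uu Ui Ua sU]] := P_smooth (ichart b u).
by exists U; rewrite -uE; split=> // v Uv; split; [exact: Ui|exact: Ua].
Qed.

Lemma open_Pdom b a : open (Pdom b a).
Proof.
rewrite openE => u /Pdom_local [U [oU Uu UP _]].
by rewrite /interior nbhsE; exists U.
Qed.

Lemma smooth_Phat b a : smooth_on (Pdom b a) (Phat b a).
Proof.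
apply: smooth_onT; first exact: open_Pdom.
by move=> u /Pdom_local [U [oU Uu _ sU]]; exists U.
Qed.

Lemma Pdom_chart b a y : dom b y -> dom a (P y) -> Pdom b a (chart b y).
Proof. by move=> yb ya; split; [exists y|rewrite (sa_K sAt)]. Qed.

Definition Jmx b a u : 'M[R]_(k, m) := jac (Phat b a) u.

Lemma smooth_Jmx b a : smooth_on (Pdom b a) (Jmx b a).
Proof. by apply: smooth_jac; [exact: open_Pdom|exact: smooth_Phat]. Qed.

Lemma dPE b a y h : dom b y -> dom a (P y) ->
  dP y (tv b y h) = tv a (P y) (h *m Jmx b a (chart b y)).
Proof.
move=> yb ya; rewrite /Jmx -jacE; last first.
  by apply: smooth_differentiable (@smooth_Phat b a) (Pdom_chart yb ya); exact: open_Pdom.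
by rewrite (mdiffE sAt sA _ (P_smooth y) yb ya) (cvK sA).
Qed.

(* Coordinates of the horizontal lift: with [J] the matrix of [dP] and [G] the
   Gram matrix of [gt], it is the right inverse of [J] whose rows are
   [G]-orthogonal to the kernel of [J]. *)
Definition Lmx b a u : 'M[R]_(m, k) :=
  let J := Jmx b a u in let Gi := invmx (gram (g := gt) b u) in
  invmx (J^T *m Gi *m J) *m J^T *m Gi.

(** The matrix is positive definite because [dP] is onto. If [x] is in its kernel, then
    [x *m J^T *m invmx G] has zero [G]-norm, so [x *m J^T = 0]; writing [x] as [h *m J] gives
    [x *m x^T = 0]. *)
Lemma Lmx_unit b a y : dom b y -> dom a (P y) ->
  (Jmx b a (chart b y))^T *m invmx (gram (g := gt) b (chart b y)) *m Jmx b a (chart b y) \in unitmx.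
Proof.
move=> yb ya; set J := Jmx _ _ _; set G := gram _ _.
have uG : G \in unitmx by exact: gram_unit.
have GT : (invmx G)^T = invmx G by rewrite trmx_inv gram_sym.
apply: row_injective_unitmx => x x0.
pose z := x *m J^T *m invmx G.
have z0 : z = 0.
  apply: (gram_pos sAt gtm yb); rewrite -/G.
  have -> : z *m G *m z^T = x *m (J^T *m invmx G *m J) *m x^T.
    by rewrite /z mulmxKV// !trmx_mul GT trmxK !mulmxA.
  by rewrite x0 mul0mx mxE.
have xJ : x *m J^T = 0 by rewrite -(mulmxKV uG (x *m J^T)) -/z z0 mul0mx.
have [h hE] := dP_onto y (tv a (P y) x).
have hx : cv b y h *m J = x.
  have := dPE (cv b y h) yb ya; rewrite (cvK sAt _ yb) hE -/J => /(congr1 (cv a (P y))).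
  have E1 : cv a (P y) (tv a (P y) x) = x by exact: tvK.
  have E2 : cv a (P y) (tv a (P y) (cv b y h *m J)) = cv b y h *m J by exact: tvK.
  move=> E.
  exact: etrans (esym E2) (etrans (esym E) E1).
have xx : (x *m x^T) 0 0 = 0.
  by rewrite -{2}hx trmx_mul mulmxA xJ mul0mx mxE.
apply/rowP => j; rewrite mxE; apply/eqP; rewrite -sqrf_eq0.
move: xx; rewrite mxE => /eqP; rewrite psumr_eq0.
  by move=> /allP /(_ j (mem_index_enum j)) /=; rewrite mxE -expr2.
by move=> i _; rewrite mxE -expr2 sqr_ge0.
Qed.

Lemma smooth_Lmx b a : smooth_on (Pdom b a) (Lmx b a).
Proof.
have oP := @open_Pdom b a.
have sJ := @smooth_Jmx b a; have sJT := smooth_trmx oP sJ.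
have D u : Pdom b a u -> dom b (ichart b u) /\ dom a (P (ichart b u)) /\ chart b (ichart b u) = u.
  by move=> [/(cimgK sAt) [? ?] ?].
have sG : smooth_on (Pdom b a) (fun u => invmx (gram (g := gt) b u)).
  apply: smooth_invmx; first exact: oP.
    by move=> u /D [bu [_ uE]]; rewrite -uE; exact: gram_unit.
  by apply: smooth_sub (smooth_gram sAt gtm b) => u [].
have s1 := smooth_mulmx oP (smooth_mulmx oP sJT sG) sJ.
have s2 : smooth_on (Pdom b a) (fun u => invmx ((Jmx b a u)^T *m invmx (gram (g := gt) b u) *m Jmx b a u)).
  apply: smooth_invmx; [exact: oP| |exact: s1].
  by move=> u /D [bu [ua uE]]; rewrite -uE; exact: Lmx_unit.
exact: (smooth_mulmx oP (smooth_mulmx oP s2 sJT) sG).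
Qed.

Definition lift y (w : 'rV[R]_m) : 'rV[R]_k := get [set u | hor y u /\ dP y u = w].

Lemma hor_lin y c u v : hor y u -> hor y v -> hor y (c *: u + v).
Proof. by move=> hu hv e ve; rewrite (rm_lin gtm) hu// hv// mulr0 addr0. Qed.

Lemma hor_vert_eq0 y u : hor y u -> dP y u = 0 -> u = 0.
Proof. by move=> hu vu; exact: (rm_eq0 gtm (hu u vu)). Qed.

Lemma hor_inj y u v : hor y u -> hor y v -> dP y u = dP y v -> u = v.
Proof.
move=> hu hv E; apply/eqP; rewrite -subr_eq0; apply/eqP; apply: (@hor_vert_eq0 y).
  by rewrite addrC -scaleN1r; exact: (hor_lin _ hv hu).
by rewrite (clinB _ _ (clin_dP y)) E subrr.
Qed.

Arguments hor_inj {y u v} _ _ _.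
Arguments hor_lin {y} c {u v} _ _.

Lemma lift_coords b a y w : dom b y -> dom a (P y) ->
  hor y (tv b y (w *m Lmx b a (chart b y))) /\
  dP y (tv b y (w *m Lmx b a (chart b y))) = tv a (P y) w.
Proof.
move=> yb ya; have uL := Lmx_unit yb ya; rewrite /Lmx.
set J := Jmx _ _ _ in uL *; set G := gram _ _ in uL *.
have uG : G \in unitmx by exact: gram_unit.
set S := J^T *m _ *m _ in uL *; split.
  move=> e ve; rewrite -(cvK sAt e yb) (gramE sAt gtm _ _ yb) -/G.
  have eJ : cv b y e *m J = 0.
    have := dPE (cv b y e) yb ya; rewrite (cvK sAt)// ve -/J => /(congr1 (cv a (P y))).
    by rewrite (tvK sA)// (clin0 (ccv ya)).
  have E0 : J^T *m (cv b y e)^T = 0 by rewrite -trmx_mul eJ trmx0.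
  by rewrite !mulmxA mulmxKV// -(mulmxA _ J^T) E0 mulmx0 mxE.
by rewrite (dPE _ yb ya) -/J; congr tv; rewrite !mulmxA -!(mulmxA w) -!(mulmxA (invmx S)) mulVmx// mulmx1.
Qed.

Lemma liftP y w : hor y (lift y w) /\ dP y (lift y w) = w.
Proof.
have yb := sa_cover sAt y; have ya := sa_cover sA (P y).
have [h1 h2] := lift_coords (cv (chart_at A (P y)) (P y) w) yb ya.
apply: (@getPex _ [set u | hor y u /\ dP y u = w]).
by exists (tv (chart_at At y) y (cv (chart_at A (P y)) (P y) w *m
  Lmx (chart_at At y) (chart_at A (P y)) (chart (chart_at At y) y))); split;
  [exact: h1|rewrite h2 (cvK sA)].
Qed.

Lemma lift_hor y w : hor y (lift y w). Proof. by have [] := liftP y w. Qed.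

Arguments lift_hor : clear implicits.

Lemma dP_lift y w : dP y (lift y w) = w. Proof. by have [] := liftP y w. Qed.

Lemma lift_dP y u : hor y u -> lift y (dP y u) = u.
Proof. by move=> hu; apply: (hor_inj (lift_hor y (dP y u)) hu); rewrite dP_lift. Qed.

Lemma lift_lin y c u v : lift y (c *: u + v) = c *: lift y u + lift y v.
Proof.
apply: (hor_inj (lift_hor y _) (hor_lin c (lift_hor y u) (lift_hor y v))).
by rewrite dP_lift (clinD _ _ (clin_dP y)) (clinZ _ _ (clin_dP y)) !dP_lift.
Qed.

Lemma clin_lift y : clin (lift y).
Proof. by apply: clin_findim => c u v; exact: lift_lin. Qed.

Lemma liftE b a y w : dom b y -> dom a (P y) ->
  lift y (tv a (P y) w) = tv b y (w *m Lmx b a (chart b y)).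
Proof.
move=> yb ya; have [h1 h2] := lift_coords w yb ya.
by rewrite -h2 lift_dP.
Qed.

Definition ver y u := u - lift y (dP y u).

Lemma verE y u : ver y u = u - lift y (dP y u). Proof. by []. Qed.

Lemma clin_ver y : clin (ver y).
Proof.
apply: clin_findim => c u v; rewrite /ver (clinD _ _ (clin_dP y)) (clinZ _ _ (clin_dP y)).
have E (D1 D2 : 'rV[R]_k) : c *: u + v - (c *: D1 + D2) = c *: (u - D1) + (v - D2).
  by rewrite scalerBr opprD addrACA.
exact: etrans (congr1 (fun z => _ - z) (lift_lin y c (dP y u) (dP y v))) (E _ _).
Qed.

Lemma ver_lin y c u v : ver y (c *: u + v) = c *: ver y u + ver y v.
Proof. have [l _] := clin_ver y; exact (l c u v). Qed.

Lemma dP_ver y u : dP y (ver y u) = 0.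
Proof. by rewrite /ver (clinB _ _ (clin_dP y)) dP_lift subrr. Qed.

Lemma ver_hor y u : hor y u -> ver y u = 0.
Proof. by move=> hu; rewrite /ver lift_dP// subrr. Qed.

Lemma gt_lift y u v : gt y (lift y u) (lift y v) = g (P y) u v.
Proof. by rewrite -P_isometry ?dP_lift//; exact: lift_hor. Qed.

(** [oproj] merely chooses a candidate, so uniqueness is the point: the difference of two candidates
    is horizontal and orthogonal to every horizontal vector, hence to itself. *)
Lemma oproj_gt y u : oproj gt hor y u = lift y (dP y u).
Proof.
rewrite /oproj; set E := [set _ | _].
have EP : E (lift y (dP y u)).
  split; first exact: lift_hor.
  by move=> e he; rewrite (rm_sym gtm) he//; exact: dP_ver.
have [hx ex] := @getPex _ E (ex_intro _ _ EP).
apply/eqP; rewrite -subr_eq0; apply/eqP.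
set e := get E in hx ex *; set l := lift y (dP y u) in EP *.
have hd : hor y (e - l) by rewrite addrC -scaleN1r; exact: (hor_lin _ EP.1 hx).
apply: (rm_eq0 gtm (x := y)).
have E1 := ex _ hd; have E2 := EP.2 _ hd.
have -> : gt y (e - l) (e - l) = gt y (u - l) (e - l) - gt y (u - e) (e - l).
  by rewrite -(rm_Bl gtm); congr (gt y _ _); rewrite [in RHS]opprB [in RHS]addrC addrA subrK.
by rewrite E1 E2 subrr.
Qed.

Section Warp.
Variable f : M -> R.
Hypothesis f0 : forall x, 0 < f x.

Lemma warpE y u v : warp At A P gt f y u v =
  g (P y) (dP y u) (dP y v) + f (P y) ^+ 2 * gt y (ver y u) (ver y v).
Proof. by rewrite /warp !oproj_gt gt_lift. Qed.

(** Evaluating on the vertical part of [u] leaves [f^2] times its squared norm, and [f] is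
    positive. *)
Lemma hor_warp : horizontal At A P (warp At A P gt f) = hor.
Proof.
apply/funext => y; rewrite predeqE => u; split=> hu v vv; last first.
  by rewrite warpE ver_hor// (rm_0l gtm) vv (rm_0r gm) mulr0 addr0.
have := hu (ver y u) (dP_ver y u); rewrite warpE dP_ver (rm_0r gm) add0r.
have -> : ver y (ver y u) = ver y u by rewrite {1}/ver dP_ver (clin0 (clin_lift y)) subr0.
move=> /eqP; rewrite mulf_eq0 expf_eq0 /= gt_eqF//= => /eqP /(rm_eq0 gtm) E.
have -> : u = lift y (dP y u) by apply/eqP; rewrite -subr_eq0 -/(ver y u) E.
exact: lift_hor.
Qed.

(** Against a horizontal vector the warped metric is pulled back from [g], so [f] disappears; this
    is why the horizontal part of Koszul's formula does not see the warping. *)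
Lemma warp_lift y u v : warp At A P gt f y u (lift y v) = g (P y) (dP y u) v.
Proof. by rewrite warpE dP_lift (ver_hor (lift_hor y v)) (rm_0r gtm) mulr0 addr0. Qed.

Lemma oproj_warp y u :
  oproj (warp At A P gt f) (horizontal At A P (warp At A P gt f)) y u = lift y (dP y u).
Proof.
rewrite hor_warp /oproj; set E := [set _ | _].
have EP : E (lift y (dP y u)).
  split; first exact: lift_hor.
  by move=> e he; rewrite -(lift_dP he) warp_lift dP_ver (rm_0l gm).
have [hx ex] := @getPex _ E (ex_intro _ _ EP).
apply: (hor_inj hx (lift_hor y _)); rewrite dP_lift.
apply/eqP; rewrite eq_sym -subr_eq0; apply/eqP; apply: (rm_nondeg gm (x := P y)) => w.
have := ex (lift y w) (lift_hor y w).
by rewrite warp_lift (clinB _ _ (clin_dP y)).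
Qed.

End Warp.

Definition lfield (a : index A) (w : 'rV[R]_m) (y : Mt) : 'rV[R]_k :=
  lift y (cfield a w (P y)).

Lemma lfieldE a w y : lfield a w y = lift y (cfield a w (P y)). Proof. by []. Qed.

Lemma lfield_coords b a w u : Pdom b a u ->
  lfield a w (ichart b u) = tv b (ichart b u) (w *m Lmx b a u).
Proof.
move=> [ub ua]; have [bu uE] := cimgK sAt ub.
by rewrite /lfield /cfield (liftE w bu ua) uE.
Qed.

Lemma smooth_lfield a w y : dom a (P y) -> smooth_field_at At (lfield a w) y.
Proof.
move=> ya; have yb := sa_cover sAt y.
apply: (proj1 (smooth_field_atI sAt yb (@open_Pdom _ a) (Pdom_chart yb ya) _
  (lfield_coords (a := a) w) _)); first by move=> u [].
apply: smooth_mulmx; [exact: open_Pdom|exact: smooth_cst|exact: smooth_Lmx].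
Qed.

End SubmersionGeometry.

(** * Levi-Civita connections of warped submersions *)

Lemma differentiable_derivable (R : realType) (V U : normedModType R) (f : V -> U) x v :
  differentiable f x -> derivable f x v.
Proof. by move=> df; exact: diff_derivable. Qed.

Section DerivativesOfFunctions.
Context {R : realType} {V W : normedModType R} {fV : findim V} {fW : findim W}.
Context {X Y : Type} {A : atlas V X} {B : atlas W Y}.
Hypotheses (sA : satlas A) (sB : satlas B).
Let sR := @satlas_euclid R R^o.

Lemma dfun_comp (F : X -> Y) (h : Y -> R^o) x v : smooth_at A B F x ->
  smooth_fun_at B h (F x) ->
  smooth_fun_at A (h \o F) x /\ dfun A (h \o F) x v = dfun B h (F x) (mdiff A B F x v).
Proof.
move=> sF sh; split; first exact: (smooth_at_comp sA sB sR sF sh).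
exact: (mdiff_comp sA sB v sF sh).
Qed.

Lemma dfun_ext (h h' : X -> R^o) x v : (\forall y \near mnbhs A x, h y = h' y) ->
  dfun A h x v = dfun A h' x v.
Proof. by move=> hh; rewrite /dfun (mdiff_ext sA hh). Qed.

Lemma smooth_fun_ext (h h' : X -> R^o) x : (\forall y \near mnbhs A x, h y = h' y) ->
  smooth_fun_at A h x -> smooth_fun_at A h' x.
Proof. exact: smooth_at_ext. Qed.

Lemma smooth_fun_cst x (r : R) : smooth_fun_at A (fun=> r : R^o) x.
Proof. exact: smooth_at_cst. Qed.

Lemma dfun_cst x (r : R) v : dfun A (fun=> r : R^o) x v = 0.
Proof. exact: mdiff_cst. Qed.

Lemma smooth_fun_lin (a : index A) (l : V -> R^o) x (r : R) : dom a x -> clin l ->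
  smooth_fun_at A (fun y => l (chart a y) + r : R^o) x /\
  forall h, dfun A (fun y => l (chart a y) + r : R^o) x (tv a x h) = l h.
Proof.
move=> ax cl; have oU := open_cimg sA a.
have s1 : smooth_on (cimg a) (fun u => l u + r : R^o).
  by apply: smoothD => //; [exact: smooth_linear|exact: smooth_cst].
have E u : cimg a u -> l u + r = l (chart a (ichart a u)) + r.
  by move=> /(cimgK sA) [_ ->].
have Ux : cimg a (chart a x) by exists x.
have sf : smooth_fun_at A (fun y => l (chart a y) + r : R^o) x.
  apply/(smooth_funP sA _ ax); exists (cimg a); split=> //.
  exact: smooth_ext s1.
split=> // h; rewrite (dfunE sA _ ax sf).
rewrite (@near_eq_derive _ _ _ _ (fun u => l u + r : R^o)); last first.
  have : nbhs (chart a x) (cimg a) by exact: open_nbhs_nbhs.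
  by apply: filterS => u /E.
have dl : derivable l (chart a x) h.
  by apply: diff_derivable; apply: smooth_differentiable (smooth_linear oU cl) Ux.
have dc : derivable (cst r : V -> R^o) (chart a x) h by exact: derivable_cst.
by have := deriveD dl dc; rewrite derive_cst addr0 (derive_clin _ _ cl).
Qed.

(** Coordinate functions suffice as tests. The torsion axiom speaks of derivations, and this turns
    it into equations between vectors. *)
Lemma dfun_nondeg x v : (forall h, smooth_fun_at A h x -> dfun A h x v = 0) -> v = 0.
Proof.
move=> H; have ax := sa_cover sA x.
have [n [e [l [cl vE]]]] := @findim_coord _ _ fV.
rewrite -(cvK sA v ax) (vE (cv _ x v)) big1 ?(clin0 (clin_tv sA ax))// => i _.
have [s E] := smooth_fun_lin 0 ax (cl i).
by rewrite -E (cvK sA)// (H _ s) scale0r.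
Qed.

(** Both sides are the second derivative of [h] in the chart [a], taken in the two orders. *)
Lemma cfield_commute (a : index A) w z (h : X -> R^o) x : dom a x -> smooth_fun_at A h x ->
  dfun A (fun y => dfun A h y (cfield a z y)) x (cfield a w x) =
  dfun A (fun y => dfun A h y (cfield a w y)) x (cfield a z x).
Proof.
move=> ax sh; have /(smooth_funP sA _ ax) [U [oU Ux Ui sU]] := sh.
have key w' z' : dfun A (fun y => dfun A h y (cfield a z' y)) x (cfield a w' x) =
    'D_w' ('D_z' (h \o ichart a)) (chart a x).
  rewrite /cfield (dfunE sA _ ax); last first.
    by apply: (smooth_dfun sA sh); exact: smooth_cfield.
  apply: near_eq_derive; have nU : nbhs (chart a x) U by exact: open_nbhs_nbhs.
  apply: filterS nU => u Uu; have [au uE] := cimgK sA (Ui _ Uu).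
  have sfu : smooth_fun_at A h (ichart a u).
    by apply/(smooth_funP sA _ au); exists U; rewrite uE.
  by rewrite [LHS](dfunE sA _ au sfu) uE.
rewrite !key; exact: (derive_symmetric z w oU Ux (sU 2%N)).
Qed.

End DerivativesOfFunctions.

Section CurveThrough.
Context {R : realType} {V : normedModType R} {fV : findim V} {X : Type} {A : atlas V X}.
Hypothesis sA : satlas A.

Lemma curve_through (a : index A) x h : dom a x -> exists c : R^o -> X,
  [/\ smooth_curve_at A c 0, c 0 = x & velocity A c 0 = tv a x h].
Proof.
move=> ax; have oU := open_cimg sA a.
pose l (t : R^o) := chart a x + (t : R) *: h.
have sl : smooth_on setT l.
  apply: smoothD; [exact: openT|exact: smooth_cst|].
  by apply: smooth_linear; [exact: openT|exact: clin_scalel].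
pose U : set R^o := [set t | cimg a (l t)].
have oU' : open U.
  have -> : U = [set t | setT t /\ cimg a (l t)] by apply/seteqP; split=> t //= [].
  apply: (open_preimage_on (@openT R^o) oU).
  by move=> t _; exact: (smooth_cont sl I).
have U0 : U 0 by rewrite /U /= /l scale0r addr0; exists x.
have c0 : ichart a (l 0) = x by rewrite /l scale0r addr0 (sa_K sA).
have d0 : dom a (ichart a (l 0)) by rewrite c0.
have E t : U t -> l t = chart a (ichart a (l t)) by move=> /(cimgK sA) [].
have sc : smooth_curve_at A (ichart a \o l) 0.
  apply/(smooth_curveP sA d0); exists U; split=> //.
    by move=> s /(cimgK sA) [].
  apply: smooth_ext oU' E _; exact: smooth_sub sl.
exists (ichart a \o l); split=> //.
rewrite (velocityE sA d0 sc) /= c0; congr tv.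
rewrite -[RHS](_ : 'D_(1 : R^o) l 0 = h).
  apply: near_eq_derive; have nU : nbhs (0 : R^o) U by exact: open_nbhs_nbhs.
  by apply: filterS nU => t /E.
have cl := @clin_scalel R _ h.
have dl : derivable (fun t : R^o => (t : R) *: h) (0 : R^o) (1 : R^o).
  apply: diff_derivable; have oT := @openT R^o.
  by apply: smooth_differentiable (smooth_linear oT cl) _.
have dc : derivable (cst (chart a x) : R^o -> V) (0 : R^o) (1 : R^o) by exact: derivable_cst.
by have := deriveD dc dl; rewrite derive_cst add0r (derive_clin _ _ cl) scale1r.
Qed.

End CurveThrough.

Section LeviCivita.
Context {R : realType} {m : nat} {X : Type} {A : atlas 'rV[R]_m X} {g : @form R 'rV[R]_m X}.
Context {D : @connection R 'rV[R]_m X}.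
Hypotheses (sA : satlas A) (gm : riemannian_metric A g) (lc : levi_civita A g D).
Let ctv (a : index A) x (ax : dom a x) : clin (tv a x) := clin_tv sA ax.
Let scf (a : index A) w x (ax : dom a x) : smooth_field_at A (cfield a w) x :=
  smooth_cfield sA w ax.

(** An algebraic consequence of metric compatibility alone: Lie brackets appear as differences
    [D xi eta - D eta xi], and the torsion axiom enters only when these differences are
    evaluated. *)
Lemma koszul x xi eta zeta : smooth_field_at A xi x -> smooth_field_at A eta x ->
  smooth_field_at A zeta x ->
  2 * g x (D x (xi x) eta) (zeta x) =
  dfun A (fun y => g y (eta y) (zeta y)) x (xi x) +
  dfun A (fun y => g y (xi y) (zeta y)) x (eta x) -
  dfun A (fun y => g y (xi y) (eta y)) x (zeta x) +
  g x (D x (xi x) eta - D x (eta x) xi) (zeta x) -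
  g x (D x (xi x) zeta - D x (zeta x) xi) (eta x) -
  g x (D x (eta x) zeta - D x (zeta x) eta) (xi x).
Proof.
move=> s1 s2 s3.
rewrite (lc_metric lc _ s2 s3) (lc_metric lc _ s1 s3) (lc_metric lc _ s1 s2).
rewrite !(rm_Bl gm) (rm_sym gm x (eta x)) !(rm_sym gm x (xi x)).
by ring.
Qed.

Lemma bracket_cfield (a : index A) w z x : dom a x ->
  D x (cfield a w x) (cfield a z) - D x (cfield a z x) (cfield a w) = 0.
Proof.
move=> ax; apply: (dfun_nondeg sA (x := x)) => h sh.
have s1 := scf w ax; have s2 := scf z ax.
have E : dfun A (fun y => dfun A h y (cfield a z y)) x (cfield a w x) =
  dfun A (fun y => dfun A h y (cfield a w y)) x (cfield a z x) by exact: cfield_commute.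
exact: etrans (lc_torsion lc s1 s2 sh) (etrans (congr1 (fun r => r - _) E) (subrr _)).
Qed.

(** The indicator function [phi] of the set where [xi] and [eta] agree is 1 near [x], hence smooth
    at [x] with zero derivative, and [phi *: xi = phi *: eta] everywhere. The Leibniz rule then
    compares both fields with this common one. *)
Lemma connection_local x v xi eta : smooth_field_at A xi x -> smooth_field_at A eta x ->
  (\forall y \near mnbhs A x, xi y = eta y) -> D x v xi = D x v eta.
Proof.
move=> s1 s2 E.
pose phi (y : X) : R^o := if `[< xi y = eta y >] then 1 else 0.
have p1 : \forall y \near mnbhs A x, 1 = phi y.
  by apply: filterS E => y e; rewrite /phi; case: asboolP.
have sp : smooth_fun_at A phi x by apply: smooth_fun_ext p1 _ => //; exact: smooth_fun_cst.
have dp : dfun A phi x v = 0 by rewrite -(dfun_ext sA v p1) dfun_cst.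
have px : phi x = 1 by rewrite -(mnbhs_singleton sA p1).
have key ze : smooth_field_at A ze x -> D x v (fun y => (phi y : R) *: ze y) = D x v ze.
  by move=> sz; rewrite (lc_leibniz lc v sp sz) dp px scale0r add0r scale1r.
rewrite -(key _ s1) -(key _ s2); congr (D x v _); apply/funext => y.
by rewrite /phi; case: asboolP => [->//|_]; rewrite !scale0r.
Qed.

Lemma connection_linear x v c xi eta : smooth_field_at A xi x -> smooth_field_at A eta x ->
  D x v (fun y => c *: xi y + eta y) = c *: D x v xi + D x v eta.
Proof.
move=> s1 s2; have sc : smooth_fun_at A (fun=> c : R^o) x by exact: smooth_fun_cst.
have E : D x v (fun y => c *: xi y) = c *: D x v xi.
  by have := lc_leibniz lc v sc s1; rewrite dfun_cst scale0r add0r.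
have s3 : smooth_field_at A (fun y => c *: xi y) x by exact: smooth_fieldZ.
exact: etrans (lc_additive lc v s3 s2) (congr1 (fun z => z + _) E).
Qed.

Lemma connection_cfield_linear (a : index A) x v c w z : dom a x ->
  D x v (cfield a (c *: w + z)) = c *: D x v (cfield a w) + D x v (cfield a z).
Proof.
move=> ax; have s1 := scf w ax; have s2 := scf z ax.
have sc : smooth_fun_at A (fun=> c : R^o) x by exact: smooth_fun_cst.
have s3 : smooth_field_at A (fun y => c *: cfield a w y) x by exact: smooth_fieldZ.
have s4 : smooth_field_at A (fun y => c *: cfield a w y + cfield a z y) x by exact: smooth_fieldD.
rewrite -connection_linear//; apply: (connection_local v (scf _ ax) s4).
apply: filterS (mnbhs_dom sA ax) => y ay.
by rewrite /cfield (clinD _ _ (ctv ay)) (clinZ _ _ (ctv ay)).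
Qed.

End LeviCivita.

Section SectionsOfTangent.
Context {R : realType} {m : nat} {X : Type} {A : atlas 'rV[R]_m X}.
Hypothesis sA : satlas A.
Local Notation TA := (tangent_atlas A).
Let sTA : satlas TA := satlas_tangent sA.
Let ctv (a : index A) x (ax : dom a x) : clin (tv a x) := clin_tv sA ax.

Lemma derive_scale_at0 (phi : 'rV[R]_m -> R^o) (G : 'rV[R]_m -> 'rV[R]_m) u h :
  differentiable phi u -> differentiable G u ->
  differentiable (fun v => (phi v : R) *: G v) u -> phi u = 0 ->
  'D_h (fun v => (phi v : R) *: G v) u = ('D_h phi u : R) *: G u.
Proof.
move=> dphi dG dphiG p0.
have cc j := @clin_coord R 1 m 0 j.
have dE j : derivable (fun v => G v 0 j : R^o) u h.
  by have [] := is_derive_clin (cc j) (diff_derivable dG : derivable G u h).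
have cj j : is_derive u h (fun v => ((phi v : R) *: G v) 0 j : R^o) ('D_h phi u * G u 0 j).
  have -> : (fun v => ((phi v : R) *: G v) 0 j : R^o) = (phi \* (fun v => G v 0 j : R^o)).
    by apply/funext => v; rewrite mxE.
  have dp : derivable phi u h by exact: diff_derivable.
  split; first exact: derivableM.
  by rewrite deriveM// p0 scale0r add0r [RHS]mulrC.
apply/rowP => j; rewrite !mxE; have [_ <-] := cj j.
by have [_ ->] := is_derive_clin (cc j) (diff_derivable dphiG : derivable _ u h).
Qed.

(** Adding [phi *: eta] with [phi x = 0] keeps the value at [x] and changes the differential by a
    vertical vector. A connection map, prescribed on differentials of sections, is thereby reached
    on vertical vectors. *)
Lemma mdiff_section_perturb (a : index A) x xi eta (phi : X -> R^o) v : dom a x ->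
  smooth_field_at A xi x -> smooth_field_at A eta x -> smooth_fun_at A phi x ->
  phi x = 0 ->
  smooth_field_at A (fun y => xi y + (phi y : R) *: eta y) x /\
  mdiff A TA (section_map (fun y => xi y + (phi y : R) *: eta y)) x v =
  mdiff A TA (section_map xi) x v +
    tv (a : index TA) (x, xi x) (0, (dfun A phi x v : R) *: cv a x (eta x)).
Proof.
move=> ax s1 s2 sp p0.
have [U1 [oU1 Ux1 Ui1 sU1]] := (smooth_fieldP sA _ ax).1 s1.
have [U2 [oU2 Ux2 _ sU2]] := (smooth_fieldP sA _ ax).1 s2.
have [U3 [oU3 Ux3 _ sU3]] := (smooth_funP sA _ ax).1 sp.
pose U := U1 `&` (U2 `&` U3).
have oU : open U by apply: openI => //; exact: openI.
have Ux : U (chart a x) by [].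
have Ui : U `<=` cimg a by move=> u [/Ui1].
have r1 := smooth_sub (O' := U) (fun u (Uu : U u) => Uu.1) sU1.
have r2 := smooth_sub (O' := U) (fun u (Uu : U u) => Uu.2.1) sU2.
have r3 := smooth_sub (O' := U) (fun u (Uu : U u) => Uu.2.2) sU3.
set c1 := (fun u => _) in r1; set c2 := (fun u => _) in r2; set c3 := phi \o _ in r3.
have r4 : smooth_on U (fun u => (c3 u : R) *: c2 u) by exact: smoothZ.
have r5 := smoothD oU r1 r4.
have E1 u : U u -> xi (ichart a u) = tv a (ichart a u) (c1 u).
  by move=> /Ui /(cimgK sA) [au _]; rewrite /c1 (cvK sA).
have E5 u : U u -> xi (ichart a u) + (phi (ichart a u) : R) *: eta (ichart a u) =
    tv a (ichart a u) (c1 u + (c3 u : R) *: c2 u).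
  move=> /Ui /(cimgK sA) [au _].
  have K1 : tv a (ichart a u) (c1 u) = xi (ichart a u) by exact: cvK.
  have K2 : tv a (ichart a u) (c2 u) = eta (ichart a u) by exact: cvK.
  have ct := ctv au.
  by rewrite -K1 -K2 -(clinZ _ _ ct) -(clinD _ _ ct).
have [_ M1] := smooth_field_atI sA ax oU Ux Ui E1 r1.
have [S5 M5] := smooth_field_atI sA (xi := fun y => xi y + (phi y : R) *: eta y) ax oU Ux Ui E5 r5.
split=> //; rewrite -(cvK sA v ax) M1 M5.
rewrite p0 scale0r addr0.
have axi : dom (a : index TA) (x, xi x) by [].
have ct : clin (tv (a : index TA) (x, xi x)) by exact: clin_tv.
have df1 : differentiable c1 (chart a x) by exact: smooth_differentiable oU r1 Ux.
have df4 : differentiable (fun u => (c3 u : R) *: c2 u) (chart a x) by exact: smooth_differentiable oU r4 Ux.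
have df2 : differentiable c2 (chart a x) by exact: smooth_differentiable oU r2 Ux.
have df3 : differentiable c3 (chart a x) by exact: smooth_differentiable oU r3 Ux.
have h1 := differentiable_derivable (v := cv a x v) df1.
have h4 := differentiable_derivable (v := cv a x v) df4.
have c30 : c3 (chart a x) = 0 by rewrite /c3 /= (sa_K sA).
have c2x : c2 (chart a x) = cv a x (eta x) by rewrite /c2 (sa_K sA).
have E := derive_scale_at0 (cv a x v) df3 df2 df4 c30; rewrite c2x in E.
rewrite (dfunE sA _ ax sp) -(clinD _ _ ct); congr (tv _ _ _).
rewrite (deriveD h1 h4) E -/c3; congr pair; rewrite addr0; reflexivity.
Qed.

#[local] Opaque velocity.

Lemma tangent_section (E : X -> set 'rV[R]_m) z xi v : smooth_field_at A xi z.1 ->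
  (forall y, E y (xi y)) -> section_map xi z.1 = z ->
  tangent_to TA (total_space E) z (mdiff A TA (section_map xi) z.1 v).
Proof.
move=> sx Ex zE; have az := sa_cover sA z.1.
have [c [sc c0 vc]] : exists c : R^o -> X, [/\ smooth_curve_at A c 0, c 0 = z.1 &
  velocity A c 0 = tv (chart_at A z.1) z.1 (cv (chart_at A z.1) z.1 v)] by exact: curve_through.
have {}vc : velocity A c 0 = v by rewrite vc; exact: cvK.
have sx' : smooth_at A TA (section_map xi) (c 0) by rewrite c0.
have [s1 v1] := velocity_comp sA sTA sc sx'.
exists (section_map xi \o c); split; first exact: s1.
- by apply: filterE => t; exact: Ex.
- by rewrite -zE -c0.
- rewrite vc in v1; rewrite v1; move: c0; move: (c 0) => y ->; reflexivity.
Qed.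

End SectionsOfTangent.

#[local] Opaque lift ver lfield.

Section HorizontalIntegrable.
Context {R : realType} {m k : nat} {M Mt : Type}.
Context {A : atlas 'rV[R]_m M} {At : atlas 'rV[R]_k Mt}.
Context {g : @form R 'rV[R]_m M} {gt : @form R 'rV[R]_k Mt} {P : Mt -> M}.
Hypotheses (sA : satlas A) (sAt : satlas At).
Hypotheses (gm : riemannian_metric A g) (gtm : riemannian_metric At gt).
Hypothesis Psub : riemannian_submersion At A P gt g.
Hypothesis Hint : integrable_distribution 'rV[R]_m At (horizontal At A P gt).
Let sE : satlas (euclid 'rV[R]_m) := satlas_euclid.
Let ctv (a : index A) x (ax : dom a x) : clin (tv a x) := clin_tv sA ax.
Local Notation dP := (mdiff At A P).
Local Notation hor := (horizontal At A P gt).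
Local Notation lift := (lift (A := A) (At := At) (gt := gt) (P := P)).
Local Notation ver := (ver (A := A) (At := At) (gt := gt) (P := P)).
Local Notation lfield := (lfield (A := A) (At := At) (gt := gt) (P := P)).

(* The leaf of the horizontal distribution through [y] is, near [y], the graph
   of a section of [P]. *)
Lemma leaf_section y : exists s : M -> Mt, s (P y) = y /\
  \forall x \near mnbhs A (P y), [/\ smooth_at A At s x, P (s x) = x &
    forall v, hor (s x) (mdiff A At s x v)].
Proof.
have [U [i [oU U0 i0 Hi]]] := Hint y.
set a := chart_at A (P y); have ya : dom a (P y) := sa_cover sA (P y).
pose O := [set u | U u /\ dom a (P (i u))]; pose phi := chart a \o P \o i.
have sPi u : U u -> smooth_at (euclid 'rV[R]_m) A (P \o i) u.
  move=> Uu; have [si _ _] := Hi u Uu.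
  exact: (smooth_at_comp sE sAt sA si (P_smooth Psub (i u))).
have loc u : O u -> exists N, [/\ open N, N u, N `<=` O & smooth_on N phi].
  move=> [Uu ua]; have eu : dom (tt : index (euclid 'rV[R]_m)) u by [].
  have [N [oN Nu _ Na sN]] := (smooth_inP sE sA (a := tt) (b := a) eu ua).1 (sPi u Uu).
  exists (N `&` U); split; [exact: openI|by []|by move=> v [/Na]|].
  by apply: smooth_sub sN => v [].
have oO : open O.
  rewrite openE => u /loc [N [oN Nu NO _]].
  by rewrite /interior nbhsE; exists N.
have sphi : smooth_on O phi.
  by apply: (smooth_onT oO) => u /loc [N [oN Nu NO sN]]; exists N.
have O0 : O 0 by split=> //; rewrite i0.
have y0 : dom a ((P \o i) 0) by rewrite /= i0.
(* Directions of the leaf are horizontal, and a horizontal vector killed by [dP] is zero; so the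
   leaf projects to [M] by a local diffeomorphism, whose inverse [psi] provides the section. *)
have inj (h : 'rV[R]_m) : 'D_h phi 0 = 0 -> h = 0.
  have e0 : dom (tt : index (euclid 'rV[R]_m)) (0 : 'rV[R]_m) by [].
  have E : 'D_h phi 0 = cv a ((P \o i) 0) (mdiff (euclid 'rV[R]_m) A (P \o i) 0 (tv (A := euclid 'rV[R]_m) tt 0 h)).
    exact: (mdiffE sE sA h (sPi 0 U0) e0 y0).
  have [si ii ri] := Hi 0 U0.
  have C : mdiff (euclid 'rV[R]_m) A (P \o i) 0 h = dP (i 0) (mdiff (euclid 'rV[R]_m) At i 0 h).
    exact: (mdiff_comp sE sAt h si (P_smooth Psub (i 0))).
  rewrite E tv_euclid C => /(congr1 (tv a ((P \o i) 0))).
  have -> : tv a ((P \o i) 0) (cv a ((P \o i) 0) (dP (i 0) (mdiff (euclid 'rV[R]_m) At i 0 h))) =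
    dP (i 0) (mdiff (euclid 'rV[R]_m) At i 0 h) by exact: cvK.
  rewrite (clin0 (ctv y0)) => d0.
  have hh : hor (i 0) (mdiff (euclid 'rV[R]_m) At i 0 h) by rewrite -ri; exists h.
  have z0 := hor_vert_eq0 gtm hh d0.
  have cm : clin (mdiff (euclid 'rV[R]_m) At i 0) by exact: clin_mdiff.
  by apply: ii; rewrite z0 (clin0 cm).
have [N [psi [oN Nc pc sN HN]]] := smooth_local_inverse oO O0 sphi inj.
have cy : phi 0 = chart a (P y) by rewrite /phi /= i0.
exists (i \o psi \o chart a); split.
  by rewrite /= -cy pc.
apply/(mnbhsE sA _ ya); rewrite -cy.
have nN : nbhs (phi 0) N by exact: open_nbhs_nbhs.
have nC : nbhs (phi 0) (cimg a).
  by apply: open_nbhs_nbhs; split; [exact: open_cimg|rewrite cy; exists (P y)].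
apply: filterS2 nN nC => u Nu Cu; have [au uE] := cimgK sA Cu.
have [[Ug ag] fg] := HN u Nu.
have s1 : smooth_at A (euclid 'rV[R]_m) (psi \o chart a) (ichart a u).
  apply: (smooth_atI sA sE (a := a) (b := tt) (U := cimg a `&` N) (r := psi)) => //.
  - by apply: openI => //; exact: open_cimg.
  - by rewrite uE.
  - by move=> v [/(cimgK sA) [_ vE] _]; split=> //=; rewrite vE.
  - by apply: smooth_sub sN => v [].
have pE : (psi \o chart a) (ichart a u) = psi u by rewrite /= uE.
have [si _ ri] := Hi _ Ug.
have s2 : smooth_at (euclid 'rV[R]_m) At i ((psi \o chart a) (ichart a u)) by rewrite pE.
split.
- exact: (smooth_at_comp sA sE sAt s1 s2).
- by rewrite /= uE -(sa_K sA ag) -[RHS](_ : ichart a (phi (psi u)) = _)// fg.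
- move=> v; have -> : mdiff A At (i \o psi \o chart a) (ichart a u) v =
    mdiff (euclid 'rV[R]_m) At i ((psi \o chart a) (ichart a u))
      (mdiff A (euclid 'rV[R]_m) (psi \o chart a) (ichart a u) v).
    exact: (mdiff_comp sA sE v s1 s2).
  have E : (i \o psi \o chart a) (ichart a u) = i (psi u) by rewrite /= uE.
  by rewrite E -ri pE; exists (mdiff A (euclid 'rV[R]_m) (psi \o chart a) (ichart a u) v).
Qed.

Lemma dP_mdiff_section (s : M -> Mt) x v : smooth_at A At s x ->
  (\forall x' \near mnbhs A x, P (s x') = x') -> dP (s x) (mdiff A At s x v) = v.
Proof.
move=> ss Ps.
have E : mdiff A A (P \o s) x v = dP (s x) (mdiff A At s x v).
  exact: (mdiff_comp sA sAt v ss (P_smooth Psub (s x))).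
have E2 : mdiff A A (P \o s) x = mdiff A A id x by exact: mdiff_ext.
by rewrite -E E2; exact: mdiff_id.
Qed.

Lemma smooth_hpart xi y : smooth_field_at At xi y ->
  smooth_field_at At (fun y => lift y (dP y (xi y))) y.
Proof.
set b := chart_at At y; set a := chart_at A (P y).
have yb : dom b y := sa_cover sAt y; have ya : dom a (P y) := sa_cover sA (P y).
move=> /(smooth_fieldP sAt _ yb) [U [oU Uy Ui sU]].
set c := (fun u => _) in sU.
pose O := U `&` Pdom (P := P) b a.
have oP : open (Pdom (A := A) (At := At) (P := P) b a) := @open_Pdom _ _ _ _ _ _ _ _ _ _ sA sAt Psub b a.
have oO : open O by exact: openI.
have s1 : smooth_on O (fun u => c u *m Jmx (P := P) b a u *m Lmx (gt := gt) (P := P) b a u).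
  apply: smooth_mulmx => //; first apply: smooth_mulmx => //.
  - by apply: smooth_sub sU => u [].
  - by apply: smooth_sub (@smooth_Jmx _ _ _ _ _ _ _ _ _ _ sA sAt Psub b a) => u [].
  - by apply: smooth_sub (@smooth_Lmx _ _ _ _ _ _ _ _ _ _ sA sAt gtm Psub b a) => u [].
apply: (proj1 (smooth_field_atI sAt yb oO _ _ _ s1)).
- by split=> //; exact: Pdom_chart.
- by move=> u [/Ui].
- move=> u [Uu [_ ua]]; have [bu uE] := cimgK sAt (Ui _ Uu).
  have K1 : tv b (ichart b u) (c u) = xi (ichart b u) by exact: cvK.
  by rewrite -K1 (dPE sA sAt Psub _ bu ua) (liftE sA sAt gtm Psub _ bu ua) uE.
Qed.

Section WarpMetric.
Variable f : M -> R.
Hypotheses (f0 : forall x, 0 < f x) (fs : forall x, smooth_fun_at A f x).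
Local Notation gn := (warp At A P gt f).

(** The base term is written with [gt] on horizontal parts, where the smoothness axiom for metrics
    on [Mt] applies. *)
Lemma hpart_lift y u v :
  g (P y) (dP y u) (dP y v) = gt y (lift y (dP y u)) (lift y (dP y v)).
Proof. by rewrite (gt_lift sA sAt gtm Psub). Qed.

Lemma smooth_fun_mul (h h' : Mt -> R^o) y : smooth_fun_at At h y -> smooth_fun_at At h' y ->
  smooth_fun_at At (fun y => h y * h' y : R^o) y.
Proof.
have yb := sa_cover sAt y.
move=> /(smooth_funP sAt _ yb) [U [oU Uy Ui sU]] /(smooth_funP sAt _ yb) [U' [oU' Uy' _ sU']].
apply/(smooth_funP sAt _ yb); exists (U `&` U'); split=> //; first exact: openI.
  by move=> u [/Ui].
apply: smoothM; first exact: openI.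
  by apply: smooth_sub sU => u [].
by apply: smooth_sub sU' => u [].
Qed.

Lemma smooth_fun_add (h h' : Mt -> R^o) y : smooth_fun_at At h y -> smooth_fun_at At h' y ->
  smooth_fun_at At (fun y => h y + h' y : R^o) y.
Proof.
have yb := sa_cover sAt y.
move=> /(smooth_funP sAt _ yb) [U [oU Uy Ui sU]] /(smooth_funP sAt _ yb) [U' [oU' Uy' _ sU']].
apply/(smooth_funP sAt _ yb); exists (U `&` U'); split=> //; first exact: openI.
  by move=> u [/Ui].
apply: smoothD; first exact: openI.
  by apply: smooth_sub sU => u [].
by apply: smooth_sub sU' => u [].
Qed.

Lemma smooth_ver xi y : smooth_field_at At xi y ->
  smooth_field_at At (fun y => ver y (xi y)) y.
Proof.
move=> sx; have sc : smooth_fun_at At (fun=> (-1 : R) : R^o) y by exact: smooth_fun_cst.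
have s1 : smooth_field_at At (fun y => (-1 : R) *: lift y (dP y (xi y))) y.
  by apply: (smooth_fieldZ sAt sc); exact: smooth_hpart.
have s2 : smooth_field_at At (fun y => xi y + (-1 : R) *: lift y (dP y (xi y))) y.
  exact: smooth_fieldD.
have -> // : (fun y => ver y (xi y)) = (fun y => xi y + (-1 : R) *: lift y (dP y (xi y))).
by apply/funext => z; rewrite verE scaleN1r.
Qed.

Lemma gnE y u v : gn y u v =
  g (P y) (dP y u) (dP y v) + f (P y) ^+ 2 * gt y (ver y u) (ver y v).
Proof. exact: (warpE sA sAt gtm Psub). Qed.

Lemma warp_metric : riemannian_metric At gn.
Proof.
split.
- move=> y u v.
  rewrite -> (gnE y u v), (gnE y v u).
  by rewrite -> (rm_sym gm (P y) (dP y u) (dP y v)), (rm_sym gtm y (ver y u) (ver y v)).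
- move=> y c u v w; rewrite -> !gnE.
  refine (eq_trans (f_equal2 (fun a b => g (P y) a (dP y w) + f (P y) ^+ 2 * gt y b (ver y w))
    (dP_lin Psub y c u v) (ver_lin sA sAt gtm Psub y c u v)) _).
  refine (eq_trans (f_equal2 (fun a b => a + f (P y) ^+ 2 * b)
    (rm_lin gm (P y) c (dP y u) (dP y v) (dP y w)) (rm_lin gtm y c (ver y u) (ver y v) (ver y w))) _).
  generalize (g (P y) (dP y u) (dP y w)) (g (P y) (dP y v) (dP y w))
    (gt y (ver y u) (ver y w)) (gt y (ver y v) (ver y w)) => r1 r2 r3 r4; ring.
- move=> y u u0; rewrite gnE.
  have [d0|d0] := eqVneq (dP y u) 0.
    have E : ver y u = u.
      by rewrite verE d0 (clin0 (clin_lift sA sAt gtm Psub y)) subr0.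
    rewrite E d0 (rm_0l gm) add0r; apply: mulr_gt0; first exact: exprn_gt0.
    exact: (rm_pos gtm).
  apply: ltr_pwDl; first exact: (rm_pos gm).
  by apply: mulr_ge0; [exact: sqr_ge0|exact: (rm_ge0 gtm)].
- move=> y xi eta s1 s2.
  have -> : (fun y => gn y (xi y) (eta y)) = (fun y =>
     gt y (lift y (dP y (xi y))) (lift y (dP y (eta y))) +
     (f (P y) * f (P y)) * gt y (ver y (xi y)) (ver y (eta y)) : R^o).
    by apply/funext => z; rewrite gnE hpart_lift expr2.
  have sfP : smooth_fun_at At (f \o P : Mt -> R^o) y.
    exact: (proj1 (dfun_comp sAt sA 0 (P_smooth Psub y) (fs (P y)))).
  apply: smooth_fun_add.
    by apply: (rm_smooth gtm); exact: smooth_hpart.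
  apply: smooth_fun_mul; first exact: (smooth_fun_mul sfP sfP).
  by apply: (rm_smooth gtm); exact: smooth_ver.
Qed.

(** Integrability enters here. Along a leaf section [s] the lifted fields are the images of
    coordinate fields, so deriving [h] along them amounts to deriving [h \o s] on [M], where
    coordinate fields commute. Hence the whole bracket of two lifts vanishes, and not only its
    horizontal part. *)
Lemma bracket_lfield_fun (a : index A) w z (h : Mt -> R^o) y : dom a (P y) -> smooth_fun_at At h y ->
  dfun At (fun y => dfun At h y (lfield a z y)) y (lfield a w y) =
  dfun At (fun y => dfun At h y (lfield a w y)) y (lfield a z y).
Proof.
move=> ya sh; have [s [sy near_s]] := leaf_section y.
have [ss0 Ps0 hs0] := mnbhs_singleton sA near_s.
have shs : smooth_fun_at A (h \o s : M -> R^o) (P y).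
  by apply: (proj1 (dfun_comp sA sAt 0 ss0 _)); rewrite sy.
have slift x v : smooth_at A At s x -> (\forall x' \near mnbhs A x, P (s x') = x') ->
    hor (s x) (mdiff A At s x v) -> mdiff A At s x v = lift (s x) v.
  move=> ssx Psx hx; rewrite -{2}(dP_mdiff_section v ssx Psx).
  by rewrite (lift_dP sA sAt gtm Psub hx).
have near2 : \forall x \near mnbhs A (P y), \forall x' \near mnbhs A x, P (s x') = x'.
  by apply: mnbhs_interior => //; apply: filterS near_s => x [].
have key z' : \forall x \near mnbhs A (P y),
    dfun At h (s x) (lfield a z' (s x)) = dfun A (h \o s : M -> R^o) x (cfield a z' x).
  have nh : \forall x \near mnbhs A (P y), smooth_fun_at At h (s x).
    apply: (smooth_at_cont sA sAt ss0).
    by rewrite sy; exact: (smooth_fun_near sAt sh).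
  apply: filterS (filterI near_s (filterI near2 nh)) => x [[ssx Psx hx] [Psx' shx]].
  have [_ ->] := dfun_comp sA sAt (cfield a z' x) ssx shx.
  by rewrite lfieldE Psx (slift _ _ ssx Psx' (hx _)).
have cdf z' : smooth_fun_at At (fun y => dfun At h y (lfield a z' y)) y.
  by apply: (smooth_dfun sAt sh); exact: (smooth_lfield sA sAt gtm Psub).
have step w' z' : dfun At (fun y => dfun At h y (lfield a z' y)) y (lfield a w' y) =
    dfun A (fun x => dfun A (h \o s : M -> R^o) x (cfield a z' x)) (P y) (cfield a w' (P y)).
  rewrite -(dfun_ext sA _ (key z')).
  have ss0' : smooth_fun_at At (fun y => dfun At h y (lfield a z' y)) (s (P y)) by rewrite sy.
  have [_ E] := dfun_comp sA sAt (cfield a w' (P y)) ss0 ss0'.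
  transitivity (dfun At (fun y => dfun At h y (lfield a z' y)) (s (P y)) (mdiff A At s (P y) (cfield a w' (P y)))).
    have P0 : \forall x' \near mnbhs A (P y), P (s x') = x' by apply: filterS near_s => x [].
    have E3 := slift _ (cfield a w' (P y)) ss0 P0 (hs0 _).
    rewrite E3.
    rewrite lfieldE.
    rewrite sy.
    reflexivity.
  exact: esym E.
have C : dfun A (fun x => dfun A (h \o s : M -> R^o) x (cfield a z x)) (P y) (cfield a w (P y)) =
  dfun A (fun x => dfun A (h \o s : M -> R^o) x (cfield a w x)) (P y) (cfield a z (P y)).
  by exact: cfield_commute.
rewrite -> (step w z), (step z w); exact C.
Qed.

(** In classical terms, [xi] is [P]-related to the coordinate field with components [w]. *)
Definition projects_to (a : index A) w (xi : Mt -> 'rV[R]_k) :=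
  forall y, dP y (xi y) = cfield a w (P y).

Lemma lfield_projects a w : projects_to a w (lfield a w).
Proof. move=> y; rewrite lfieldE; exact (dP_lift sA sAt gtm Psub y _). Qed.

Lemma dfun_P (h : M -> R^o) y v : smooth_fun_at A h (P y) ->
  smooth_fun_at At (h \o P : Mt -> R^o) y /\ dfun At (h \o P : Mt -> R^o) y v = dfun A h (P y) (dP y v).
Proof. move=> sh; exact (dfun_comp sAt sA v (P_smooth Psub y) sh). Qed.

Lemma dfun_projectable a w z xi eta (h : M -> R^o) y : dom a (P y) ->
  projects_to a w xi -> projects_to a z eta -> smooth_fun_at A h (P y) ->
  dfun At (fun y => dfun At (h \o P : Mt -> R^o) y (eta y)) y (xi y) =
  dfun A (fun x => dfun A h x (cfield a z x)) (P y) (cfield a w (P y)).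
Proof.
move=> ya px pe sh.
have nP : \forall y' \near mnbhs At y, smooth_fun_at A h (P y').
  apply: (smooth_at_cont sAt sA (P_smooth Psub y)).
  exact (smooth_fun_near sA sh).
have E : \forall y' \near mnbhs At y, dfun At (h \o P : Mt -> R^o) y' (eta y') =
    ((fun x => dfun A h x (cfield a z x)) \o P) y'.
  apply: filterS nP => y' sh'; have [_ ->] := dfun_P (eta y') sh'.
  exact (congr1 (dfun A h (P y')) (pe y')).
refine (eq_trans (dfun_ext sAt (xi y) E) _).
have sz : smooth_field_at A (cfield a z) (P y) by exact: smooth_cfield.
have sd : smooth_fun_at A (fun x => dfun A h x (cfield a z x)) (P y) by exact: smooth_dfun.
have [_ E2] := dfun_P (xi y) sd; refine (eq_trans E2 _).
exact (congr1 (dfun A _ (P y)) (px y)).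
Qed.

Section Connections.
Context {D : @connection R 'rV[R]_m M} {Dt : @connection R 'rV[R]_k Mt}.
Hypotheses (lc : levi_civita A g D) (lct : levi_civita At gn Dt).
Let gnm := warp_metric.
Let slf (a : index A) w y (ya : dom a (P y)) : smooth_field_at At (lfield a w) y :=
  smooth_lfield sA sAt gtm Psub w ya.

Lemma bracket_lfield (a : index A) w z y : dom a (P y) ->
  Dt y (lfield a w y) (lfield a z) - Dt y (lfield a z y) (lfield a w) = 0.
Proof.
move=> ya; apply: (dfun_nondeg sAt (x := y)) => h sh.
refine (eq_trans (lc_torsion lct (slf w ya) (slf z ya) sh) _).
rewrite -> (bracket_lfield_fun w z ya sh); exact: subrr.
Qed.

(** Brackets of [P]-related fields are [P]-related to the bracket below, which is zero for
    coordinate fields. *)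
Lemma dP_bracket (a : index A) w z xi eta y : dom a (P y) ->
  projects_to a w xi -> projects_to a z eta ->
  smooth_field_at At xi y -> smooth_field_at At eta y ->
  dP y (Dt y (xi y) eta - Dt y (eta y) xi) = 0.
Proof.
move=> ya px pe sx se; apply: (dfun_nondeg sA (x := P y)) => h sh.
have [sP E] := dfun_P (Dt y (xi y) eta - Dt y (eta y) xi) sh.
refine (eq_trans (esym E) _).
refine (eq_trans (lc_torsion lct sx se sP) _).
rewrite -> (dfun_projectable ya px pe sh), (dfun_projectable ya pe px sh).
have C : dfun A (fun x => dfun A h x (cfield a z x)) (P y) (cfield a w (P y)) =
  dfun A (fun x => dfun A h x (cfield a w x)) (P y) (cfield a z (P y)) by exact: cfield_commute.
rewrite -> C; exact: subrr.
Qed.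

(** The inner product of a projectable field with a lifted one is the pull-back of a function on
    [M], so it is differentiated there. *)
Lemma dfun_gn (a : index A) u z xi y : dom a (P y) ->
  projects_to a u xi -> forall v,
  dfun At (fun y => gn y (xi y) (lfield a z y)) y v =
  dfun A (fun x => g x (cfield a u x) (cfield a z x)) (P y) (dP y v).
Proof.
move=> ya px v.
have sg : smooth_fun_at A (fun x => g x (cfield a u x) (cfield a z x)) (P y).
  by apply: (rm_smooth gm); exact: smooth_cfield.
have [_ <-] := dfun_P v sg.
have E : (fun y => gn y (xi y) (lfield a z y)) =
    (fun x => g x (cfield a u x) (cfield a z x)) \o P.
  apply/funext => y'; rewrite lfieldE.
  refine (eq_trans (warp_lift sA sAt gtm Psub f y' (xi y') (cfield a z (P y'))) _).
  exact (congr1 (fun u => g (P y') u (cfield a z (P y'))) (px y')).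
rewrite -> E; reflexivity.
Qed.

Let koszul_core (r1 r2 r3 s1 s2 s3 l0 l l' : R) (b1 b2 b3 c1 c2 c3 : R) :
  2 * l0 = r1 + r2 - r3 + b1 - b2 - b3 -> 2 * l' = s1 + s2 - s3 + c1 - c2 - c3 ->
  l0 = l -> r1 = s1 -> r2 = s2 -> r3 = s3 ->
  b1 = 0 -> b2 = 0 -> b3 = 0 -> c1 = 0 -> c2 = 0 -> c3 = 0 -> l = l'.
Proof. by move=> e1 e2 e3 e4 e5 e6 b10 b20 b30 c10 c20 c30; lra. Qed.

(* For vertical [v] this needs brackets of lifted fields to be horizontal. *)
Lemma connection_lfield (a : index A) w y v : dom a (P y) ->
  dP y (Dt y v (lfield a w)) = D (P y) (dP y v) (cfield a w).
Proof.
move=> ya; set b := chart_at At y; have yb : dom b y := sa_cover sAt y.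
pose u := cv a (P y) (dP y v).
(* Extension of [v] to a projectable field: the horizontal part is extended by a lifted coordinate
   field, the vertical part by the vertical projection of a coordinate field of [Mt]. *)
pose xi y' := lfield a u y' + ver y' (cfield b (cv b y v) y').
have xiE : xi y = v.
  rewrite /xi; have -> : cfield b (cv b y v) y = v by exact: cvK.
  rewrite lfieldE; have -> : cfield a u (P y) = dP y v by exact: cvK.
  by rewrite verE addrC subrK.
have px : projects_to a u xi.
  move=> y'; have [l _] := clin_dP Psub y'.
  have := l 1 (lfield a u y') (ver y' (cfield b (cv b y v) y')).
  rewrite (dP_ver sA sAt gtm Psub) addr0 !scale1r => E; refine (eq_trans E _).
  exact (lfield_projects a u y').
have sv : smooth_field_at At (fun y' => ver y' (cfield b (cv b y v) y')) y.
  by apply: smooth_ver; exact: smooth_cfield.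
have sx : smooth_field_at At xi y by exact (smooth_fieldD sAt (slf u ya) sv).
have cu : cfield a u (P y) = dP y v by exact: cvK.
have scf z : smooth_field_at A (cfield a z) (P y) by exact: smooth_cfield.
apply/eqP; rewrite -subr_eq0; apply/eqP; apply: (rm_nondeg gm (x := P y)) => z0.
have zE : z0 = cfield a (cv a (P y) z0) (P y) by apply: esym; exact: cvK.
rewrite zE; move: (cv a (P y) z0) => z {z0 zE}.
rewrite (rm_Bl gm); apply/eqP; rewrite subr_eq0; apply/eqP.
have K1 := koszul gnm lct sx (slf w ya) (slf z ya).
have K2 := koszul gm lc (scf u) (scf w) (scf z).
have R1 := eq_trans (dfun_gn z ya (lfield_projects a w) (xi y)) (congr1 (dfun A _ (P y)) (px y)).
have R2 := eq_trans (dfun_gn z ya px (lfield a w y)) (congr1 (dfun A _ (P y)) (lfield_projects a w y)).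
have R3 := eq_trans (dfun_gn w ya px (lfield a z y)) (congr1 (dfun A _ (P y)) (lfield_projects a z y)).
have Lz b' z' : gn y b' (lfield a z' y) = g (P y) (dP y b') (cfield a z' (P y)).
  rewrite lfieldE; exact (warp_lift sA sAt gtm Psub f y b' (cfield a z' (P y))).
have L0 b' z' : dP y b' = 0 -> gn y b' (lfield a z' y) = 0.
  move=> d0; refine (eq_trans (Lz b' z') _); rewrite -> d0; exact (rm_0l gm (P y) _).
have G1 := L0 _ z (dP_bracket ya px (lfield_projects a w) sx (slf w ya)).
have G2 := L0 _ w (dP_bracket ya px (lfield_projects a z) sx (slf z ya)).
(* The only bracket paired with [xi], which may have a vertical part: here the full bracket has to
   vanish. *)
have G3 : gn y (Dt y (lfield a w y) (lfield a z) - Dt y (lfield a z y) (lfield a w)) (xi y) = 0.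
  rewrite -> (bracket_lfield w z ya); exact (rm_0l gnm y (xi y)).
have H w' z' t : g (P y) (D (P y) (cfield a w' (P y)) (cfield a z') -
    D (P y) (cfield a z' (P y)) (cfield a w')) t = 0.
  exact (eq_trans (congr1 (fun b => g (P y) b t) (bracket_cfield sA lc w' z' ya)) (rm_0l gm (P y) t)).
have F := koszul_core K1 K2 (Lz (Dt y (xi y) (lfield a w)) z) R1 R2 R3 G1 G2 G3 (H u w _) (H u z _) (H w z _).
rewrite -> xiE, cu in F; exact F.
Qed.

End Connections.
End WarpMetric.
End HorizontalIntegrable.

(** * Connection maps *)

Section CoordinateBump.
Context {R : realType} {n : nat} {X : Type} {A : atlas 'rV[R]_n X}.
Hypothesis sA : satlas A.

(** A coordinate of the chart, shifted to vanish at [x]; [0 < n] guarantees that there is one. It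
    serves as the factor in [mdiff_section_perturb]. *)
Lemma coordinate_bump (a : index A) x : (0 < n)%N -> dom a x ->
  exists (phi : X -> R^o) (e : 'rV[R]_n),
    [/\ smooth_fun_at A phi x, phi x = 0 & dfun A phi x (tv a x e) = 1].
Proof.
case: n A sA a => [//|n'] A' sA' a _ ax.
have cl := @clin_coord R 1 n'.+1 0 ord0.
have [s d] : smooth_fun_at A' (fun y => chart a y 0 ord0 + (- chart a x 0 ord0) : R^o) x /\
  forall h, dfun A' (fun y => chart a y 0 ord0 + (- chart a x 0 ord0) : R^o) x (tv a x h) = h 0 ord0.
  exact: (smooth_fun_lin sA' (- chart a x 0 ord0) ax cl).
exists (fun y => chart a y 0 ord0 + (- chart a x 0 ord0) : R^o), (delta_mx 0 ord0).
by split; [exact: s|exact: subrr|rewrite d mxE !eqxx].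
Qed.

End CoordinateBump.

Section ConnectionMapTM.
Context {R : realType} {m : nat} {M : Type} {A : atlas 'rV[R]_m M}.
Context {g : @form R 'rV[R]_m M} {D : @connection R 'rV[R]_m M}.
Context {K : M * 'rV[R]_m -> 'rV[R]_m * 'rV[R]_m -> 'rV[R]_m}.
Hypotheses (sA : satlas A) (m0 : (0 < m)%N).
Hypotheses (gm : riemannian_metric A g) (lc : levi_civita A g D).
Hypothesis KM : connection_map A (fun=> setT) D K.
Local Notation TA := (tangent_atlas A).
Let sTA : satlas TA := satlas_tangent sA.
Let scf (a : index A) w x (ax : dom a x) : smooth_field_at A (cfield a w) x :=
  smooth_cfield sA w ax.

Lemma tangent_to_total z al : tangent_to TA (total_space (fun=> setT)) z al.
Proof.
have az := sa_cover sTA z; set a := chart_at TA z in az.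
have [c [sc c0 vc]] : exists c : R^o -> M * 'rV[R]_m, [/\ smooth_curve_at TA c 0, c 0 = z &
    velocity TA c 0 = tv a z (cv a z al)] by exact: curve_through.
have E : tv a z (cv a z al) = al by exact: cvK.
have HT : \forall t \near (0 : R^o), total_space (fun=> [set: 'rV[R]_m]) (c t).
  by apply: filterE => t.
exists c; split; [exact sc|exact HT|exact c0|exact (eq_trans vc E)].
Qed.

Lemma K_add z al be : K z (al + be) = K z al + K z be.
Proof.
have [_ l _] := KM (I : total_space (fun=> setT) z).
have := l 1 al be (tangent_to_total z al) (tangent_to_total z be).
by rewrite !scale1r.
Qed.

Lemma K_section xi x v : smooth_field_at A xi x ->
  K (x, xi x) (mdiff A TA (section_map xi) x v) = D x v xi.
Proof.
move=> sx; have [_ _ s] := KM (I : total_space (fun=> setT) (x, xi x)).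
by apply: s.
Qed.

(** [K] is prescribed on differentials of sections. The vertical vector [(0, l)] is the difference
    of two of them in direction [e], for [cfield a w] with and without the perturbation
    [phi *: cfield a l], and the Leibniz rule evaluates [K] on it to the vector with components
    [l]. *)
Lemma K_coords (a : index A) x w h l : dom a x ->
  K (x, tv a x w) (tv (a : index TA) (x, tv a x w) (h, l)) =
  D x (tv a x h) (cfield a w) + tv a x l.
Proof.
move=> ax; have [phi [e [sp p0 dp]]] := coordinate_bump sA m0 ax.
set T := tv (a : index TA) (x, tv a x w).
have cT : clin T by exact: clin_tv.
have s1 := scf w ax; have s2 := scf l ax.
have [s3 E3] := mdiff_section_perturb sA (tv a x e) ax s1 s2 sp p0.
have K3 := K_section (tv a x e) s3.
have E1 : mdiff A TA (section_map (cfield a w)) x (tv a x h) = T (h, 0) by exact: mdiff_cfield.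
have K1 := K_section (tv a x h) s1.
have K2 := K_section (tv a x e) s1.
set xi := fun y => _ in s3 E3 K3.
have xx : xi x = tv a x w by rewrite /xi p0 scale0r addr0.
have E3' : mdiff A TA (section_map xi) x (tv a x e) =
    mdiff A TA (section_map (cfield a w)) x (tv a x e) + T (0, l).
  refine (eq_trans E3 _); rewrite dp scale1r.
  have E4 : cv a x (cfield a l x) = l by exact: tvK.
  exact (congr1 (fun c => mdiff A TA (section_map (cfield a w)) x (tv a x e) + T (0, c)) E4).
have DL : D x (tv a x e) xi = D x (tv a x e) (cfield a w) + tv a x l.
  have s4 : smooth_field_at A (fun y => (phi y : R) *: cfield a l y) x by exact: smooth_fieldZ.
  refine (eq_trans (lc_additive lc (tv a x e) s1 s4) _).
  refine (congr1 (fun v => _ + v) _).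
  refine (eq_trans (lc_leibniz lc (tv a x e) sp s2) _).
  refine (eq_trans (f_equal2 (fun r t : R => r *: cfield a l x + t *: D x (tv a x e) (cfield a l)) dp p0) _).
  generalize (D x (tv a x e) (cfield a l)) => d0; rewrite scale1r scale0r addr0; exact (erefl _).
have hl : (h, l) = (h, 0) + (0, l) :> 'rV[R]_m * 'rV[R]_m by congr pair; rewrite ?addr0 ?add0r.
rewrite hl (clinD _ _ cT) K_add.
have F : K (x, tv a x w) (T (0, l)) = tv a x l.
  have E5 := eq_trans (esym (K_add (x, tv a x w) (mdiff A TA (section_map (cfield a w)) x (tv a x e)) (T (0, l))))
    (congr1 (K (x, tv a x w)) (esym E3')).
  have E6 : K (x, tv a x w) (mdiff A TA (section_map xi) x (tv a x e)) = D x (tv a x e) xi.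
    refine (eq_trans _ K3); exact (congr1 (fun z => K (x, z) (mdiff A TA (section_map xi) x (tv a x e))) (esym xx)).
  have E7 := eq_trans E5 (eq_trans E6 DL).
  have E8 := eq_trans (congr1 (fun v => v + K (x, tv a x w) (T (0, l))) (esym K2)) E7.
  exact: addrI E8.
refine (f_equal2 (fun u v => u + v) _ F).
exact (eq_trans (congr1 (K (x, tv a x w)) (esym E1)) K1).
Qed.

End ConnectionMapTM.

Section JointDerivative.
Context {R : realType} {m k : nat} (O : set 'rV[R]_k) (L : 'rV[R]_k -> 'M[R]_(m, k)).
Hypotheses (oO : open O) (sL : smooth_on O L).
Let G (z : 'rV[R]_k * 'rV[R]_m) : 'rV[R]_k := z.2 *m L z.1.
Let OO := [set z : 'rV[R]_k * 'rV[R]_m | O z.1].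
Let oOO : open OO := openXT oO.

Lemma smooth_mul_joint : smooth_on OO G.
Proof.
apply: smooth_mulmx; [exact: oOO|exact: smooth_snd|].
apply: (smooth_comp oOO oO) => //; exact: smooth_fst.
Qed.

Let dI (V : normedModType R) {fV : findim V} (u : V) : differentiable (id : V -> V) u.
Proof. by apply: (smooth_differentiable (@openT _)) => //; exact: smooth_id. Qed.

Let dC (V W : normedModType R) {fV : findim V} {fW : findim W} (w : W) (u : V) : differentiable (cst w : V -> W) u.
Proof. by apply: (smooth_differentiable (@openT _)) => //; exact: smooth_cst. Qed.

Lemma derive_mul_joint u w h l : O u ->
  'D_(h, l) G (u, w) = 'D_h (fun u => w *m L u) u + l *m L u.
Proof.
move=> Ou; have dG : differentiable G (u, w) by exact: (smooth_differentiable oOO smooth_mul_joint).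
have cG := differentiable_clin dG.
have hl : (h, l) = (h, 0) + (0, l) :> 'rV[R]_k * 'rV[R]_m by congr pair; rewrite ?addr0 ?add0r.
rewrite hl; refine (eq_trans (clinD (h, 0) (0, l) cG) _).
refine (f_equal2 (fun a b => a + b) _ _).
- have d1 : differentiable (fun u : 'rV[R]_k => (u, w)) u.
    by apply: (smooth_differentiable (@openT _)) => //; apply: smooth_pair; [exact: openT|exact: smooth_id|exact: smooth_cst].
  have E := derive_comp h d1 dG.
  have E2 : 'D_h (fun u : 'rV[R]_k => (u, w)) u = (h, 0).
    have := @derive_pair R _ _ _ (id : 'rV[R]_k -> 'rV[R]_k) (cst w) u h.
    by rewrite derive_id derive_cst; apply; [exact: dI|exact: dC].
  by rewrite E2 in E; rewrite -E.
- have d1 : differentiable (fun l : 'rV[R]_m => (u, l)) w.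
    by apply: (smooth_differentiable (@openT _)) => //; apply: smooth_pair; [exact: openT|exact: smooth_cst|exact: smooth_id].
  have E := derive_comp l d1 dG.
  have E2 : 'D_l (fun l : 'rV[R]_m => (u, l)) w = (0, l).
    have := @derive_pair R _ _ _ (cst u) (id : 'rV[R]_m -> 'rV[R]_m) w l.
    by rewrite derive_id derive_cst; apply; [exact: dC|exact: dI].
  rewrite E2 in E; rewrite -E.
  exact: (derive_clin w l (clin_mulmxr (L u))).
Qed.

End JointDerivative.

Section ConnectionMapE.
Context {R : realType} {m k : nat} {M Mt : Type}.
Context {A : atlas 'rV[R]_m M} {At : atlas 'rV[R]_k Mt}.
Context {g : @form R 'rV[R]_m M} {gt : @form R 'rV[R]_k Mt} {P : Mt -> M}.
Hypotheses (sA : satlas A) (sAt : satlas At) (m0 : (0 < m)%N).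
Hypotheses (gm : riemannian_metric A g) (gtm : riemannian_metric At gt).
Hypothesis Psub : riemannian_submersion At A P gt g.
Hypothesis Hint : integrable_distribution 'rV[R]_m At (horizontal At A P gt).
Variable f : M -> R.
Hypotheses (f0 : forall x, 0 < f x) (fs : forall x, smooth_fun_at A f x).
Local Notation dP := (mdiff At A P).
Local Notation hor := (horizontal At A P gt).
Local Notation lift := (lift (A := A) (At := At) (gt := gt) (P := P)).
Local Notation lfield := (lfield (A := A) (At := At) (gt := gt) (P := P)).
Local Notation gn := (warp At A P gt f).
Local Notation TA := (tangent_atlas A).
Local Notation TAt := (tangent_atlas At).
Local Notation horn := (horizontal At A P gn).
Context {D : @connection R 'rV[R]_m M} {Dt : @connection R 'rV[R]_k Mt}.
Hypotheses (lc : levi_civita A g D) (lct : levi_civita At gn Dt).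
Context {K : M * 'rV[R]_m -> 'rV[R]_m * 'rV[R]_m -> 'rV[R]_m}.
Context {Kt : Mt * 'rV[R]_k -> 'rV[R]_k * 'rV[R]_k -> 'rV[R]_k}.
Hypothesis KM : connection_map A (fun=> setT) D K.
Hypothesis KtM : connection_map At horn (projected_connection gn horn Dt) Kt.
Let sTA : satlas TA := satlas_tangent sA.
Let sTAt : satlas TAt := satlas_tangent sAt.
Let slf (a : index A) w y (ya : dom a (P y)) : smooth_field_at At (lfield a w) y :=
  smooth_lfield sA sAt gtm Psub w ya.
Let hornE : horn = hor := hor_warp sA sAt gm gtm Psub f0.

Lemma k_gt0 (y : Mt) : (0 < k)%N.
Proof.
have [v vE] := dP_onto Psub y (delta_mx 0 (Ordinal m0)).
rewrite lt0n; apply/eqP => k0.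
have v0 : v = 0.
  apply/rowP => i; have i0 := ltn_ord i; exfalso; move: i0; move: (nat_of_ord i) => j.
  by rewrite k0.
move: vE; rewrite v0 (clin0 (clin_dP Psub y)) => /rowP /(_ (Ordinal m0)) /eqP.
by rewrite !mxE !eqxx eq_sym oner_eq0.
Qed.

Lemma Kt_add z al be : total_space horn z -> tangent_to TAt (total_space horn) z al ->
  tangent_to TAt (total_space horn) z be -> Kt z (al + be) = Kt z al + Kt z be.
Proof.
move=> hz ta tb; have [_ l _] := KtM hz.
by have := l 1 al be ta tb; rewrite !scale1r.
Qed.

Lemma Kt_section xi y v : smooth_field_at At xi y -> (forall y, horn y (xi y)) ->
  dP y (Kt (y, xi y) (mdiff At TAt (section_map xi) y v)) = dP y (Dt y v xi).
Proof.
move=> sx hx; have [_ _ s] := KtM (hx y : total_space horn (y, xi y)).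
have -> : Kt (y, xi y) (mdiff At TAt (section_map xi) y v) = projected_connection gn horn Dt y v xi.
  exact (s xi v sx hx (erefl _)).
rewrite /projected_connection (oproj_warp sA sAt gm gtm Psub f0).
exact (dP_lift sA sAt gtm Psub y _).
Qed.

(** The argument of [K_coords], except that [Kt] is additive only on tangent vectors of the
    horizontal bundle. The relation is therefore arranged as [be + X3 = X1 + X2], whose four terms
    are all known to be tangent, instead of isolating a vertical vector. *)
Lemma Kt_coords (b : index At) (a : index A) y w h l : dom b y -> dom a (P y) ->
  let be := tv (b : index TAt) (y, lfield a w y)
    (h, 'D_h (fun u => w *m Lmx (gt := gt) (P := P) b a u) (chart b y) +
        l *m Lmx (gt := gt) (P := P) b a (chart b y)) in
  tangent_to TAt (total_space horn) (y, lfield a w y) be ->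
  dP y (Kt (y, lfield a w y) be) = D (P y) (dP y (tv b y h)) (cfield a w) + tv a (P y) l.
Proof.
move=> yb ya be tbe.
have [phi [e [sp p0 dp]]] := coordinate_bump sAt (k_gt0 y) yb.
set z := (y, lfield a w y) in be tbe *.
set T := tv (b : index TAt) z in be tbe *.
have cT : clin T by exact: clin_tv.
have s1 := slf w ya; have s2 := slf l ya.
have hl w' y' : horn y' (lfield a w' y').
  rewrite hornE lfieldE; exact (@lift_hor _ _ _ _ _ _ _ _ _ _ sA sAt gtm Psub y' _).
have [s3 E3] := mdiff_section_perturb sAt (tv b y e) yb s1 s2 sp p0.
set xi := fun y => _ in s3 E3.
have hxi y' : horn y' (xi y').
  rewrite /xi; have := hl w y'; have := hl l y'; rewrite hornE => h1 h2.
  rewrite addrC; exact: (hor_lin gtm (phi y' : R) h1 h2).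
have xy : xi y = lfield a w y by rewrite /xi p0 scale0r addr0.
pose X1 := mdiff At TAt (section_map (lfield a w)) y (tv b y h).
pose X2 := mdiff At TAt (section_map xi) y (tv b y e).
pose X3 := mdiff At TAt (section_map (lfield a w)) y (tv b y e).
have hz : total_space horn z by exact (hl w y).
have t1 : tangent_to TAt (total_space horn) z X1 := tangent_section sAt (z := z) (tv b y h) s1 (hl w) (erefl _).
have t3 : tangent_to TAt (total_space horn) z X3 := tangent_section sAt (z := z) (tv b y e) s1 (hl w) (erefl _).
have t2 : tangent_to TAt (total_space horn) z X2.
  have E : section_map xi z.1 = z by rewrite /section_map xy.
  exact (tangent_section sAt (z := z) (tv b y e) s3 hxi E).
set L := Lmx _ _ in be tbe *.
have oP : open (Pdom (A := A) (At := At) (P := P) b a) := open_Pdom sA sAt Psub (b := b) (a := a).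
have sL : smooth_on (Pdom (A := A) (At := At) (P := P) b a) L := @smooth_Lmx _ _ _ _ _ _ _ _ _ _ sA sAt gtm Psub b a.
have sm : smooth_on (Pdom (A := A) (At := At) (P := P) b a) (fun u => w *m L u).
  by apply: smooth_mulmx => //; exact: smooth_cst.
have E1 : X1 = T (h, 'D_h (fun u => w *m L u) (chart b y)).
  have Ui : Pdom (A := A) (At := At) (P := P) b a `<=` cimg b by move=> u [].
  have [_ E] := smooth_field_atI sAt yb oP (Pdom_chart sAt yb ya) Ui
    (lfield_coords sA sAt gtm Psub w) sm.
  exact (E h).
have cl : cv b y (lfield a l y) = l *m L (chart b y).
  have E := liftE sA sAt gtm Psub l yb ya.
  rewrite lfieldE; refine (eq_trans (congr1 (cv b y) E) _); exact: tvK.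
have E2 : X2 = X3 + T (0, l *m L (chart b y)).
  refine (eq_trans E3 _).
  refine (congr1 (fun c => X3 + T (0, c)) _).
  refine (eq_trans (f_equal2 (fun r c => r *: c) dp cl) _); exact: scale1r.
have Ebe : be + X3 = X1 + X2.
  rewrite /be E1 E2; set d := 'D_h _ _.
  have hl' : (h, d + l *m L (chart b y)) = (h, d) + (0, l *m L (chart b y)) :> 'rV[R]_k * 'rV[R]_k.
    by congr pair; rewrite addr0.
  have AC (p1 p2 p3 : 'rV[R]_k * 'rV[R]_k) : p1 + p2 + p3 = p1 + (p3 + p2) by rewrite addrAC addrA.
  rewrite hl'; exact (eq_trans (congr1 (fun v => v + X3) (clinD (h, d) (0, l *m L (chart b y)) cT)) (AC _ _ _)).
have F : Kt z be + Kt z X3 = Kt z X1 + Kt z X2.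
  exact (eq_trans (esym (Kt_add hz tbe t3)) (eq_trans (congr1 (Kt z) Ebe) (Kt_add hz t1 t2))).
have [lP _] := clin_dP Psub y.
have dPD u v : dP y (u + v) = dP y u + dP y v by have := lP 1 u v; rewrite !scale1r.
have F2 : dP y (Kt z be) + dP y (Kt z X3) = dP y (Kt z X1) + dP y (Kt z X2).
  refine (eq_trans (esym (dPD _ _)) _); refine (eq_trans (congr1 (dP y) F) _); exact (dPD _ _).
have G1 : dP y (Kt z X1) = D (P y) (dP y (tv b y h)) (cfield a w).
  refine (eq_trans (Kt_section (tv b y h) s1 (hl w)) _).
  exact (connection_lfield sA sAt gm gtm Psub Hint f0 fs lc lct w (tv b y h) ya).
have G3 := Kt_section (tv b y e) s1 (hl w).
have G2 : dP y (Kt z X2) = dP y (Dt y (tv b y e) (lfield a w)) + tv a (P y) l.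
  have E := Kt_section (tv b y e) s3 hxi.
  have E' : dP y (Kt z X2) = dP y (Dt y (tv b y e) xi).
    by refine (eq_trans _ E); rewrite xy; exact (erefl _).
  refine (eq_trans E' _).
  have s4 : smooth_field_at At (fun y => (phi y : R) *: lfield a l y) y by exact: smooth_fieldZ.
  refine (eq_trans (congr1 (dP y) (lc_additive lct (tv b y e) s1 s4)) _).
  refine (eq_trans (dPD _ _) _).
  refine (congr1 (fun c => _ + c) _).
  refine (eq_trans (congr1 (dP y) (lc_leibniz lct (tv b y e) sp s2)) _).
  refine (eq_trans (congr1 (dP y) (f_equal2 (fun r t : R => r *: lfield a l y + t *: Dt y (tv b y e) (lfield a l)) dp p0)) _).
  rewrite scale1r scale0r addr0; exact (lfield_projects sA sAt gtm Psub a l y).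
have G3' : dP y (Kt z X3) = dP y (Dt y (tv b y e) (lfield a w)) by exact G3.
have AC (q q1 q2 q3 q4 p1 p2 : 'rV[R]_m) : q + q3 = p1 + p2 -> p1 = q1 -> p2 = q2 + q4 -> q3 = q2 ->
    q = q1 + q4.
  by move=> q0E p1E p2E q3E; apply: (addIr q3); rewrite q0E p1E p2E q3E addrA addrAC.
exact (AC _ _ _ _ _ _ _ F2 G1 G2 G3').
Qed.

Let Ps := tangent_map At A P.

Lemma derive_joint_fst (O : set 'rV[R]_k) (F : 'rV[R]_k -> 'rV[R]_m) (u xi : 'rV[R]_k) (al : 'rV[R]_k * 'rV[R]_k) :
  open O -> O u -> smooth_on O F ->
  differentiable (F \o fst : 'rV[R]_k * 'rV[R]_k -> 'rV[R]_m) (u, xi) /\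
  'D_al (F \o fst : 'rV[R]_k * 'rV[R]_k -> 'rV[R]_m) (u, xi) = 'D_(al.1) F u.
Proof.
move=> oO Ou sF.
have oT := @openXT _ 'rV[R]_k 'rV[R]_k O oO.
have d1 : differentiable (fst : 'rV[R]_k * 'rV[R]_k -> 'rV[R]_k) (u, xi).
  by apply: (smooth_differentiable oT) => //; exact: smooth_fst.
have d2 : differentiable F ((u, xi) : 'rV[R]_k * 'rV[R]_k).1 by exact: (smooth_differentiable oO).
split; first exact: differentiable_comp d1 d2.
refine (eq_trans (derive_comp al d1 d2) _).
by rewrite (derive_clin _ _ (clin_fst 'rV[R]_k 'rV[R]_k)).
Qed.

Lemma hor_coords (b : index At) (a : index A) y xi : dom b y -> dom a (P y) ->
  horn y (tv b y xi) ->
  [/\ tv b y xi = lfield a (xi *m Jmx (P := P) b a (chart b y)) y,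
    dP y (tv b y xi) = tv a (P y) (xi *m Jmx (P := P) b a (chart b y)) &
    xi *m Jmx (P := P) b a (chart b y) *m Lmx (gt := gt) (P := P) b a (chart b y) = xi].
Proof.
move=> yb ya; rewrite hornE => hy.
have E1 := dPE sA sAt Psub xi yb ya.
have E2 := lift_dP sA sAt gtm Psub hy.
have E3 := liftE sA sAt gtm Psub (xi *m Jmx (P := P) b a (chart b y)) yb ya.
have E4 := eq_trans (esym E3) (eq_trans (congr1 (lift y) (esym E1)) E2).
split; [|exact E1|].
- rewrite lfieldE; exact (eq_trans (esym E2) (congr1 (lift y) E1)).
- have K1 : cv b y (tv b y (xi *m Jmx (P := P) b a (chart b y) *m Lmx (gt := gt) (P := P) b a (chart b y))) =
    xi *m Jmx (P := P) b a (chart b y) *m Lmx (gt := gt) (P := P) b a (chart b y) by exact: tvK.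
  have K2 : cv b y (tv b y xi) = xi by exact: tvK.
  exact (eq_trans (esym K1) (eq_trans (congr1 (cv b y) E4) K2)).
Qed.

(** In coordinates a curve in the horizontal bundle is fixed by the map sending [(u, xi)] to
    [(u, xi *m J u *m L u)], since [L] undoes [J] on horizontal vectors. Differentiating this at
    time 0 gives the fibre component of [al], where [l] is the derivative of [xi *m J u]; the same
    [l] is the fibre component of the image under [Ps]. *)
Lemma tangent_coords (b : index At) (a : index A) y xi al :
  dom b y -> dom a (P y) -> horn y (tv b y xi) ->
  tangent_to TAt (total_space horn) (y, tv b y xi) al ->
  let w := xi *m Jmx (P := P) b a (chart b y) in
  exists h l, [/\ tv b y xi = lfield a w y,
    dP y (tv b y xi) = tv a (P y) w,
    al = tv (b : index TAt) (y, tv b y xi)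
      (h, 'D_h (fun u => w *m Lmx (gt := gt) (P := P) b a u) (chart b y) +
        l *m Lmx (gt := gt) (P := P) b a (chart b y)) &
    exists h', tv a (P y) h' = dP y (tv b y h) /\
      mdiff TAt TA Ps (y, tv b y xi) al = tv (a : index TA) (P y, dP y (tv b y xi)) (h', l)].
Proof.
move=> yb ya hy [c [sc nc c0 vc]] w.
set z := (y, tv b y xi) in nc c0 *.
set u0 := chart b y in w *.
pose O := Pdom (A := A) (At := At) (P := P) b a.
have oO : open O := open_Pdom sA sAt Psub (b := b) (a := a).
have Ou : O u0 by exact: Pdom_chart.
pose J := Jmx (A := A) (At := At) (P := P) b a.
pose L := Lmx (A := A) (At := At) (gt := gt) (P := P) b a.
have sJ : smooth_on O J := @smooth_Jmx _ _ _ _ _ _ _ _ _ _ sA sAt Psub b a.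
have sL : smooth_on O L := @smooth_Lmx _ _ _ _ _ _ _ _ _ _ sA sAt gtm Psub b a.
have sPh : smooth_on O (Phat b a) := @smooth_Phat _ _ _ _ _ _ _ _ _ _ sA sAt Psub b a.
have oOO := @openXT _ 'rV[R]_k 'rV[R]_k O oO.
have oOO' := @openXT _ 'rV[R]_k 'rV[R]_m O oO.
set OO := [set _ | _] in oOO; set OO' := [set _ | _] in oOO'.
pose q (v : 'rV[R]_k * 'rV[R]_k) : 'rV[R]_m := v.2 *m J v.1.
pose rho v := (v.1, q v).
pose G (v : 'rV[R]_k * 'rV[R]_m) : 'rV[R]_k := v.2 *m L v.1.
pose r v := (v.1, G v).
have zb : dom (b : index TAt) z by exact yb.
have za : dom (a : index TA) (Ps z) by exact ya.
have zE : chart (b : index TAt) z = (u0, xi).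
  by rewrite tangent_chartE; congr pair; exact: tvK.
have sq : smooth_on OO q.
  refine (smooth_mulmx oOO (smooth_snd oOO) _).
  apply: (smooth_comp oOO oO) => //; exact: smooth_fst.
have dq : differentiable q (u0, xi) by exact: (smooth_differentiable oOO sq).
have sG : smooth_on OO' G by exact: smooth_mul_joint.
have [U [oU U0 Ub sU]] : exists U : set R^o, [/\ open U, U 0,
    (forall s, U s -> dom (b : index TAt) (c s)) & smooth_on U (chart (b : index TAt) \o c)].
  have cb : dom (b : index TAt) (c 0) by rewrite c0.
  exact (proj1 (smooth_curveP sTAt cb) sc).
set ch := chart (b : index TAt) \o c in sU.
have ch0 : ch 0 = (u0, xi) by rewrite /ch /= c0.
pose al1 := 'D_(1 : R^o) ch 0.
have alE : al = tv (b : index TAt) z al1.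
  have E : velocity TAt c 0 = tv (b : index TAt) (c 0) al1.
    by apply: velocityE => //; rewrite c0.
  exact (eq_trans (esym vc) (eq_trans E (congr1 (fun z => tv (b : index TAt) z al1) c0))).
have dch : differentiable ch 0 by exact: (smooth_differentiable oU sU).
have [e1 e2 e3] := hor_coords yb ya hy.
have OOc : OO (ch 0) by rewrite ch0.
have cch : {for 0, continuous ch} := smooth_cont sU U0.
(* Only times at which the curve lies in the horizontal bundle and in the chart satisfy the
   fixed-point relation; near 0 this holds, which is enough to differentiate it. *)
have near_r : \forall t \near (0 : R^o), ch t = (r \o (rho \o ch)) t.
  have n1 : \forall t \near (0 : R^o), OO (ch t) by apply: cch; exact: open_nbhs_nbhs.
  have n2 : nbhs (0 : R^o) U by exact: open_nbhs_nbhs.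
  apply: filterS (filterI nc (filterI n1 n2)) => t [hc [Oc Ut]].
  have bt := Ub _ Ut; have bt' : dom b (c t).1 by exact bt.
  have at' : dom a (P (c t).1) by move: Oc => [_]; rewrite /= (sa_K sAt bt').
  have hc' : horn (c t).1 (tv b (c t).1 (cv b (c t).1 (c t).2)).
    have -> : tv b (c t).1 (cv b (c t).1 (c t).2) = (c t).2 by exact: cvK.
    exact hc.
  have [_ _ E] := hor_coords bt' at' hc'.
  exact (congr1 (fun v => (chart b (c t).1, v)) (esym E)).
have dfst : differentiable (fst : 'rV[R]_k * 'rV[R]_k -> 'rV[R]_k) (u0, xi).
  by apply: (smooth_differentiable oOO) => //; exact: smooth_fst.
have drho : differentiable rho (u0, xi) by exact: differentiable_pair.
have Drho : 'D_al1 rho (u0, xi) = (al1.1, 'D_al1 q (u0, xi)).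
  refine (eq_trans (derive_pair al1 dfst dq) _).
  by rewrite (derive_clin _ _ (clin_fst 'rV[R]_k 'rV[R]_k)).
have rho0 : rho (u0, xi) = (u0, w) by [].
have dfst' : differentiable (fst : 'rV[R]_k * 'rV[R]_m -> 'rV[R]_k) (u0, w).
  by apply: (smooth_differentiable oOO') => //; exact: smooth_fst.
have dG : differentiable G (u0, w) by exact: (smooth_differentiable oOO' sG).
have dr : differentiable r (u0, w) by exact: differentiable_pair.
have Dr h l : 'D_(h, l) r (u0, w) = (h, 'D_h (fun u => w *m L u) u0 + l *m L u0).
  refine (eq_trans (derive_pair (h, l) dfst' dG) _).
  refine (f_equal2 pair _ (derive_mul_joint oO sL w h l Ou)).
  exact (derive_clin (u0, w) (h, l) (clin_fst 'rV[R]_k 'rV[R]_m)).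
have al1E : al1 = (al1.1, 'D_(al1.1) (fun u => w *m L u) u0 + 'D_al1 q (u0, xi) *m L u0).
  rewrite -Dr -Drho.
  have d1 : differentiable rho (ch 0) by rewrite ch0.
  have d2 : differentiable (rho \o ch) 0 by exact: differentiable_comp.
  have d3 : differentiable r ((rho \o ch) 0) by rewrite /= ch0.
  have C1 := derive_comp (1 : R^o) dch d1.
  have C2 := derive_comp (1 : R^o) d2 d3.
  have C3 : al1 = 'D_(1 : R^o) (r \o (rho \o ch)) 0 by exact: near_eq_derive.
  refine (eq_trans C3 (eq_trans C2 _)).
  exact (f_equal2 (fun v p => 'D_v r p) (eq_trans C1 (congr1 (fun p => 'D_al1 rho p) ch0)) (congr1 rho ch0)).
exists al1.1, ('D_al1 q (u0, xi)); split; [exact e1|exact e2|exact (eq_trans alE (congr1 (tv (b : index TAt) z) al1E))|].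
exists ('D_(al1.1) (Phat (A := A) (At := At) (P := P) b a) u0); split.
  have dPh : differentiable (Phat (A := A) (At := At) (P := P) b a) u0 by exact: (smooth_differentiable oO sPh).
  have E := dPE sA sAt Psub al1.1 yb ya.
  refine (eq_trans _ (esym E)); exact (congr1 (tv a (P y)) (jacE al1.1 dPh)).
have sPs : smooth_at TAt TA Ps z by exact (smooth_tangent_map sAt sA (F := P) (z := z) (P_smooth Psub z.1)).
have M1 := mdiffE sTAt sTA al1 sPs zb za.
have M2 : mdiff TAt TA Ps z al = tv (a : index TA) (Ps z) ('D_al1 (chart (a : index TA) \o Ps \o ichart (b : index TAt)) (chart (b : index TAt) z)).
  rewrite -alE in M1; rewrite M1; apply: esym; exact: cvK.
refine (eq_trans M2 (congr1 (tv (a : index TA) (Ps z)) _)).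
rewrite zE.
have [dPf DPf] := derive_joint_fst xi al1 oO Ou sPh.
refine (eq_trans _ (f_equal2 pair DPf (erefl ('D_al1 q (u0, xi))))).
refine (eq_trans _ (derive_pair al1 dPf dq)).
apply: near_eq_derive.
have n1 : nbhs (u0, xi) OO := open_nbhs_nbhs (conj oOO (Ou : OO (u0, xi))).
apply: filterS n1 => v Ov.
have vb : cimg b v.1 by have [] := Ov.
have [bv bvE] := cimgK sAt vb.
have av : dom a (P (ichart b v.1)) by have [] := Ov.
have E0 := tangent_ichartE sAt vb.
have E1 := dPE sA sAt Psub v.2 bv av.
have E2 : cv a (P (ichart b v.1)) (tv a (P (ichart b v.1)) (v.2 *m J (chart b (ichart b v.1)))) =
  v.2 *m J (chart b (ichart b v.1)) by exact: tvK.
refine (eq_trans (congr1 (fun z => chart (a : index TA) (Ps z)) E0) _).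
refine (congr1 (fun c => (chart a (P (ichart b v.1)), c)) _).
refine (eq_trans (congr1 (cv a (P (ichart b v.1))) E1) (eq_trans E2 _)).
exact (congr1 (fun u => v.2 *m J u) bvE).
Qed.

(** The connection map of the horizontal bundle is the pull-back of that of [TM]: in coordinates
    both sides are the derivative of [cfield a w] along the projected direction plus the vector with
    components [l]. The warping function has dropped out. *)
Lemma dP_Kt z al : total_space horn z -> tangent_to TAt (total_space horn) z al ->
  dP z.1 (Kt z al) = K (Ps z) (mdiff TAt TA Ps z al).
Proof.
case: z => y eta hz; set b := chart_at At y; set a := chart_at A (P y).
have yb : dom b y := sa_cover sAt y; have ya : dom a (P y) := sa_cover sA (P y).
have eE : tv b y (cv b y eta) = eta by exact: cvK.
rewrite -eE in hz *; set xi := cv b y eta in hz *; clearbody xi => tal.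
have [h [l [E1 E2 E3 [h' [E4 E5]]]]] := tangent_coords yb ya hz tal.
set w := xi *m _ in E1 E2 E3.
have C1 := K_coords sA m0 lc KM w h' l ya.
rewrite -> E1 in tal, E3, E5 |- *; rewrite -> E1 in E2.
have tbe := tal; rewrite -> E3 in tbe.
have C2 := Kt_coords yb ya tbe.
refine (eq_trans (congr1 (fun al => dP y (Kt (y, lfield a w y) al)) E3) (eq_trans C2 _)).
refine (eq_trans (congr1 (fun v => D (P y) v (cfield a w) + tv a (P y) l) (esym E4)) (eq_trans (esym C1) _)).
refine (eq_trans (congr1 (fun v => K (P y, v) (tv (a : index TA) (P y, v) (h', l))) (esym E2)) _).
exact (congr1 (K (P y, dP y (lfield a w y))) (esym E5)).
Qed.

End ConnectionMapE.

(** * The (p,q)-metrics as continuous forms *)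

Section ContinuousFormsTheory.
Context {R : realType} {V : normedModType R} {fV : findim V} {X : Type} {A : atlas V X}.
Hypothesis sA : satlas A.
Local Notation TA := (tangent_atlas A).
Let sTA : satlas TA := satlas_tangent sA.

Lemma cform_coords (Q : @form R V X) :
  (forall x c v, Q x (c *: v) (c *: v) = c ^+ 2 * Q x v v) ->
  (forall a : index A, exists q : V * V -> R^o, smooth_on [set z : V * V | cimg a z.1] q /\
    forall u h, cimg a u ->
      Q (ichart a u) (tv a (ichart a u) h) (tv a (ichart a u) h) = q (u, h)) ->
  cform A Q.
Proof.
move=> Qh Qc; split=> // z.
have az : dom (chart_at A z.1) z.1 := sa_cover sA z.1; set a := chart_at A z.1 in az.
have azT : dom (a : index TA) z by exact az.
have [q [sq qE]] := Qc a.
have oU : open [set z : V * V | cimg a z.1] by apply: openXT; exact: open_cimg.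
have U0 : [set z : V * V | cimg a z.1] (chart (a : index TA) z) by exists z.1.
have Q0 : Q z.1 z.2 z.2 = q (chart (a : index TA) z).
  rewrite tangent_chartE -(qE (chart a z.1) (cv a z.1 z.2)); last by exists z.1.
  rewrite (sa_K sA az).
  have -> : tv a z.1 (cv a z.1 z.2) = z.2 by exact: cvK.
  by [].
have cq := smooth_cont sq U0.
rewrite Q0 => B HB.
apply/(mnbhsE sTA (fun z' => B (Q z'.1 z'.2 z'.2)) azT).
have n1 : nbhs (chart (a : index TA) z) [set z : V * V | cimg a z.1].
  exact (open_nbhs_nbhs (conj oU U0)).
apply: filterS (filterI n1 (cq _ HB)) => -[u h] [uc Bq].
have E := tangent_ichartE sA (uc : cimg a (u, h).1).
have Bq' : B (q (u, h)) by exact Bq.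
by rewrite E; rewrite -(qE u h uc) in Bq'.
Qed.

Lemma cformD (Q1 Q2 : @form R V X) : cform A Q1 -> cform A Q2 ->
  cform A (fun x u v => Q1 x u v + Q2 x u v).
Proof.
move=> [c1 h1] [c2 h2]; split=> [z|x c v]; last by rewrite h1 h2 mulrDr.
by apply: cvgD; [exact: c1|exact: c2].
Qed.

Lemma cformB (Q1 Q2 : @form R V X) : cform A Q1 -> cform A Q2 ->
  cform A (fun x u v => Q1 x u v - Q2 x u v).
Proof.
move=> [c1 h1] [c2 h2]; split=> [z|x c v]; last by rewrite h1 h2 mulrBr.
by apply: cvgB; [exact: c1|exact: c2].
Qed.

Lemma cform_pullback (W : normedModType R) {fW : findim W} Y (B : atlas W Y) (sB : satlas B)
    (F : X -> Y) (Q : @form R W Y) : (forall x, smooth_at A B F x) -> cform B Q ->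
  cform A (fun x u v => Q (F x) (mdiff A B F x u) (mdiff A B F x v)).
Proof.
move=> sF [c1 h1]; split=> [z|x c v].
  have sT : smooth_at TA (tangent_atlas B) (tangent_map A B F) z.
    exact (smooth_tangent_map sA sB (F := F) (z := z) (sF z.1)).
  have sTB : satlas (tangent_atlas B) by exact: satlas_tangent.
  move=> N HN.
  exact (smooth_at_cont sTA sTB sT (c1 (tangent_map A B F z) N HN)).
have cF : clin (mdiff A B F x) by exact: clin_mdiff.
rewrite -h1; congr (Q _ _ _); exact (clinZ c v cF).
Qed.

End ContinuousFormsTheory.

Section RiemannianForm.
Context {R : realType} {n : nat} {X : Type} {A : atlas 'rV[R]_n X} {g : @form R 'rV[R]_n X}.
Hypotheses (sA : satlas A) (gm : riemannian_metric A g).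

Lemma smooth_bilinear (W : normedModType R) (O : set W) (u : W -> 'rV[R]_n)
    (v w : W -> 'rV[R]_n) (a : index A) : open O -> smooth_on O u -> smooth_on O v ->
  smooth_on O w -> findim W -> (forall z, O z -> cimg a (u z)) ->
  smooth_on O (fun z => (v z *m gram (g := g) a (u z) *m (w z)^T) 0 0 : R^o).
Proof.
move=> oO su sv sw fW Oc; apply: (smooth_mxE 0 0 oO).
apply: smooth_mulmx => //; last exact: smooth_trmx.
apply: smooth_mulmx => //.
apply: (smooth_comp oO (open_cimg sA a)) => //; exact: smooth_gram.
Qed.

Lemma cform_riemannian : cform A g.
Proof.
apply: (cform_coords sA) => [x c v|a]; first by rewrite (rm_Zl gm) (rm_Zr gm) mulrA expr2.
have oU : open [set z : 'rV[R]_n * 'rV[R]_n | cimg a z.1] by apply: openXT; exact: open_cimg.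
exists (fun z => (z.2 *m gram (g := g) a z.1 *m (z.2)^T) 0 0); split.
  apply: smooth_bilinear => //; [exact: smooth_fst|exact: smooth_snd|exact: smooth_snd].
move=> u h /(cimgK sA) [au uE].
by rewrite (gramE sA gm h h au) uE.
Qed.

End RiemannianForm.

Section SphereForm.
Context {R : realType} {m : nat} {M : Type} {A : atlas 'rV[R]_m M}.
Context {g : @form R 'rV[R]_m M} {D : @connection R 'rV[R]_m M}.
Context {K : M * 'rV[R]_m -> 'rV[R]_m * 'rV[R]_m -> 'rV[R]_m}.
Hypotheses (sA : satlas A) (m0 : (0 < m)%N).
Hypotheses (gm : riemannian_metric A g) (lc : levi_civita A g D).
Hypothesis KM : connection_map A (fun=> setT) D K.
Local Notation TA := (tangent_atlas A).
Let sTA : satlas TA := satlas_tangent sA.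
Let scf (a : index A) w x (ax : dom a x) : smooth_field_at A (cfield a w) x :=
  smooth_cfield sA w ax.
Let ctv (a : index A) x (ax : dom a x) : clin (tv a x) := clin_tv sA ax.
Let ccv (a : index A) x (ax : dom a x) : clin (cv a x) := clin_cv sA ax.

Definition christoffel (a : index A) i j (u : 'rV[R]_m) : 'rV[R]_m :=
  cv a (ichart a u) (D (ichart a u) (tv a (ichart a u) (delta_mx 0 i)) (cfield a (delta_mx 0 j))).

Lemma smooth_christoffel a i j : smooth_on (cimg a) (christoffel a i j).
Proof.
apply: smooth_onT => [|u uc]; first exact: open_cimg.
have [au uE] := cimgK sA uc.
have sf := lc_smooth lc (scf (delta_mx 0 i) au) (scf (delta_mx 0 j) au).
have [U [oU Uu _ sU]] := (smooth_fieldP sA _ au).1 sf.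
by exists U; rewrite uE in Uu; split=> //; exact sU.
Qed.

Definition christoffel_sum (a : index A) (h w u : 'rV[R]_m) : 'rV[R]_m :=
  \sum_i h 0 i *: \sum_j w 0 j *: christoffel a i j u.

Lemma connection_coords (a : index A) u w h : cimg a u ->
  D (ichart a u) (tv a (ichart a u) h) (cfield a w) = tv a (ichart a u) (christoffel_sum a h w u).
Proof.
move=> uc; have [au uE] := cimgK sA uc; set x := ichart a u in au *.
have c1 : clin (fun h => cv a x (D x (tv a x h) (cfield a w))).
  apply: clin_findim => c h1 h2.
  rewrite (clinD (c *: h1) h2 (ctv au)) (clinZ c h1 (ctv au)) (lc_linear lc (scf w au)).
  by rewrite (clinD _ _ (ccv au)) (clinZ _ _ (ccv au)).
have c2 i : clin (fun w => cv a x (D x (tv a x (delta_mx 0 i)) (cfield a w))).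
  apply: clin_findim => c w1 w2.
  refine (eq_trans (congr1 (cv a x)
    (connection_cfield_linear sA lc (tv a x (delta_mx 0 i)) c w1 w2 au)) _).
  by rewrite (clinD _ _ (ccv au)) (clinZ _ _ (ccv au)).
have E : cv a x (D x (tv a x h) (cfield a w)) = christoffel_sum a h w u.
  rewrite {1}(row_sum_delta h) (clin_sum _ c1); apply: eq_bigr => i _.
  rewrite (clinZ (h 0 i) (delta_mx 0 i) c1); congr (_ *: _).
  rewrite {1}(row_sum_delta w) (clin_sum _ (c2 i)); apply: eq_bigr => j _.
  exact (clinZ (w 0 j) (delta_mx 0 j) (c2 i)).
by rewrite -E; apply: esym; exact: cvK.
Qed.

(* With [c = (1 + 1)^-p] this is the (p,q)-metric at unit vectors; a constant [c]
   spares the smoothness of the real power. *)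
Definition sphere_form (c q : R) : @form R ('rV[R]_m * 'rV[R]_m)%type (M * 'rV[R]_m)%type :=
  fun z al be =>
    g z.1 (mdiff TA A fst z al) (mdiff TA A fst z be) +
    c * (g z.1 (K z al) (K z be) + q * g z.1 (K z al) z.2 * g z.1 (K z be) z.2).

Lemma smooth_christoffel_sum (a : index A) (W : normedModType R) {fW : findim W} (O : set W)
   (u h w : W -> 'rV[R]_m) : open O -> (forall z, O z -> cimg a (u z)) ->
  smooth_on O u -> smooth_on O h -> smooth_on O w ->
  smooth_on O (fun z => christoffel_sum a (h z) (w z) (u z)).
Proof.
move=> oO Oc su sh sw; apply: (smooth_sum _ _ oO) => i.
apply: (smoothZ oO); first exact: smooth_mxE.
apply: (smooth_sum _ _ oO) => j.
apply: (smoothZ oO); first exact: smooth_mxE.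
apply: (smooth_comp oO (open_cimg sA a)) => //; exact: smooth_christoffel.
Qed.

Lemma K_homogeneous z c al : K z (c *: al) = c *: K z al.
Proof.
have [_ l _] := KM (I : total_space (fun=> setT) z).
have t0 v := tangent_to_total sA z v.
have K0 : K z 0 = 0.
  by have := l 1 0 0 (t0 0) (t0 0); rewrite !scale1r addr0 => /eqP; rewrite -subr_eq0 opprD addNKr oppr_eq0 => /eqP.
by have := l c al 0 (t0 al) (t0 0); rewrite K0 !addr0.
Qed.

Lemma sphere_form_coords c q (a : index A) u w h l : cimg a u ->
  sphere_form c q (ichart a u, tv a (ichart a u) w)
    (tv (a : index TA) (ichart a u, tv a (ichart a u) w) (h, l))
    (tv (a : index TA) (ichart a u, tv a (ichart a u) w) (h, l)) =
  let B v w := (v *m gram (g := g) a u *m w^T) 0 0 in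
  let k := christoffel_sum a h w u + l in
  B h h + c * (B k k + q * B k w * B k w).
Proof.
move=> uc /=; have [au uE] := cimgK sA uc.
set z := (ichart a u, _); set al := tv _ z _.
have E1 : mdiff TA A fst z al = tv a (ichart a u) h by exact: mdiff_fst.
have E2 : K z al = tv a (ichart a u) (christoffel_sum a h w u + l).
  refine (eq_trans (K_coords sA m0 lc KM w h l au) _).
  rewrite (connection_coords w h uc); apply: esym; exact: (clinD _ _ (ctv au)).
have G v v' : g (ichart a u) (tv a (ichart a u) v) (tv a (ichart a u) v') =
    (v *m gram (g := g) a u *m v'^T) 0 0.
  by rewrite (gramE sA gm v v' au) uE.
rewrite -!G /sphere_form -/(z.1) -/(z.2).
rewrite -> E1, E2; reflexivity.
Qed.

Lemma cform_sphere_form c q : cform TA (sphere_form c q).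
Proof.
apply: (cform_coords sTA) => [z r al|a].
  have cf : clin (mdiff TA A fst z) by exact (clin_mdiff (smooth_at_fst sA z)).
  rewrite /sphere_form K_homogeneous (clinZ _ _ cf) !(rm_Zl gm) !(rm_Zr gm); ring.
set O := [set _ | _].
have oO : open O by apply: openXT; exact: open_cimg.
have Oc z : O z -> cimg (a : index A) z.1.1 by rewrite /O /= tangent_cimg.
pose V2 := ('rV[R]_m * 'rV[R]_m)%type.
have s1 : smooth_on O (fun z : V2 * V2 => z.1.1).
  by apply: (smooth_linear oO); exact: (clin_comp (clin_fst V2 V2) (clin_fst _ _)).
have s2 : smooth_on O (fun z : V2 * V2 => z.1.2).
  by apply: (smooth_linear oO); exact: (clin_comp (clin_fst V2 V2) (clin_snd _ _)).
have s3 : smooth_on O (fun z : V2 * V2 => z.2.1).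
  by apply: (smooth_linear oO); exact: (clin_comp (clin_snd V2 V2) (clin_fst _ _)).
have s4 : smooth_on O (fun z : V2 * V2 => z.2.2).
  by apply: (smooth_linear oO); exact: (clin_comp (clin_snd V2 V2) (clin_snd _ _)).
pose k (z : V2 * V2) := christoffel_sum (a : index A) z.2.1 z.1.2 z.1.1 + z.2.2.
have sk : smooth_on O k by apply: smoothD => //; exact: smooth_christoffel_sum.
pose B (v w : V2 * V2 -> 'rV[R]_m) z : R^o := (v z *m gram (g := g) (a : index A) z.1.1 *m (w z)^T) 0 0.
have sB v w : smooth_on O v -> smooth_on O w -> smooth_on O (B v w).
  by move=> sv sw; apply: (smooth_bilinear sA gm oO).
have sc r : smooth_on O (fun=> r : R^o) by exact: smooth_cst.
exists (fun z => B (fun z => z.2.1) (fun z => z.2.1) z + c * (B k k z + q * B k (fun z => z.1.2) z * B k (fun z => z.1.2) z) : R^o); split.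
  apply: smoothD => //; first exact: sB.
  apply: smoothM => //; apply: smoothD => //; first exact: sB.
  apply: smoothM => //; last exact: sB.
  by apply: smoothM => //; exact: sB.
move=> [u w] [h l] ouw; have uc : cimg (a : index A) u by move: ouw; rewrite tangent_cimg.
have E := tangent_ichartE sA (uc : cimg (a : index A) (u, w).1).
rewrite -> E.
exact (sphere_form_coords c q w h l uc).
Qed.

End SphereForm.

Lemma near_shift (R : realType) (t : R) (Q : R -> Prop) :
  (\forall s \near t, Q s) -> \forall r \near (0 : R), Q (t + 1 * r).
Proof.
move=> Qt; have ct : t + 1 * r @[r --> (0 : R)] --> t + 1 * 0.
  by apply: cvgD; [exact: cvg_cst|apply: cvgM; [exact: cvg_cst|exact: cvg_id]].
by apply: ct; rewrite mulr0 addr0.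
Qed.

Section HorizontalForm.
Context {R : realType} {m k : nat} {M Mt : Type}.
Context {A : atlas 'rV[R]_m M} {At : atlas 'rV[R]_k Mt}.
Context {g : @form R 'rV[R]_m M} {gt : @form R 'rV[R]_k Mt} {P : Mt -> M}.
Hypotheses (sA : satlas A) (sAt : satlas At) (m0 : (0 < m)%N).
Hypotheses (gm : riemannian_metric A g) (gtm : riemannian_metric At gt).
Hypothesis Psub : riemannian_submersion At A P gt g.
Hypothesis Hint : integrable_distribution 'rV[R]_m At (horizontal At A P gt).
Variable f : M -> R.
Hypotheses (f0 : forall x, 0 < f x) (fs : forall x, smooth_fun_at A f x).
Local Notation dP := (mdiff At A P).
Local Notation hor := (horizontal At A P gt).
Local Notation lift := (lift (A := A) (At := At) (gt := gt) (P := P)).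
Local Notation gn := (warp At A P gt f).
Local Notation TA := (tangent_atlas A).
Local Notation TAt := (tangent_atlas At).
Local Notation horn := (horizontal At A P gn).
Local Notation Ps := (tangent_map At A P).
Context {D : @connection R 'rV[R]_m M} {Dt : @connection R 'rV[R]_k Mt}.
Hypotheses (lc : levi_civita A g D) (lct : levi_civita At gn Dt).
Context {K : M * 'rV[R]_m -> 'rV[R]_m * 'rV[R]_m -> 'rV[R]_m}.
Context {Kt : Mt * 'rV[R]_k -> 'rV[R]_k * 'rV[R]_k -> 'rV[R]_k}.
Hypothesis KM : connection_map A (fun=> setT) D K.
Hypothesis KtM : connection_map At horn (projected_connection gn horn Dt) Kt.
Variables (p q : R).
Hypothesis q0 : 0 <= q.
Let sTA : satlas TA := satlas_tangent sA.
Let sTAt : satlas TAt := satlas_tangent sAt.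
Let gnm := warp_metric sA sAt gm gtm Psub f0 fs.
Let hornE : horn = hor := hor_warp sA sAt gm gtm Psub f0.
Local Notation QS := (sphere_form (A := A) (g := g) (K := K) ((1 + 1) `^ p)^-1 q).
Local Notation SM := (unit_bundle g (fun=> setT)).
Local Notation EM := (unit_bundle gn horn).

(** By [warpE] this is [f (P y) ^+ 2 * gt y (ver y u) (ver y v)]; written as a difference, its
    continuity follows from that of [gn] and of a pull-back. *)
Definition vertical_form : @form R 'rV[R]_k Mt :=
  fun y u v => gn y u v - g (P y) (dP y u) (dP y v).

(* At unit horizontal vectors this is the (p,q)-metric, but [Kt] is unspecified on
   vectors that are not tangent to the horizontal bundle, where this form is
   smooth. *)
Definition horizontal_sphere_form : @form R ('rV[R]_k * 'rV[R]_k)%type (Mt * 'rV[R]_k)%type :=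
  fun z al be => vertical_form z.1 (mdiff TAt At fst z al) (mdiff TAt At fst z be) +
    QS (Ps z) (mdiff TAt TA Ps z al) (mdiff TAt TA Ps z be).
Local Notation QE := horizontal_sphere_form.

Lemma gn_hor y u v : hor y v -> gn y u v = g (P y) (dP y u) (dP y v).
Proof.
move=> hv; have E := lift_dP sA sAt gtm Psub hv.
refine (eq_trans (congr1 (gn y u) (esym E)) _).
exact (warp_lift sA sAt gtm Psub f y u (dP y v)).
Qed.

Lemma vertical_form_ge0 y u : 0 <= vertical_form y u u.
Proof.
rewrite /vertical_form (warpE sA sAt gtm Psub) addrC addKr.
by apply: mulr_ge0; [exact: sqr_ge0|exact: (rm_ge0 gtm)].
Qed.

Lemma vertical_form_hor y u : hor y u -> vertical_form y u u = 0.
Proof. by move=> hu; rewrite /vertical_form gn_hor// subrr. Qed.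

Lemma cform_gn : cform At gn. Proof. exact: cform_riemannian sAt gnm. Qed.

Lemma cform_vertical_form : cform At vertical_form.
Proof.
apply: cformB; first exact: cform_gn.
exact (cform_pullback sAt sA (P_smooth Psub) (cform_riemannian sA gm)).
Qed.

Let sPs z : smooth_at TAt TA Ps z.
Proof. exact (smooth_tangent_map sAt sA (F := P) (z := z) (P_smooth Psub z.1)). Qed.

Lemma cform_QE : cform TAt QE.
Proof.
apply: cformD.
  exact (cform_pullback sTAt sAt (smooth_at_fst sAt) cform_vertical_form).
exact (cform_pullback sTAt sTA sPs (cform_sphere_form sA m0 gm lc KM _ _)).
Qed.

Lemma pq_metric_sphere z al : SM z -> pq_metric A g K p q z al al = QS z al al.
Proof. by move=> [_ z1]; rewrite /pq_metric z1. Qed.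

Lemma fst_Ps z al : mdiff TA A fst (Ps z) (mdiff TAt TA Ps z al) =
  dP z.1 (mdiff TAt At fst z al).
Proof.
have C1 : mdiff TAt A (fst \o Ps) z al = mdiff TA A fst (Ps z) (mdiff TAt TA Ps z al).
  exact: (mdiff_comp sTAt sTA al (sPs z) (smooth_at_fst sA (Ps z))).
have C2 : mdiff TAt A (P \o fst) z al = dP z.1 (mdiff TAt At fst z al).
  exact: (mdiff_comp sTAt sAt al (smooth_at_fst sAt z) (P_smooth Psub z.1)).
exact (eq_trans (esym C1) C2).
Qed.

Lemma Ps_in z : EM z -> SM (Ps z).
Proof.
case: z => y eta [hz z1]; split=> //.
have hz' : hor y eta by rewrite -hornE; exact hz.
exact (eq_trans (esym (gn_hor eta hz')) z1).
Qed.

(** The values of [Kt] on tangent vectors are horizontal, so [gn] of them is [g] of their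
    projections, which [dP_Kt] identifies. The fibre terms thus come from [SM], and the base term
    splits into its vertical part and the base term of [SM]. *)
Lemma pq_metric_horizontal z al : EM z -> tangent_to TAt (total_space horn) z al ->
  pq_metric At gn Kt p q z al al = QE z al al.
Proof.
move=> [hz z1] tal; have [Kh _ _] := KtM hz.
have hK : hor z.1 (Kt z al) by rewrite -hornE; exact (Kh al tal).
have hz' : hor z.1 z.2 by rewrite -hornE; exact hz.
have dK := dP_Kt sA sAt m0 gm gtm Psub Hint f0 fs lc lct KM KtM hz tal.
have E1 := eq_trans (gn_hor (Kt z al) hK) (f_equal2 (fun a b => g (P z.1) a b) dK dK).
have E2 := eq_trans (gn_hor (Kt z al) hz') (congr1 (fun a => g (P z.1) a (dP z.1 z.2)) dK).
have core (c r0 r1 r2 r3 s1 s2 s3 : R) : r1 = s1 -> r2 = s2 -> r3 = s3 ->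
    r0 + c * (r1 + q * r2 * r2) = r0 - s3 + (r3 + c * (s1 + q * s2 * s2)).
  by move=> -> -> ->; ring.
have E3 : g (Ps z).1 (mdiff TA A fst (Ps z) (mdiff TAt TA Ps z al)) (mdiff TA A fst (Ps z) (mdiff TAt TA Ps z al)) =
  g (P z.1) (dP z.1 (mdiff TAt At fst z al)) (dP z.1 (mdiff TAt At fst z al)).
  exact (f_equal2 (fun a b => g (P z.1) a b) (fst_Ps z al) (fst_Ps z al)).
have F := core ((1 + 1) `^ p)^-1 (gn z.1 (mdiff TAt At fst z al) (mdiff TAt At fst z al)) _ _ _ _ _ _ E1 E2 E3.
rewrite /pq_metric z1; exact F.
Qed.

Lemma sphere_form_ge z al : g z.1 (mdiff TA A fst z al) (mdiff TA A fst z al) <= QS z al al.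
Proof.
rewrite /sphere_form lerDl; apply: mulr_ge0; first by rewrite invr_ge0 powR_ge0.
apply: addr_ge0; first exact: (rm_ge0 gm).
by rewrite -mulrA; apply: mulr_ge0 => //; rewrite -expr2 sqr_ge0.
Qed.

Lemma dP_le y v : g (P y) (dP y v) (dP y v) <= gn y v v.
Proof. by have := vertical_form_ge0 y v; rewrite /vertical_form subr_ge0. Qed.

Lemma Ps_le z al : QS (Ps z) (mdiff TAt TA Ps z al) (mdiff TAt TA Ps z al) <= QE z al al.
Proof. by rewrite /QE lerDr; exact: vertical_form_ge0. Qed.

(** The form on [SM] dominates its base term because [q] is nonnegative, and that term restores what
    [vertical_form] subtracts from [gn]. Hence the projection to [Mt] is 1-Lipschitz. *)
Lemma fst_le z al : gn z.1 (mdiff TAt At fst z al) (mdiff TAt At fst z al) <= QE z al al.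
Proof.
have E := sphere_form_ge (Ps z) (mdiff TAt TA Ps z al).
rewrite -> fst_Ps in E.
have core (r s t : R) : s <= t -> r <= r - s + t by move=> ?; lra.
exact (core _ _ _ E).
Qed.

Lemma rdist_sphere : unit_bundle_dist A g (fun=> setT) K p q = rdist TA QS SM.
Proof.
have H c (t : R) : smooth_curve_at TA c t -> (\forall s \near t, SM (c s)) ->
    pq_metric A g K p q (c t) (velocity TA c t) (velocity TA c t) =
    QS (c t) (velocity TA c t) (velocity TA c t).
  by move=> _ St; apply: pq_metric_sphere; exact: nbhs_singleton St.
exact (rdist_ext sTA (cform_sphere_form sA m0 gm lc KM _ q) H).
Qed.

Lemma rdist_horizontal : unit_bundle_dist At gn horn Kt p q = rdist TAt QE EM.
Proof.
have H c (t : R) : smooth_curve_at TAt c t -> (\forall s \near t, EM (c s)) ->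
    pq_metric At gn Kt p q (c t) (velocity TAt c t) (velocity TAt c t) =
    QE (c t) (velocity TAt c t) (velocity TAt c t); last exact (rdist_ext sTAt cform_QE H).
move=> sc Et; apply: pq_metric_horizontal; first exact: nbhs_singleton Et.
(* [tangent_to] asks for a curve passing through the point at time 0; the time shift is written
   [t + 1 * r] to fit [curve_affine]. *)
have sc' : smooth_curve_at TAt c (t + 1 * 0) by rewrite mulr0 addr0.
have [s1 v1] := curve_affine sTAt sc'.
exists (fun r => c (t + 1 * r)); split; [exact s1| | |].
- by apply: filterS (near_shift Et) => r [].
- by rewrite mulr0 addr0.
- by rewrite v1 scale1r mulr0 addr0.
Qed.

End HorizontalForm.

Section IsometricSections.
Context {R : realType} {m k : nat} {M Mt : Type}.
Context {A : atlas 'rV[R]_m M} {At : atlas 'rV[R]_k Mt}.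
Context {g : @form R 'rV[R]_m M} {gt : @form R 'rV[R]_k Mt} {P : Mt -> M}.
Hypotheses (sA : satlas A) (sAt : satlas At).
Hypotheses (gm : riemannian_metric A g) (gtm : riemannian_metric At gt).
Hypothesis Psub : riemannian_submersion At A P gt g.
Hypothesis Hint : integrable_distribution 'rV[R]_m At (horizontal At A P gt).
Variable f : M -> R.
Hypotheses (f0 : forall x, 0 < f x).
Local Notation dP := (mdiff At A P).
Local Notation hor := (horizontal At A P gt).
Local Notation lift := (lift (A := A) (At := At) (gt := gt) (P := P)).
Local Notation gn := (warp At A P gt f).
Local Notation TA := (tangent_atlas A).
Local Notation TAt := (tangent_atlas At).
Local Notation horn := (horizontal At A P gn).
Local Notation Ps := (tangent_map At A P).
Variables (K : M * 'rV[R]_m -> 'rV[R]_m * 'rV[R]_m -> 'rV[R]_m) (p q : R).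
Let sTA : satlas TA := satlas_tangent sA.
Let sTAt : satlas TAt := satlas_tangent sAt.
Let hornE : horn = hor := hor_warp sA sAt gm gtm Psub f0.
Local Notation QS := (sphere_form (A := A) (g := g) (K := K) ((1 + 1) `^ p)^-1 q).
Local Notation QE := (horizontal_sphere_form (A := A) (At := At) (g := g) (gt := gt) (P := P) f (K := K) p q).
Local Notation SM := (unit_bundle g (fun=> setT)).
Local Notation EM := (unit_bundle gn horn).

Lemma leaf_section_near y : exists s : M -> Mt, s (P y) = y /\
  \forall x \near mnbhs A (P y), [/\ smooth_at A At s x, P (s x) = x,
    (forall v, hor (s x) (mdiff A At s x v)) & forall v, dP (s x) (mdiff A At s x v) = v].
Proof.
have [s [sy near_s]] := leaf_section sA sAt gtm Psub Hint y.
exists s; split => //.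
have near2 := mnbhs_interior sA near_s.
apply: filterS near2 => x nx; have [ss Ps hs] := mnbhs_singleton sA nx.
split=> // v.
apply: (dP_mdiff_section sA sAt Psub v ss).
by apply: filterS nx => x' [].
Qed.

Lemma gn_section (s : M -> Mt) x v : hor (s x) (mdiff A At s x v) -> P (s x) = x ->
  dP (s x) (mdiff A At s x v) = v ->
  gn (s x) (mdiff A At s x v) (mdiff A At s x v) = g x v v.
Proof.
move=> hs Psx dv.
refine (eq_trans (gn_hor sA sAt gtm Psub f _ hs) _).
refine (eq_trans (f_equal2 (fun a b => g (P (s x)) a b) dv dv) _).
by rewrite Psx.
Qed.

Lemma isometric_section_base y : exists s : M -> Mt,
  local_isometric_section (A := At) (A' := A) gn setT g setT P y s.
Proof.
have [s [sy near_s]] := leaf_section_near y.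
exists s; split=> //; apply: filterS near_s => x [ss Psx hs ds]; split=> // v.
exact (gn_section (hs v) Psx (ds v)).
Qed.

(** For the differential of a leaf section, the vertical part of the form vanishes because the
    section is horizontal, and the rest is the form of [SM] because [Ps] undoes it. All conditions
    on [s] concern base points, so they hold along whole fibres of the tangent bundle. *)
Lemma isometric_section_sphere z : EM z -> exists s : M * 'rV[R]_m -> Mt * 'rV[R]_k,
  local_isometric_section (A := TAt) (A' := TA) QE EM QS SM Ps z s.
Proof.
case: z => y eta [hz _]; have hy : hor y eta by rewrite -hornE; exact hz.
have [s [sy near_s]] := leaf_section_near y.
pose s2 := tangent_map A At s.
have [ss0 Ps0 hs0 ds0] := mnbhs_singleton sA near_s.
exists s2; split.
  have dE : dP (s (P y)) (mdiff A At s (P y) (dP y eta)) = dP (s (P y)) eta.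
    by rewrite ds0 sy.
  have hy' : hor (s (P y)) eta by rewrite sy.
  have E := hor_inj gtm Psub (hs0 (dP y eta)) hy' dE.
  exact (f_equal2 pair sy E).
have near2 := mnbhs_interior sA near_s.
have near_fst z (Q : M -> Prop) : mnbhs A z.1 Q -> mnbhs TA z (fun z => Q z.1).
  by apply: (smooth_at_cont sTA sA); exact: smooth_at_fst.
apply: filterS (near_fst (Ps (y, eta)) _ near2) => z nz.
have [ss Psx hs ds] := mnbhs_singleton sA nz.
have ss2 : smooth_at TA TAt s2 z by exact (smooth_tangent_map sA sAt (F := s) (z := z) ss).
have PE : Ps (s2 z) = z.
  case: z Psx ds {nz ss hs ss2} => x xi /= Psx ds.
  exact (f_equal2 pair Psx (ds xi)).
split.
- exact ss2.
- move=> [_ z1]; split; first by rewrite hornE; exact (hs z.2).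
  exact (eq_trans (gn_section (hs z.2) Psx (ds z.2)) z1).
- exact PE.
move=> v.
have idn : \forall z' \near mnbhs TA z, (Ps \o s2) z' = id z'.
  apply: filterS (near_fst z _ nz) => -[x xi] [_ Px _ dx]; exact (f_equal2 pair Px (dx xi)).
have sPs : smooth_at TAt TA Ps (s2 z).
  exact (smooth_tangent_map sAt sA (F := P) (z := s2 z) (P_smooth Psub (s2 z).1)).
have E1 : mdiff TAt TA Ps (s2 z) (mdiff TA TAt s2 z v) = v.
  have C : mdiff TA TA (Ps \o s2) z v = mdiff TAt TA Ps (s2 z) (mdiff TA TAt s2 z v).
    exact: (mdiff_comp sTA sTAt v ss2 sPs).
  have C2 : mdiff TA TA (Ps \o s2) z = mdiff TA TA id z by exact: mdiff_ext.
  have C3 : mdiff TA TA id z v = v by exact: mdiff_id.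
  exact (eq_trans (esym C) (eq_trans (congr1 (fun F => F v) C2) C3)).
have E2 : mdiff TAt At fst (s2 z) (mdiff TA TAt s2 z v) = mdiff A At s z.1 (mdiff TA A fst z v).
  have C : mdiff TA At (fst \o s2) z v = mdiff TAt At fst (s2 z) (mdiff TA TAt s2 z v).
    exact: (mdiff_comp sTA sTAt v ss2 (smooth_at_fst sAt (s2 z))).
  have C2 : mdiff TA At (s \o fst) z v = mdiff A At s z.1 (mdiff TA A fst z v).
    exact: (mdiff_comp sTA sA v (smooth_at_fst sA z) ss).
  exact (eq_trans (esym C) C2).
have V0 : vertical_form (A := A) (At := At) (g := g) (gt := gt) (P := P) f (s z.1)
    (mdiff A At s z.1 (mdiff TA A fst z v)) (mdiff A At s z.1 (mdiff TA A fst z v)) = 0.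
  exact (vertical_form_hor sA sAt gtm Psub f (hs _)).
have F1 := eq_trans (f_equal2 (fun a b => vertical_form (A := A) (At := At) (g := g) (gt := gt) (P := P) f (s z.1) a b) E2 E2) V0.
have F2 : QS (Ps (s2 z)) (mdiff TAt TA Ps (s2 z) (mdiff TA TAt s2 z v)) (mdiff TAt TA Ps (s2 z) (mdiff TA TAt s2 z v)) = QS z v v.
  refine (eq_trans (f_equal2 (fun a b => QS (Ps (s2 z)) a b) E1 E1) _).
  exact (congr1 (fun z => QS z v v) PE).
exact (eq_trans (f_equal2 (fun a b => a + b) F1 F2) (add0r _)).
Qed.

End IsometricSections.

(** * Compactness *)

Section Compactness.
Context {R : realType}.

Lemma compact_finite_cover (T : topologicalType) (K : set T) (U : T -> set T) :
  compact K -> (forall x, K x -> nbhs x (U x)) ->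
  exists s : seq T, forall y, K y -> exists x, [/\ x \in s, K x & U x y].
Proof.
move=> /compact_near_coveringP cK HU.
(* Finite lists directed by inclusion: a property holds eventually along [F] when it holds for every
   list containing some fixed one. This brings the covering into the near-covering form of
   compactness. *)
pose F : set_system (seq T) := fun Q => exists s0 : seq T, forall s, {subset s0 <= s} -> Q s.
have FF : Filter F.
  split; first by exists [::].
    move=> Q1 Q2 [s1 H1] [s2 H2]; exists (s1 ++ s2) => s ss.
    by split; [apply: H1|apply: H2] => x xs; apply: ss; rewrite mem_cat xs ?orbT.
  by move=> Q1 Q2 Q12 [s1 H1]; exists s1 => s /H1 /Q12.
have [s0 H] : \near F, K `<=` (fun y => exists x, [/\ x \in F, K x & U x y]).
  apply: cK => x Kx; exists (U x, [set s : seq T | x \in s]); first split => /=; first exact: HU.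
    by exists [:: x] => s ss; apply: ss; rewrite inE.
  by move=> [y s] [/= Uy xs]; exists x.
by exists s0; apply: H.
Qed.

(** Near each [t] all large enough constants work, uniformly for [u] near [u0]; compactness is
    applied along the product of the filters at [u0] and at infinity, which produces one constant
    and one neighbourhood for all [t]. *)
Lemma dominated_on_compact (T U : topologicalType) (K : set T) (u0 : U) (f1 f2 : U * T -> R) :
  compact K -> (forall t, K t -> {for (u0, t), continuous f1}) ->
  (forall t, K t -> {for (u0, t), continuous f2}) -> (forall t, K t -> 0 < f2 (u0, t)) ->
  exists2 C, 0 < C & \forall u \near u0, forall t, K t -> f1 (u, t) <= C * f2 (u, t).
Proof.
move=> /compact_near_coveringP cK c1 c2 f2p.
have [[A1 B1] [/= nA nB] H] : \forall z \near filter_prod (nbhs u0) (@pinfty_nbhs R),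
    K `<=` (fun t => f1 (z.1, t) <= z.2 * f2 (z.1, t)).
  apply: cK => t Kt.
  (* Near [(u0, t)] the function [f1] exceeds its value by at most 1 and [f2] keeps at least half of
     its positive value. *)
  pose C0 := (`|f1 (u0, t)| + 1) / (f2 (u0, t) / 2).
  have f2t := f2p t Kt.
  have n1 : nbhs (u0, t) [set z | f1 z < f1 (u0, t) + 1].
    by apply: cvgr_lt (c1 t Kt) _ _; rewrite ltrDl.
  have n2 : nbhs (u0, t) [set z | f2 (u0, t) / 2 < f2 z].
    by apply: cvgr_gt (c2 t Kt) _ _; lra.
  have [[A2 B2] [/= nA2 nB2] H2] := filterI n1 n2.
  exists (B2, [set z | A2 z.1 /\ C0 <= z.2]).
    split; first exact: nB2.
    exists (A2, [set C | C0 <= C]); last by move=> [u C].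
    by split; [exact: nA2|exact: (nbhs_pinfty_ge (num_real C0))].
  move=> [t' [u C]] [/= Bt [Au CC]]; have [/= h1 h2] := H2 (u, t') (conj Au Bt).
  have C00 : 0 < C0 by rewrite divr_gt0 ?divr_gt0// ltr_wpDl.
  apply: (le_trans (ltW h1)); apply: le_trans (_ : C0 * (f2 (u0, t) / 2) <= _).
    rewrite /C0 divfK ?lerD2r ?ler_norm//; apply: lt0r_neq0; lra.
  apply: ler_pM => //; [exact: ltW|lra|exact: ltW].
have [C [BC C0]] : exists C, B1 C /\ 0 < C.
  have n0 : \forall C \near +oo, B1 C /\ 0 < C.
    by apply: filterI; [exact: nB|exact: (nbhs_pinfty_gt (num_real 0))].
  by have [C HC] := filter_ex n0; exists C.
by exists C => //; apply: filterS nA => u Au t Kt; exact: (H (u, C)).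
Qed.

Lemma cvg_skip_middle (T1 T2 T3 : topologicalType) (x : T1) (y : T2) (z : T3) :
  (t.1, t.2.2) @[t --> (x, (y, z))] --> (x, z).
Proof.
move=> Q [[B1 B3] [/= n1 n3] H]; exists (B1, [set t | B3 t.2]).
  split; first exact: n1.
  by exists (setT, B3); [split; [exact: filterT|exact: n3]|move=> [a b] []].
by move=> [a [b c]] [/= a1 c3]; exact: (H (a, c)).
Qed.

Lemma quadratic_scale n (G : 'M[R]_n) c (h : 'rV[R]_n) :
  ((c *: h) *m G *m (c *: h)^T) 0 0 = c ^+ 2 * (h *m G *m h^T) 0 0.
Proof. by rewrite linearZ /= -scalemxAr -!scalemxAl scalerA mxE expr2. Qed.

Lemma sphere_compact n : compact [set h : 'rV[R]_n | `|h| = 1].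
Proof.
apply: bounded_closed_compact.
  exists 1; split; first exact: num_real.
  by move=> r r1 h /= ->; exact: ltW.
rewrite (_ : [set h | _] = (fun h : 'rV[R]_n => `|h|) @^-1` [set 1])//.
apply: closed_comp; last exact: closed_eq.
by move=> x _; exact: norm_continuous.
Qed.

Lemma closed_ball_rV_compact n (u0 : 'rV[R]_n) r : 0 < r -> compact (closed_ball u0 r).
Proof.
move=> r0; apply: bounded_closed_compact; last exact: closed_ball_closed.
exists (`|u0| + r); split; first exact: num_real.
move=> t rt h; rewrite closed_ballE// /closed_ball_ /= => hr.
rewrite -(subrK u0 h); apply: le_trans (ler_normD _ _) _.
by rewrite addrC (distrC h u0); apply: le_trans (lerD (lexx _) hr) (ltW rt).
Qed.

End Compactness.

(** * The Riemannian distance and the topology of the manifold *)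

Section ManifoldTopology.
Context {R : realType} {n : nat} {M : topologicalType} {A : atlas 'rV[R]_n M}.
Hypothesis Mm : smooth_manifold A.

Lemma satlas_manifold : satlas A.
Proof.
split.
- exact: (mfd_cover Mm).
- exact: (mfd_chartK Mm).
- move=> a b.
  have -> : overlap a b = [set u | cimg a u /\ dom b (ichart a u)].
    apply/seteqP; split=> [_ [x [ax bx] <-]|u [[x ax <-]]].
      by split; [exists x|rewrite (mfd_chartK Mm)].
    by rewrite (mfd_chartK Mm) // => bx; exists x.
  apply: open_preimage_on; [exact: (mfd_open_img Mm)|exact: (mfd_open_dom Mm)|].
  exact: (mfd_ichart_cont Mm).
- exact: (mfd_transition Mm).
Qed.
Let sA := satlas_manifold.

Lemma mnbhs_nbhs x (Q : set M) : mnbhs A x Q <-> nbhs x Q.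
Proof.
have ax := mfd_cover Mm x; set a := chart_at A x in ax; split=> H.
- have nd : nbhs x (dom a) by apply: open_nbhs_nbhs; split => //; exact: (mfd_open_dom Mm).
  have H2 := (mfd_chart_cont Mm ax) _ H.
  by apply: filterS (filterI nd H2) => y [ay] /=; rewrite (mfd_chartK Mm ay).
- have xi : (chart a @` dom a) (chart a x) by exists x.
  apply: (mfd_ichart_cont Mm xi).
  by rewrite (mfd_chartK Mm ax).
Qed.

Lemma continuous_smooth_at (W : normedModType R) {fW : findim W} (Y : Type) (B : atlas W Y)
    (sB : satlas B) (F : Y -> M) y (Q : set M) : smooth_at B A F y -> nbhs (F y) Q ->
  mnbhs B y (fun y => Q (F y)).
Proof. by move=> sF /mnbhs_nbhs; exact: smooth_at_cont. Qed.

(** A C^1 cut-off is enough for the bump functions below, as only their first derivative along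
    curves is estimated. *)
Definition sqpos (s : R^o) : R^o := Num.max 0 s ^+ 2.

Lemma sqpos_differentiable s : differentiable sqpos s /\ forall h, 'D_h sqpos s = 2 * Num.max 0 s * h.
Proof.
have cl : clin (fun h : R^o => 2 * Num.max 0 s * h : R^o).
  apply: clin_findim => c u v; rewrite /GRing.scale /=; ring.
have H e : 0 < e -> \forall h \near (0 : R^o), `|sqpos (s + h) - sqpos s - 2 * Num.max 0 s * h| <= e * `|h|.
  move=> e0; apply/nbhs_ballP; exists e => //= h; rewrite -ball_normE /= sub0r normrN => he.
  apply: (@le_trans _ _ (`|h| * `|h|)); last by rewrite ler_wpM2r // ltW.
  rewrite -normrM -expr2 [X in _ <= X]ger0_norm ?sqr_ge0// /sqpos ler_norml.
  have [s0|s0] := leP s 0; have [t0|t0] := leP (s + h) 0.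
  - have := sqr_ge0 h; lra.
  - by apply/andP; split; nra.
  - by apply/andP; split; nra.
  - by apply/andP; split; nra.
have [d E] := differentiable_eps cl H.
by split=> // h; rewrite deriveE.
Qed.

Section Riemannian.
Context {g : @form R 'rV[R]_n M}.
Hypothesis gm : riemannian_metric A g.
Local Notation d := (rdist A g setT).

Lemma smooth_ichart (a : index A) u : cimg a u ->
  smooth_at (euclid 'rV[R]_n) A (ichart a) u.
Proof.
move=> ua; have [au uE] := cimgK sA ua; have sE : satlas (euclid 'rV[R]_n) := satlas_euclid.
apply: (smooth_atI sE sA (a := tt) (b := a) (U := cimg a) (r := id)) => //.
- exact: open_cimg.
- by move=> v _; exists v.
- by move=> v /(cimgK sA).
- exact: smooth_id.
Qed.

Lemma rdist_near x e : 0 < e -> nbhs x (fun y => (d y x <= e%:E)%E).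
Proof.
move=> e0; have ax := sa_cover sA x; set a := chart_at A x in ax.
apply/mnbhs_nbhs/(mnbhsE sA _ ax).
have ux : cimg a (chart a x) by exists x.
have H : \forall v \near chart a x, (d (ichart a v) (ichart a (chart a x)) <= e%:E)%E.
  apply: (rdist_smooth_map sA (cform_riemannian sA gm) (open_cimg sA a) ux _ e0).
  by move=> v va; split=> //; exact: smooth_ichart.
by rewrite (sa_K sA ax) in H.
Qed.

(** Both sides are homogeneous of degree 2 in [h], so it suffices to compare them on the unit
    sphere, which is compact and where the metric is positive. The additional parameter [w] in a
    compact set makes the constant uniform over a family of forms. *)
Lemma gram_dominates (W : topologicalType) (K : set W) (a : index A) u0
    (f : 'rV[R]_n * (W * 'rV[R]_n) -> R) : cimg a u0 -> compact K ->
  (forall w h, K w -> {for (u0, (w, h)), continuous f}) ->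
  (forall u w c h, cimg a u -> K w -> f (u, (w, c *: h)) = c ^+ 2 * f (u, (w, h))) ->
  exists2 C, 0 < C & \forall u \near u0, forall w h, K w ->
    f (u, (w, h)) <= C * g (ichart a u) (tv a (ichart a u) h) (tv a (ichart a u) h).
Proof.
move=> ua cK cf fh.
pose f2 (z : 'rV[R]_n * (W * 'rV[R]_n)) : R := (z.2.2 *m gram (g := g) a z.1 *m (z.2.2)^T) 0 0.
have oU : open [set z : 'rV[R]_n * 'rV[R]_n | cimg a z.1] by apply: openXT; exact: open_cimg.
have sB : smooth_on [set z : 'rV[R]_n * 'rV[R]_n | cimg a z.1]
    (fun z => (z.2 *m gram (g := g) a z.1 *m (z.2)^T) 0 0 : R^o).
  by apply: (smooth_bilinear sA gm oU); [exact: smooth_fst|exact: smooth_snd|exact: smooth_snd|].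
have cB h := smooth_cont sB (ua : [set z : 'rV[R]_n * 'rV[R]_n | cimg a z.1] (u0, h)).
have cf2 w h : {for (u0, (w, h)), continuous f2}.
  move=> Q HQ; have H2 := cB h Q HQ.
  have H3 := @cvg_skip_middle 'rV[R]_n W 'rV[R]_n u0 w h _ H2.
  exact H3.
have [au uE] := cimgK sA ua.
have f2E u h w : cimg a u -> f2 (u, (w, h)) = g (ichart a u) (tv a (ichart a u) h) (tv a (ichart a u) h).
  move=> /(cimgK sA) [au' uE']; have E := gramE sA gm h h au'.
  exact (eq_trans (congr1 (fun u => (h *m gram (g := g) a u *m h^T) 0 0) (esym uE')) (esym E)).
have [C C0 H] : exists2 C, 0 < C & \forall u \near u0, forall t : W * 'rV[R]_n,
    (K `*` [set h : 'rV[R]_n | `|h| = 1]) t -> f (u, t) <= C * f2 (u, t).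
  apply: dominated_on_compact => [||[w h] _|[w h] [_ h1]]; first exact (compact_setX cK (@sphere_compact R n)).
  - by move=> [w h] [Kw _]; exact: cf.
  - exact: cf2.
  - rewrite f2E//; apply: (rm_pos gm); apply/eqP => th.
    have E : cv a (ichart a u0) (tv a (ichart a u0) h) = h by exact: tvK.
    have c0 : clin (cv a (ichart a u0)) by exact: clin_cv.
    by move: h1; rewrite /= -E th (clin0 c0) normr0 => /eqP; rewrite eq_sym oner_eq0.
exists C => //.
have nc : nbhs u0 (cimg a) by apply: open_nbhs_nbhs; split => //; exact: open_cimg.
apply: filterS2 H nc => u H uc w h Kw; rewrite -(f2E u h w uc).
have [->|h0] := eqVneq h 0.
  have f20 : f2 (u, (w, 0)) = 0 by rewrite /f2 /= !mul0mx mxE.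
  by have := fh u w 0 0 uc Kw; rewrite scale0r expr0n mul0r f20 mulr0 => ->.
have h0' : `|h| != 0 by rewrite normr_eq0.
have hE : h = `|h| *: (`|h|^-1 *: h) by rewrite scalerA divff// scale1r.
rewrite hE fh//; set h' := _ *: h.
have f2h : f2 (u, (w, `|h| *: h')) = `|h| ^+ 2 * f2 (u, (w, h')).
  exact: quadratic_scale.
rewrite f2h mulrCA ler_wpM2l ?sqr_ge0//; apply: H; split => //=.
by rewrite /h' normrZ normfV normr_id mulVf.
Qed.

(** In a chart, [psi] is the cut-off [sqpos] of [rho ^+ 2] minus the squared Euclidean distance to
    the centre, extended by zero. The Riemannian metric dominates the squared derivative of that
    distance function near the centre, so [psi] varies along a curve at most at [C] times its
    speed. *)
Lemma bump_function x0 (Q : set M) : nbhs x0 Q ->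
  exists (psi : M -> R) C, [/\ 0 < C, 0 < psi x0, (forall x, 0 < psi x -> Q x) &
    forall c t, smooth_curve_at A c t ->
      exists d, is_derive (t : R^o) (1 : R^o) (psi \o c : R^o -> R^o) d /\ `|d| <= C * speed A g c t].
Proof.
move=> nQ; have ax := sa_cover sA x0; set a := chart_at A x0 in ax; set u0 := chart a x0.
have u0c : cimg a u0 by exists x0.
pose q (u : 'rV[R]_n) : R^o := ((u - u0) *m (u - u0)^T) 0 0.
have oT := @openT 'rV[R]_n.
have sq : smooth_on setT q.
  have s0 : smooth_on setT (fun u : 'rV[R]_n => u - u0).
    by apply: smoothD => //; [exact: smooth_id|exact: smooth_cst].
  by apply: smooth_mxE => //; apply: smooth_mulmx => //; exact: smooth_trmx.
have dq u : differentiable q u by exact: (smooth_differentiable oT sq).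
have qnorm u : `|u - u0| <= Num.sqrt (q u).
  apply: mx_norm_le; first exact: sqrtr_ge0.
  have qE : q u = \sum_j (u - u0) 0 j ^+ 2.
    by rewrite /q mxE; apply: eq_bigr => l _; rewrite [X in _ * X]mxE expr2.
  move=> i j; rewrite -sqrtr_sqr ler_wsqrtr// qE (bigD1 j)//= (ord1 i) lerDl.
  by apply: sumr_ge0 => l _; exact: sqr_ge0.
pose fq (z : 'rV[R]_n * (R * 'rV[R]_n)) : R := ('D_(z.2.2) q z.1) ^+ 2.
have [C1 C10 H1] : exists2 C, 0 < C & \forall u \near u0, forall (w : R) h, [set 0 : R] w ->
    fq (u, (w, h)) <= C * g (ichart a u) (tv a (ichart a u) h) (tv a (ichart a u) h).
  apply: gram_dominates => //; first exact: compact_set1.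
    move=> w h _; have sD : smooth_on [set z : 'rV[R]_n * 'rV[R]_n | [set: 'rV[R]_n] z.1] (fun z => 'D_(z.2) q z.1).
      exact: smooth_derive_joint.
    have oOT : open [set z : 'rV[R]_n * 'rV[R]_n | [set: 'rV[R]_n] z.1] by exact: openXT.
    have sD2 := smoothM oOT sD sD.
    have cD := smooth_cont sD2 (I : [set z : 'rV[R]_n * 'rV[R]_n | [set: 'rV[R]_n] z.1] (u0, h)).
    move=> B HB; have HB' := cD B HB.
    exact (@cvg_skip_middle 'rV[R]_n R 'rV[R]_n u0 w h _ HB').
  move=> u w c h _ _; have E := clinZ c h (differentiable_clin (dq u)).
  refine (eq_trans (congr1 (fun r => r ^+ 2) E) _); exact: exprMn.
have n1 : nbhs u0 (cimg a) by apply: open_nbhs_nbhs; split => //; exact: open_cimg.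
have n2 : nbhs u0 (fun u => Q (ichart a u)).
  by apply/(mnbhsE sA Q ax)/mnbhs_nbhs.
have [e /= e0 He] := (nbhs_ballP _ _).1 (filterI H1 (filterI n1 n2)).
pose rho := e / 2; have rho0 : 0 < rho by rewrite divr_gt0.
have Hrho u : `|u - u0| <= rho -> [/\ cimg a u, Q (ichart a u) &
    forall h, ('D_h q u) ^+ 2 <= C1 * g (ichart a u) (tv a (ichart a u) h) (tv a (ichart a u) h)].
  move=> ur; have [|h1 [h2 h3]] := He u.
    rewrite -ball_normE /= distrC; apply: le_lt_trans ur _; rewrite /rho; lra.
  by split=> // h; exact: (h1 0 h erefl).
pose Kc := closed_ball u0 rho.
have KcE u : Kc u <-> `|u - u0| <= rho.
  by rewrite /Kc closed_ballE// /closed_ball_ /= distrC.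
pose KM := ichart a @` Kc.
have cKM : closed KM.
  apply: compact_closed; first exact: (mfd_hausdorff Mm).
  apply: continuous_compact; last exact: closed_ball_rV_compact.
  apply: continuous_in_subspaceT => u; rewrite inE => /KcE /Hrho [uc _ _].
  exact: (mfd_ichart_cont Mm uc).
pose psi x : R := if `[< dom a x >] then sqpos (rho ^+ 2 - q (chart a x)) else 0.
have psi0 x : psi x != 0 -> dom a x /\ `|chart a x - u0| <= rho.
  rewrite /psi; case: asboolP => [ax'|_]; last by rewrite eqxx.
  move=> h; split=> //; apply: le_trans (qnorm _) _.
  rewrite -(ger0_norm (ltW rho0)) -sqrtr_sqr ler_wsqrtr//.
  by rewrite leNgt; apply/negP => lt; move: h; rewrite /sqpos max_l ?expr0n ?eqxx// subr_le0 ltW.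
have psiK x : psi x != 0 -> KM x.
  by move=> /psi0 [ax' xr]; exists (chart a x); [apply/KcE|exact: (sa_K sA)].
(* The derivative of [sqpos] is at most [2 * rho ^+ 2] at the values taken, and that of [q] at most
   [Num.sqrt C1] times the speed. *)
pose Cc := 2 * rho ^+ 2 * Num.sqrt C1.
have Cc0 : 0 < Cc by rewrite !mulr_gt0// ?exprn_gt0// sqrtr_gt0.
exists psi, Cc; split; first exact: Cc0.
- rewrite /psi; case: asboolP => // _.
  by rewrite /q subrr mul0mx mxE subr0 /sqpos max_r ?exprn_gt0// sqr_ge0.
- move=> x /lt0r_neq0 /psi0 [ax' /Hrho [_ + _]]; by rewrite (sa_K sA).
move=> c t sc.
(* [psi] vanishes off [KM], which is compact and hence closed in the Hausdorff space [M]; at a curve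
   point outside [KM] the function is therefore zero at all nearby times. *)
have [Kt|Kt] := pselect (KM (c t)); last first.
  exists 0; split; last by rewrite normr0; exact: (mulr_ge0 (ltW Cc0) (speed_ge0 _ _ _ _)).
  have near0 : \forall s \near (t : R^o), (cst 0 : R^o -> R^o) s = (psi \o c : R^o -> R^o) s.
    have nK : nbhs (c t) (~` KM) by apply: open_nbhs_nbhs; split => //; exact: closed_openC.
    have sE : satlas (euclid R^o) := satlas_euclid.
    have H : mnbhs (euclid R^o) t (fun s => (~` KM) (c s)) by exact: continuous_smooth_at.
    rewrite mnbhs_euclid in H; apply: filterS H => s nKs /=; apply: esym; apply/eqP; by apply: contraT => /psiK.
  apply: (near_eq_is_derive near0); exact: is_derive_cst.
have [at_ ur] : dom a (c t) /\ `|chart a (c t) - u0| <= rho.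
  by move: Kt => [u /KcE ur <-]; have [uc _ _] := Hrho u ur; have [? ->] := cimgK sA uc.
have [_ _ Hq] := Hrho _ ur; rewrite (sa_K sA at_) in Hq.
have [U [oU Ut Ua sU]] := (smooth_curveP sA at_).1 sc.
set ch := chart a \o c in sU.
have dch : differentiable ch t by exact: (smooth_differentiable oU sU).
pose rq := (cst (rho ^+ 2) - q : 'rV[R]_n -> R^o).
have dcst u : differentiable (cst (rho ^+ 2) : 'rV[R]_n -> R^o) u.
  by apply: (smooth_differentiable oT) => //; exact: smooth_cst.
have drq u : differentiable rq u by exact: differentiableB.
have Drq u h : 'D_h rq u = - 'D_h q u.
  have E := deriveB (differentiable_derivable (v := h) (dcst u)) (differentiable_derivable (v := h) (dq u)).
  by refine (eq_trans E _); rewrite derive_cst sub0r.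
have drc : differentiable (rq \o ch) t by exact: differentiable_comp.
have [ds Ds] := sqpos_differentiable ((rq \o ch) t).
pose v := 'D_(1 : R^o) ch t.
pose d : R := 2 * Num.max 0 (rq (ch t)) * - 'D_v q (ch t).
have dF : is_derive (t : R^o) (1 : R^o) (sqpos \o (rq \o ch)) d.
  split; first by apply: differentiable_derivable; exact: differentiable_comp.
  refine (eq_trans (derive_comp (1 : R^o) drc ds) _).
  rewrite Ds; refine (congr1 (fun r => 2 * Num.max 0 (rq (ch t)) * r) _).
  exact (eq_trans (derive_comp (1 : R^o) dch (drq (ch t))) (Drq (ch t) v)).
exists d; split.
  have nU : nbhs (t : R^o) U by exact: open_nbhs_nbhs.
  apply: near_eq_is_derive dF; apply: filterS nU => s Us; rewrite /= /psi.
  by case: asboolP => [//|[]]; exact: Ua.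
have vE : velocity A c t = tv a (c t) v by exact: velocityE.
have b1 : 0 <= Num.max 0 (rq (ch t)) <= rho ^+ 2.
  rewrite le_max lexx /= ge_max sqr_ge0 /=; rewrite /rq /= lerBlDr lerDl.
  rewrite /q mxE; apply: sumr_ge0 => l _; by rewrite [X in _ * X]mxE -expr2 sqr_ge0.
have b2 : `|'D_v q (ch t)| <= Num.sqrt C1 * speed A g c t.
  rewrite -sqrtr_sqr /speed -sqrtrM ?(ltW C10)// ler_wsqrtr// vE; exact: Hq.
rewrite /d normrM normrN ger0_norm; last by apply: mulr_ge0 => //; have /andP[] := b1.
have core (x y r s : R) : 0 <= x <= y -> 0 <= r -> r <= s -> 2 * x * r <= 2 * y * s.
  by move=> /andP[x0' xy] r0 rs; apply: ler_pM => //; [exact: mulr_ge0|rewrite ler_wpM2l].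
have F := core _ _ _ _ b1 (normr_ge0 _) b2.
by apply: le_trans F _; rewrite /Cc -!mulrA.
Qed.

(** Small metric balls lie in a given neighbourhood: [psi] loses at most [C] times the length along
    a path, so it is still positive within distance [psi x0 / C] of [x0], and its support lies in
    [Q]. *)
Lemma rdist_ball x0 (Q : set M) : nbhs x0 Q ->
  exists2 r : R, 0 < r & forall x, (d x0 x < r%:E)%E -> Q x.
Proof.
move=> /bump_function [psi [C [C0 p0 pQ Hc]]].
have cg := cform_riemannian sA gm.
have lip x y l : pw_path A g setT x y l -> ((psi x)%:E <= (psi y)%:E + C%:E * l)%E.
  elim => {x y l} [x _|c y l Sc pl IH]; first by rewrite mule0 adde0.
  have Sc' : smooth_in_S A setT c 0 1 by move=> t /Sc.
  have cs : cont_on (speed A g c) 0 1 by exact: (speed_cont_on sA cg Sc').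
  rewrite (lengthE sA cg Sc').
  have l0 : (0 <= (arc (speed A g c) 0 1)%:E)%E by rewrite lee_fin; apply: arc_ge0 => r; exact: speed_ge0.
  rewrite ge0_muleDr ?l0 ?(pw_path_ge0 pl)// -EFinM addeCA.
  apply: (@le_trans _ _ ((C * arc (speed A g c) 0 1)%:E + (psi (c 1))%:E)%E); last by rewrite leeD2l.
  rewrite -EFinD lee_fin.
  (* Its derivative is nonpositive by the bound on [psi]; comparing the values at 0 and 1 gives the
     Lipschitz estimate for one curve. *)
  pose G (t : R) : R := - psi (c t) - C * arc (speed A g c) 0 t.
  have dG (t : R) : 0 < t < 1 -> exists2 e, is_derive t (1 : R) G e & e <= 0.
    move=> t01; have t01' : 0 <= t <= 1 by case/andP: t01 => *; rewrite !ltW.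
    have [s1 _] := Sc t t01'.
    have [e [de le]] := Hc c t s1.
    have da := arc_derive t01 cs.
    exists (- e - C * speed A g c t).
      have dN : is_derive t (1 : R) (fun t => - psi (c t)) (- e) by exact: is_deriveN.
      have dM : is_derive t (1 : R) (fun t => C * arc (speed A g c) 0 t) (C * speed A g c t).
        by apply: is_deriveZ.
      exact: is_deriveB.
    by rewrite subr_le0; apply: le_trans le; rewrite -normrN ler_norm.
  have cG : {within `[0, 1], continuous G}.
    have c1 : {within `[0, 1], continuous (psi \o c : R -> R)}.
      apply: cont_on_within => t t01; have [s1 _] := Sc t t01.
      have [e [de _]] := Hc c t s1.
      by apply: differentiable_continuous; apply/derivable1_diffP; exact: (@ex_derive _ _ _ _ _ _ _ de).
    have c2 := arc_continuous ler01 cs.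
    by move=> t; apply: cvgB; [apply: cvgN; exact: c1|apply: cvgMr; exact: c2].
  have D1 t : t \in `]0, 1[ -> derivable G t 1 by rewrite in_itv /= => /dG [e [dd _] _].
  have D2 t : t \in `]0, 1[ -> derive1 G t <= 0.
    by rewrite in_itv /= => /dG [e [_ dd] e0]; rewrite derive1E dd.
  have := ler0_derive1_nincr D1 D2 cG (lexx 0) ler01 (lexx 1).
  rewrite /G arc_refl mulr0 subr0; lra.
exists (psi x0 / C); first exact: divr_gt0.
move=> x dx; have [l pl lt] := rdist_lt_path dx; apply: pQ.
have H := lip _ _ _ pl.
have lf : l \is a fin_num by rewrite ge0_fin_numE ?(pw_path_ge0 pl)// (lt_trans lt)// ltry.
move: H lt; rewrite -(fineK lf) -EFinM -EFinD lee_fin lte_fin ltr_pdivlMr// => H lt.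
rewrite mulrC in lt; lra.
Qed.

End Riemannian.
End ManifoldTopology.

(** * Parametrisations of the unit bundles *)

Section UnitVectors.
Context {R : realType} {m : nat} {M : Type} {A : atlas 'rV[R]_m M} {g : @form R 'rV[R]_m M}.
Hypotheses (sA : satlas A) (gm : riemannian_metric A g).
Local Notation TA := (tangent_atlas A).
Let sTA : satlas TA := satlas_tangent sA.
Local Notation SM := (unit_bundle g (fun=> setT)).
Local Notation V2 := ('rV[R]_m * 'rV[R]_m)%type.

Definition sqnorm (a : index A) (z : V2) : R^o := (z.2 *m gram (g := g) a z.1 *m z.2^T) 0 0.

Definition unit_dom (a : index A) : set V2 := [set z | cimg a z.1 /\ 0 < sqnorm a z].

(** Normalisation parametrises [SM] over a chart by an open set of pairs, redundantly up to positive
    scaling of the second entry. Continuity and compactness arguments on [SM] are carried out on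
    these parameters. *)
Definition unit_vector (a : index A) (z : V2) : M * 'rV[R]_m :=
  (ichart a z.1, tv a (ichart a z.1) ((Num.sqrt (sqnorm a z))^-1 *: z.2)).

Lemma sqnormE (a : index A) u w : cimg a u ->
  sqnorm a (u, w) = g (ichart a u) (tv a (ichart a u) w) (tv a (ichart a u) w).
Proof.
move=> /(cimgK sA) [au uE]; have E := gramE sA gm w w au.
exact (eq_trans (congr1 (fun u => (w *m gram (g := g) a u *m w^T) 0 0) (esym uE)) (esym E)).
Qed.

Lemma smooth_sqnorm (a : index A) : smooth_on [set z : V2 | cimg a z.1] (sqnorm a).
Proof.
have oU : open [set z : V2 | cimg a z.1] by apply: openXT; exact: open_cimg.
by apply: (smooth_bilinear sA gm oU); [exact: smooth_fst|exact: smooth_snd|exact: smooth_snd|].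
Qed.

Lemma open_unit_dom (a : index A) : open (unit_dom a).
Proof.
have oU : open [set z : V2 | cimg a z.1] by apply: openXT; exact: open_cimg.
have o0 : open [set t : R^o | 0 < t] by exact: open_gt.
apply: (open_preimage_on oU o0) => z zc; exact: smooth_cont (@smooth_sqnorm a) zc.
Qed.

Lemma sqnorm_gt0 (a : index A) u w : cimg a u -> w != 0 -> 0 < sqnorm a (u, w).
Proof.
move=> uc w0; rewrite sqnormE//; apply: (rm_pos gm); apply/eqP => tw.
have [au _] := cimgK sA uc; have cc : clin (cv a (ichart a u)) by exact: clin_cv.
have E : cv a (ichart a u) (tv a (ichart a u) w) = w by exact: tvK.
by move: w0; rewrite -E tw (clin0 cc) eqxx.
Qed.

Lemma smooth_unit_coord (a : index A) :
  smooth_on (unit_dom a) (fun z => (Num.sqrt (sqnorm a z))^-1 : R^o).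
Proof.
apply: smooth_invsqrt; first exact: open_unit_dom.
  by move=> z [].
by apply: smooth_sub (@smooth_sqnorm a) => z [].
Qed.

Lemma unit_vectorP (a : index A) z : unit_dom a z ->
  smooth_at (euclid V2) TA (unit_vector a) z /\ SM (unit_vector a z).
Proof.
move=> Uz; have oU := @open_unit_dom a; have sE : satlas (euclid V2) := satlas_euclid.
have s1 := @smooth_unit_coord a.
split.
  apply: (smooth_atI sE sTA (a := tt) (b := a) (U := unit_dom a)
    (r := fun z => (z.1, (Num.sqrt (sqnorm a z))^-1 *: z.2))) => //.
  - by case: Uz => /(cimgK sA) [].
  - by move=> u _; exists u.
  - move=> u [uc _]; have [au uE] := cimgK sA uc; split; first exact au.
    have E : cv a (ichart a u.1) (tv a (ichart a u.1) ((Num.sqrt (sqnorm a u))^-1 *: u.2)) =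
      (Num.sqrt (sqnorm a u))^-1 *: u.2 by exact: tvK.
    exact (f_equal2 pair uE E).
  - apply: smooth_pair => //; first exact: smooth_fst.
    by apply: smoothZ => //; exact: smooth_snd.
case: z Uz => u w [uc w0]; split => //=.
have [au _] := cimgK sA uc; have ct : clin (tv a (ichart a u)) by exact: clin_tv.
set r := Num.sqrt _.
have r0 : 0 < r by rewrite sqrtr_gt0.
have E := clinZ r^-1 w ct.
refine (eq_trans (f_equal2 (fun v w => g (ichart a u) v w) E E) _).
rewrite (rm_Zl gm) (rm_Zr gm); have H := sqnormE w uc; simpl in H.
rewrite -[X in _ * (_ * X)](sqnormE w uc) -[sqnorm a (u, w)]sqr_sqrtr ?ltW// -/r.
by rewrite expr2 mulKf ?gt_eqF// mulVf ?gt_eqF.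
Qed.

Lemma unit_vector_onto (a : index A) x xi : dom a x -> SM (x, xi) ->
  unit_dom a (chart a x, cv a x xi) /\ unit_vector a (chart a x, cv a x xi) = (x, xi).
Proof.
move=> ax [_ x1]; have xc : cimg a (chart a x) by exists x.
have N1 : sqnorm a (chart a x, cv a x xi) = 1.
  rewrite sqnormE// (sa_K sA ax).
  have E : tv a x (cv a x xi) = xi by exact: cvK.
  by rewrite E; exact x1.
split; first by split=> //; rewrite N1.
rewrite /unit_vector N1 sqrtr1 invr1 scale1r /= (sa_K sA ax).
by have -> : tv a x (cv a x xi) = xi by exact: cvK.
Qed.

Lemma unit_vector_scale (a : index A) u w c : 0 < c ->
  unit_vector a (u, c *: w) = unit_vector a (u, w).
Proof.
move=> c0; rewrite /unit_vector /=; congr (_, tv a (ichart a u) _).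
have -> : sqnorm a (u, c *: w) = c ^+ 2 * sqnorm a (u, w) by exact: quadratic_scale.
rewrite sqrtrM ?sqr_ge0// sqrtr_sqr gtr0_norm// scalerA; congr (_ *: _).
by rewrite invfM mulrAC mulVf ?gt_eqF// mul1r.
Qed.

End UnitVectors.

Section ClusterOfFibers.
Context {R : realType} {Mt M : topologicalType}.

(** The points [w t], for [t] in [B] tending to [T], cluster at some [y0] by compactness. Their
    images converge to [c T], and since [M] is Hausdorff the image of [y0] must be this limit. *)
Lemma cluster_over (P : Mt -> M) (c : R -> M) (T : R) (B : set R) (w : R -> Mt) :
  hausdorff_space M -> compact [set: Mt] -> continuous P -> {for T, continuous c} ->
  closure B T -> (forall t, B t -> P (w t) = c t) ->
  exists y0, P y0 = c T /\ forall N e, nbhs y0 N -> 0 < e ->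
    exists t, [/\ B t, `|t - T| < e & N (w t)].
Proof.
move=> hM cMt cP cc BT Pw.
pose F := w @ within B (nbhs T).
have FF : ProperFilter F by apply: fmap_proper_filter; exact: within_nbhs_proper.
have [y0 [_ cl]] := cMt F FF filterT.
have key N Q : nbhs y0 N -> nbhs T Q -> exists t, [/\ B t, Q t & N (w t)].
  move=> nN nQ.
  have FS : F (w @` (B `&` Q)).
    by rewrite /F /fmap /= /within /=; apply: filterS nQ => t Qt Bt; exists t.
  by have [_ [[t [Bt Qt] <-] Nt]] := cl _ _ FS nN; exists t.
exists y0; split.
  apply: hM => N1 N2 n1 n2.
  have [t [Bt N2t N1t]] := key _ _ (cP y0 _ n1) (cc _ n2).
  by exists (c t); split => //; rewrite -Pw.
move=> N e nN e0; have nQ : nbhs T (fun t => `|t - T| < e).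
  by apply/nbhs_ballP; exists e => //= t; rewrite -ball_normE /= distrC.
by have [t [Bt Qt Nt]] := key _ _ nN nQ; exists t.
Qed.

End ClusterOfFibers.

Section Properness.
Context {R : realType} {m k : nat} {M Mt : topologicalType}.
Context {A : atlas 'rV[R]_m M} {At : atlas 'rV[R]_k Mt}.
Context {g : @form R 'rV[R]_m M} {gt : @form R 'rV[R]_k Mt} {P : Mt -> M}.
Hypotheses (Mm : smooth_manifold A) (Mtm : smooth_manifold At) (cMt : compact [set: Mt]).
Hypothesis m0 : (0 < m)%N.
Hypotheses (gm : riemannian_metric A g) (gtm : riemannian_metric At gt).
Hypothesis Psub : riemannian_submersion At A P gt g.
Variable f : M -> R.
Hypotheses (f0 : forall x, 0 < f x) (fs : forall x, smooth_fun_at A f x).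
Let sA : satlas A := satlas_manifold Mm.
Let sAt : satlas At := satlas_manifold Mtm.
Local Notation dP := (mdiff At A P).
Local Notation hor := (horizontal At A P gt).
Local Notation lift := (lift (A := A) (At := At) (gt := gt) (P := P)).
Local Notation gn := (warp At A P gt f).
Local Notation TA := (tangent_atlas A).
Local Notation TAt := (tangent_atlas At).
Local Notation horn := (horizontal At A P gn).
Local Notation Ps := (tangent_map At A P).
Context {D : @connection R 'rV[R]_m M}.
Hypothesis lc : levi_civita A g D.
Context {K : M * 'rV[R]_m -> 'rV[R]_m * 'rV[R]_m -> 'rV[R]_m}.
Hypothesis KM : connection_map A (fun=> setT) D K.
Variables (p q : R).
Let sTA : satlas TA := satlas_tangent sA.
Let sTAt : satlas TAt := satlas_tangent sAt.
Let gnm := warp_metric sA sAt gm gtm Psub f0 fs.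
Let hornE : horn = hor := hor_warp sA sAt gm gtm Psub f0.
Local Notation QE := (horizontal_sphere_form (A := A) (At := At) (g := g) (gt := gt) (P := P) f (K := K) p q).
Local Notation SM := (unit_bundle g (fun=> setT)).
Local Notation EM := (unit_bundle gn horn).
Let cQE : cform TAt QE := cform_QE sA sAt m0 gm gtm Psub f0 fs lc KM p q.

Lemma P_continuous : continuous P.
Proof.
move=> y N nN; apply/(mnbhs_nbhs Mtm).
exact (continuous_smooth_at Mm sAt (P_smooth Psub y) nN).
Qed.

Lemma proper_base : proper_over_curves (A := At) (A' := A) gn setT setT P.
Proof.
move=> c T B w sc _ BT Bw.
have cc : {for T, continuous (c : R -> M)}.
  move=> N nN; have sE : satlas (euclid R^o) := satlas_euclid.
  exact (continuous_smooth_at Mm sE sc nN).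
have [y0 [y0E H]] := cluster_over (mfd_hausdorff Mm) cMt P_continuous cc BT (fun t Bt => (Bw t Bt).2).
exists y0; split=> // e e0.
have [t [Bt te dt]] := H _ e (rdist_near Mtm gnm y0 e0) e0.
by exists t.
Qed.

Local Notation V2 := ('rV[R]_k * 'rV[R]_m)%type.
Local Notation Lm := (Lmx (A := A) (At := At) (gt := gt) (P := P)).
Local Notation Pd := (Pdom (A := A) (At := At) (P := P)).
Local Notation Ph := (Phat (A := A) (At := At) (P := P)).

Definition hor_dom (b : index At) (a : index A) : set V2 :=
  [set z | Pd b a z.1 /\
    unit_dom (g := g) a (Ph b a z.1, z.2)].

(** Up to scaling, the second entry of [z] holds the components of the projected vector, not of the
    lift itself. It thus depends only on the point of [SM] below, which [proper_sphere] exploits. *)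
Definition unit_hor (b : index At) (a : index A) (z : V2) : Mt * 'rV[R]_k :=
  (ichart b z.1, lift (ichart b z.1) (unit_vector (g := g) a (Ph b a z.1, z.2)).2).

Lemma open_hor_dom b a : open (hor_dom b a).
Proof.
have oP : open (Pd b a) := open_Pdom sA sAt Psub (b := b) (a := a).
have oPT := @openXT _ 'rV[R]_k 'rV[R]_m _ oP.
set O1 := [set _ | _] in oPT.
have sfst : smooth_on O1 (fst : V2 -> 'rV[R]_k) by exact: smooth_fst.
have sPh : smooth_on (Pd b a) (Ph b a) := @smooth_Phat _ _ _ _ _ _ _ _ _ _ sA sAt Psub b a.
have sph : smooth_on O1 (fun z : V2 => (Ph b a z.1, z.2)).
  by apply: smooth_pair; [exact: oPT|exact: (smooth_comp oPT oP _ sfst sPh)|exact: smooth_snd].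
have oU2 : open (unit_dom (g := g) a) := @open_unit_dom _ _ _ _ _ sA gm a.
by apply: (open_preimage_on oPT oU2) => z' z'c; exact: smooth_cont sph z'c.
Qed.

Lemma unit_horP b a z : hor_dom b a z ->
  smooth_at (euclid V2) TAt (unit_hor b a) z /\ EM (unit_hor b a z).
Proof.
move=> Uz; have oP : open (Pd b a) := open_Pdom sA sAt Psub (b := b) (a := a).
have oPT := @openXT _ 'rV[R]_k 'rV[R]_m _ oP.
set O1 := [set _ | _] in oPT.
have sPh : smooth_on (Pd b a) (Ph b a) := @smooth_Phat _ _ _ _ _ _ _ _ _ _ sA sAt Psub b a.
have sL : smooth_on (Pd b a) (Lm b a) := @smooth_Lmx _ _ _ _ _ _ _ _ _ _ sA sAt gtm Psub b a.
have oU2 : open (unit_dom (g := g) a) := @open_unit_dom _ _ _ _ _ sA gm a.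
pose ph (z : V2) := (Ph b a z.1, z.2).
have sfst : smooth_on O1 (fst : V2 -> 'rV[R]_k) by exact: smooth_fst.
have ssnd : smooth_on O1 (snd : V2 -> 'rV[R]_m) by exact: smooth_snd.
have sph : smooth_on O1 ph.
  by apply: smooth_pair => //; exact: (smooth_comp oPT oP _ sfst sPh).
have oO : open (hor_dom b a) := open_hor_dom (b := b) (a := a).
have OO1 : hor_dom b a `<=` O1 by move=> z' [].
have sE : satlas (euclid V2) := satlas_euclid.
have sN : smooth_on (hor_dom b a) (fun z => (Num.sqrt (sqnorm (g := g) a (ph z)))^-1 : R^o).
  apply: (smooth_comp oO oU2) (@smooth_unit_coord _ _ _ _ _ sA gm a); first by move=> z' [].
  exact: smooth_sub sph.
have sG : smooth_on (hor_dom b a) (fun z => z.2 *m Lm b a z.1).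
  have s1 : smooth_on (hor_dom b a) (fun z : V2 => Lm b a z.1).
    have H z' : hor_dom b a z' -> Pd b a z'.1 by move=> [].
    exact (smooth_comp oO oP H (smooth_sub OO1 sfst) sL).
  exact (smooth_mulmx oO (smooth_sub OO1 ssnd) s1).
split.
  apply: (smooth_atI sE sTAt (a := tt) (b := b) (U := hor_dom b a)
    (r := fun z => (z.1, (Num.sqrt (sqnorm (g := g) a (ph z)))^-1 *: (z.2 *m Lm b a z.1)))) => //.
  - by case: Uz => [[/(cimgK sAt) [bz _] _] _].
  - by move=> u _; exists u.
  - move=> u [[uc ua] _]; have [bu uE] := cimgK sAt uc; split; first exact bu.
    set c := (Num.sqrt (sqnorm (g := g) a (ph u)))^-1.
    set y := ichart b u.1 in bu uE ua *.
    have PyE : ichart a (Ph b a u.1) = P y by exact (sa_K sA ua).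
    have E1 : lift y (tv a (ichart a (Ph b a u.1)) (c *: u.2)) = tv b y ((c *: u.2) *m Lm b a u.1).
      refine (eq_trans (congr1 (fun x => lift y (tv a x (c *: u.2))) PyE) _).
      refine (eq_trans (liftE sA sAt gtm Psub (c *: u.2) bu ua) _).
      exact (congr1 (fun v => tv b y ((c *: u.2) *m Lm b a v)) uE).
    have E2 : cv b y (tv b y ((c *: u.2) *m Lm b a u.1)) = (c *: u.2) *m Lm b a u.1 by exact: tvK.
    refine (f_equal2 pair uE (eq_trans (congr1 (cv b y) E1) (eq_trans E2 _))).
    by rewrite scalemxAl.
  - apply: smooth_pair => //; first exact: smooth_sub sfst.
    exact: (smoothZ oO).
case: z Uz => u w [[uc ua] Uw].
have [_ [_ n1]] := unit_vectorP sA gm Uw.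
set y := ichart b u in ua *.
have PyE : ichart a (Ph b a u) = P y by exact (sa_K sA ua).
have hl v : hor y (lift y v) by exact (@lift_hor _ _ _ _ _ _ _ _ _ _ sA sAt gtm Psub y v).
split; first by rewrite hornE; exact (hl _).
refine (eq_trans (warp_lift sA sAt gtm Psub f y _ _) _).
refine (eq_trans (congr1 (fun v => g (P y) v _) (dP_lift sA sAt gtm Psub y _)) _).
refine (eq_trans _ n1); exact (congr1 (fun x => g x (unit_vector (g := g) a (Ph b a u, w)).2 (unit_vector (g := g) a (Ph b a u, w)).2) (esym PyE)).
Qed.

Lemma unit_hor_onto b a y eta : dom b y -> dom a (P y) -> EM (y, eta) ->
  hor_dom b a (chart b y, cv a (P y) (dP y eta)) /\
  unit_hor b a (chart b y, cv a (P y) (dP y eta)) = (y, eta).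
Proof.
move=> yb ya Ey; have Sy := Ps_in sA sAt gm gtm Psub f0 Ey.
have PhE : Ph b a (chart b y) = chart a (P y) by rewrite /Phat /= (sa_K sAt yb).
have [U1 U2] := unit_vector_onto sA gm ya Sy.
split.
  split; first by exact: Pdom_chart.
  by rewrite /= PhE; exact U1.
have hy : hor y eta by rewrite -hornE; case: Ey.
have U2' : unit_vector (g := g) a (chart a (P y), cv a (P y) (dP y eta)) = (P y, dP y eta) := U2.
refine (f_equal2 pair (sa_K sAt yb) _).
refine (eq_trans (congr1 (fun v => lift (ichart b (chart b y))
  (unit_vector (g := g) a (v, cv a (P y) (dP y eta))).2) PhE) _).
refine (eq_trans (congr1 (fun z => lift (ichart b (chart b y)) z.2) U2') _).
refine (eq_trans (congr1 (fun y' => lift y' (dP y eta)) (sa_K sAt yb)) _).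
exact (lift_dP sA sAt gtm Psub hy).
Qed.

(** Compactness of [Mt] gives a limit of the base points. The vectors follow: a horizontal vector is
    determined by its base point and its image, and the images are the points [c t], which converge.
    In the parameters of [unit_hor] both entries converge. *)
Lemma proper_sphere : proper_over_curves (A := TAt) (A' := TA) QE EM SM Ps.
Proof.
move=> c T B w sc ScT BT Bw.
have sE : satlas (euclid R^o) := satlas_euclid.
have sc1 : smooth_at (euclid R^o) A (fst \o c) T.
  exact: (smooth_at_comp sE sTA sA sc (smooth_at_fst sA (c T))).
have cc : {for T, continuous (fst \o c : R -> M)}.
  move=> N nN; exact (continuous_smooth_at Mm sE sc1 nN).
have Bw1 t : B t -> P (w t).1 = (fst \o c) t by move=> Bt; rewrite /= -(Bw t Bt).2.
have [y0 [y0E H]] := cluster_over (mfd_hausdorff Mm) cMt P_continuous cc BT Bw1.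
have y0E' : (y0, lift y0 (c T).2).1 = y0 by [].
set eta := lift y0 (c T).2.
have hl : hor y0 eta by exact (@lift_hor _ _ _ _ _ _ _ _ _ _ sA sAt gtm Psub y0 _).
have dl : dP y0 eta = (c T).2 by exact (dP_lift sA sAt gtm Psub y0 _).
have PsE : Ps (y0, eta) = c T.
  refine (eq_trans (f_equal2 pair y0E dl) _); exact: esym (surjective_pairing _).
have Ew : EM (y0, eta).
  split; first by rewrite hornE; exact hl.
  refine (eq_trans (warp_lift sA sAt gtm Psub f y0 eta _) _).
  refine (eq_trans (f_equal2 (fun x v => g x v (c T).2) y0E dl) _).
  by case: ScT.
exists (y0, eta); split; [exact Ew|exact PsE|move=> e e0].
set b := chart_at At y0; set a := chart_at A (P y0).
have yb : dom b y0 := sa_cover sAt y0; have ya : dom a (P y0) := sa_cover sA (P y0).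
have [U0 V0] := unit_hor_onto yb ya Ew.
set v0 := (chart b y0, cv a (P y0) (dP y0 eta)) in U0 V0.
have Hn : \forall v \near v0, (rdist TAt QE EM (unit_hor b a v) (unit_hor b a v0) <= e%:E)%E.
  exact (rdist_smooth_map sTAt cQE (open_hor_dom (b := b) (a := a)) U0 (fun v Hv => unit_horP Hv) e0).
rewrite V0 in Hn; have [[A1 A2] [/= n1 n2] H12] := Hn.
have nN : nbhs y0 [set y | [/\ dom b y, A1 (chart b y) & dom a (P y)]].
  apply/(mnbhs_nbhs Mtm).
  have d1 : mnbhs At y0 (dom b) by exact: mnbhs_dom.
  have d2 : mnbhs At y0 (fun y => A1 (chart b y)).
    have C : chart b y @[y --> mnbhs At y0] --> chart b y0 by exact: chart_cvg.
    exact (C A1 n1).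
  have d3 : mnbhs At y0 (fun y => dom a (P y)).
    have nd : nbhs (P y0) (dom a) by apply: open_nbhs_nbhs; split => //; exact: (mfd_open_dom Mm).
    exact (continuous_smooth_at Mm sAt (P_smooth Psub y0) nd).
  by apply: filterS (filterI d1 (filterI d2 d3)) => y [? [? ?]].
have cTE : (c T).1 = P y0 by rewrite -PsE.
have aT : dom (a : index TA) (c T) by rewrite /= cTE.
have nT : \forall t \near T, A2 (cv a (c t).1 (c t).2).
  have C : chart (a : index TA) z @[z --> mnbhs TA (c T)] --> chart (a : index TA) (c T) by exact: chart_cvg.
  have nA : nbhs (chart (a : index TA) (c T)) (fun v => A2 v.2).
    have E : (chart (a : index TA) (c T)).2 = cv a (P y0) (dP y0 eta) by rewrite -PsE.
    by have n2' := n2; rewrite -E in n2'; exact: cvg_snd n2'.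
  have H1 := C _ nA.
  exact (smooth_at_cont sE sTA sc H1).
have [e' /= e'0 He'] := (nbhs_ballP _ _).1 nT.
have ee' : 0 < Num.min e e' by rewrite lt_min e0 e'0.
have [t [Bt te [bt A1t at_]]] := H _ (Num.min e e') nN ee'.
move: te; rewrite lt_min => /andP[te te'].
have A2t : A2 (cv a (c t).1 (c t).2) by apply: He'; rewrite -ball_normE /= distrC.
have [Et PsEt] := Bw t Bt.
exists t; split=> //.
case: (w t) Et PsEt bt A1t at_ => y xi Et PsEt bt A1t at_.
have [_ E] := unit_hor_onto bt at_ Et.
rewrite -PsEt in A2t.
have F := H12 (chart b y, cv a (P y) (dP y xi)) (conj A1t A2t).
by rewrite -E; exact F.
Qed.

End Properness.

(** * Total boundedness of [M] and of its unit sphere bundle *)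

Section TotallyBounded.
Context {R : realType}.

Lemma totally_bounded_seq (X : Type) (S : set X) (d : X -> X -> \bar R) :
  (forall e : R, 0 < e -> exists s : seq (set X), (forall z, S z -> exists2 c, c \in s & c z) /\
    forall c z z', c \in s -> S z -> S z' -> c z -> c z' -> (d z z' <= e%:E)%E) ->
  totally_bounded S d.
Proof.
move=> H e e0; have [s [cov diam]] := H e e0.
exists (size s), (fun i => nth set0 s i); split.
  move=> z /cov [c cs cz]; have cn : (seq.index c s < size s)%N by rewrite index_mem.
  by exists (Ordinal cn); rewrite /= nth_index.
by move=> i z z' Sz Sz'; apply: diam => //; exact: mem_nth.
Qed.

Lemma nbhs_seq_all (T : topologicalType) (W : eqType) (s : seq W) (Q : W -> set T) (x : T) :
  (forall w, w \in s -> nbhs x (Q w)) -> nbhs x (fun y => forall w, w \in s -> Q w y).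
Proof.
elim: s => [_|w s IH H]; first by apply: filterE => y w.
have h1 := H w (mem_head _ _).
have h2 := IH (fun w' ws => H w' (mem_behead (s := w :: s) ws)).
by apply: filterS (filterI h1 h2) => y [y1 y2] w'; rewrite inE => /orP[/eqP ->|/y2].
Qed.

Lemma totally_bounded_local (X : Type) (M : topologicalType) (S : set X) (pi : X -> M)
    (d : X -> X -> \bar R) : compact [set: M] ->
  (forall (e : R) (x0 : M), 0 < e -> exists U (s : seq (set X)), [/\ nbhs x0 U,
    (forall z, S z -> U (pi z) -> exists2 c, c \in s & c z) &
    forall c z z', c \in s -> S z -> S z' -> c z -> c z' -> (d z z' <= e%:E)%E]) ->
  totally_bounded S d.
Proof.
move=> cM H; apply: totally_bounded_seq => e e0.
have H2 (x0 : M) : exists p : set M * seq (set X), [/\ nbhs x0 p.1,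
    (forall z, S z -> p.1 (pi z) -> exists2 c, c \in p.2 & c z) &
    forall c z z', c \in p.2 -> S z -> S z' -> c z -> c z' -> (d z z' <= e%:E)%E].
  by have [U [s Hs]] := H e x0 e0; exists (U, s).
have [F HF] := choice H2.
have [|xs cov] := compact_finite_cover (U := fun x => (F x).1) cM.
  by move=> x _; have [] := HF x.
exists (flatten [seq (F x).2 | x <- xs]); split.
  move=> z Sz; have [x [xin _ Ux]] := cov (pi z) I.
  have [_ h _] := HF x; have [c cs cz] := h z Sz Ux.
  by exists c => //; apply/flatten_mapP; exists x.
by move=> c z z' /flatten_mapP [x xin cs]; have [_ _] := HF x; apply.
Qed.

Lemma rdist_pseudometric (V : normedModType R) {fV : findim V} (X : Type) (A : atlas V X)
    (sA : satlas A) (g : @form R V X) S : cform A g -> pseudometric_on S (rdist A g S).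
Proof.
move=> cg; split.
- by move=> x y; exact: rdist_ge0.
- by move=> x Sx; exact: rdist_refl.
- by move=> x y; exact: rdist_sym.
- by move=> x y z; exact: rdist_triangle.
Qed.

Lemma dist_center (X : Type) (S : set X) (d : X -> X -> \bar R) z0 z z' (e : R) :
  pseudometric_on S d -> (d z z0 <= (e / 2)%:E)%E -> (d z' z0 <= (e / 2)%:E)%E ->
  (d z z' <= e%:E)%E.
Proof.
move=> pd h1 h2; apply: le_trans (pm_triangle pd z z0 z') _.
by rewrite (pm_sym pd z0 z') [in leRHS](splitr e) EFinD leeD.
Qed.

End TotallyBounded.

Section SphereBundleTotallyBounded.
Context {R : realType} {m : nat} {M : topologicalType} {A : atlas 'rV[R]_m M} {g : @form R 'rV[R]_m M}.
Hypotheses (Mm : smooth_manifold A) (cM : compact [set: M]) (gm : riemannian_metric A g).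
Let sA : satlas A := satlas_manifold Mm.
Local Notation TA := (tangent_atlas A).
Let sTA : satlas TA := satlas_tangent sA.
Local Notation SM := (unit_bundle g (fun=> setT)).

Lemma base_totally_bounded : totally_bounded setT (rdist A g setT).
Proof.
have pd : pseudometric_on setT (rdist A g setT).
  by apply: rdist_pseudometric => //; exact: cform_riemannian.
apply: (totally_bounded_local (pi := id) cM) => e x0 e0.
have e20 : 0 < e / 2 by rewrite divr_gt0.
pose U : set M := fun y => (rdist A g setT y x0 <= (e / 2)%:E)%E.
exists U, [:: U]; split; first exact (rdist_near Mm gm x0 e20).
  by move=> z _ Uz; exists U => //; rewrite inE.
by move=> c z z'; rewrite inE => /eqP -> _ _ h1 h2; exact (dist_center pd h1 h2).
Qed.

(** Compactness is used in the base and in the Euclidean unit sphere of the model space: around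
    [x0], each direction [w] has a box of parameters on which [unit_vector] moves by at most
    [e / 2], and finitely many boxes cover all directions. *)
Lemma sphere_totally_bounded Q : cform TA Q -> totally_bounded SM (rdist TA Q SM).
Proof.
move=> cQ; have pd : pseudometric_on SM (rdist TA Q SM) by exact: rdist_pseudometric.
apply: (totally_bounded_local (pi := fst) cM) => e x0 e0.
have e20 : 0 < e / 2 by rewrite divr_gt0.
have ax := sa_cover sA x0; set a := chart_at A x0 in ax; set u0 := chart a x0.
have uc : cimg a u0 by exists x0.
pose Sph := [set h : 'rV[R]_m | `|h| = 1].
have Sph0 w : Sph w -> w != 0 by move=> w1; rewrite -normr_eq0 w1 oner_eq0.
have Hw w : exists p : set 'rV[R]_m * set 'rV[R]_m, Sph w -> [/\ nbhs u0 p.1, nbhs w p.2 &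
    forall u w', p.1 u -> p.2 w' ->
      (rdist TA Q SM (unit_vector (g := g) a (u, w')) (unit_vector (g := g) a (u0, w)) <= (e / 2)%:E)%E].
  have [Sw|nSw] := pselect (Sph w); last by exists (set0, set0).
  have Uw : unit_dom (g := g) a (u0, w) by split => //; apply: sqnorm_gt0 => //; exact: Sph0.
  have Hn : \forall v \near (u0, w), (rdist TA Q SM (unit_vector (g := g) a v) (unit_vector (g := g) a (u0, w)) <= (e / 2)%:E)%E.
    exact (rdist_smooth_map sTA cQ (@open_unit_dom _ _ _ _ _ sA gm a) Uw (fun v Hv => unit_vectorP sA gm Hv) e20).
  have [[A1 A2] [/= n1 n2] H12] := Hn.
  by exists (A1, A2) => _; split=> // u w' ? ?; exact: (H12 (u, w')).
have [p Hp] := choice Hw.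
have [|ws cov] := compact_finite_cover (U := fun w => (p w).2) (@sphere_compact R m).
  by move=> w /Hp [].
(* Pieces of the cover: unit vectors that some parameter in the box of [w] represents. The clause
   [Sph w] is recorded because the box [p w] is arbitrary for other [w]. *)
pose c w := [set z : M * 'rV[R]_m | Sph w /\ exists2 w', (p w).2 w' &
  (p w).1 (chart a z.1) /\ z = unit_vector (g := g) a (chart a z.1, w')].
exists (fun x => dom a x /\ forall w, w \in ws -> Sph w -> (p w).1 (chart a x)), [seq c w | w <- ws]; split.
- have nd : nbhs x0 (dom a) by apply: open_nbhs_nbhs; split => //; exact: (mfd_open_dom Mm).
  have nw : nbhs u0 (fun u => forall w, w \in ws -> Sph w -> (p w).1 u).
    apply: nbhs_seq_all => w _; have [Sw|nSw] := pselect (Sph w).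
      by have [h _ _] := Hp w Sw; apply: filterS h => u pu _.
    by apply: filterE => u.
  apply: filterI; first exact: nd.
  exact: (mfd_chart_cont Mm ax nw).
- move=> [x xi] Sz [/= ax' Hx].
  have [U1 U2] := unit_vector_onto sA gm ax' Sz.
  set w1 := cv a x xi in U1 U2.
  have w10 : w1 != 0.
    apply/eqP => w10; move: U1 => [_]; rewrite w10 /sqnorm /= mul0mx mul0mx mxE ltxx//.
  have nw1 : 0 < `|w1| by rewrite normr_gt0.
  pose w' := `|w1|^-1 *: w1.
  have Sw' : Sph w' by rewrite /Sph /= /w' normrZ normfV normr_id mulVf// gt_eqF.
  have [w [win Sw pw]] := cov w' Sw'.
  exists (c w); first by apply/mapP; exists w.
  split; first exact Sw.
  exists w'; first exact pw.
  split; first exact (Hx w win Sw).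
  by rewrite /w' unit_vector_scale ?invr_gt0.
- move=> _ z z' /mapP [w win ->] _ _ [Sw [w1 p1 [q1 zE]]] [_ [w2 p2 [q2 zE']]].
  have [_ _ Hd] := Hp w Sw.
  apply: (dist_center (z0 := unit_vector (g := g) a (u0, w)) pd).
    by rewrite zE; exact: Hd.
  by rewrite zE'; exact: Hd.
Qed.

End SphereBundleTotallyBounded.

(** * Comparison of the fibres *)

(** Brings a form evaluated at [((u, w), (h, 0))] into the shape [(u, (w, h))] that [gram_dominates]
    expects, the last entry being frozen. *)
Lemma cvg_reassoc (T1 T2 T3 T4 : topologicalType) (x : T1) (y : T2) (z : T3) (e : T4) :
  ((t.1, t.2.1), (t.2.2, e)) @[t --> (x, (y, z))] --> ((x, y), (z, e)).
Proof.
move=> Q [[B1 B2] [/= [[C1 C2] [/= n1 n2] H1] [[C3 C4] [/= n3 n4] H2]] H].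
exists (C1, [set t | C2 t.1 /\ C3 t.2]).
  by split => //=; exists (C2, C3) => //= -[a b].
move=> [a [b c]] [/= c1 [c2 c3]]; apply: H; split => /=; first exact: H1.
by apply: H2; split => //=; exact: nbhs_singleton.
Qed.

Lemma continuous_reassoc (T1 T2 T3 T4 U : topologicalType) (x : T1) (y : T2) (z : T3) (e : T4)
    (F : (T1 * T2) * (T3 * T4) -> U) : F t @[t --> ((x, y), (z, e))] --> F ((x, y), (z, e)) ->
  {for (x, (y, z)), continuous (fun t => F ((t.1, t.2.1), (t.2.2, e)))}.
Proof. by move=> cF B HB; exact: (cvg_reassoc (e := e)) (cF B HB). Qed.

Lemma chart_pair_smooth {R : realType} (V W : normedModType R) {fV : findim V} {fW : findim W}
    (X : Type) (A : atlas V X) (sA : satlas A) (a : index A) (w : W) x : dom a x ->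
  smooth_at A (euclid (V * W)%type) (fun x => (chart a x, w)) x /\
  forall v, mdiff A (euclid (V * W)%type) (fun x => (chart a x, w)) x v = (cv a x v, 0).
Proof.
move=> ax; have xc : cimg a (chart a x) by exists x.
have oU := open_cimg sA a; have sE : satlas (euclid (V * W)%type) := satlas_euclid.
have sr : smooth_on (cimg a) (fun u => (u, w) : (V * W)%type).
  by apply: smooth_pair => //; [exact: smooth_id|exact: smooth_cst].
have Hj u : cimg a u -> dom (tt : index (euclid (V * W)%type)) (chart a (ichart a u), w) /\
    chart (tt : index (euclid (V * W)%type)) (chart a (ichart a u), w) = (u, w).
  by move=> /(cimgK sA) [_ E]; split => //=; rewrite E.
have tx : dom (tt : index (euclid (V * W)%type)) (chart a x, w) by [].
pose j := (fun x => (chart a x, w)) : X -> (V * W)%type.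
split; first exact: (smooth_atI sA sE (a := a) (b := tt) (F := j) ax tx oU xc (fun u uc => uc) Hj sr).
move=> v; have vE : tv a x (cv a x v) = v by exact: cvK.
have E : mdiff A (euclid (V * W)%type) j x (tv a x (cv a x v)) =
  tv (A := euclid (V * W)%type) tt (j x) ('D_(cv a x v) (fun u => (u, w) : (V * W)%type) (chart a x)).
  exact: (mdiffI sA sE (a := a) (b := tt) (F := j) (cv a x v) ax tx oU xc (fun u uc => uc) Hj sr).
rewrite vE in E; refine (eq_trans E _); refine (eq_trans (tv_euclid _ _) _).
have d1 : differentiable (id : V -> V) (chart a x).
  exact (smooth_differentiable oU (smooth_id _) xc).
have d2 : differentiable (cst w : V -> W) (chart a x).
  exact (smooth_differentiable oU (smooth_cst _ w) xc).
refine (eq_trans (derive_pair (cv a x v) d1 d2) _).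
by rewrite derive_id derive_cst.
Qed.

Section UnitField.
Context {R : realType} {m : nat} {M : topologicalType} {A : atlas 'rV[R]_m M} {g : @form R 'rV[R]_m M}.
Hypotheses (Mm : smooth_manifold A) (gm : riemannian_metric A g).
Let sA : satlas A := satlas_manifold Mm.
Local Notation TA := (tangent_atlas A).
Let sTA : satlas TA := satlas_tangent sA.
Local Notation V2 := ('rV[R]_m * 'rV[R]_m)%type.
Let sE : satlas (euclid V2) := satlas_euclid.

Definition unit_field (a : index A) w x : M * 'rV[R]_m := unit_vector (g := g) a (chart a x, w).

Lemma unit_field_fst (a : index A) w x : dom a x -> (unit_field a w x).1 = x.
Proof. exact: (sa_K sA). Qed.

Lemma unit_field_smooth (a : index A) w x : dom a x -> w != 0 ->
  smooth_at A TA (unit_field a w) x /\ forall v, mdiff A TA (unit_field a w) x v =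
    mdiff (euclid V2) TA (unit_vector (g := g) a) (chart a x, w) (cv a x v, 0).
Proof.
move=> ax w0; have xc : cimg a (chart a x) by exists x.
have Uw : unit_dom (g := g) a (chart a x, w) by split => //; exact: sqnorm_gt0.
have [sU _] := unit_vectorP sA gm Uw.
have [sj E] : smooth_at A (euclid V2) (fun x => (chart a x, w)) x /\ forall v,
  mdiff A (euclid V2) (fun x => (chart a x, w)) x v = (cv a x v, 0) by exact: chart_pair_smooth.
split; first exact: (smooth_at_comp sA sE sTA sj sU).
move=> v; refine (eq_trans (mdiff_comp sA sE v sj sU) _).
exact (congr1 (mdiff (euclid V2) TA (unit_vector (g := g) a) (chart a x, w)) (E v)).
Qed.

(** [gram_dominates] with the Euclidean unit sphere as parameter set: one constant serves all
    directions [w] and all points near [x0]. Only the geometry of [M] is involved. *)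
Lemma unit_field_dominated (Q : @form R V2 (M * 'rV[R]_m)%type) (x0 : M) : cform TA Q ->
  let a := chart_at A x0 in
  exists2 C, 0 < C & nbhs x0 [set x | dom a x /\ forall w v, `|w| = 1 ->
    Q (unit_field a w x) (mdiff A TA (unit_field a w) x v) (mdiff A TA (unit_field a w) x v) <=
      C * g x v v].
Proof.
move=> cQ a; have ax : dom a x0 := sa_cover sA x0.
have uc : cimg a (chart a x0) by exists x0.
pose uv := unit_vector (g := g) a.
pose F (z : V2 * V2) := Q (uv z.1) (mdiff (euclid V2) TA uv z.1 z.2) (mdiff (euclid V2) TA uv z.1 z.2).
pose f (z : 'rV[R]_m * ('rV[R]_m * 'rV[R]_m)) : R := F ((z.1, z.2.1), (z.2.2, 0)).
have Sph0 (w : 'rV[R]_m) : `|w| = 1 -> w != 0 by move=> w1; rewrite -normr_eq0 w1 oner_eq0.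
have [C C0 H] : exists2 C, 0 < C & \forall u \near chart a x0, forall w h,
    [set h : 'rV[R]_m | `|h| = 1] w ->
    f (u, (w, h)) <= C * g (ichart a u) (tv a (ichart a u) h) (tv a (ichart a u) h).
  apply: (gram_dominates Mm gm uc (@sphere_compact R m)).
    move=> w h w1; have Uw : unit_dom (g := g) a (chart a x0, w).
      by split => //; apply: sqnorm_gt0 => //; exact: Sph0.
    have [sU _] := unit_vectorP sA gm Uw.
    pose pt : V2 * V2 := ((chart a x0, w), (h, 0)).
    have cF : F z @[z --> pt] --> F pt.
      exact (@cform_smooth _ _ _ _ _ sTA Q V2 _ uv (chart a x0, w) (h, 0) cQ sU).
    clearbody F; move: cF; rewrite {}/f {}/pt; clear -F => cF.
    exact (@continuous_reassoc 'rV[R]_m 'rV[R]_m 'rV[R]_m 'rV[R]_m R (chart a x0) w h 0 F cF).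
  move=> u w c h uc' w1; have Uw : unit_dom (g := g) a (u, w).
    by split => //; apply: sqnorm_gt0 => //; exact: Sph0.
  have [sU _] := unit_vectorP sA gm Uw.
  have cl : clin (mdiff (euclid V2) TA uv (u, w)) by exact: clin_mdiff.
  have E : mdiff (euclid V2) TA uv (u, w) (c *: h, 0) = c *: mdiff (euclid V2) TA uv (u, w) (h, 0).
    refine (eq_trans _ (clinZ c (h, 0) cl)).
    by congr (mdiff _ _ _ _ (_, _)); rewrite scaler0.
  have [_ hQ] := cQ.
  exact (eq_trans (f_equal2 (fun p q => Q (uv (u, w)) p q) E E) (hQ _ _ _)).
exists C => //.
have nd : nbhs x0 (dom a) by apply: open_nbhs_nbhs; split => //; exact: (mfd_open_dom Mm).
apply: filterS (filterI nd (mfd_chart_cont Mm ax H)) => x [ax' Hx]; split=> // w v w1.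
have [_ E] := unit_field_smooth ax' (Sph0 w w1).
have Hv := Hx w (cv a x v) w1; rewrite (sa_K sA ax') in Hv.
have vE : tv a x (cv a x v) = v by exact: cvK.
rewrite vE in Hv; refine (le_trans _ Hv).
have E2 := f_equal2 (fun p q => Q (unit_field a w x) p q) (E v) (E v).
by rewrite le_eqVlt; apply/orP; left; apply/eqP; exact E2.
Qed.

End UnitField.

Lemma sqrt_le_mul (R : realType) (s G q1 q2 : R) : 0 <= s -> q1 = q2 -> q2 <= s * G ->
  Num.sqrt q1 <= Num.sqrt s * Num.sqrt G.
Proof. by move=> s0 -> h; rewrite -sqrtrM//; apply: ler_wsqrtr. Qed.

Section HorizontalField.
Context {R : realType} {m k : nat} {M Mt : topologicalType}.
Context {A : atlas 'rV[R]_m M} {At : atlas 'rV[R]_k Mt}.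
Context {g : @form R 'rV[R]_m M} {gt : @form R 'rV[R]_k Mt} {P : Mt -> M}.
Hypotheses (Mm : smooth_manifold A) (Mtm : smooth_manifold At).
Hypothesis m0 : (0 < m)%N.
Hypotheses (gm : riemannian_metric A g) (gtm : riemannian_metric At gt).
Hypothesis Psub : riemannian_submersion At A P gt g.
Let sA : satlas A := satlas_manifold Mm.
Let sAt : satlas At := satlas_manifold Mtm.
Local Notation dP := (mdiff At A P).
Local Notation hor := (horizontal At A P gt).
Local Notation lift := (lift (A := A) (At := At) (gt := gt) (P := P)).
Local Notation TA := (tangent_atlas A).
Local Notation TAt := (tangent_atlas At).
Local Notation Ps := (tangent_map At A P).
Local Notation uf := (unit_field (g := g)).
Local Notation V2 := ('rV[R]_k * 'rV[R]_m)%type.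
Let sTAt : satlas TAt := satlas_tangent sAt.
Let sE : satlas (euclid V2) := satlas_euclid.

Definition hor_field (a : index A) w y : Mt * 'rV[R]_k := (y, lift y (uf a w (P y)).2).

Lemma hor_field_Ps (a : index A) w y : dom a (P y) -> Ps (hor_field a w y) = uf a w (P y).
Proof.
move=> ay; have E1 := unit_field_fst (g := g) Mm w ay.
have E2 := dP_lift sA sAt gtm Psub y (uf a w (P y)).2.
refine (eq_trans (f_equal2 pair (esym E1) E2) _); exact: esym (surjective_pairing _).
Qed.

(** The same [w] works over the whole fibre of [P], so a single field passes through all unit
    horizontal vectors with image [(x, xi)]. Rescaling [w] to norm 1 brings it within the scope of
    [unit_field_dominated]. *)
Lemma hor_field_onto (a : index A) x xi : dom a x -> unit_bundle g (fun=> setT) (x, xi) ->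
  exists w, [/\ `|w| = 1 & forall y eta, P y = x -> hor y eta -> dP y eta = xi ->
    hor_field a w y = (y, eta)].
Proof.
move=> ax Sx; have [U1 U2] := unit_vector_onto sA gm ax Sx.
set w1 := cv a x xi in U1 U2.
have w10 : w1 != 0.
  apply/eqP => w0; case: U1 => _; rewrite /sqnorm /= w0 mul0mx mul0mx mxE.
  by rewrite ltxx.
have n0 : 0 < `|w1| by rewrite normr_gt0.
exists (`|w1|^-1 *: w1); split.
  by rewrite normrZ gtr0_norm ?invr_gt0// mulVf ?gt_eqF.
move=> y eta yx hy yxi.
have E : uf a (`|w1|^-1 *: w1) x = (x, xi).
  have n1 : 0 < `|w1|^-1 by rewrite invr_gt0.
  exact (eq_trans (unit_vector_scale a (chart a x) w1 n1) U2).
have E2 : (uf a (`|w1|^-1 *: w1) (P y)).2 = dP y eta by rewrite yx E yxi.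
refine (f_equal2 pair erefl _); refine (eq_trans (congr1 (lift y) E2) _).
exact (lift_dP sA sAt gtm Psub hy).
Qed.

Section OneWarping.
Variable f : M -> R.
Hypotheses (f0 : forall x, 0 < f x) (fs : forall x, smooth_fun_at A f x).
Local Notation gn := (warp At A P gt f).
Local Notation horn := (horizontal At A P gn).
Context {D : @connection R 'rV[R]_m M}.
Hypothesis lc : levi_civita A g D.
Context {K : M * 'rV[R]_m -> 'rV[R]_m * 'rV[R]_m -> 'rV[R]_m}.
Hypothesis KM : connection_map A (fun=> setT) D K.
Variables (p q : R).
Local Notation QS := (sphere_form (A := A) (g := g) (K := K) ((1 + 1) `^ p)^-1 q).
Local Notation QE := (horizontal_sphere_form (A := A) (At := At) (g := g) (gt := gt) (P := P) f (K := K) p q).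
Local Notation EM := (unit_bundle gn horn).
Let cQE : cform TAt QE := cform_QE sA sAt m0 gm gtm Psub f0 fs lc KM p q.
Let cgn : cform At gn := cform_gn sA sAt gm gtm Psub f0 fs.

(** Near [y] the field is [unit_hor b a] with its second entry frozen at [w]. *)
Lemma hor_field_smooth (a : index A) w y : dom a (P y) -> w != 0 ->
  smooth_at At TAt (hor_field a w) y /\ EM (hor_field a w y).
Proof.
move=> ay w0; have yb := sa_cover sAt y; set b := chart_at At y in yb.
have PhE y' : dom b y' -> Phat (A := A) (At := At) (P := P) b a (chart b y') = chart a (P y').
  by move=> yb'; rewrite /Phat /= (sa_K sAt yb').
have hfE y' : dom b y' -> unit_hor (g := g) (gt := gt) (P := P) b a (chart b y', w) = hor_field a w y'.
  move=> yb'; refine (f_equal2 pair (sa_K sAt yb') _).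
  refine (eq_trans (congr1 (fun u => lift (ichart b (chart b y'))
    (unit_vector (g := g) a (u, w)).2) (PhE y' yb')) _).
  exact (congr1 (fun y0 => lift y0 (unit_vector (g := g) a (chart a (P y'), w)).2) (sa_K sAt yb')).
have Hd : hor_dom (At := At) (g := g) (P := P) b a (chart b y, w).
  split; first exact: Pdom_chart.
  rewrite /= PhE//; split => //=; first by exists (P y).
  by apply: sqnorm_gt0 => //; exists (P y).
have [sU EU] := unit_horP Mm Mtm gm gtm Psub f0 Hd.
rewrite hfE// in EU; split; last exact EU.
have [sj _] : smooth_at At (euclid V2) (fun x => (chart b x, w)) y /\ forall v,
  mdiff At (euclid V2) (fun x => (chart b x, w)) y v = (cv b y v, 0) by exact: chart_pair_smooth.
have sc : smooth_at At TAt (unit_hor (g := g) (gt := gt) (P := P) b a \o (fun x => (chart b x, w))) y.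
  exact (smooth_at_comp sAt sE sTAt sj sU).
have N : \forall y' \near mnbhs At y,
    (unit_hor (g := g) (gt := gt) (P := P) b a \o (fun x => (chart b x, w))) y' = hor_field a w y'.
  by have H := mnbhs_dom sAt yb; apply: filterS H => y' yb'; exact (hfE y' yb').
exact (smooth_at_ext sAt sTAt N sc).
Qed.

Lemma hor_field_fst (a : index A) w y v : dom a (P y) -> w != 0 ->
  mdiff TAt At fst (hor_field a w y) (mdiff At TAt (hor_field a w) y v) = v.
Proof.
move=> ay w0; have [sh _] := hor_field_smooth ay w0.
exact (eq_trans (esym (mdiff_comp sAt sTAt v sh (smooth_at_fst sAt (hor_field a w y)))) (mdiff_id sAt y v)).
Qed.

(** Differentiates the identity of [Ps \o hor_field a w] with [uf a w \o P], which holds near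
    [y]. *)
Lemma hor_field_Ps_diff (a : index A) w y v : dom a (P y) -> w != 0 ->
  mdiff TAt TA Ps (hor_field a w y) (mdiff At TAt (hor_field a w) y v) =
  mdiff A TA (uf a w) (P y) (dP y v).
Proof.
move=> ay w0; have [sh _] := hor_field_smooth ay w0.
have sPs : smooth_at TAt TA Ps (hor_field a w y).
  exact (smooth_tangent_map sAt sA (F := P) (z := hor_field a w y) (P_smooth Psub y)).
have [su _] := unit_field_smooth Mm gm ay w0.
refine (eq_trans (esym (mdiff_comp sAt sTAt v sh sPs)) (eq_trans _ (mdiff_comp sAt sA v (P_smooth Psub y) su))).
have N : \forall y' \near mnbhs At y, (Ps \o hor_field a w) y' = (uf a w \o P) y'.
  have H := smooth_at_cont sAt sA (P_smooth Psub y) (mnbhs_dom sA ay).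
  by apply: filterS H => y' ay'; exact: hor_field_Ps.
exact (congr1 (fun F => F v) (mdiff_ext sAt N)).
Qed.

(** The form splits into the vertical part of [gn] and a term on [SM] which is at most [C] times the
    horizontal part. The factor [1 + C] does not involve [f]; on lengths it becomes
    [Num.sqrt (1 + C)]. *)
Lemma hor_field_le (a : index A) w C y v : dom a (P y) -> w != 0 -> 0 <= C ->
  QS (uf a w (P y)) (mdiff A TA (uf a w) (P y) (dP y v)) (mdiff A TA (uf a w) (P y) (dP y v)) <=
    C * g (P y) (dP y v) (dP y v) ->
  QE (hor_field a w y) (mdiff At TAt (hor_field a w) y v) (mdiff At TAt (hor_field a w) y v) <=
    (1 + C) * gn y v v.
Proof.
move=> ay w0 C0; have le1 := dP_le sA sAt gtm Psub f y v.
have g0 : 0 <= g (P y) (dP y v) (dP y v) by exact: (rm_ge0 gm).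
have E1 := hor_field_fst v ay w0; have E2 := hor_field_Ps_diff v ay w0.
have E3 := hor_field_Ps w ay.
have E : QE (hor_field a w y) (mdiff At TAt (hor_field a w) y v) (mdiff At TAt (hor_field a w) y v) =
   gn y v v - g (P y) (dP y v) (dP y v) +
   QS (uf a w (P y)) (mdiff A TA (uf a w) (P y) (dP y v)) (mdiff A TA (uf a w) (P y) (dP y v)).
  refine (f_equal2 +%R _ _).
    exact (f_equal2 (fun u v => gn y u v - g (P y) (dP y u) (dP y v)) E1 E1).
  refine (eq_trans (f_equal2 (fun u v => QS (Ps (hor_field a w y)) u v) E2 E2) _).
  exact (congr1 (fun z => QS z (mdiff A TA (uf a w) (P y) (dP y v)) (mdiff A TA (uf a w) (P y) (dP y v))) E3).
have core (G r s t : R) : 0 <= r -> r <= G -> s = G - r + t -> t <= C * r -> s <= (1 + C) * G.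
  move=> r0 rG -> tr; have : C * r <= C * G by rewrite ler_wpM2l.
  lra.
exact: (core _ _ _ _ g0 le1 E).
Qed.

Section Path.
Variables (a : index A) (x0 : M) (N : set M) (C r : R) (w : 'rV[R]_m).
Hypotheses (C0 : 0 <= C) (w0 : w != 0).
Hypothesis Nball : forall x, (rdist A g setT x0 x < r%:E)%E -> N x.
Hypothesis Ndom : forall x, N x -> dom a x.
Hypothesis Nle : forall x v, N x ->
  QS (uf a w x) (mdiff A TA (uf a w) x v) (mdiff A TA (uf a w) x v) <= C * g x v v.

Lemma hor_field_curve c : smooth_in_S At setT c 0 1 ->
  (forall t, 0 <= t <= 1 -> N (P (c t))) ->
  (rdist TAt QE EM (hor_field a w (c 0%R)) (hor_field a w (c 1%R)) <=
    (Num.sqrt (1 + C))%:E * length At gn c)%E.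
Proof.
move=> Hc HN; pose c' : R^o -> Mt * 'rV[R]_k := hor_field a w \o c.
have H t : 0 <= t <= 1 -> [/\ smooth_curve_at TAt c' t, EM (c' t) &
    velocity TAt c' t = mdiff At TAt (hor_field a w) (c t) (velocity At c t)].
  move=> t01; have ay := Ndom (HN t t01); have [sc _] := Hc t t01.
  have [sh Eh] := hor_field_smooth ay w0.
  have V : smooth_curve_at TAt c' t /\
      velocity TAt c' t = mdiff At TAt (hor_field a w) (c t) (velocity At c t).
    exact (velocity_comp sAt sTAt sc sh).
  by case: V => [s1 E1]; split; [exact s1|exact Eh|exact E1].
have Hc' : smooth_in_S TAt EM c' 0 1.
  by move=> t t01; case: (H t t01) => h1 h2 _; split; [exact h1|exact h2].
have s0 : 0 <= 1 + C by rewrite addr_ge0.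
have S : cont_on (speed At gn c) 0 1 by exact: (speed_cont_on sAt cgn Hc).
have S' : cont_on (speed TAt QE c') 0 1 by exact: (speed_cont_on sTAt cQE Hc').
have l1 : length At gn c = (arc (speed At gn c) 0 1)%:E by exact: (lengthE sAt cgn Hc).
have l2 : length TAt QE c' = (arc (speed TAt QE c') 0 1)%:E by exact: (lengthE sTAt cQE Hc').
have cS : cont_on (fun t => Num.sqrt (1 + C) * speed At gn c t) 0 1.
  move=> t t01; apply: cvgM; first exact: cvg_cst.
  exact: S.
have L : (rdist TAt QE EM (hor_field a w (c 0%R)) (hor_field a w (c 1%R)) <= length TAt QE c')%E.
  exact (rdist_le (pw_path_one QE Hc' erefl erefl)).
apply: (le_trans L).
rewrite l1 l2 -EFinM lee_fin.
have -> : Num.sqrt (1 + C) * arc (speed At gn c) 0 1 = arc (fun t => Num.sqrt (1 + C) * speed At gn c t) 0 1.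
  by rewrite /arc RintegralZl//; exact: integrable_cont.
apply: arc_le => // t /andP[t0 t1]; have t01 : 0 <= t <= 1 by rewrite !ltW.
have [_ _ vE] := H t t01.
have B := hor_field_le (v := velocity At c t) (Ndom (HN t t01)) w0 C0 (Nle (dP (c t) (velocity At c t)) (HN t t01)).
have E := f_equal2 (fun u v => QE (c' t) u v) vE vE.
exact (sqrt_le_mul s0 E B).
Qed.

Lemma rdist_P y y' : (rdist A g setT (P y) (P y') <= rdist At gn setT y y')%E.
Proof.
apply: (rdist_map sAt sA cgn (cform_riemannian sA gm)) => y1 _; split=> //.
  exact (P_smooth Psub y1).
by move=> v; exact (dP_le sA sAt gtm Psub f y1 v).
Qed.

(** The bound holds only over [N]. As [P] is 1-Lipschitz, the condition that the distance of the
    start from [x0] plus the length of the path be less than [r] passes from each curve to the rest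
    of the path and keeps it over [N]. *)
Lemma hor_field_path y y' l : pw_path At gn setT y y' l ->
  (rdist A g setT x0 (P y) + l < r%:E)%E ->
  (rdist TAt QE EM (hor_field a w y) (hor_field a w y') <= (Num.sqrt (1 + C))%:E * l)%E.
Proof.
elim=> [y1 _ Hr|c y1 l' Hc pth IH Hr].
  rewrite mule0 rdist_refl//; rewrite adde0 in Hr.
  by have [] := hor_field_smooth (Ndom (Nball Hr)) w0.
have l0 := pw_path_ge0 pth.
have lE : length At gn c = (arc (speed At gn c) 0 1)%:E by exact: (lengthE sAt cgn Hc).
have le0 : (0 <= length At gn c)%E by exact: length_ge0.
have near0 t : 0 <= t <= 1 -> (rdist A g setT x0 (P (c t)) <= rdist A g setT x0 (P (c 0%R)) + length At gn c)%E.
  move=> /andP[t0 t1]; apply: le_trans (rdist_triangle _ _ _ (P (c 0%R)) _) _.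
  apply: leeD2l; apply: le_trans (rdist_P _ _) _.
  have Hc0 : smooth_in_S At setT c 0 t.
    by move=> s /andP[s0 st]; apply: Hc; rewrite s0 (le_trans st).
  apply: le_trans (rdist_arc sAt cgn t0 Hc0) _; rewrite lE lee_fin.
  rewrite (arc_add t0 t1 (speed_cont_on sAt cgn Hc)) lerDl; apply: arc_ge0 => s; exact: speed_ge0.
apply: le_trans (rdist_triangle _ _ _ (hor_field a w (c 1%R)) _) _.
rewrite ge0_muleDr//; apply: leeD.
  apply: hor_field_curve => // t t01; apply: Nball.
  apply: le_lt_trans (near0 t t01) _; apply: le_lt_trans Hr.
  by apply: leeD2l; rewrite leeDl.
apply: IH; apply: le_lt_trans Hr; rewrite addeA leeD2r//.
by apply: near0; rewrite ler01 lexx.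
Qed.

End Path.

End OneWarping.

End HorizontalField.

Lemma uniform_pair (R : realType) (T : eqType) (c d : T -> R) (s : seq T) :
  (forall x, 0 < c x) -> (forall x, 0 < d x) ->
  exists C e, [/\ 0 < C, 0 < e & forall x, x \in s -> c x <= C /\ e <= d x].
Proof.
move=> c0 d0; elim: s => [|x s [C [e [C0 e0 H]]]]; first by exists 1, 1.
exists (Num.max (c x) C), (Num.min (d x) e); split.
- by rewrite lt_max C0 orbT.
- by rewrite lt_min d0.
- move=> y; rewrite inE => /predU1P[->|/H [h1 h2]].
    by rewrite le_max ge_min !lexx.
  by rewrite le_max ge_min h1 h2 !orbT.
Qed.

Section FiberDistances.
Context {R : realType} {m k : nat} {M Mt : topologicalType}.
Context {A : atlas 'rV[R]_m M} {At : atlas 'rV[R]_k Mt}.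
Context {g : @form R 'rV[R]_m M} {gt : @form R 'rV[R]_k Mt} {P : Mt -> M}.
Hypotheses (Mm : smooth_manifold A) (Mtm : smooth_manifold At).
Hypothesis m0 : (0 < m)%N.
Hypotheses (gm : riemannian_metric A g) (gtm : riemannian_metric At gt).
Hypothesis Psub : riemannian_submersion At A P gt g.
Let sA : satlas A := satlas_manifold Mm.
Let sAt : satlas At := satlas_manifold Mtm.
Local Notation dP := (mdiff At A P).
Local Notation hor := (horizontal At A P gt).
Local Notation TA := (tangent_atlas A).
Local Notation TAt := (tangent_atlas At).
Local Notation Ps := (tangent_map At A P).
Context {D : @connection R 'rV[R]_m M}.
Hypothesis lc : levi_civita A g D.
Context {K : M * 'rV[R]_m -> 'rV[R]_m * 'rV[R]_m -> 'rV[R]_m}.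
Hypothesis KM : connection_map A (fun=> setT) D K.
Variables (p q : R).
Hypothesis q0 : 0 <= q.
Local Notation gn := (warp At A P gt).
Local Notation QS := (sphere_form (A := A) (g := g) (K := K) ((1 + 1) `^ p)^-1 q).
Local Notation QE f := (horizontal_sphere_form (A := A) (At := At) (g := g) (gt := gt) (P := P) f (K := K) p q).
Local Notation EM f := (unit_bundle (gn f) (horizontal At A P (gn f))).
Let cQS : cform TA QS := cform_sphere_form sA m0 gm lc KM _ q.

(** [C] and [d] precede the warping function: this uniformity is what allows the comparison along a
    sequence of warpings. *)
Definition short_lift (C d : R) (U : set M) : Prop :=
  forall f, (forall x, 0 < f x) -> (forall x, smooth_fun_at A f x) ->
  forall z z' l, EM f z -> EM f z' -> U (P z.1) -> Ps z = Ps z' ->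
    pw_path At (gn f) setT z.1 z'.1 l -> (l < d%:E)%E ->
    (rdist TAt (QE f) (EM f) z z' <= C%:E * l)%E.

Lemma short_lift_local (x0 : M) : exists C d U, [/\ 0 < C, 0 < d, nbhs (x0 : M) U & short_lift C d U].
Proof.
have [C C0 HN] := unit_field_dominated Mm gm x0 cQS.
set a := chart_at A x0 in HN; set N := [set x | _] in HN.
have [r r0 Hr] := rdist_ball Mm gm HN.
(* The start projects to within [r / 3] of [x0] and the path is shorter than [r / 3]; together this
   is less than [r], the radius within which the field is controlled. *)
have r30 : 0 < r / 3 by rewrite divr_gt0.
exists (Num.sqrt (1 + C)), (r / 3), (fun y => (rdist A g setT y x0 <= (r / 3)%:E)%E); split=> //.
- by rewrite sqrtr_gt0 addr_gt0.
- exact: (rdist_near Mm gm x0 r30).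
move=> f f0 fs [y eta] [y' eta'] l Ez Ez' Uz PsE pth ld.
have cg := cform_riemannian sA gm.
have dx0 : (rdist A g setT x0 (P y) <= (r / 3)%:E)%E.
  by rewrite (rdist_sym sA setT x0 (P y) cg); exact: Uz.
have dr : (rdist A g setT x0 (P y) < r%:E)%E.
  apply: le_lt_trans dx0 _; rewrite lte_fin; lra.
have [ay _] := Hr _ dr.
have Sz : unit_bundle g (fun=> setT) (P y, dP y eta).
  exact (Ps_in sA sAt gm gtm Psub f0 Ez).
have hE := hor_warp sA sAt gm gtm Psub f0.
have hy : hor y eta by rewrite -hE; case: Ez.
have hy' : hor y' eta' by rewrite -hE; case: Ez'.
have [w [w1 Hw]] := hor_field_onto (At := At) (gt := gt) (P := P) Mm Mtm gm gtm Psub ay Sz.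
have E1 := Hw y eta erefl hy erefl.
have E2 := Hw y' eta' (esym (congr1 fst PsE)) hy' (esym (congr1 snd PsE)).
have w0 : w != 0 by rewrite -normr_eq0 w1 oner_eq0.
have Hp : (rdist TAt (QE f) (EM f) (hor_field (At := At) (g := g) (gt := gt) (P := P) a w y)
    (hor_field (At := At) (g := g) (gt := gt) (P := P) a w y') <= (Num.sqrt (1 + C))%:E * l)%E.
  apply: (hor_field_path (N := N) (x0 := x0) (r := r) Mm Mtm m0 gm gtm Psub f0 fs lc KM (ltW C0) w0 Hr _ _ pth).
  - by move=> x [].
  - by move=> x v [_ H]; exact (H w v w1).
  - apply: le_lt_trans (leeD dx0 (ltW ld)) _; rewrite -EFinD lte_fin; lra.
by rewrite E1 E2 in Hp.
Qed.

Lemma short_lift_uniform : compact [set: M] ->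
  exists C d, [/\ 0 < C, 0 < d & short_lift C d setT].
Proof.
move=> cM; have /choice [c /choice [d /choice [U H]]] := short_lift_local.
have [s Hs] := compact_finite_cover (U := U) cM (fun x _ => let: And4 _ _ h _ := H x in h).
have c0 x : 0 < c x by case: (H x).
have d0 x : 0 < d x by case: (H x).
have [C [e [C0 e0 Ce]]] := uniform_pair s c0 d0.
exists C, e; split=> // f f0 fs z z' l Ez Ez' _ PsE pth le.
have [x [xs _ Ux]] := Hs (P z.1) I; have [cC ed] := Ce x xs.
have [_ _ _ L] := H x.
have ld : (l < (d x)%:E)%E by apply: (lt_le_trans le); rewrite lee_fin.
have Lz := L f f0 fs z z' l Ez Ez' Ux PsE pth ld.
apply: (le_trans Lz).
by apply: lee_wpmul2r; [exact: pw_path_ge0 pth|rewrite lee_fin].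
Qed.

Lemma unit_horizontal_onto f z : (forall x, 0 < f x) ->
  unit_bundle g (fun=> setT) z -> forall y, P y = z.1 -> exists2 z', EM f z' & z'.1 = y /\ Ps z' = z.
Proof.
move=> f0 [_ z1] y yz; set eta := lift (A := A) (At := At) (gt := gt) (P := P) y z.2.
have dl : dP y eta = z.2 by exact (dP_lift sA sAt gtm Psub y _).
have hE := hor_warp sA sAt gm gtm Psub f0.
have hl : hor y eta by exact (@lift_hor _ _ _ _ _ _ _ _ _ _ sA sAt gtm Psub y z.2).
exists (y, eta); last first.
  split=> //; refine (eq_trans (f_equal2 pair yz dl) _); exact: esym (surjective_pairing _).
split; first by rewrite hE; exact hl.
refine (eq_trans (warp_lift sA sAt gtm Psub f y eta _) _).
exact (eq_trans (f_equal2 (fun x v => g x v z.2) yz dl) z1).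
Qed.

(** A constant nonzero vector in a chart, which exists as [0 < m], is normalised. *)
Lemma unit_vector_exists x : exists xi, unit_bundle g (fun=> setT) (x, xi).
Proof.
have ax := sa_cover sA x; set a := chart_at A x in ax.
have uc : cimg a (chart a x) by exists x.
have w0 : const_mx 1 != 0 :> 'rV[R]_m.
  apply/eqP => /matrixP /(_ 0 (Ordinal m0)); rewrite !mxE => /eqP; by rewrite oner_eq0.
have Ud : unit_dom (g := g) a (chart a x, const_mx 1) by split=> //; exact: sqnorm_gt0.
have [_ S1] := unit_vectorP sA gm Ud.
exists (unit_vector (g := g) a (chart a x, const_mx 1)).2.
have E := unit_field_fst (g := g) Mm (const_mx 1) ax.
have E2 : (x, (unit_vector (g := g) a (chart a x, const_mx 1)).2) = unit_vector (g := g) a (chart a x, const_mx 1).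
  refine (eq_trans (f_equal2 pair (esym E) erefl) _); exact: esym (surjective_pairing _).
exact (eq_ind_r _ S1 E2).
Qed.

(** From left to right, two points of a fibre of [P] carry horizontal unit vectors with a common
    image, and the projection to [Mt] does not increase distances. From right to left, short paths
    between base points are lifted with the uniform constants of [short_lift_uniform]. *)
Lemma fibers_small (f : nat -> M -> R) : compact [set: M] ->
  (forall n x, 0 < f n x) -> (forall n x, smooth_fun_at A (f n) x) ->
  (forall e : R, 0 < e -> \forall n \near \oo, forall z z', EM (f n) z -> EM (f n) z' ->
    Ps z = Ps z' -> (rdist TAt (QE (f n)) (EM (f n)) z z' <= e%:E)%E) <->
  (forall e : R, 0 < e -> \forall n \near \oo, forall y y', [set: Mt] y -> [set: Mt] y' ->
    P y = P y' -> (rdist At (gn (f n)) setT y y' <= e%:E)%E).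
Proof.
move=> cM f0 fs; split=> H e e0.
  have He := H e e0; apply: filterS He => n Hn y y' _ _ yy'.
  have [xi Sxi] := unit_vector_exists (P y).
  have [z Ez [zy Pz]] := unit_horizontal_onto (f0 n) Sxi erefl.
  have [z' Ez' [zy' Pz']] := unit_horizontal_onto (f0 n) Sxi (esym yy').
  have L := Hn z z' Ez Ez' (eq_trans Pz (esym Pz')).
  rewrite -zy -zy'; refine (le_trans _ L).
  have cgn := cform_gn sA sAt gm gtm Psub (f0 n) (fs n).
  have cQE := cform_QE sA sAt m0 gm gtm Psub (f0 n) (fs n) lc KM p q.
  apply: (rdist_map (satlas_tangent sAt) sAt cQE cgn) => u _; split=> //.
    exact: (smooth_at_fst sAt u).
  by move=> v; exact (fst_le sA sAt gm Psub (f n) (K := K) p q0 u v).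
have [C [d [C0 d0 SL]]] := short_lift_uniform cM.
(* Halving makes the distance bound strict, so a path shorter than both [d] and [e / C] exists; the
   first allows it to be lifted, the second makes the result at most [e]. *)
have e'0 : 0 < Num.min d (e / C) / 2 by rewrite divr_gt0// lt_min d0 divr_gt0.
have He := H _ e'0; apply: filterS He => n Hn z z' Ez Ez' PsE.
have L := Hn z.1 z'.1 I I (congr1 fst PsE).
have L2 : (rdist At (gn (f n)) setT z.1 z'.1 < (Num.min d (e / C))%:E)%E.
  apply: (le_lt_trans L); rewrite lte_fin ltr_pdivrMr// mulr2n mulrDr mulr1 ltrDl.
  by rewrite lt_min d0 divr_gt0.
have [l pth ll] := rdist_lt_path L2.
have ld : (l < d%:E)%E by apply: (lt_le_trans ll); rewrite lee_fin ge_min lexx.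
have S1 := SL (f n) (f0 n) (fs n) z z' l Ez Ez' I PsE pth ld.
apply: (le_trans S1).
have le : (l <= (e / C)%:E)%E.
  by apply: ltW; apply: (lt_le_trans ll); rewrite lee_fin ge_min lexx orbT.
have -> : e%:E = (C%:E * (e / C)%:E)%E by rewrite -EFinM mulrCA divff ?mulr1// gt_eqF.
by apply: lee_wpmul2l => //; rewrite lee_fin ltW.
Qed.

End FiberDistances.

(** * The two limits as statements on fibres *)

Section GromovHausdorffLimits.
Context {R : realType} {m k : nat} {M Mt : topologicalType}.
Context {A : atlas 'rV[R]_m M} {At : atlas 'rV[R]_k Mt}.
Context {g : @form R 'rV[R]_m M} {gt : @form R 'rV[R]_k Mt} {P : Mt -> M}.
Hypotheses (Mm : smooth_manifold A) (Mtm : smooth_manifold At) (cMt : compact [set: Mt]).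
Hypothesis m0 : (0 < m)%N.
Hypotheses (gm : riemannian_metric A g) (gtm : riemannian_metric At gt).
Hypothesis Psub : riemannian_submersion At A P gt g.
Hypothesis Hint : integrable_distribution 'rV[R]_m At (horizontal At A P gt).
Variable f : nat -> M -> R.
Hypotheses (f0 : forall n x, 0 < f n x) (fs : forall n x, smooth_fun_at A (f n) x).
Variable y0 : Mt.
Let sA : satlas A := satlas_manifold Mm.
Let sAt : satlas At := satlas_manifold Mtm.
Local Notation TA := (tangent_atlas A).
Local Notation TAt := (tangent_atlas At).
Local Notation Ps := (tangent_map At A P).
Let sTA : satlas TA := satlas_tangent sA.
Let sTAt : satlas TAt := satlas_tangent sAt.
Local Notation gn n := (warp At A P gt (f n)).
Let cg : cform A g := cform_riemannian sA gm.
Let cgn n : cform At (gn n) := cform_gn sA sAt gm gtm Psub (f0 n) (fs n).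

Lemma P_surjective (x : M) : exists2 y, [set: Mt] y & P y = x.
Proof. by case: Psub => _ onto _ _; have [y yx] := onto x; exists y. Qed.

Lemma compact_base : compact [set: M].
Proof.
have -> : [set: M] = P @` [set: Mt].
  by rewrite predeqE => x; split=> // _; have [y _ <-] := P_surjective x; exists y.
apply: continuous_compact cMt; apply: continuous_subspaceT.
exact (P_continuous Mm Mtm Psub).
Qed.

Lemma gh_cvg_base :
  gh_cvg (fun=> [set: Mt]) (fun n => rdist At (gn n) setT) [set: M] (rdist A g setT) <->
  forall e : R, 0 < e -> \forall n \near \oo, forall y y', [set: Mt] y -> [set: Mt] y' ->
    P y = P y' -> (rdist At (gn n) setT y y' <= e%:E)%E.
Proof.
apply: (gh_cvg_fibers (p := P)) => [n|n|||//|n y _|n y y' _ _|n y x _ _ r yx].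
- by exists y0.
- exact (rdist_pseudometric sAt setT (cgn n)).
- exact (rdist_pseudometric sA setT cg).
- exact (base_totally_bounded Mm compact_base gm).
- exact: P_surjective.
- apply: (rdist_map sAt sA (cgn n) cg) => u _; split=> //; first exact (P_smooth Psub u).
  by move=> v; exact (dP_le sA sAt gtm Psub (f n) u v).
have [l pth lr] := rdist_lt_path yx.
have [w [Sw Pw dw]] := lift_path sAt sA (cgn n) cg
  (fun w _ => isometric_section_base sA sAt gtm Psub Hint (f n) w)
  (@proper_base _ _ _ _ _ _ _ _ _ _ Mm Mtm cMt gm gtm Psub (f n) (f0 n) (fs n)) (z := y) I pth.
by exists w; split=> //; apply: (le_trans dw); exact: ltW.
Qed.

Context {D : @connection R 'rV[R]_m M}.
Hypothesis lc : levi_civita A g D.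
Context {K : M * 'rV[R]_m -> 'rV[R]_m * 'rV[R]_m -> 'rV[R]_m}.
Hypothesis KM : connection_map A (fun=> setT) D K.
Variables (p q : R).
Hypothesis q0 : 0 <= q.
Local Notation QS := (sphere_form (A := A) (g := g) (K := K) ((1 + 1) `^ p)^-1 q).
Local Notation QE n := (horizontal_sphere_form (A := A) (At := At) (g := g) (gt := gt) (P := P) (f n) (K := K) p q).
Local Notation SM := (unit_bundle g (fun=> setT)).
Local Notation EM n := (unit_bundle (gn n) (horizontal At A P (gn n))).
Let cQS : cform TA QS := cform_sphere_form sA m0 gm lc KM _ q.
Let cQE n : cform TAt (QE n) := cform_QE sA sAt m0 gm gtm Psub (f0 n) (fs n) lc KM p q.

Lemma Ps_onto n z : SM z -> exists2 z', EM n z' & Ps z' = z.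
Proof.
move=> Sz; have [y _ yz] := P_surjective z.1.
have [z' Ez' [_ z'z]] := unit_horizontal_onto Mm Mtm gm gtm Psub (f0 n) Sz yz.
by exists z'.
Qed.

Lemma gh_cvg_sphere :
  gh_cvg (fun n => EM n) (fun n => rdist TAt (QE n) (EM n)) SM (rdist TA QS SM) <->
  forall e : R, 0 < e -> \forall n \near \oo, forall z z', EM n z -> EM n z' ->
    Ps z = Ps z' -> (rdist TAt (QE n) (EM n) z z' <= e%:E)%E.
Proof.
apply: (gh_cvg_fibers (p := Ps)) => [n|n|||n z Ez|n z Sz|n z z' _ _|n z x Ez Sx r zx].
- have [xi Sxi] := unit_vector_exists Mm m0 gm (P y0).
  by have [z Ez _] := Ps_onto n Sxi; exists z.
- exact (rdist_pseudometric sTAt (EM n) (cQE n)).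
- exact (rdist_pseudometric sTA SM cQS).
- exact (sphere_totally_bounded Mm compact_base gm cQS).
- exact (Ps_in sA sAt gm gtm Psub (f0 n) Ez).
- exact (Ps_onto n Sz).
- apply: (rdist_map sTAt sTA (cQE n) cQS) => u Eu; split.
  + exact (smooth_tangent_map sAt sA (F := P) (z := u) (P_smooth Psub u.1)).
  + exact (Ps_in sA sAt gm gtm Psub (f0 n) Eu).
  + by move=> v; exact (Ps_le sA sAt gtm Psub (f n) (K := K) p q u v).
have [l pth lr] := rdist_lt_path zx.
have [w [Sw Pw dw]] := lift_path sTAt sTA (cQE n) cQS
  (fun w Ew => isometric_section_sphere sA sAt gm gtm Psub Hint (f0 n) K p q Ew)
  (@proper_sphere _ _ _ _ _ _ _ _ _ _ Mm Mtm cMt m0 gm gtm Psub (f n) (f0 n) (fs n) _ lc _ KM p q)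
  Ez pth.
by exists w; split=> //; apply: (le_trans dw); exact: ltW.
Qed.

End GromovHausdorffLimits.

Theorem theorem2 (R : realType) (m k : nat) (M Mt : topologicalType)
    (A : atlas 'rV[R]_m M) (At : atlas 'rV[R]_k Mt)
    (g : M -> 'rV[R]_m -> 'rV[R]_m -> R)
    (gt : Mt -> 'rV[R]_k -> 'rV[R]_k -> R)
    (P : Mt -> M) (f : nat -> M -> R) (p q : R)
    (m_gt0 : (0 < m)%N)
    (M_mfd : smooth_manifold A) (Mt_mfd : smooth_manifold At)
    (g_metric : riemannian_metric A g) (gt_metric : riemannian_metric At gt)
    (Mt_connected : connected [set: Mt]) (Mt_compact : compact [set: Mt])
    (P_submersion : riemannian_submersion At A P gt g)
    (H_integrable :
       integrable_distribution 'rV[R]_m At (horizontal At A P gt))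
    (f_smooth : forall n x, smooth_fun_at A (f n) x)
    (f_gt0 : forall n x, 0 < f n x)
    (f_bounded : exists C : R, forall n x, f n x <= C)
    (q_ge0 : 0 <= q)
    (nabla : M -> 'rV[R]_m -> (M -> 'rV[R]_m) -> 'rV[R]_m)
    (nablat : nat -> Mt -> 'rV[R]_k -> (Mt -> 'rV[R]_k) -> 'rV[R]_k)
    (K : M * 'rV[R]_m -> 'rV[R]_m * 'rV[R]_m -> 'rV[R]_m)
    (Kt : nat -> Mt * 'rV[R]_k -> 'rV[R]_k * 'rV[R]_k -> 'rV[R]_k) :
  let TM : M -> set 'rV[R]_m := fun=> setT in
  let gn n := warp At A P gt (f n) in
  let Hn n := horizontal At A P (gn n) in
  levi_civita A g nabla ->
  connection_map A TM nabla K ->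
  (forall n, levi_civita At (gn n) (nablat n)) ->
  (forall n, connection_map At (Hn n)
               (projected_connection (gn n) (Hn n) (nablat n)) (Kt n)) ->
  (gh_cvg (fun n => unit_bundle (gn n) (Hn n))
          (fun n => unit_bundle_dist At (gn n) (Hn n) (Kt n) p q)
          (unit_bundle g TM) (unit_bundle_dist A g TM K p q)
   <->
   gh_cvg (fun=> [set: Mt]) (fun n => rdist At (gn n) [set: Mt])
          [set: M] (rdist A g [set: M])).
Proof.
move=> TM gn Hn lc KM lct KtM.
(* For empty manifolds all the distances to the limits are [-oo], and the two convergence statements
   coincide. *)
have [[y0]|noy] := pselect (inhabited Mt); last first.
  have nox : M -> False.
    by case: P_submersion => _ onto _ _ x; have [y _] := onto x; apply: noy.
  have e1 : [set: Mt] = set0 by rewrite predeqE => y; split=> // _; exact: (noy (inhabits y)).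
  have e2 : [set: M] = set0 by rewrite predeqE => x; split=> // _; exact: (nox x).
  have e3 : unit_bundle g TM = set0 by rewrite predeqE => -[x v]; split=> // _; exact: nox x.
  have e4 n : unit_bundle (gn n) (Hn n) = set0.
    by rewrite predeqE => -[y v]; split=> // _; apply: noy.
  rewrite /gh_cvg; under eq_fun do rewrite (gh_dist_empty _ _ (e4 _) e3).
  by under [in X in _ <-> X]eq_fun do rewrite (gh_dist_empty _ _ e1 e2).
have sA := satlas_manifold M_mfd; have sAt := satlas_manifold Mt_mfd.
(* From here on the unit bundles carry the forms that are continuous everywhere; the connection maps
   [Kt n] no longer occur. *)
have -> : unit_bundle_dist A g TM K p q = _ := rdist_sphere sA m_gt0 g_metric lc KM p q.
have -> : (fun n => unit_bundle_dist At (gn n) (Hn n) (Kt n) p q) =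
    (fun n => rdist (tangent_atlas At) (horizontal_sphere_form (A := A) (At := At) (g := g)
       (gt := gt) (P := P) (f n) (K := K) p q) (unit_bundle (gn n) (Hn n))).
  apply/funext => n.
  exact (rdist_horizontal sA sAt m_gt0 g_metric gt_metric P_submersion H_integrable
    (f_gt0 n) (f_smooth n) lc (lct n) KM (KtM n) p q).
apply: (iff_trans (gh_cvg_sphere M_mfd Mt_mfd Mt_compact m_gt0 g_metric gt_metric P_submersion
  H_integrable f_gt0 f_smooth y0 lc KM p q)).
apply: (iff_trans (fibers_small M_mfd Mt_mfd m_gt0 g_metric gt_metric P_submersion lc KM p q_ge0
  (compact_base M_mfd Mt_mfd Mt_compact P_submersion) f_gt0 f_smooth)).
apply: iff_sym; exact: (gh_cvg_base M_mfd Mt_mfd Mt_compact g_metric gt_metric P_submersion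
  H_integrable f_gt0 f_smooth y0).
Qed.
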